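(* Let $X,Y$ be two indecomposable objects in $\mathrm{coh}\text{-}\mathbb{X}(p,q)$. Assume $X,Y$ are not supported at ordinary points. Then $$\dim_{\mathbf{k}}\mathrm{Ext}^1(X,Y)=I^{+}(\phi^{-1}(X),\phi^{-1}(Y)).$$
   Context: Sheaves. Let $\mathbf{k}$ be an algebraically closed field and $1\le p\le q$ integers. $\mathbb{L}(p,q)$ is the abelian group on generators $\vec{x}_1,\vec{x}_2$ with relation $p\vec{x}_1=q\vec{x}_2=:\vec{c}$. $S=\mathbf{k}[x_1,x_2]$ is $\mathbb{L}(p,q)$-graded with $\deg x_i=\vec{x}_i$. $\mathrm{coh}\text{-}\mathbb{X}(p,q)$ is the quotient of the category of finitely generated $\mathbb{L}(p,q)$-graded $S$-modules by the Serre subcategory of finite dimensional modules; $\mathcal{O}$ is the image of $S$, and $\mathcal{O}(\vec{x})$ its grading shifts. Its indecomposable objects are the line bundles $\mathcal{O}(\vec{x})$ (all indecomposable vector bundles) and the uniserial torsion sheaves $S_{\infty,i}^{(j)}$ ($i\in\mathbb{Z}/p$), $S_{0,i}^{(j)}$ ($i\in\mathbb{Z}/q$), $S_\lambda^{(j)}$ ($\lambda\in\mathbf{k}^*$), of length $j\ge1$ with simple top $S_{\infty,i}=\mathrm{coker}(x_1:\mathcal{O}((i-1)\vec{x}_1)\to\mathcal{O}(i\vec{x}_1))$, $S_{0,i}=\mathrm{coker}(x_2:\mathcal{O}((i-1)\vec{x}_2)\to\mathcal{O}(i\vec{x}_2))$, $S_\lambda=\mathrm{coker}(x_2^q-\lambda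 x_1^p:\mathcal{O}\to\mathcal{O}(\vec{c}))$. The sheaves supported at ordinary points are the $S_\lambda^{(j)}$ with $\lambda\in\mathbf{k}^*$. Annulus. Let $\mathbb{U}=\mathbb{R}\times[0,1]$ (standard orientation) and $\pi:\mathbb{U}\to A_{p,q}$ the quotient by $(x,y)\sim(x+1,y)$; $y=1$ covers the inner boundary $\partial$, $y=0$ the outer boundary $\partial'$. Put $(\tfrac{i}{p})_\partial:=(\tfrac{i}{p},1)$, $(\tfrac{j}{q})_{\partial'}:=(\tfrac{j}{q},0)$, $i,j\in\mathbb{Z}$; their images are the marked points. $[P,Q]$ denotes the oriented curve in $\mathbb{U}$ from $P$ to $Q$ with interior in the interior of $\mathbb{U}$ (unique up to homotopy). The bijection $\phi$ from homotopy classes of curves in $A_{p,q}$ to indecomposable sheaves not supported at ordinary points is: $\pi([(\tfrac{j}{q})_{\partial'},(\tfrac{i}{p})_\partial])\mapsto\mathcal{O}(i\vec{x}_1-j\vec{x}_2)$; $\pi([(\tfrac{i-j-1}{p})_\partial,(\tfrac{i}{p})_\partial])\mapsto S_{\infty,i}^{(j)}$; $\pi([(\tfrac{-i}{q})_{\partial'},(\tfrac{j-i+1}{q})_{\partial'}])\mapsto S_{0,i}^{(j)}$ ($j\geq 1$ in the last two). Positive intersections. A point of intersection of two oriented curves $\alpha,\beta$ is a positive intersection of $\alpha$ and $\beta$ if $\beta$ crosses $\alpha$ from the right side of $\alpha$ to its left side (locally: $\alpha$ runs from south-west to north-east, $\beta$ from south-east to north-west). $I^+(\alpha,\beta)=\min_{\alpha'\sim\alpha,\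 \beta'\sim\beta}|\alpha'\cap^+\beta'|$, where $\sim$ is homotopy (fixing endpoints) and $\alpha'\cap^+\beta'$ is the set of positive intersections of $\alpha'$ and $\beta'$, excluding their endpoints. *)

(* Defs.v *)
From HB Require Import structures.
From mathcomp Require Import all_boot all_order all_algebra.
From mathcomp Require Import generic_quotient ring_quotient.
From mathcomp Require Import all_classical all_reals all_analysis.

Set Implicit Arguments.
Unset Strict Implicit.
Unset Printing Implicit Defensive.

Import Order.TTheory GRing.Theory Num.Theory.
Import Quotient.
Import numFieldNormedType.Exports.

Local Open Scope classical_set_scope.
Local Open Scope ring_scope.

Record lincat (k : fieldType) := LinCat {
  ob :> Type;
  hom : ob -> ob -> lmodType k;
  idm : forall x, hom x x;
  comp : forall x y z, hom y z -> hom x y -> hom x z;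
  compA : forall w x y z (h : hom y z) (g : hom x y) (f : hom w x),
    comp h (comp g f) = comp (comp h g) f;
  comp1m : forall x y (f : hom x y), comp (idm y) f = f;
  compm1 : forall x y (f : hom x y), comp f (idm x) = f;
  compDl : forall x y z a (g g' : hom y z) (f : hom x y),
    comp (a *: g + g') f = a *: comp g f + comp g' f;
  compDr : forall x y z a (g : hom y z) (f f' : hom x y),
    comp g (a *: f + f') = a *: comp g f + comp g f' }.

Arguments hom {k l} x y : rename.
Arguments idm {k l} x : rename.

Declare Scope lincat_scope.
Notation "g \c f" := (comp g f)
  (at level 40, left associativity) : lincat_scope.
Local Open Scope lincat_scope.

Section LinearCategory.
Variables (k : fieldType) (C : lincat k).
Implicit Types (x y z s t u v : C).

Definition zero_ob x := idm x = 0.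

Definition iso_arrow x y (f : hom x y) :=
  exists g : hom y x, g \c f = idm x /\ f \c g = idm y.

Definition isomorphic x y := exists f : hom x y, iso_arrow f.

Definition mono x y (f : hom x y) :=
  forall t (g h : hom t x), f \c g = f \c h -> g = h.

Definition is_kernel x y z (f : hom x y) (g : hom y z) :=
  g \c f = 0 /\
  forall t (h : hom t y), g \c h = 0 -> exists! u : hom t x, f \c u = h.

Definition is_cokernel x y z (f : hom x y) (g : hom y z) :=
  g \c f = 0 /\
  forall t (h : hom y t), h \c f = 0 -> exists! u : hom z t, u \c g = h.

Definition short_exact x y z (f : hom x y) (g : hom y z) :=
  is_kernel f g /\ is_cokernel f g.

Definition coker_object x y (f : hom x y) z :=
  exists c : hom y z, is_cokernel f c.

Definition is_biproduct x1 x2 s (i1 : hom x1 s) (i2 : hom x2 s)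
    (p1 : hom s x1) (p2 : hom s x2) :=
  [/\ p1 \c i1 = idm x1, p2 \c i2 = idm x2, p1 \c i2 = 0, p2 \c i1 = 0
    & i1 \c p1 + i2 \c p2 = idm s].

Definition indecomposable x :=
  ~ zero_ob x /\
  forall a b (i1 : hom a x) (i2 : hom b x) (p1 : hom x a) (p2 : hom x b),
    is_biproduct i1 i2 p1 p2 -> zero_ob a \/ zero_ob b.

Definition simple_ob t :=
  ~ zero_ob t /\
  forall x (f : hom x t), mono f -> zero_ob x \/ iso_arrow f.

Inductive has_length : C -> nat -> Prop :=
| has_length0 x : zero_ob x -> has_length x 0
| has_lengthS x' x t (f : hom x' x) (g : hom x t) n :
    short_exact f g -> simple_ob t -> has_length x' n -> has_length x n.+1.

Definition subob_le u v x (f : hom u x) (g : hom v x) :=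
  exists h : hom u v, f = g \c h.

Definition uniserial x :=
  forall u v (f : hom u x) (g : hom v x), mono f -> mono g ->
    subob_le f g \/ subob_le g f.

Definition maximal_subob u x (f : hom u x) :=
  exists t (g : hom x t), short_exact f g /\ simple_ob t.

(* the intersection of all maximal subobjects of x *)
Definition is_radical r x (i : hom r x) :=
  [/\ mono i,
      forall u (f : hom u x), maximal_subob f -> subob_le i f
    & forall v (g : hom v x), mono g ->
        (forall u (f : hom u x), maximal_subob f -> subob_le g f) ->
        subob_le g i].

Definition has_top x t :=
  exists r (i : hom r x) (c : hom x t), is_radical i /\ short_exact i c.

Definition uniserial_of (t : C) (j : nat) x :=
  [/\ uniserial x, has_length x j & has_top x t].

(* An element of Ext^1(X, Y) is the class of 0 -> Y -> E -> X -> 0. *)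
Record extension x y := Extension {
  ext_mid : C;
  ext_in : hom y ext_mid;
  ext_out : hom ext_mid x;
  ext_exact : short_exact ext_in ext_out }.

(* ext_map a b xi xi' : some arrow of middle terms completes (a, b) to a
   morphism of short exact sequences; in an abelian category this says that
   the pushout of xi along a is the pullback of xi' along b. *)
Definition ext_map x y x' y' (a : hom y y') (b : hom x x')
    (xi : extension x y) (xi' : extension x' y') :=
  exists h : hom (ext_mid xi) (ext_mid xi'),
    h \c ext_in xi = ext_in xi' \c a /\ ext_out xi' \c h = b \c ext_out xi.

Definition ext_equiv x y (xi xi' : extension x y) :=
  ext_map (idm y) (idm x) xi xi'.

(* a *: xi is the pushout of xi along a *: idm y. *)
Definition ext_scale x y (a : k) (xi xi' : extension x y) :=
  ext_map (a *: idm y) (idm x) xi xi'.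

(* xi is the Baer sum of xi1 and xi2: eta is the pullback of the direct sum
   xi1 (+) xi2 along the diagonal of x, and xi is the pushout of eta along the
   codiagonal of y. *)
Definition baer_sum x y (xi1 xi2 xi : extension x y) :=
  exists yy (j1 j2 : hom y yy) (q1 q2 : hom yy y),
  exists xx (l1 l2 : hom x xx) (r1 r2 : hom xx x),
  exists e (i1 : hom (ext_mid xi1) e) (i2 : hom (ext_mid xi2) e)
    (p1 : hom e (ext_mid xi1)) (p2 : hom e (ext_mid xi2)),
  exists eta : extension x yy,
  [/\ is_biproduct j1 j2 q1 q2, is_biproduct l1 l2 r1 r2,
      is_biproduct i1 i2 p1 p2,
      ext_map (q1 + q2) (idm x) eta xi
    & exists h : hom (ext_mid eta) e,
        h \c ext_in eta
          = i1 \c ext_in xi1 \c q1 + i2 \c ext_in xi2 \c q2 /\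
        (l1 \c ext_out xi1 \c p1 + l2 \c ext_out xi2 \c p2) \c h
          = (l1 + l2) \c ext_out eta].

(* Phi induces a k-linear isomorphism from k^n onto Ext^1(x, y). *)
Definition ext1_dim x y (n : nat) :=
  exists Phi : 'rV[k]_n -> extension x y,
  [/\ forall v w : 'rV[k]_n, baer_sum (Phi v) (Phi w) (Phi (v + w)),
      forall a (v : 'rV[k]_n), ext_scale a (Phi v) (Phi (a *: v)),
      forall v w : 'rV[k]_n, ext_equiv (Phi v) (Phi w) -> v = w
    & forall xi, exists v : 'rV[k]_n, ext_equiv (Phi v) xi].

End LinearCategory.

Section Weights.
Variables p q : nat.

(* L(p,q) is the quotient of Z x Z by the subgroup generated by (p, - q). *)
Definition weight_rel : {pred int * int} :=
  fun v => `[< exists n : int, v = (n * p%:Z, - (n * q%:Z)) >].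

Lemma weight_rel_closed : zmod_closed weight_rel.
Proof.
split; first by apply/asboolP; exists 0; rewrite !mul0r oppr0.
move=> _ _ /asboolP[n ->] /asboolP[m ->]; apply/asboolP; exists (n - m).
by rewrite !mulrBl opprD.
Qed.

HB.instance Definition _ :=
  GRing.isZmodClosed.Build (int * int)%type weight_rel weight_rel_closed.

Definition weight : zmodType := {quot weight_rel}.

Definition wx1 : weight := \pi_({quot weight_rel})%qT (1, 0).
Definition wx2 : weight := \pi_({quot weight_rel})%qT (0, 1).
Definition wc : weight := wx1 *+ p.

Lemma wx_rel : wx1 *+ p = wx2 *+ q.
Proof.
have pairMn n (a b : int) : (a, b) *+ n = (a *+ n, b *+ n).
  by elim: n => // n IH; rewrite !mulrS IH.
rewrite /wx1 /wx2 -!raddfMn; apply/eqP.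
rewrite -(idealrBE weight_rel); apply/asboolP; exists 1.
by rewrite !pairMn !mul0rn !mul1r; congr (_, _); rewrite /= ?subr0 ?sub0r natz.
Qed.

End Weights.

Section GradedModules.
Variables (k : closedFieldType) (p q : nat).
Local Notation S := {poly {poly k}}.
Local Notation L := (weight p q).

Definition sx1 : S := ('X)%:P.
Definition sx2 : S := 'X.
Definition sC (a : k) : S := a%:P%:P.

(* S = k[x1, x2] is encoded as k[x1][x2]: the coefficient of x1^i x2^j in f is
   f`_j`_i. *)
Definition mon_weight (i j : nat) : L := wx1 p q *+ i + wx2 p q *+ j.

Definition homogeneous (d : L) (f : S) :=
  forall i j, f`_j`_i != 0 -> mon_weight i j = d.

Definition spart (d : L) (f : S) : S :=
  \poly_(j < size f) \poly_(i < size f`_j)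
    (if mon_weight i j == d then f`_j`_i else 0).

(* hpart l m is the component of weight l of m, and the space of homogeneous
   elements of weight l is the image of hpart l. *)
Record grmod := GrMod {
  carrier :> lmodType S;
  hpart : L -> carrier -> carrier;
  hpartD : forall l, {morph hpart l : m n / m + n};
  hpartK : forall l l' m, hpart l (hpart l' m) = if l == l' then hpart l m else 0;
  hpart_sum : forall m, exists2 s : seq L, uniq s & m = \sum_(l <- s) hpart l m;
  hpart_act : forall d l (f : S) m, homogeneous d f ->
    hpart (d + l) (f *: hpart l m) = f *: hpart l m;
  fin_gen : exists s : seq carrier, forall m, exists c : nat -> S,
    m = \sum_(i < size s) c i *: s`_i }.

Definition kcomb (M : lmodType S) (c : nat -> k) (s : seq M) : M :=
  \sum_(i < size s) sC (c i) *: s`_i.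

Definition finite_dim (M : lmodType S) (P : set M) :=
  exists s : seq M, forall m, P m -> exists c, m = kcomb c s.

Definition finite_codim (M : lmodType S) (P : set M) :=
  exists s : seq M, forall m, exists c, P (m - kcomb c s).

Definition graded_submod (M : grmod) (P : set M) :=
  [/\ P 0, forall (a : S) m m', P m -> P m' -> P (a *: m + m')
    & forall l m, P m -> P (hpart l m)].

(* The Hom space from M to N in the quotient by finite dimensional modules is
   the colimit of Hom(M', N/N') over the graded submodules M' of M of finite
   codimension and the finite dimensional graded submodules N' of N.  A
   morphism M' -> N/N' is given by its graph {(m, n) | n is in the class of the
   image of m}, a graded submodule of M x N from which M' and N' are recovered
   as the domain and the set of the n related to 0. *)
Section QuotientHom.
Variables M N : grmod.

Record qgraph := QGraph {
  qrel :> M -> N -> Prop;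
  qrel0 : qrel 0 0;
  qrelP : forall (a : S) m m' n n',
    qrel m n -> qrel m' n' -> qrel (a *: m + m') (a *: n + n');
  qrel_gr : forall l m n, qrel m n -> qrel (hpart l m) (hpart l n);
  qrel_dom : finite_codim [set m | exists n, qrel m n];
  qrel_ind : finite_dim [set n | qrel 0 n] }.

(* R and R' agree in some Hom(M0, N/N0) of the colimit. *)
Definition qequiv (R R' : qgraph) :=
  exists (M0 : set M) (N0 : set N),
  [/\ graded_submod M0 /\ finite_codim M0, graded_submod N0 /\ finite_dim N0,
      forall m, M0 m -> (exists n, R m n) /\ (exists n, R' m n)
    & forall m n n', M0 m -> R m n -> R' m n' -> N0 (n - n')].

End QuotientHom.

Section KRel.
Implicit Types M N : lmodType S.

Lemma sCD a b : sC (a + b) = sC a + sC b.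
Proof. by rewrite /sC !polyCD. Qed.
Lemma sCM a b : sC (a * b) = sC a * sC b.
Proof. by rewrite /sC !polyCM. Qed.
Lemma sC1 : sC 1 = 1.
Proof. by []. Qed.
Lemma sC0 : sC 0 = 0.
Proof. by rewrite /sC !polyC0. Qed.
Lemma sCN a : sC (- a) = - sC a.
Proof. by rewrite /sC !polyCN. Qed.

Definition ksub M (P : set M) :=
  P 0 /\ forall a m m', P m -> P m' -> P (sC a *: m + m').

Definition krel M N (T : M -> N -> Prop) := 
  T 0 0 /\ forall a m m' n n', T m n -> T m' n' ->
    T (sC a *: m + m') (sC a *: n + n').

Lemma kcomb_nil M c : kcomb c ([::] : seq M) = 0.
Proof. by rewrite /kcomb big_ord0. Qed.

Lemma kcomb_cons M c (v : M) s :
  kcomb c (v :: s) = sC (c 0) *: v + kcomb (fun i => c i.+1) s.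
Proof. by rewrite /kcomb big_ord_recl. Qed.

Definition ccons (a : k) (c : nat -> k) i := if i is j.+1 then c j else a.

Lemma kcomb_ccons M a c (v : M) s : kcomb (ccons a c) (v :: s) = sC a *: v + kcomb c s.
Proof. by rewrite kcomb_cons. Qed.

Lemma kcombP M a c d (s : seq M) :
  kcomb (fun i => a * c i + d i) s = sC a *: kcomb c s + kcomb d s.
Proof.
rewrite /kcomb scaler_sumr -big_split; apply: eq_bigr => i _ /=.
by rewrite sCD sCM scalerDl scalerA.
Qed.

Lemma ksubB M (P : set M) m m' : ksub P -> P m -> P m' -> P (m - m').
Proof.
by move=> [_ h] Pm Pm'; rewrite addrC -[- m']scaleN1r -sC1 -sCN; apply: h.
Qed.

Lemma ksubD M (P : set M) m m' : ksub P -> P m -> P m' -> P (m + m').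
Proof. by move=> [_ h] Pm Pm'; rewrite -[m]scale1r -sC1; apply: h. Qed.

Lemma ksubZ M (P : set M) a m : ksub P -> P m -> P (sC a *: m).
Proof. by move=> [h0 h] Pm; rewrite -[X in P X]addr0; apply: h. Qed.

Lemma krelB M N (T : M -> N -> Prop) m m' n n' : krel T -> T m n -> T m' n' ->
  T (m - m') (n - n').
Proof.
move=> [_ h] Pm Pm'; rewrite addrC -[- m']scaleN1r [n - _]addrC -[- n']scaleN1r.
by rewrite -sC1 -sCN; apply: h.
Qed.

Lemma krelD M N (T : M -> N -> Prop) m m' n n' : krel T -> T m n -> T m' n' ->
  T (m + m') (n + n').
Proof.
by move=> [_ h] Pm Pm'; rewrite -[m]scale1r -[n]scale1r -sC1; apply: h.
Qed.

Lemma krelZ M N (T : M -> N -> Prop) a m n : krel T -> T m n ->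
  T (sC a *: m) (sC a *: n).
Proof. by move=> [h0 h] Pm; rewrite -[sC a *: m]addr0 -[sC a *: n]addr0; apply: h. Qed.

Lemma finite_dim_sub M (P Q : set M) : (forall m, P m -> Q m) ->
  finite_dim Q -> finite_dim P.
Proof. by move=> PQ [s hs]; exists s => m /PQ /hs. Qed.

Lemma finite_codim_sub M (P Q : set M) : (forall m, P m -> Q m) ->
  finite_codim P -> finite_codim Q.
Proof. by move=> PQ [s hs]; exists s => m; have [c /PQ] := hs m; exists c. Qed.

Lemma finite_dim0 M : finite_dim [set m : M | m = 0].
Proof. by exists [::] => m ->; exists (fun=> 0); rewrite kcomb_nil. Qed.

Lemma finite_codimT M : finite_codim [set: M].
Proof. by exists [::] => m; exists (fun=> 0). Qed.

Lemma kcomb_cat M (s t : seq M) c d :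
  exists e, kcomb e (s ++ t) = kcomb c s + kcomb d t.
Proof.
elim: s c => [|v s IH] c; first by exists d; rewrite kcomb_nil add0r.
have [e he] := IH (fun i => c i.+1).
by exists (ccons (c 0) e); rewrite /= kcomb_ccons he kcomb_cons addrA.
Qed.

Lemma finite_dimD M (P Q : set M) : finite_dim P -> finite_dim Q ->
  finite_dim [set m | exists m1 m2, [/\ P m1, Q m2 & m = m1 + m2]].
Proof.
move=> [s hs] [t ht]; exists (s ++ t) => _ [m1 [m2 [/hs[c ->] /ht[d ->] ->]]].
by have [e <-] := kcomb_cat s t c d; exists e.
Qed.

Lemma finite_dim_image M N (T : M -> N -> Prop) (P : set M) : krel T ->
  finite_dim [set n | T 0 n] -> finite_dim P ->
  finite_dim [set n | exists2 m, P m & T m n].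
Proof.
move=> kT indT [s hs].
suff: finite_dim [set n | exists c, T (kcomb c s) n].
  by apply: finite_dim_sub => n [m /hs[c ->] Tn]; exists c.
elim: s {P hs} => [|v s [t ht]].
  by apply: finite_dim_sub indT => n [c]; rewrite kcomb_nil.
have [[c [n0 [c0 Tn0]]]|nex] :=
    pselect (exists c n0, c 0 != 0 /\ T (kcomb c (v :: s)) n0); last first.
  exists t => n [c Tn]; apply: ht; exists (fun i => c i.+1).
  have c0 : c 0 = 0.
    by apply/eqP/negPn/negP => c0; apply: nex; exists c, n.
  by move: Tn; rewrite kcomb_cons c0 sC0 scale0r add0r.
exists (n0 :: t) => n [d Td].
pose a := d 0 / c 0.
have := krelB kT Td (krelZ a kT Tn0).
rewrite !kcomb_cons scalerDr scalerA -sCM mulfVK // opprD addrACA subrr add0r.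
set m' := _ - _ => Tm.
have [|e he] := ht (n - sC a *: n0).
  exists (fun i => - a * c i.+1 + d i.+1); rewrite kcombP sCN scaleNr addrC.
  exact: Tm.
by exists (ccons a e); rewrite kcomb_ccons -he addrC subrK.
Qed.

Lemma finite_codim_preim_rel M N (T : M -> N -> Prop) (Q : set N) : krel T ->
  ksub Q -> finite_codim Q ->
  exists u : seq M, (forall i, (i < size u)%N -> exists n, T u`_i n) /\
    forall m n, T m n -> exists c n', T (m - kcomb c u) n' /\ Q n'.
Proof.
move=> kT kQ [t ht]; elim: t Q kQ ht => [|v t IH] Q kQ ht.
  exists [::]; split=> // m n Tmn; exists (fun=> 0), n; rewrite kcomb_nil subr0.
  by split=> //; have [c] := ht n; rewrite kcomb_nil subr0.
pose Q' := [set n | exists a, Q (n - sC a *: v)].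
have kQ' : ksub Q'.
  split; first by exists 0; rewrite sC0 scale0r subr0; case: kQ.
  move=> a m m' [b Qb] [b' Qb']; exists (a * b + b').
  suff -> : sC a *: m + m' - sC (a * b + b') *: v =
            sC a *: (m - sC b *: v) + (m' - sC b' *: v) by case: kQ => _; apply.
  by rewrite sCD sCM scalerDl scalerBr scalerA opprD addrACA.
have [|u [uT hu]] := IH Q' kQ'.
  move=> n; have [c] := ht n; rewrite kcomb_cons => Qn.
  by exists (fun i => c i.+1), (c 0); rewrite -addrA -opprD [_ + sC _ *: _]addrC.
have [[w [n0 [a [Tw a0 Qa]]]]|nex] :=
    pselect (exists w n0 a, [/\ T w n0, a != 0 & Q (n0 - sC a *: v)]); last first.
  exists u; split=> // m n /hu[c [n' [Tn' [a Qa]]]]; exists c, n'; split=> //.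
  have [a0|a0] := eqVneq a 0; last by exfalso; apply: nex; exists (m - kcomb c u), n', a.
  by move: Qa; rewrite a0 sC0 scale0r subr0.
exists (w :: u); split; first by case=> [|i] //= ?; [exists n0|exact: uT].
move=> m n /hu[c [n' [Tn' [b Qb]]]].
exists (ccons (b / a) c), (n' - sC (b / a) *: n0); rewrite kcomb_ccons; split.
  by rewrite opprD addrCA addrC; apply: krelB => //; apply: krelZ.
suff -> : n' - sC (b / a) *: n0 = (n' - sC b *: v) - sC (b / a) *: (n0 - sC a *: v).
  by apply: ksubB => //; apply: ksubZ.
by rewrite scalerBr scalerA -sCM divfK // opprB addrA subrK.
Qed.

Lemma finite_codim_preim M N (T : M -> N -> Prop) (Q : set N) : krel T ->
  finite_codim [set m | exists n, T m n] -> ksub Q -> finite_codim Q ->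
  finite_codim [set m | exists2 n, T m n & Q n].
Proof.
move=> kT [s hs] kQ fQ.
have [u [_ hu]] := finite_codim_preim_rel kT kQ fQ.
exists (s ++ u) => m; have [c [n /hu[d [n' [Tn Qn]]]]] := hs m.
have [e he] := kcomb_cat s u c d; exists e; exists n' => //.
by rewrite he opprD addrA.
Qed.

Lemma finite_codimI M (P Q : set M) : ksub P -> ksub Q -> finite_codim P ->
  finite_codim Q -> finite_codim [set m | P m /\ Q m].
Proof.
move=> kP kQ fP fQ.
have kT : krel (fun m n : M => P m /\ n = m).
  split; first by split=> //; case: kP.
  by move=> a m m' n n' [Pm ->] [Pm' ->]; split=> //; case: kP => _; apply.
have := finite_codim_preim kT _ kQ fQ.
have fd : finite_codim [set m | exists n : M, P m /\ n = m].
  by apply: finite_codim_sub fP => m Pm; exists m.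
by move=> /(_ fd); apply: finite_codim_sub => m [n [Pm ->] Qm].
Qed.

Lemma finite_dim_range M N (T : M -> N -> Prop) (P : set M) : krel T ->
  ksub P -> finite_codim P -> finite_dim [set n | exists2 m, P m & T m n] ->
  finite_dim [set n | exists m, T m n].
Proof.
move=> kT kP fP [t ht].
have kI : krel (fun m m' : M => (exists n, T m n) /\ m' = m).
  split; first by split=> //; exists 0; case: kT.
  move=> a m m' _ _ [[n Tn] ->] [[n' Tn'] ->]; split=> //.
  by exists (sC a *: n + n'); case: kT => _; apply.
have [u [uT hu]] := finite_codim_preim_rel kI kP fP.
have uT' : exists w : seq N, forall c, T (kcomb c u) (kcomb c w).
  elim: u uT {hu} => [|v u IH] uT.
    by exists [::] => c; rewrite !kcomb_nil; case: kT.
  have [|w hw] := IH; first by move=> i hi; apply: (uT i.+1).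
  have [_ [[n Tn] _]] := uT 0%N isT; exists (n :: w) => c.
  by rewrite !kcomb_cons; case: kT => _; apply.
have [w hw] := uT'; exists (w ++ t) => n [m Tmn].
have [|c [m' [[_ ->] Pm]]] := hu m m; first by split=> //; exists n.
have [|d hd] := ht (n - kcomb c w); first by exists (m - kcomb c u) => //; apply: krelB.
by have [e he] := kcomb_cat w t c d; exists e; rewrite he -hd addrC subrK.
Qed.

End KRel.

Section GradedTheory.
Variable M : grmod.

Lemma hpart0 l : hpart l (0 : M) = 0.
Proof. by apply: (addrI (hpart l 0)); rewrite -hpartD !addr0. Qed.

Lemma hpart_bigsum l (s : seq L) (F : L -> M) :
  hpart l (\sum_(i <- s) F i) = \sum_(i <- s) hpart l (F i).
Proof.
elim: s => [|i s IH]; first by rewrite !big_nil hpart0.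
by rewrite !big_cons hpartD IH.
Qed.

Lemma hpart_homog d l f (m : M) : homogeneous d f ->
  hpart (d + l) (f *: m) = f *: hpart l m.
Proof.
move=> hf; have [s _ mE] := hpart_sum m.
rewrite [in LHS]mE [in RHS]mE scaler_sumr !hpart_bigsum scaler_sumr.
apply: eq_bigr => l' _; rewrite -(hpart_act l' m hf) !hpartK.
rewrite (inj_eq (addrI d)); case: eqP => [->|_]; last by rewrite scaler0.
by rewrite (hpart_act l' m hf).
Qed.

Lemma homogeneous_sC a : homogeneous 0 (sC a).
Proof.
move=> i j; rewrite /sC coefC; case: j => [|j] /=; last by rewrite coef0 eqxx.
rewrite coefC; case: i => [|i] /=; last by rewrite eqxx.
by rewrite /mon_weight !mulr0n addr0.
Qed.

Lemma hpartZ l a (m : M) : hpart l (sC a *: m) = sC a *: hpart l m.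
Proof. by rewrite -(hpart_homog l m (@homogeneous_sC a)) add0r. Qed.

Lemma hpartB l (m m' : M) : hpart l (m - m') = hpart l m - hpart l m'.
Proof. by rewrite -scaleN1r -sC1 -sCN hpartD hpartZ sCN scaleN1r. Qed.

Lemma ksub_graded (P : set M) : graded_submod P -> ksub P.
Proof. by case=> P0 PP _; split=> // a; apply: PP. Qed.

End GradedTheory.

Local Obligation Tactic := idtac.

Section QuotientHomTheory.
Variables M N : grmod.
Implicit Types R : qgraph M N.

Lemma krel_q R : krel R.
Proof. by split=> [|a]; [apply: qrel0|apply: qrelP]. Qed.

Definition qdom R := [set m | exists n, R m n].

Lemma graded_qdom R : graded_submod (qdom R).
Proof.
split; first by exists 0; apply: qrel0.
  by move=> a m m' [n Rn] [n' Rn']; exists (a *: n + n'); apply: qrelP.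
by move=> l m [n Rn]; exists (hpart l n); apply: qrel_gr.
Qed.

Definition qdiff R R' :=
  [set d | exists m n n', [/\ R m n, R' m n' & d = n - n']].

Lemma graded_qdiff R R' : graded_submod (qdiff R R').
Proof.
split; first by exists 0, 0, 0; rewrite subr0; split=> //; apply: qrel0.
  move=> a _ _ [m [n [n' [h h' ->]]]] [m1 [n1 [n1' [h1 h1' ->]]]].
  exists (a *: m + m1), (a *: n + n1), (a *: n' + n1').
  by split; [apply: qrelP|apply: qrelP|rewrite scalerBr opprD addrACA].
move=> l _ [m [n [n' [h h' ->]]]]; exists (hpart l m), (hpart l n), (hpart l n').
by split; [apply: qrel_gr|apply: qrel_gr|rewrite hpartB].
Qed.

Lemma graded_submodI (P Q : set M) :
  graded_submod P -> graded_submod Q -> graded_submod [set m | P m /\ Q m].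
Proof.
move=> [P0 PP Pl] [Q0 QQ Ql]; split=> //=.
  by move=> a m m' [? ?] [? ?]; split; [apply: PP|apply: QQ].
by move=> l m [? ?]; split; [apply: Pl|apply: Ql].
Qed.

Lemma graded_submodD (P Q : set N) : graded_submod P -> graded_submod Q ->
  graded_submod [set m | exists m1 m2, [/\ P m1, Q m2 & m = m1 + m2]].
Proof.
move=> [P0 PP Pl] [Q0 QQ Ql]; split=> //=.
- by exists 0, 0; rewrite addr0.
- move=> a _ _ [m1 [m2 [h1 h2 ->]]] [n1 [n2 [h3 h4 ->]]].
  exists (a *: m1 + n1), (a *: m2 + n2); split; [exact: PP|exact: QQ|].
  by rewrite scalerDr addrACA.
- move=> l _ [m1 [m2 [h1 h2 ->]]]; exists (hpart l m1), (hpart l m2).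
  by split; [exact: Pl|exact: Ql|rewrite hpartD].
Qed.

Lemma qequivP R R' : qequiv R R' <-> finite_dim (qdiff R R').
Proof.
split=> [[M0 [N0 [[gM fM] [gN fN] h1 h2]]]|fd]; last first.
  exists [set m | qdom R m /\ qdom R' m], (qdiff R R'); split=> //.
  - split; first by apply: graded_submodI; apply: graded_qdom.
    by apply: finite_codimI; try exact: qrel_dom; apply/ksub_graded/graded_qdom.
  - by split=> //; apply: graded_qdiff.
  - by move=> m n n' _ Rn R'n'; exists m, n, n'.
have kT : krel (fun m d => exists n n', [/\ R m n, R' m n' & d = n - n']).
  split; first by exists 0, 0; rewrite subr0; split=> //; apply: qrel0.
  move=> a m m1 _ _ [n [n' [h h' ->]]] [n1 [n1' [h3 h3' ->]]].
  exists (sC a *: n + n1), (sC a *: n' + n1').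
  by split; [apply: qrelP|apply: qrelP|rewrite scalerBr opprD addrACA].
apply: (finite_dim_range kT (ksub_graded gM) fM).
by apply: finite_dim_sub fN => _ [m Mm [n [n' [Rn R'n' ->]]]]; apply: h2 Rn R'n'.
Qed.

Lemma qequiv_sub R R' : (forall m n, R m n -> R' m n) -> qequiv R R'.
Proof.
move=> sRR'; apply/qequivP; apply: finite_dim_sub (qrel_ind R').
move=> _ [m [n [n' [/sRR' h h' ->]]]] /=; rewrite -(subrr m).
exact: (krelB (krel_q R')).
Qed.

Lemma qequiv_refl R : qequiv R R.
Proof. exact: qequiv_sub. Qed.

Lemma qequiv_sym R R' : qequiv R R' -> qequiv R' R.
Proof.
move=> [M0 [N0 [gM gN h1 h2]]]; exists M0, N0; split=> //.
  by move=> m /h1[].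
move=> m n n' Mm Rn R'n'; rewrite -opprB -[- _]add0r.
by apply: ksubB; [apply: ksub_graded (gN.1)|case: gN => -[]|apply: h2 R'n' Rn].
Qed.

Lemma qequiv_trans R1 R2 R3 : qequiv R1 R2 -> qequiv R2 R3 -> qequiv R1 R3.
Proof.
move=> [M0 [N0 [[gM fM] [gN fN] h1 h2]]] [M1 [N1 [[gM' fM'] [gN' fN'] h3 h4]]].
exists [set m | M0 m /\ M1 m],
  [set m | exists m1 m2, [/\ N0 m1, N1 m2 & m = m1 + m2]]; split.
- split; first exact: graded_submodI.
  by apply: finite_codimI => //; apply: ksub_graded.
- by split; [exact: graded_submodD|exact: finite_dimD].
- by move=> m [/h1[? _] /h3[_ ?]].
- move=> m n n' [M0m M1m] Rn Rn'; have [_ [n2 Rn2]] := h1 m M0m.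
  exists (n - n2), (n2 - n'); split; [exact: h2 Rn Rn2|exact: h4 Rn2 Rn'|].
  by rewrite addrA subrK.
Qed.

Definition qequivb R R' := `[< qequiv R R' >].

Lemma qequivb_equiv : equiv_class_of qequivb.
Proof.
split=> [R|R R'|R R' R'']; first by apply/asboolP/qequiv_refl.
  by apply/asbool_equiv_eq; split; apply: qequiv_sym.
by move=> /asboolP h /asboolP h'; apply/asboolP/(qequiv_trans h h').
Qed.

HB.instance Definition _ := gen_eqMixin (qgraph M N).
HB.instance Definition _ := gen_choiceMixin (qgraph M N).

Canonical qequivb_equivrel := EquivRelPack qequivb_equiv.
Canonical qequivb_encModRel := defaultEncModRel qequivb.

Definition qhom := {eq_quot qequivb}%qT.
HB.instance Definition _ : EqQuotient _ qequivb qhom := EqQuotient.on qhom.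
HB.instance Definition _ := Choice.on qhom.

Definition qclass R : qhom := \pi_qhom%qT R.

Lemma qclassP R R' : qclass R = qclass R' <-> qequiv R R'.
Proof.
split; first by move=> /eqmodP /asboolP.
by move=> h; apply/eqmodP/asboolP.
Qed.

Lemma qclassE R R' : qequiv R R' -> qclass R = qclass R'.
Proof. by move/qclassP. Qed.

Lemma qclass_repr (f : qhom) : qclass (repr f) = f.
Proof. exact: reprK. Qed.

Lemma qrepr_class R : qequiv (repr (qclass R)) R.
Proof. by apply/qclassP; rewrite qclass_repr. Qed.

Program Definition qzero : qgraph M N :=
  @QGraph M N (fun _ n => n = 0) _ _ _ _ _.
Next Obligation. by []. Qed.
Next Obligation. by move=> a m m' n n' -> ->; rewrite scaler0 addr0. Qed.
Next Obligation. by move=> l m n ->; rewrite hpart0. Qed.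
Next Obligation.
by apply: finite_codim_sub (finite_codimT M) => m _; exists 0.
Qed.
Next Obligation. exact: finite_dim0. Qed.

Program Definition qadd R R' : qgraph M N :=
  @QGraph M N (fun m n => exists n1 n2, [/\ R m n1, R' m n2 & n = n1 + n2])
    _ _ _ _ _.
Next Obligation.
by move=> R R'; exists 0, 0; rewrite addr0; split=> //; apply: qrel0.
Qed.
Next Obligation.
move=> R R' a m m' _ _ [n1 [n2 [h1 h2 ->]]] [n3 [n4 [h3 h4 ->]]].
exists (a *: n1 + n3), (a *: n2 + n4); split; [exact: qrelP|exact: qrelP|].
by rewrite scalerDr addrACA.
Qed.
Next Obligation.
move=> R R' l m _ [n1 [n2 [h1 h2 ->]]]; exists (hpart l n1), (hpart l n2).
by split; [exact: qrel_gr|exact: qrel_gr|rewrite hpartD].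
Qed.
Next Obligation.
move=> R R'; have := finite_codimI (ksub_graded (graded_qdom R))
  (ksub_graded (graded_qdom R')) (qrel_dom R) (qrel_dom R').
apply: finite_codim_sub => m [[n1 h1] [n2 h2]].
by exists (n1 + n2), n1, n2.
Qed.
Next Obligation. by move=> R R'; apply: finite_dimD (qrel_ind R) (qrel_ind R'). Qed.

Program Definition qscale (a : k) R : qgraph M N :=
  @QGraph M N (fun m n => exists2 n1, R m n1 & n = sC a *: n1) _ _ _ _ _.
Next Obligation. by move=> a R; exists 0; [exact: qrel0|rewrite scaler0]. Qed.
Next Obligation.
move=> a R b m m' _ _ [n1 h1 ->] [n2 h2 ->]; exists (b *: n1 + n2); first exact: qrelP.
by rewrite scalerDr !scalerA mulrC.
Qed.
Next Obligation.
by move=> a R l m _ [n1 h1 ->]; exists (hpart l n1); [exact: qrel_gr|rewrite hpartZ].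
Qed.
Next Obligation.
move=> a R; apply: finite_codim_sub (qrel_dom R) => m [n h]; exists (sC a *: n).
by exists n.
Qed.
Next Obligation.
move=> a R; have kT : krel (fun n1 n : N => n = sC a *: n1).
  split; first by rewrite scaler0.
  by move=> b m m' _ _ -> ->; rewrite scalerDr !scalerA mulrC.
apply: (finite_dim_image kT _ (qrel_ind R)).
by apply: finite_dim_sub (finite_dim0 N) => n ->; rewrite /= scaler0.
Qed.

Lemma qadd_compat R1 R1' R2 R2' : qequiv R1 R1' -> qequiv R2 R2' ->
  qequiv (qadd R1 R2) (qadd R1' R2').
Proof.
move=> /qequivP h1 /qequivP h2; apply/qequivP.
apply: finite_dim_sub (finite_dimD h1 h2).
move=> _ [m [_ [_ [[n1 [n2 [r1 r2 ->]]] [n3 [n4 [r3 r4 ->]]] ->]]]].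
exists (n1 - n3), (n2 - n4); split; last by rewrite opprD addrACA.
  by exists m, n1, n3.
by exists m, n2, n4.
Qed.

Lemma qscale_compat a R R' : qequiv R R' -> qequiv (qscale a R) (qscale a R').
Proof.
move=> [M0 [N0 [gM [gN fN] h1 h2]]]; exists M0, N0; split=> //.
  move=> m /h1[[n h] [n' h']].
  by split; [exists (sC a *: n), n|exists (sC a *: n'), n'].
move=> m _ _ Mm [n1 r1 ->] [n2 r2 ->]; rewrite -scalerBr.
by apply: ksubZ; [exact: ksub_graded|exact: h2 r1 r2].
Qed.

Definition qhadd (f g : qhom) := qclass (qadd (repr f) (repr g)).
Definition qhscale a (f : qhom) := qclass (qscale a (repr f)).
Definition qhopp (f : qhom) := qhscale (- 1) f.
Definition qhzero := qclass qzero.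

Lemma qhaddE R R' : qhadd (qclass R) (qclass R') = qclass (qadd R R').
Proof. by apply/qclassE/qadd_compat; exact: qrepr_class. Qed.

Lemma qhscaleE a R : qhscale a (qclass R) = qclass (qscale a R).
Proof. by apply/qclassE/qscale_compat; exact: qrepr_class. Qed.

Lemma qhomW (P : qhom -> Prop) : (forall R, P (qclass R)) -> forall f, P f.
Proof. by move=> h f; rewrite -[f]qclass_repr. Qed.

Lemma qhaddA : associative qhadd.
Proof.
elim/qhomW=> R1; elim/qhomW=> R2; elim/qhomW=> R3; rewrite !qhaddE.
apply/qclassE/qequiv_sub => m _ [n1 [_ [r1 [n2 [n3 [r2 r3 ->]]] ->]]].
by exists (n1 + n2), n3; rewrite addrA; split=> //; exists n1, n2.
Qed.

Lemma qhaddC : commutative qhadd.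
Proof.
elim/qhomW=> R1; elim/qhomW=> R2; rewrite !qhaddE.
apply/qclassE/qequiv_sub => m _ [n1 [n2 [r1 r2 ->]]].
by exists n2, n1; rewrite addrC.
Qed.

Lemma qhadd0 : left_id qhzero qhadd.
Proof.
elim/qhomW=> R; rewrite qhaddE.
by apply/qclassE/qequiv_sub => m _ [_ [n [-> r ->]]]; rewrite add0r.
Qed.

Lemma qhaddN : left_inverse qhzero qhopp qhadd.
Proof.
elim/qhomW=> R; rewrite /qhopp qhscaleE qhaddE; apply/qclassE/qequivP.
apply: finite_dim_sub (qrel_ind R).
move=> _ [m [_ [_ [[_ [n1 [[n2 r2 ->] r1 ->]]] -> ->]]]] /=.
rewrite sCN sC1 scaleN1r subr0 addrC -(subrr m).
exact: (krelB (krel_q R)).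
Qed.

HB.instance Definition _ := GRing.isZmodule.Build qhom qhaddA qhaddC qhadd0 qhaddN.

Lemma qclassD R R' : qclass R + qclass R' = qclass (qadd R R').
Proof. exact: qhaddE. Qed.

Lemma qhscaleA a b (f : qhom) : qhscale a (qhscale b f) = qhscale (a * b) f.
Proof.
elim/qhomW: f => R; rewrite !qhscaleE.
apply/qclassE/qequiv_sub => m _ [_ [n r ->] ->].
by exists n => //; rewrite scalerA -sCM.
Qed.

Lemma qhscale1 : left_id 1 qhscale.
Proof.
elim/qhomW=> R; rewrite !qhscaleE.
by apply/qclassE/qequiv_sub => m _ [n r ->]; rewrite sC1 scale1r.
Qed.

Lemma qhscaleDr : right_distributive qhscale +%R.
Proof.
move=> a; elim/qhomW=> R; elim/qhomW=> R'.
rewrite qclassD !qhscaleE qclassD.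
apply/qclassE/qequiv_sub => m _ [_ [n1 [n2 [r1 r2 ->]]] ->].
exists (sC a *: n1), (sC a *: n2); rewrite scalerDr.
by split=> //; [exists n1|exists n2].
Qed.

Lemma qhscaleDl (f : qhom) : {morph qhscale^~ f : a b / a + b}.
Proof.
move=> a b; elim/qhomW: f => R; rewrite !qhscaleE qclassD.
apply/qclassE/qequiv_sub => m _ [n r ->].
exists (sC a *: n), (sC b *: n); rewrite sCD scalerDl.
by split=> //; exists n.
Qed.

HB.instance Definition _ := GRing.Zmodule_isLmodule.Build k qhom
  qhscaleA qhscale1 qhscaleDr qhscaleDl.

Lemma qclassP_lin a R R' :
  a *: qclass R + qclass R' = qclass (qadd (qscale a R) R').
Proof. by rewrite -qclassD -qhscaleE. Qed.

End QuotientHomTheory.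

Section QuotientComp.

Program Definition qid (M : grmod) : qgraph M M :=
  @QGraph M M (fun m n => n = m) _ _ _ _ _.
Next Obligation. by []. Qed.
Next Obligation. by move=> M a m m' n n' -> ->. Qed.
Next Obligation. by move=> M l m n ->. Qed.
Next Obligation.
by move=> M; apply: finite_codim_sub (finite_codimT M) => m _; exists m.
Qed.
Next Obligation. by move=> M; apply: finite_dim0. Qed.

Program Definition qcomp (M N P : grmod) (T : qgraph N P) (R : qgraph M N) :
    qgraph M P :=
  @QGraph M P (fun m x => exists2 n, R m n & T n x) _ _ _ _ _.
Next Obligation. by move=> M N P T R; exists 0; apply: qrel0. Qed.
Next Obligation.
by move=> M N P T R a m m' x x' [n1 h1 h2] [n2 h3 h4]; exists (a *: n1 + n2); apply: qrelP.
Qed.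
Next Obligation.
by move=> M N P T R l m x [n1 h1 h2]; exists (hpart l n1); apply: qrel_gr.
Qed.
Next Obligation.
move=> M N P T R; have := finite_codim_preim (krel_q R) (qrel_dom R)
  (ksub_graded (graded_qdom T)) (qrel_dom T).
by apply: finite_codim_sub => m [n Rn [x Tx]]; exists x, n.
Qed.
Next Obligation.
by move=> M N P T R; apply: finite_dim_image (krel_q T) (qrel_ind T) (qrel_ind R).
Qed.

Lemma qcomp_compat (M N P : grmod) (T T' : qgraph N P) (R R' : qgraph M N) :
  qequiv T T' -> qequiv R R' -> qequiv (qcomp T R) (qcomp T' R').
Proof.
move=> eT eR; apply: (@qequiv_trans _ _ _ (qcomp T R')).
  have /qequivP fd := eR; apply/qequivP.
  apply: finite_dim_sub (finite_dim_image (krel_q T) (qrel_ind T) fd).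
  move=> _ [m [x [x' [[n r t] [n' r' t'] ->]]]].
  by exists (n - n'); [exists m, n, n'|exact: (krelB (krel_q T))].
have /qequivP fd := eT.
have fI := finite_dim_image (krel_q T) (qrel_ind T) (qrel_ind R').
have fI' := finite_dim_image (krel_q T') (qrel_ind T') (qrel_ind R').
pose M0 := [set m | exists2 n, R' m n & qdom T n /\ qdom T' n].
pose K := [set y : P | exists y1 y2, [/\ qdiff T T' y1,
  [set y | exists z z', [/\ (exists2 n, R' 0 n & T n z),
     (exists2 n, R' 0 n & T' n z') & y = z + z']] y2 & y = y1 + y2]].
have gI (U : qgraph N P) : graded_submod [set x | exists2 n, R' 0 n & U n x].
  split; first by exists 0; apply: qrel0.
    move=> a x x' [n r u] [n' r' u']; exists (a *: n + n'); last exact: qrelP.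
    by have := qrelP a r r'; rewrite scaler0 addr0.
  move=> l x [n r u]; exists (hpart l n); last exact: qrel_gr.
  by rewrite -(hpart0 M l); apply: qrel_gr.
exists M0, K; split.
- have gd := graded_submodI (graded_qdom T) (graded_qdom T').
  split.
    split; first by exists 0; [exact: qrel0|case: gd].
      move=> a m m' [n r d] [n' r' d']; exists (a *: n + n'); first exact: qrelP.
      by case: gd => _ + _; apply.
    move=> l m [n r d]; exists (hpart l n); first exact: qrel_gr.
    by case: gd => _ _; apply.
  apply: (finite_codim_preim (krel_q R') (qrel_dom R') (ksub_graded gd)).
  by apply: finite_codimI; try exact: qrel_dom; apply/ksub_graded/graded_qdom.
- split; last exact: finite_dimD fd (finite_dimD fI fI').
  by apply: graded_submodD; [exact: graded_qdiff|apply: graded_submodD; exact: gI].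
- by move=> m [n r [[x t] [x' t']]]; split; [exists x, n|exists x', n].
- move=> m x x' [n r [[x1 t] [x1' t']]] [n1 r1 t1] [n2 r2 t2].
  exists (x1 - x1'), ((x - x1) + (x1' - x')); split.
  + by exists n, x1, x1'.
  + exists (x - x1), (x1' - x'); split=> //.
      exists (n1 - n); last exact: (krelB (krel_q T)).
      by rewrite -(subrr m); apply: (krelB (krel_q R')).
    exists (n - n2); last exact: (krelB (krel_q T')).
    by rewrite -(subrr m); apply: (krelB (krel_q R')).
  + rewrite [_ - x1 + _]addrC addrA (addrA (x1 - x1')) subrK addrC addrA subrK.
    by [].
Qed.
Definition qhcomp (M N P : grmod) (g : qhom N P) (f : qhom M N) : qhom M P :=
  qclass (qcomp (repr g) (repr f)).

Lemma qhcompE (M N P : grmod) (T : qgraph N P) (R : qgraph M N) :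
  qhcomp (qclass T) (qclass R) = qclass (qcomp T R).
Proof. by apply/qclassE/qcomp_compat; exact: qrepr_class. Qed.

Lemma qhcompA (M N P Q : grmod) (h : qhom P Q) (g : qhom N P) (f : qhom M N) :
  qhcomp h (qhcomp g f) = qhcomp (qhcomp h g) f.
Proof.
elim/qhomW: h => H; elim/qhomW: g => G; elim/qhomW: f => F; rewrite !qhcompE.
apply/qclassE/qequiv_sub => m x [y [n r1 r2] r3].
by exists n => //; exists y.
Qed.

Lemma qhcomp1m (M N : grmod) (f : qhom M N) : qhcomp (qclass (qid N)) f = f.
Proof.
elim/qhomW: f => F; rewrite qhcompE.
by apply/qclassE/qequiv_sub => m x [n r ->].
Qed.

Lemma qhcompm1 (M N : grmod) (f : qhom M N) : qhcomp f (qclass (qid M)) = f.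
Proof.
elim/qhomW: f => F; rewrite qhcompE.
by apply/qclassE/qequiv_sub => m x [n ->].
Qed.

Lemma qhcompDl (M N P : grmod) a (g g' : qhom N P) (f : qhom M N) :
  qhcomp (a *: g + g') f = a *: qhcomp g f + qhcomp g' f.
Proof.
elim/qhomW: g => G; elim/qhomW: g' => G'; elim/qhomW: f => F.
rewrite qclassP_lin !qhcompE qclassP_lin.
apply/qclassE/qequiv_sub => m x [n r [_ [x2 [[x1 g1 ->] g2 ->]]]].
exists (sC a *: x1), x2; split=> //; last by exists n.
by exists x1 => //; exists n.
Qed.

Lemma qhcompDr (M N P : grmod) a (g : qhom N P) (f f' : qhom M N) :
  qhcomp g (a *: f + f') = a *: qhcomp g f + qhcomp g f'.
Proof.
elim/qhomW: g => G; elim/qhomW: f => F; elim/qhomW: f' => F'.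
rewrite qclassP_lin !qhcompE qclassP_lin.
apply/esym/qclassE/qequiv_sub => m _ [_ [x2 [[x1 [n1 r1 g1] ->] [n2 r2 g2] ->]]].
exists (sC a *: n1 + n2); last by apply: qrelP.
by exists (sC a *: n1), n2; split=> //; exists n1.
Qed.

End QuotientComp.

Definition coh : lincat k :=
  @LinCat k grmod (fun M N => qhom M N : lmodType k) (fun M => qclass (qid M))
    qhcomp qhcompA qhcomp1m qhcompm1 qhcompDl qhcompDr.

Lemma coef_spart d f i j :
  (spart d f)`_j`_i = if mon_weight i j == d then f`_j`_i else 0.
Proof.
rewrite /spart coef_poly; case: ltnP => [_|hj]; last first.
  by rewrite (nth_default 0 hj) !coef0 if_same.
rewrite coef_poly; case: ltnP => // hi.
by rewrite (nth_default 0 hi) if_same.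
Qed.

Lemma spart_eqP (f g : S) : (forall i j, f`_j`_i = g`_j`_i) -> f = g.
Proof. by move=> h; apply/polyP => j; apply/polyP => i. Qed.

Lemma spartD d : {morph spart d : f g / f + g}.
Proof.
move=> f g; apply: spart_eqP => i j; rewrite !(coef_spart, coefD).
by case: eqP => //; rewrite addr0.
Qed.

Lemma spartK d d' f : spart d (spart d' f) = if d == d' then spart d f else 0.
Proof.
apply: spart_eqP => i j; rewrite !coef_spart.
case: (d =P d') => [<-|ne]; first by rewrite coef_spart; case: eqP.
rewrite !coef0; case: eqP => // ->.
by case: eqP.
Qed.

Lemma coefM2 (f g : S) i j : (f * g)`_j`_i =
  \sum_(b < j.+1) \sum_(a < i.+1) f`_b`_a * g`_(j - b)`_(i - a).
Proof.
rewrite coefM coef_sum; apply: eq_bigr => b _; exact: coefM.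
Qed.

Lemma mon_weightB i j (a : 'I_i.+1) (b : 'I_j.+1) :
  mon_weight i j = mon_weight a b + mon_weight (i - a) (j - b).
Proof.
rewrite /mon_weight addrACA -!mulrnDr !subnKC //; [exact: leq_ord|exact: leq_ord].
Qed.

Lemma spartM d e f g : homogeneous d f -> spart (d + e) (f * g) = f * spart e g.
Proof.
move=> hf; apply: spart_eqP => i j; rewrite coef_spart !coefM2.
transitivity (\sum_(b < j.+1) \sum_(a < i.+1)
  if mon_weight i j == d + e then f`_b`_a * g`_(j - b)`_(i - a) else 0).
  by case: eqP => // _; rewrite big1 // => b _; rewrite big1.
apply: eq_bigr => b _; apply: eq_bigr => a _; rewrite coef_spart.
have [->|/hf fE] := eqVneq (f`_b`_a) 0; first by rewrite !mul0r if_same.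
rewrite (mon_weightB a b) fE (inj_eq (addrI d)).
by case: eqP; rewrite ?mulr0.
Qed.

Lemma spart_sum f : exists2 s : seq L, uniq s & f = \sum_(d <- s) spart d f.
Proof.
pose s := undup [seq mon_weight ij.1 ij.2 |
  ij <- [seq (i, j) | j <- iota 0 (size f), i <- iota 0 (size f`_j)]].
exists s; first exact: undup_uniq.
apply: spart_eqP => i j; rewrite !coef_sum.
have [f0|fn0] := eqVneq (f`_j`_i) 0.
  by rewrite f0 big1 // => d _; rewrite coef_spart f0 if_same.
have ms : mon_weight i j \in s.
  rewrite mem_undup; apply/mapP; exists (i, j) => //.
  apply/allpairsPdep; exists j, i; rewrite !mem_iota !add0n /=; split=> //.
    by rewrite ltnNge; apply: contra fn0 => h; rewrite (nth_default 0 h) coef0.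
  by rewrite ltnNge; apply: contra fn0 => h; rewrite (nth_default 0 h).
rewrite (bigD1_seq _ ms (undup_uniq _)) /= coef_spart eqxx big1 ?addr0 // => d.
by rewrite coef_spart eq_sym => /negPf ->.
Qed.

(* S(x), with S(x)_l = S_(x + l) *)
Section Shift.
Variable x : L.

Let part l (f : S^o) : S^o := spart (x + l) f.

Lemma shift_partD l : {morph part l : f g / f + g}.
Proof. exact: spartD. Qed.

Lemma shift_partK l l' f : part l (part l' f) = if l == l' then part l f else 0.
Proof. by rewrite /part spartK (inj_eq (addrI x)). Qed.

Lemma shift_part_sum f : exists2 s : seq L, uniq s & f = \sum_(l <- s) part l f.
Proof.
have [s us fE] := spart_sum f; exists [seq d - x | d <- s].
  by rewrite map_inj_uniq //; exact: addIr.
rewrite big_map [LHS]fE; apply: eq_bigr => d _.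
by rewrite /part addrC subrK.
Qed.

Lemma shift_part_act d l (f : S) g : homogeneous d f ->
  part (d + l) (f *: part l g) = f *: part l g.
Proof. by move=> hf; rewrite /part addrCA spartM // spartK eqxx. Qed.

Lemma shift_fin_gen : exists s : seq S^o, forall m, exists c : nat -> S,
  m = \sum_(i < size s) c i *: s`_i.
Proof.
by exists [:: 1] => m; exists (fun=> m); rewrite big_ord1 /= [RHS]mulr1.
Qed.

Definition line_bundle : coh :=
  GrMod shift_partD shift_partK shift_part_sum shift_part_act shift_fin_gen.

End Shift.

Section Multiplication.
Variables (x y : L) (f : S).
Hypothesis homf : homogeneous (y - x) f.

Local Notation Ox := (line_bundle x : grmod).
Local Notation Oy := (line_bundle y : grmod).

Definition mulgraph : qgraph Ox Oy.
Proof.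
refine (@QGraph Ox Oy (fun m n : S => n = f * m) _ _ _ _ _).
- by rewrite mulr0.
- by move=> a m m' n n' -> ->; rewrite mulrDr mulrCA.
- move=> l m n ->; rewrite /= -(spartM _ _ homf).
  by rewrite addrA subrK.
- by apply: finite_codim_sub (finite_codimT Ox) => m _; exists (f * m).
- by apply: finite_dim_sub (finite_dim0 Oy) => n; rewrite /= mulr0.
Defined.

Definition mul_arrow : hom (line_bundle x) (line_bundle y) := qclass mulgraph.

End Multiplication.

Lemma homogeneousB d f g :
  homogeneous d f -> homogeneous d g -> homogeneous d (f - g).
Proof.
move=> hf hg i j; rewrite !coefB.
have [->|/hf //] := eqVneq (f`_j`_i) 0.
have [->|/hg //] := eqVneq (g`_j`_i) 0.
by rewrite subrr eqxx.
Qed.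

Lemma homogeneous_x1n n a : homogeneous (wx1 p q *+ n) (sC a * sx1 ^+ n).
Proof.
move=> i j; rewrite /sC /sx1 -polyC_exp -polyCM coefC.
case: (j =P 0%N) => [->|_]; last by rewrite coef0 eqxx.
rewrite coefCM coefXn; case: (i =P n) => [->|_]; last by rewrite mulr0 eqxx.
by rewrite /mon_weight mulr0n addr0.
Qed.

Lemma homogeneous_x2n n : homogeneous (wx2 p q *+ n) (sx2 ^+ n).
Proof.
move=> i j; rewrite /sx2 coefXn.
case: (j =P n) => [->|_]; last by rewrite coef0 eqxx.
rewrite coef1; case: (i =P 0%N) => [->|_]; last by rewrite eqxx.
by rewrite /mon_weight mulr0n add0r.
Qed.

Lemma homogeneous_x1 (i : int) :
  homogeneous (wx1 p q *~ i - wx1 p q *~ (i - 1)) sx1.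
Proof.
rewrite mulrzBr opprB addrC subrK mulr1z.
by have := @homogeneous_x1n 1 1; rewrite sC1 mul1r expr1.
Qed.

Lemma homogeneous_x2 (i : int) :
  homogeneous (wx2 p q *~ i - wx2 p q *~ (i - 1)) sx2.
Proof.
rewrite mulrzBr opprB addrC subrK mulr1z.
exact: (@homogeneous_x2n 1).
Qed.

Lemma homogeneous_ordinary (lambda : k) :
  homogeneous (wc p q - 0) (sx2 ^+ q - sC lambda * sx1 ^+ p).
Proof.
rewrite subr0; apply: homogeneousB; last exact: homogeneous_x1n.
by rewrite /wc wx_rel; apply: homogeneous_x2n.
Qed.

(* The simple sheaves are determined up to isomorphism. *)
Definition is_simple_infty (i : int) (T : coh) :=
  coker_object (mul_arrow (@homogeneous_x1 i)) T.

Definition is_simple_zero (i : int) (T : coh) :=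
  coker_object (mul_arrow (@homogeneous_x2 i)) T.

Definition is_simple_ordinary (lambda : k) (T : coh) :=
  coker_object (mul_arrow (@homogeneous_ordinary lambda)) T.

Definition is_torsion_infty (i : int) (j : nat) (X : coh) :=
  exists T, is_simple_infty i T /\ uniserial_of T j X.

Definition is_torsion_zero (i : int) (j : nat) (X : coh) :=
  exists T, is_simple_zero i T /\ uniserial_of T j X.

Definition is_torsion_ordinary (lambda : k) (j : nat) (X : coh) :=
  exists T, is_simple_ordinary lambda T /\ uniserial_of T j X.

Definition ordinary_support (X : coh) :=
  exists (lambda : k) (j : nat),
    [/\ lambda != 0, (0 < j)%N & is_torsion_ordinary lambda j X].

End GradedModules.

Section Annulus.
Variable R : realType.

Definition deck : {pred R * R} :=
  fun v => `[< exists n : int, v = (n%:~R, 0) >].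

Lemma deck_closed : zmod_closed deck.
Proof.
split; first by apply/asboolP; exists 0.
move=> _ _ /asboolP[n ->] /asboolP[m ->]; apply/asboolP; exists (n - m).
by rewrite intrB; congr (_, _); rewrite /= subrr.
Qed.

HB.instance Definition _ :=
  GRing.isZmodClosed.Build (R * R)%type deck deck_closed.

(* The quotient of the plane by (x, y) ~ (x + 1, y), which contains the annulus,
   the quotient of the strip R x [0,1], as a closed subspace. *)
Definition cylinder := quotient_topology {quot deck}.

Definition cpi (z : R * R) : cylinder := \pi_({quot deck})%qT z.

Definition annulus : set cylinder := cpi @` [set z | 0 <= z.2 <= 1].
Definition annulus_interior : set cylinder := cpi @` [set z | 0 < z.2 < 1].

Definition homotopic (a b : R -> cylinder) :=
  exists H : R * R -> cylinder,
  [/\ {within `[0, 1]%classic `*` `[0, 1]%classic, continuous H},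
      forall t u, 0 <= t <= 1 -> 0 <= u <= 1 -> annulus (H (t, u)),
      forall t, 0 <= t <= 1 -> H (t, 0) = a t /\ H (t, 1) = b t
    & forall u, 0 <= u <= 1 -> H (0, u) = a 0 /\ H (1, u) = a 1].

(* g is a representative of the curve [P, Q]. *)
Definition strip_curve (P Q : R * R) (g : R -> R * R) :=
  [/\ {within `[0, 1], continuous g}, g 0 = P, g 1 = Q
    & forall t, 0 < t < 1 -> 0 < (g t).2 < 1].

(* the velocity of a at time t, in the coordinates of the universal cover *)
Definition velocity (a : R -> cylinder) (t : R) (v : R * R) :=
  exists g h : R -> R,
  [/\ \forall u \near t, a u = cpi (g u, h u), is_derive t 1 g v.1
    & is_derive t 1 h v.2].

Definition det2 (v w : R * R) := v.1 * w.2 - v.2 * w.1.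

(* Crossings are recorded by their pairs of parameters, so that a point through
   which a curve passes several times is counted with multiplicity. *)
Definition crossing (a b : R -> cylinder) : set (R * R) :=
  [set tu | [/\ 0 < tu.1 < 1, 0 < tu.2 < 1 & a tu.1 = b tu.2]].

Definition transversal (a b : R -> cylinder) :=
  forall tu, crossing a b tu -> exists v w,
    [/\ velocity a tu.1 v, velocity b tu.2 w & det2 v w != 0].

(* det2 v w > 0 when the second curve goes from the right to the left of the
   first one: for instance v = (1, 1) and w = (-1, 1). *)
Definition positive_crossing (a b : R -> cylinder) : set (R * R) :=
  [set tu | crossing a b tu /\ exists v w,
    [/\ velocity a tu.1 v, velocity b tu.2 w & 0 < det2 v w]].

Variables p q : nat.

(* y = 1 covers the inner boundary and y = 0 the outer boundary. *)
Definition inner_pt (i : int) : R * R := (i%:~R / p%:R, 1).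
Definition outer_pt (j : int) : R * R := (j%:~R / q%:R, 0).

Definition marked : set cylinder :=
  cpi @` (range inner_pt `|` range outer_pt).

Definition curve (a : R -> cylinder) :=
  [/\ {within `[0, 1], continuous a}, marked (a 0), marked (a 1)
    & forall t, 0 < t < 1 -> annulus_interior (a t)].

Definition representatives (a b a' b' : R -> cylinder) :=
  [/\ curve a' /\ homotopic a a', curve b' /\ homotopic b b' & transversal a' b'].

(* The minimum is taken over representatives in general position: without this
   requirement, tangencies and common arcs could hide crossings. *)
Definition Iplus (a b : R -> cylinder) (n : nat) :=
  (exists a' b', representatives a b a' b' /\ (positive_crossing a' b' #= `I_n)%card) /\
  forall a' b' m, representatives a b a' b' ->
    (positive_crossing a' b' #= `I_m)%card -> (n <= m)%N.

(* phi is the graph of the bijection from homotopy classes of curves to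
   isomorphism classes of sheaves. *)
Variable k : closedFieldType.

Inductive phi (a : R -> cylinder) (X : coh k p q) : Prop :=
| phi_line (i j : int) (g : R -> R * R) of
    strip_curve (outer_pt j) (inner_pt i) g & homotopic (cpi \o g) a &
    isomorphic X (line_bundle k (wx1 p q *~ i - wx2 p q *~ j))
| phi_infty (i : int) (j : nat) (g : R -> R * R) of (0 < j)%N &
    strip_curve (inner_pt (i - j%:Z - 1)) (inner_pt i) g &
    homotopic (cpi \o g) a & is_torsion_infty i j X
| phi_zero (i : int) (j : nat) (g : R -> R * R) of (0 < j)%N &
    strip_curve (outer_pt (- i)) (outer_pt (j%:Z - i + 1)) g &
    homotopic (cpi \o g) a & is_torsion_zero i j X.

End Annulus.

(* Main.v *)
From HB Require Import structures.
From mathcomp Require Import all_boot all_order all_algebra.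
From mathcomp Require Import generic_quotient ring_quotient.
From mathcomp Require Import all_classical all_reals all_analysis.
Require Import Defs.
From mathcomp Require Import ring lra zify.

Set Implicit Arguments.
Unset Strict Implicit.
Unset Printing Implicit Defensive.

Import Order.TTheory GRing.Theory Num.Theory.
Import Quotient.

Local Open Scope ring_scope.
Local Open Scope lincat_scope.

(* Algebraic side.  Up to isomorphism a line bundle is the free cyclic module
   S(w), and the torsion sheaf of length j with top coker(x_b) is S(w)/(x_b^j):
   the annihilator of a homogeneous element lifting a generator contains a
   power of x_b, because its subobjects x_b^a X and fX are comparable.  An
   extension of X is classified through the resolutions
   0 -> S(v - N x_t - j x_b) -> S(v - N x_t) -> X -> 0 of a torsion sheaf (x_t
   the other variable), or the Koszul complexes on x_1^N, x_2^N of a line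
   bundle, by letting N grow; the monomials that survive are indexed by the
   integers m satisfying the inequalities of [pos_shift].

   Geometric side.  The crossings of a and b are the zeros in the unit square of
   F_m(t, u) = b(u) + (m, 0) - a(t), for lifts of a and b to the strip and all
   integers m, and a crossing is positive when F_m reverses the orientation
   there.  If no zero does, subdividing the square shows that F_m turns
   nonnegatively along the boundary.  The boundary values lie in half planes, so
   the turning number depends only on the end points of the curves; it is
   negative when m satisfies [pos_shift], whence one positive crossing for every
   such m.  Equality holds for chords and loops given by quadratic functions. *)

(** * Noetherian modules *)

(** Hom spaces of the quotient category are colimits: a morphism out of [O a] is given by an element
    only after multiplication by a power of a variable. This is why a single resolution does not
    suffice; the power of the variable is paid for by passing to a deeper level of a tower.
    Extensions are Yoneda classes with Baer sums, so the long exact sequence is replaced by pushouts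
    of a fixed resolution along cocycles. Finite dimension and codimension of graded submodules are
    both turned into the statement that large powers of each variable act by zero, which composes
    well and rests on Hilbert's basis theorem. On the geometric side the curves are only continuous
    away from their crossings, so no smooth degree theory applies; arguments are lifted by adding
    small angles over a fine subdivision. Neither side is evaluated in closed form: both are shown
    to be the size of one and the same list of integers [m]. *)

Section Generation.
Variable A : comNzRingType.

Definition gen (M : lmodType A) (s : seq M) (m : M) :=
  exists c : nat -> A, m = \sum_(i < size s) c i *: s`_i.

Definition submodule (M : lmodType A) (P : M -> Prop) :=
  P 0 /\ forall (a : A) m m', P m -> P m' -> P (a *: m + m').

Section Module.
Variable M : lmodType A.
Implicit Types (P : M -> Prop) (s t : seq M) (m : M).

Lemma submoduleZ P a m : submodule P -> P m -> P (a *: m).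
Proof. by move=> [P0 h] Pm; rewrite -[X in P X]addr0; apply: h. Qed.

Lemma submoduleD P m m' : submodule P -> P m -> P m' -> P (m + m').
Proof. by move=> [P0 h] Pm; rewrite -[m]scale1r; apply: h. Qed.

Lemma submoduleB P m m' : submodule P -> P m -> P m' -> P (m - m').
Proof. by move=> [P0 h] Pm Pm'; rewrite addrC -scaleN1r; apply: h. Qed.

Lemma submodule_sum P (I : Type) (r : seq I) (Q : pred I) (F : I -> M) :
  submodule P -> (forall i, Q i -> P (F i)) -> P (\sum_(i <- r | Q i) F i).
Proof.
by move=> sP h; elim/big_ind: _ => //; [case: sP | move=> *; apply: submoduleD].
Qed.

Lemma gen_nil m : gen [::] m -> m = 0.
Proof. by case=> c ->; rewrite big_ord0. Qed.

Lemma gen_submodule s : submodule (gen s).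
Proof.
split; first by exists (fun=> 0); rewrite big1 // => i _; rewrite scale0r.
move=> a _ _ [c ->] [d ->]; exists (fun i => a * c i + d i).
rewrite scaler_sumr -big_split; apply: eq_bigr => i _.
by rewrite scalerA scalerDl.
Qed.

Lemma gen_nth s i : (i < size s)%N -> gen s s`_i.
Proof.
move=> hi; exists (fun j => (j == i)%:R).
rewrite (bigD1 (Ordinal hi)) //= eqxx scale1r big1 ?addr0 // => j ne.
suff -> : (j == i :> nat) = false by rewrite scale0r.
by apply/negbTE; apply: contraNneq ne => e; apply/eqP/val_inj.
Qed.

Lemma gen_mem s m : m \in s -> gen s m.
Proof. by case/(nthP 0) => i hi <-; apply: gen_nth. Qed.

Lemma gen_sub s P m : submodule P -> (forall v, v \in s -> P v) -> gen s m -> P m.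
Proof.
move=> sP h [c ->]; apply: submodule_sum => // i _.
by apply: submoduleZ => //; apply: h; apply: mem_nth.
Qed.

Lemma gen_cat s t m m' : gen s m -> gen t m' -> gen (s ++ t) (m + m').
Proof.
move=> hs ht; apply: submoduleD; first exact: gen_submodule.
  by apply: gen_sub hs => [|v vs]; [exact: gen_submodule | apply: gen_mem; rewrite mem_cat vs].
by apply: gen_sub ht => [|v vs]; [exact: gen_submodule | apply: gen_mem;
  rewrite mem_cat vs orbT].
Qed.

Lemma gen_cons v s m : gen (v :: s) m <-> exists a m', gen s m' /\ m = a *: v + m'.
Proof.
split=> [[c ->]|[a [m' [gm ->]]]].
  by exists (c 0%N), (\sum_(i < size s) c i.+1 *: s`_i); rewrite big_ord_recl; split=> //;
    exists (fun i => c i.+1).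
have [_ h] := gen_submodule (v :: s); apply: h; first by apply: gen_mem; rewrite mem_head.
apply: gen_sub gm => [|w ws]; first exact: gen_submodule.
by apply: gen_mem; rewrite inE ws orbT.
Qed.

End Module.

Definition fgen (M : lmodType A) (P : M -> Prop) :=
  exists s : seq M, (forall v, v \in s -> P v) /\ forall m, P m -> gen s m.

Definition noetherian := forall I : A^o -> Prop, submodule I -> fgen I.

(** Induction on [s]. The coefficients of the head [v] in elements of [P] form an ideal, finitely
    generated by assumption; what remains of [P] after subtracting lifts of its generators lies in
    the span of the tail. *)
Lemma noetherian_module (M : lmodType A) (P : M -> Prop) (s : seq M) :
  noetherian -> submodule P -> (forall m, P m -> gen s m) -> fgen P.
Proof.
move=> nA; elim: s P => [|v s IH] P sP Ps.
  by exists [::]; split=> // m /Ps.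
pose I (a : A^o) := exists m', gen s m' /\ P (a *: v + m').
have sI : submodule I.
  split; first by exists 0; rewrite scale0r addr0; split; [case: (gen_submodule s)|case: sP].
  move=> a b b' [m [gm Pm]] [m' [gm' Pm']]; exists (a *: m + m'); split.
    by case: (gen_submodule s) => _; apply.
  suff -> : (a *: b + b' : A^o) *: v + (a *: m + m') = a *: (b *: v + m) + (b' *: v + m').
    by case: sP => _; apply.
  by rewrite scalerDl scalerDr !scalerA addrACA.
have [t [tI It]] := nA I sI.
(* [u] lifts the generators [t] of the ideal of head coefficients to elements of [P]. *)
have [u [uP hu]] : exists u : seq M, (forall w, w \in u -> P w) /\
    forall a, gen t a -> exists m, gen u m /\ exists2 m', gen s m' & m = a *: v + m'.
  elim: t tI {It} => [|a t IHt] tI.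
    exists [::]; split=> // a /gen_nil ->; exists 0; split;
      first by case: (gen_submodule ([::] : seq M)).
    by exists 0; [case: (gen_submodule s)|rewrite scale0r addr0].
  have [|u [uP hu]] := IHt; first by move=> b bt; apply: tI; rewrite inE bt orbT.
  have [|m [gm Pm]] := tI a; first by rewrite mem_head.
  exists ((a *: v + m) :: u); split.
    by move=> w; rewrite inE => /predU1P[->|/uP].
  move=> b /gen_cons[c [b' [/hu[m' [gm' [m1 gm1 mE]]] ->]]].
  exists (c *: (a *: v + m) + m'); split; first by apply/gen_cons; exists c, m'.
  exists (c *: m + m1); first by case: (gen_submodule s) => _; apply.
  by rewrite mE scalerDr scalerDl !scalerA addrACA.
have [|u' [u'P hu']] := IH (fun m => P m /\ gen s m) _ (fun m => @proj2 _ _).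
  split; first by split; [case: sP|case: (gen_submodule s)].
  move=> a m m' [Pm gm] [Pm' gm']; split; first by case: sP => _; apply.
  by case: (gen_submodule s) => _; apply.
exists (u ++ u'); split; first by move=> w; rewrite mem_cat => /orP[/uP|/u'P[]].
move=> m Pm; have /gen_cons[a [m' [gm' mE]]] := Ps m Pm.
have [|n [gn [n' gn' nE]]] := hu a; first by apply: It; exists m'; rewrite -mE.
rewrite -(subrK n m) addrC; apply: gen_cat => //; apply: hu'; split.
  by apply: submoduleB => //; apply: gen_sub gn.
rewrite mE nE opprD addrACA subrr add0r.
exact: submoduleB (gen_submodule s) gm' gn'.
Qed.

End Generation.

Lemma noetherian_field (k : fieldType) : noetherian k.
Proof.
move=> I sI; have [[a [Ia a0]]|nex] := pselect (exists a, I a /\ a != 0).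
  exists [:: a]; split=> [v|b Ib]; first by rewrite inE => /eqP ->.
  by exists (fun=> b / a); rewrite big_ord1 /= [_ *: _]divfK.
exists [::]; split=> // b Ib; exists (fun=> 0); rewrite big_ord0.
by apply/eqP/negPn/negP => b0; apply: nex; exists b.
Qed.

(** * Hilbert's basis theorem *)

Section Hilbert.
Variable A : comNzRingType.

(** [L d] collects the coefficients in degree [d] of the elements of [I] of degree at most [d]. The
    union over [d] is a finitely generated ideal whose generators already occur in some [L D]. Lifts
    of them lower every degree that is at least [D]; degrees below [D] are handled one at a time. *)
Lemma noetherian_poly : noetherian A -> noetherian {poly A}.
Proof.
move=> nA I sI.
pose L d (a : A^o) := exists2 f : {poly A}, I f & (size f <= d.+1)%N /\ f`_d = a.
have IM f g : I g -> I (f * g) by exact: (@submoduleZ _ _ I f g sI).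
have sL d : submodule (L d).
  split; first by exists 0; [case: sI|rewrite size_poly0 coef0].
  move=> a _ _ [f If [sf <-]] [g Ig [sg <-]]; exists (a%:P * f + g).
    by case: sI => _; apply.
  rewrite coefD coefCM; split=> //.
  rewrite (leq_trans (size_polyD _ _)) // geq_max sg andbT.
  by rewrite mul_polyC (leq_trans (size_scale_leq _ _)).
have Lmono d d' a : (d <= d')%N -> L d a -> L d' a.
  move=> dd' [f If [sf <-]]; exists ('X^(d' - d) * f); first exact: IM.
  split; last by rewrite coefXnM ltnNge leq_subr /= subKn.
  rewrite (leq_trans (size_polyMleq _ _)) // size_polyXn.
  by rewrite addSn /= -{2}(subnK dd') -addnS leq_add2l.
have lift d (t : seq A^o) : (forall a, a \in t -> L d a) ->
    exists G : seq {poly A}^o, (forall g, g \in G -> I g) /\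
    forall a, gen t a -> exists2 g, gen G g & (size g <= d.+1)%N /\ g`_d = a.
  elim: t => [|a t IHt] tL.
    exists [::]; split=> // a /gen_nil ->; exists 0; last by rewrite size_poly0 coef0.
    by case: (gen_submodule ([::] : seq {poly A}^o)).
  have [|G [GI hG]] := IHt; first by move=> b bt; apply: tL; rewrite inE bt orbT.
  have [|f If [sf fE]] := tL a; first by rewrite mem_head.
  exists ((f : {poly A}^o) :: G); split; first by move=> g; rewrite inE => /predU1P[->|/GI].
  move=> b /gen_cons[c [b' [/hG[g gg [sg gE]] ->]]].
  exists ((c%:P : {poly A}) *: (f : {poly A}^o) + g); first by apply/gen_cons; exists c%:P, g.
  rewrite coefD coefCM fE gE; split=> //.
  rewrite (leq_trans (size_polyD _ _)) // geq_max sg andbT.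
  by rewrite [_ *: _]mul_polyC (leq_trans (size_scale_leq _ _)).
have Igen (G : seq {poly A}^o) g : (forall g, g \in G -> I g) -> gen G g -> I g.
  by move=> h; apply: gen_sub.
have low d : exists G : seq {poly A}^o, (forall g, g \in G -> I g) /\
    forall f, I f -> (size f <= d)%N -> gen G f.
  elim: d => [|d [G [GI hG]]].
    exists [::]; split=> // f If; rewrite leqn0 size_poly_eq0 => /eqP ->.
    by case: (gen_submodule ([::] : seq {poly A}^o)).
  have [t [tL Lt]] := nA _ (sL d); have [H [HI hH]] := lift d t tL.
  exists (G ++ H); split; first by move=> g; rewrite mem_cat => /orP[/GI|/HI].
  move=> f If sf; have [|g gg [sg gE]] := hH f`_d; first by apply: Lt; exists f.
  rewrite -(subrK g f); apply: gen_cat => //; apply: hG.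
    by apply: submoduleB => //; apply: Igen gg.
  apply/leq_sizeP => j; rewrite leq_eqVlt => /predU1P[<-|dj].
    by rewrite coefB gE subrr.
  by rewrite coefB !nth_default ?subrr // (leq_trans _ dj).
pose Linf (a : A^o) := exists d, L d a.
have sLinf : submodule Linf.
  split; first by exists 0%N; case: (sL 0%N).
  move=> a b b' [d Ld] [d' Ld']; exists (maxn d d').
  case: (sL (maxn d d')) => _; apply; [apply: Lmono Ld|apply: Lmono Ld'].
    exact: leq_maxl.
  exact: leq_maxr.
have [t [tL Lt]] := nA _ sLinf.
have [D hD] : exists D, forall a, a \in t -> L D a.
  elim: t tL {Lt} => [|a t IHt] tL; first by exists 0%N.
  have [|D hD] := IHt; first by move=> b bt; apply: tL; rewrite inE bt orbT.
  have [|d Ld] := tL a; first by rewrite mem_head.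
  exists (maxn d D) => b; rewrite inE => /predU1P[->|/hD].
    by apply: Lmono Ld; apply: leq_maxl.
  by apply: Lmono; apply: leq_maxr.
have [H [HI hH]] := lift D t hD; have [G [GI hG]] := low D.
exists (G ++ H); split; first by move=> g; rewrite mem_cat => /orP[/GI|/HI].
move=> f If; have [n] := ubnP (size f); elim: n f If => // n IHn f If sf.
have [sD|Ds] := leqP (size f) D.
  rewrite -[f]addr0; apply: gen_cat; first exact: hG.
  by case: (gen_submodule H).
have sf0 : size f = (size f).-1.+1 by rewrite prednK // (leq_ltn_trans _ Ds).
have Dd : (D <= (size f).-1)%N by rewrite -ltnS -sf0.
have [|g gg [sg gE]] := hH (f`_(size f).-1).
  by apply: Lt; exists (size f).-1; exists f => //; rewrite -sf0.
(* [h] has the degree and the leading coefficient of [f], so the difference has smaller size. *)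
pose h := 'X^((size f).-1 - D) * g.
have gh : gen (G ++ H) h.
  rewrite -[h]add0r; apply: gen_cat; first by case: (gen_submodule G).
  exact: (submoduleZ _ (gen_submodule H) gg).
rewrite -(subrK h f); apply: (submoduleD (gen_submodule _)) => //.
have Ih : I h by apply: IM; apply: Igen gg.
apply: IHn; first exact: (submoduleB sI If Ih).
apply: (@leq_trans (size f)); last by rewrite -ltnS.
rewrite [X in (_ < X)%N]sf0 ltnS; apply/leq_sizeP => j.
rewrite leq_eqVlt => /predU1P[<-|dj].
  by rewrite coefB coefXnM ltnNge leq_subr /= subKn // gE subrr.
rewrite coefB [f`_j]nth_default ?sub0r; last by rewrite sf0.
rewrite nth_default ?oppr0 // (leq_trans (size_polyMleq _ _)) // size_polyXn.
rewrite addSn /= (leq_trans _ dj) // -{2}(subnK Dd) -addnS leq_add2l //.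
Qed.

End Hilbert.

(** * Weights, torsion and submodules of finite codimension *)

Section Weight.
Variables p q : nat.

(** The two variables are indexed by a boolean, so that each argument about one variable and the
    other, [~~ b], is made only once. *)
Definition wx (b : bool) : weight p q := if b then wx2 p q else wx1 p q.
Definition pw (b : bool) : nat := if b then q else p.

Lemma wx_eq0 b (i j : int) : wx b *~ i + wx (~~ b) *~ j = 0 <->
  exists n : int, i = n * (pw b)%:Z /\ j = - (n * (pw (~~ b))%:Z).
Proof.
have pairMz (u v m : int) : (u, v) *~ m = (u * m, v * m).
  have pairMn n : (u, v) *+ n = (u *+ n, v *+ n).
    by elim: n => // n IH; rewrite !mulrS IH.
  case: m => n; first by rewrite -!pmulrn pairMn !pmulrn !mulrzz.
  by rewrite !NegzE !mulrN !mulrNz -!pmulrn pairMn !pmulrn !mulrzz.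
have key (a c : int) : wx false *~ a + wx true *~ c = 0 <->
    exists n : int, a = n * p%:Z /\ c = - (n * q%:Z).
  rewrite /wx /wx1 /wx2 -!raddfMz -raddfD !pairMz.
  rewrite [(_, _) + _](_ : _ = (a, c)); last first.
    by congr (_, _); rewrite /= ?mul0r ?mul1r ?addr0 ?add0r.
  rewrite -(raddf0 (\pi_({quot @weight_rel p q})%qT)).
  split=> [/eqP|[n [-> ->]]].
    by rewrite -(idealrBE (@weight_rel p q)) subr0 => /asboolP[n [-> ->]]; exists n.
  by apply/eqP; rewrite -(idealrBE (@weight_rel p q)) subr0; apply/asboolP; exists n.
case: b => /=; last exact: key.
rewrite addrC key; split=> -[n [-> ->]]; exists (- n).
  by rewrite !mulNr opprK.
by rewrite !mulNr opprK.
Qed.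

(** The group may have torsion, but each of the two generators has infinite order. *)
Lemma wx_inj b (i j : nat) : (0 < p)%N -> (0 < q)%N -> wx b *+ i = wx b *+ j -> i = j.
Proof.
move=> hp hq /eqP; rewrite -subr_eq0 !pmulrn -mulrzBr => /eqP e.
have /wx_eq0[n [e1 e2]] : wx b *~ (i%:Z - j%:Z) + wx (~~ b) *~ 0 = 0.
  by rewrite e mulr0z addr0.
have pb : (0 < pw (~~ b))%N by case: (b).
have n0 : n = 0.
  have : n * (pw (~~ b))%:Z = 0 by rewrite -[LHS]opprK -e2 oppr0.
  by move/eqP; rewrite mulf_eq0 => /orP[/eqP //|]; rewrite eqz_nat eqn0Ngt pb.
by move: e1; rewrite n0 mul0r => /eqP; rewrite subr_eq0 eqz_nat => /eqP.
Qed.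

End Weight.

Section Powers.
Variables (k : closedFieldType) (p q : nat).
Hypotheses (hp : (0 < p)%N) (hq : (0 < q)%N).
Local Notation S := {poly {poly k}}.
Local Notation L := (weight p q).
Local Notation wx := (wx p q).

Definition sx (b : bool) : S := if b then sx2 k else sx1 k.

Lemma homogeneousM d e (f g : S) : homogeneous (p:=p) (q:=q) d f -> homogeneous e g ->
  homogeneous (d + e : L) (f * g).
Proof.
have E d' (h : S) : homogeneous (d' : L) h -> spart d' h = h.
  move=> hh; apply: spart_eqP => i j; rewrite coef_spart.
  by case: eqP => // ne; have [-> //|/hh /ne] := eqVneq (h`_j`_i) 0.
move=> hf hg i j; rewrite -{1}(E _ _ hg) -(spartM _ _ hf) coef_spart.
by case: ifP => [/eqP //|_]; rewrite eqxx.
Qed.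

Lemma homogeneous_sx b n : homogeneous (wx b *+ n : L) (sx b ^+ n).
Proof.
case: b; first exact: homogeneous_x2n.
by have := @homogeneous_x1n k p q n 1; rewrite sC1 mul1r.
Qed.

(** The class of [m] modulo [P] is killed by a power of each variable. For a graded [P], this
    condition on all [m] is finite codimension, in a form that composes without choosing bases. *)
Definition ev (M : lmodType S) (P : M -> Prop) (m : M) :=
  exists N, forall b, P (sx b ^+ N *: m).

Definition tors (M : lmodType S) (m : M) := ev (fun x => x = 0) m.

Section Ev.
Variable M : lmodType S.
Implicit Types (P Q : M -> Prop) (m : M).

Lemma submodule0 : submodule (fun x : M => x = 0).
Proof. by split=> // a m m' -> ->; rewrite scaler0 addr0. Qed.

Lemma ev_pow P m b i j : submodule P -> (i <= j)%N -> P (sx b ^+ i *: m) ->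
  P (sx b ^+ j *: m).
Proof. by move=> sP /subnK <- h; rewrite exprD -scalerA; apply: submoduleZ. Qed.

Lemma ev_in P m : P m -> ev P m.
Proof. by move=> Pm; exists 0%N => b; rewrite expr0 scale1r. Qed.

Lemma ev_submodule P : submodule P -> submodule (ev P).
Proof.
move=> sP; split; first by apply: ev_in; case: sP.
move=> a m m' [i hi] [j hj]; exists (maxn i j) => b.
rewrite scalerDr scalerA mulrC -scalerA; case: (sP) => _; apply.
  exact: ev_pow (leq_maxl i j) (hi b).
exact: ev_pow (leq_maxr i j) (hj b).
Qed.

Lemma ev_sub P Q m : (forall x, P x -> Q x) -> ev P m -> ev Q m.
Proof. by move=> PQ [N h]; exists N => b; apply: PQ. Qed.

Lemma ev_trans P Q m : submodule Q -> ev P m -> (forall x, P x -> ev Q x) -> ev Q m.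
Proof.
move=> sQ [N h] PQ; have [i hi] := PQ _ (h false); have [j hj] := PQ _ (h true).
exists (maxn i j + N)%N => b; rewrite exprD -scalerA; case: b.
  exact: ev_pow (leq_maxr i j) (hj true).
exact: ev_pow (leq_maxl i j) (hi false).
Qed.

Lemma ev_sx P N m : submodule P -> (forall b, ev P (sx b ^+ N *: m)) -> ev P m.
Proof.
move=> sP h; apply: (@ev_trans (ev P)) => //; first by exists N.
Qed.

Lemma tors_submodule : submodule (@tors M).
Proof. exact/ev_submodule/submodule0. Qed.

Lemma torsD m m' : tors m -> tors m' -> tors (m + m').
Proof. exact: (submoduleD tors_submodule). Qed.

Lemma torsN m : tors (- m) -> tors m.
Proof. by move=> h; rewrite -[m]opprK -scaleN1r; apply: (submoduleZ _ tors_submodule). Qed.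

Lemma torsZ (a : S) m : tors m -> tors (a *: m).
Proof. by move=> h; apply: (submoduleZ _ tors_submodule). Qed.

Lemma tors0 : tors (0 : M).
Proof. by case: tors_submodule. Qed.

End Ev.

Section Combination.
Variable M : lmodType S.

(** The coefficients form a matrix with one more row than columns, which has a nonzero left
    kernel. *)
Lemma kcomb_dep (P : set M) (s : seq M) (v : nat -> M) : ksub P ->
  (forall i, exists c, P (v i - kcomb c s)) ->
  exists (d : nat -> k) (i0 : 'I_(size s).+1),
    d i0 != 0 /\ P (\sum_(i < (size s).+1) sC (d i) *: v i).
Proof.
move=> kP /choice[c hc].
pose C : 'M[k]_((size s).+1, size s) := \matrix_(i, j) c i j.
have : kermx C != 0.
  rewrite kermx_eq0; apply/negP => /eqP rC.
  by have := rank_leq_col C; rewrite rC ltnn.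
case/rowV0Pn => u /sub_kermxP uC u0.
have [i0 ui0] : exists i0, u 0 i0 != 0 by apply/rV0Pn.
exists (fun i => if insub i is Some i' then u 0 i' else 0), i0.
split; first by rewrite valK.
have E (i : 'I_(size s).+1) :
    (if insub (i : nat) is Some i' then u 0 i' else 0) = u 0 i by rewrite valK.
under eq_bigr do rewrite E.
have -> : \sum_(i < (size s).+1) sC (u 0 i) *: v i =
    \sum_(i < (size s).+1) sC (u 0 i) *: (v i - kcomb (c i) s).
  under [RHS]eq_bigr do rewrite scalerBr.
  rewrite big_split /= -[LHS]addr0; congr (_ + _); apply/esym/eqP.
  rewrite sumrN oppr_eq0; apply/eqP.
  rewrite /kcomb; under eq_bigr do rewrite scaler_sumr.
  rewrite exchange_big big1 // => j _ /=.
  under eq_bigr do rewrite scalerA -sCM.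
  rewrite -scaler_suml.
  have sCsum (I : finType) (F : I -> k) : \sum_i sC (F i) = sC (\sum_i F i).
    elim/big_rec2: _ => [|i a b _ ->]; first by rewrite sC0.
    by rewrite sCD.
  rewrite sCsum; have := congr1 (fun A : 'rV_(size s) => A 0 j) uC.
  rewrite !mxE => uCj; rewrite -[X in sC X](_ : 0 = _) ?sC0 ?scale0r //.
  by rewrite -[LHS]uCj; apply: eq_bigr => i _; rewrite mxE.
elim/big_ind: _ => [|x y|i _]; [by case: kP|exact: ksubD|exact: ksubZ].
Qed.

(** If [sx b ^+ N] sends a generator into [P] for both [b], only the monomials with both exponents
    below [N] contribute modulo [P]. *)
Lemma kspan_fgen (P : M -> Prop) (s : seq M) : submodule P ->
  (forall v, v \in s -> ev P v) ->
  exists T : seq M, forall m, gen s m -> exists c, P (m - kcomb c T).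
Proof.
move=> sP sv; have kP : ksub P by case: sP => P0 h; split=> // a; apply: h.
elim: s sv => [|v s IH] sv.
  exists [::] => m /gen_nil ->; exists (fun=> 0).
  by rewrite kcomb_nil subr0; case: sP.
have [|T hT] := IH; first by move=> w ws; apply: sv; rewrite inE ws orbT.
have [|N hN] := sv v; first by rewrite mem_head.
pose U := [seq (sx1 k ^+ i * sx2 k ^+ j) *: v | i <- iota 0 N, j <- iota 0 N].
exists (U ++ T) => m /gen_cons[f [m' [/hT[c Pc] ->]]].
suff [d Pd] : exists d, P (f *: v - kcomb d U).
  have [e he] := kcomb_cat U T d c; exists e.
  by rewrite he opprD addrACA; apply: submoduleD.
have cl0 x : P x -> exists d, P (x - kcomb d U).
  move=> Px; exists (fun=> 0); rewrite /kcomb big1 ?subr0 // => i _.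
  by rewrite sC0 scale0r.
have cl a x y : (exists d, P (x - kcomb d U)) -> (exists d, P (y - kcomb d U)) ->
    exists d, P (sC a *: x + y - kcomb d U).
  move=> [d1 h1] [d2 h2]; exists (fun i => a * d1 i + d2 i).
  rewrite kcombP opprD addrACA -scalerBr; apply: submoduleD => //.
  exact: submoduleZ.
have mon i j : exists d, P ((sx1 k ^+ i * sx2 k ^+ j) *: v - kcomb d U).
  have [iN|Ni] := ltnP i N; last first.
    by apply: cl0; rewrite mulrC -scalerA; apply: submoduleZ => //;
      apply: (ev_pow sP Ni (hN false)).
  have [jN|Nj] := ltnP j N; last first.
    by apply: cl0; rewrite -scalerA; apply: submoduleZ => //; apply: (ev_pow sP Nj (hN true)).
  have mU : (sx1 k ^+ i * sx2 k ^+ j) *: v \in U.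
    by apply/allpairsP; exists (i, j); rewrite !mem_iota.
  have /nthP := mU; move=> /(_ 0)[l lU lE].
  exists (fun l' => (l' == l)%:R); rewrite /kcomb (bigD1 (Ordinal lU)) //= eqxx.
  rewrite sC1 scale1r lE big1 ?addr0 ?subrr; first by case: sP.
  move=> l' ne; suff -> : (l' == l :> nat) = false by rewrite sC0 scale0r.
  by apply/negbTE; apply: contraNneq ne => e; apply/eqP/val_inj.
have -> : f = \sum_(j < size f) \sum_(i < size f`_j)
    sC f`_j`_i * (sx1 k ^+ i * sx2 k ^+ j).
  rewrite -[LHS]coefK poly_def; apply: eq_bigr => j _.
  rewrite -mul_polyC -[X in X%:P](coefK f`_j) poly_def raddf_sum mulr_suml.
  by apply: eq_bigr => i _; rewrite /= /sC /sx1 /sx2 -mul_polyC polyCM polyC_exp mulrA.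
rewrite scaler_suml.
elim/big_rec: _ => [|j x _ hx]; first by apply: cl0; case: sP.
rewrite -[_ *: v]scale1r -sC1; apply: (cl) => //.
rewrite scaler_suml; elim/big_rec: _ => [|i y _ hy]; first by apply: cl0; case: sP.
by rewrite -scalerA; apply: cl.
Qed.

End Combination.

Lemma noetherian_S : noetherian S.
Proof. exact/noetherian_poly/noetherian_poly/noetherian_field. Qed.

Section Graded.
Variable M : grmod k p q.
Implicit Types (P : set M) (m : M) (l : L).

Lemma graded_submodule P : graded_submod P -> submodule P.
Proof. by case. Qed.

Lemma hpart_sx b n l m : hpart (wx b *+ n + l) (sx b ^+ n *: m) = sx b ^+ n *: hpart l m.
Proof. exact/hpart_homog/homogeneous_sx. Qed.

Lemma ev_graded P : graded_submod P -> graded_submod (ev P).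
Proof.
move=> gP; split; [by case: (ev_submodule (graded_submodule gP)) ..|].
move=> l m [N h]; exists N => b; rewrite -hpart_sx.
by case: gP => _ _; apply.
Qed.

Lemma graded_sum P m : graded_submod P -> (forall l, P (hpart l m)) -> P m.
Proof.
move=> gP h; have [s _ ->] := hpart_sum m.
by apply: submodule_sum => //; apply: graded_submodule.
Qed.

Lemma graded0 : graded_submod [set m : M | m = 0].
Proof. by split=> // [a m m' -> ->|l m ->]; rewrite ?scaler0 ?addr0 ?hpart0. Qed.

Lemma hpart_idem l m : hpart l (hpart l m) = hpart l m.
Proof. by rewrite hpartK eqxx. Qed.

(** The elements [sx b ^+ i *: hpart l m] have pairwise distinct weights, because the weight of a
    variable has infinite order. A linear dependence among them modulo the graded [P] therefore puts
    one of them in [P]. *)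
Lemma kcomb_ev P (Q : set M) (s : seq M) : graded_submod P -> graded_submod Q ->
  (forall m, Q m -> exists c, P (m - kcomb c s)) -> forall m, Q m -> ev P m.
Proof.
move=> gP gQ h m Qm; apply: graded_sum => [|l]; first exact: ev_graded.
have key b : exists N, P (sx b ^+ N *: hpart l m).
  have [|d [i0 [di0 Pd]]] := @kcomb_dep M P s (fun i => sx b ^+ i *: hpart l m)
    (ksub_graded gP).
    move=> i; apply: h; apply: submoduleZ; first exact: graded_submodule.
    by case: gQ => _ _; apply.
  exists i0; have [_ _ /(_ (wx b *+ i0 + l) _ Pd)] := gP.
  rewrite (big_morph _ (hpartD _) (hpart0 M _)) (bigD1 i0) //= big1 ?addr0 => [|i ne].
    rewrite hpartZ hpart_sx hpart_idem => /(ksubZ (d i0)^-1 (ksub_graded gP)).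
    by rewrite scalerA -sCM mulVf // sC1 scale1r.
  rewrite hpartZ -(hpart_idem l m) -hpart_sx hpartK (inj_eq (addIr l)).
  case: eqP => [/(wx_inj hp hq) e|_]; last by rewrite scaler0.
  by case/eqP: ne; apply: val_inj.
have [i hi] := key false; have [j hj] := key true.
have sP := graded_submodule gP.
exists (maxn i j) => -[]; first exact: ev_pow (leq_maxr i j) hj.
exact: ev_pow (leq_maxl i j) hi.
Qed.

Lemma finite_codimP P : graded_submod P -> finite_codim P <-> forall m, ev P m.
Proof.
move=> gP; split=> [[s hs] m|h].
  by apply: (@kcomb_ev P [set: M] s) => // m' _; apply: hs.
have [s hs] := fin_gen M.
have [|T hT] := @kspan_fgen M P s (graded_submodule gP); first by move=> v _.
by exists T => m; apply: hT; apply: hs.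
Qed.

(** The converse takes finitely many generators of [P], which exist because [S] is noetherian, and
    each of them generates a finite dimensional module. *)
Lemma finite_dimP P : graded_submod P -> finite_dim P <-> forall m, P m -> tors m.
Proof.
move=> gP; split=> [[s hs]|h].
  apply: (@kcomb_ev [set m | m = 0] P s) => //; first exact: graded0.
  by move=> m /hs[c ->]; exists c; rewrite /= subrr.
have [s hs] := fin_gen M.
have [|t [tP Pt]] := @noetherian_module _ M P s noetherian_S (graded_submodule gP).
  by move=> m _; apply: hs.
have [|T hT] := @kspan_fgen M _ t (submodule0 M); first by move=> v /tP /h.
by exists T => m /Pt /hT[c /subr0_eq ->]; exists c.
Qed.

End Graded.
End Powers.

(** * Extensions in linear categories *)

Section Lincat.
Variables (k : fieldType) (C : lincat k).
Implicit Types (x y z : C).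

Lemma comp0l x y z (f : hom x y) : (0 : hom y z) \c f = 0.
Proof.
by have := compDl 1 (0 : hom y z) 0 f; rewrite !scale1r addr0 -[LHS]addr0 => /addrI.
Qed.

Lemma comp0r x y z (g : hom y z) : g \c (0 : hom x y) = 0.
Proof.
by have := compDr 1 g (0 : hom x y) 0; rewrite !scale1r addr0 -[LHS]addr0 => /addrI.
Qed.

Lemma compDl1 x y z (g g' : hom y z) (f : hom x y) : (g + g') \c f = g \c f + g' \c f.
Proof. by rewrite -[g]scale1r compDl !scale1r. Qed.

Lemma compDr1 x y z (g : hom y z) (f f' : hom x y) : g \c (f + f') = g \c f + g \c f'.
Proof. by rewrite -[f]scale1r compDr !scale1r. Qed.

Lemma compZl x y z a (g : hom y z) (f : hom x y) : (a *: g) \c f = a *: (g \c f).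
Proof. by rewrite -[a *: g]addr0 compDl comp0l addr0. Qed.

Lemma compZr x y z a (g : hom y z) (f : hom x y) : g \c (a *: f) = a *: (g \c f).
Proof. by rewrite -[a *: f]addr0 compDr comp0r addr0. Qed.

Lemma compBl x y z (g g' : hom y z) (f : hom x y) : (g - g') \c f = g \c f - g' \c f.
Proof. by rewrite compDl1 -scaleN1r compZl scaleN1r. Qed.

Lemma compBr x y z (g : hom y z) (f f' : hom x y) : g \c (f - f') = g \c f - g \c f'.
Proof. by rewrite compDr1 -scaleN1r compZr scaleN1r. Qed.

Lemma comp_suml x y z (f : hom x y) (I : finType) (F : I -> hom y z) :
  (\sum_i F i) \c f = \sum_i F i \c f.
Proof. by apply: (big_morph (fun g => g \c f)) => [g g'|]; [exact: compDl1|exact: comp0l]. Qed.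

Definition epi x y (f : hom x y) := forall z (u v : hom y z), u \c f = v \c f -> u = v.

Lemma mono0 x y (f : hom x y) :
  (forall t (h : hom t x), f \c h = 0 -> h = 0) -> mono f.
Proof. by move=> h t u v e; apply/subr0_eq/h; rewrite compBr e subrr. Qed.

Lemma epi0 x y (f : hom x y) :
  (forall t (h : hom y t), h \c f = 0 -> h = 0) -> epi f.
Proof. by move=> h t u v e; apply/subr0_eq/h; rewrite compBl e subrr. Qed.

Lemma kernel_mono x y z (f : hom x y) (g : hom y z) : is_kernel f g -> mono f.
Proof.
move=> [gf h] t u v e; have [|w [_ uw]] := h t (f \c v); first by rewrite compA gf comp0l.
by rewrite -(uw u e) -(uw v erefl).
Qed.

Lemma cokernel_epi x y z (f : hom x y) (g : hom y z) : is_cokernel f g -> epi g.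
Proof.
move=> [gf h] t u v e; have [|w [_ uw]] := h t (v \c g); first by rewrite -compA gf comp0r.
by rewrite -(uw u e) -(uw v erefl).
Qed.

Lemma cokernel_unique x y z z' (f : hom x y) (g : hom y z) (g' : hom y z') :
  is_cokernel f g -> is_cokernel f g' ->
  exists u : hom z z', iso_arrow u /\ u \c g = g'.
Proof.
move=> cg cg'; have [u [ug _]] := cg.2 _ g' cg'.1; have [v [vg' _]] := cg'.2 _ g cg.1.
exists u; split=> //; exists v; split.
  by apply: (cokernel_epi cg); rewrite -compA ug vg' comp1m.
by apply: (cokernel_epi cg'); rewrite -compA vg' ug comp1m.
Qed.

Lemma isomorphic_sym x y : isomorphic x y -> isomorphic y x.
Proof. by move=> [f [g [gf fg]]]; exists g, f. Qed.

Lemma iso_comp x y z (g : hom y z) (f : hom x y) :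
  iso_arrow g -> iso_arrow f -> iso_arrow (g \c f).
Proof.
move=> [g' [g'g gg']] [f' [f'f ff']]; exists (f' \c g'); split.
  by rewrite compA -(compA f') g'g compm1.
by rewrite compA -(compA g) ff' compm1.
Qed.

Lemma isomorphic_trans x y z : isomorphic x y -> isomorphic y z -> isomorphic x z.
Proof. by move=> [f hf] [g hg]; exists (g \c f); apply: iso_comp. Qed.

Lemma iso_mono x y (f : hom x y) : iso_arrow f -> mono f.
Proof. by move=> [g [gf _]] t u v e; rewrite -[u]comp1m -[v]comp1m -gf -!compA e. Qed.

Lemma iso_epi x y (f : hom x y) : iso_arrow f -> epi f.
Proof. by move=> [g [_ fg]] t u v e; rewrite -[u]compm1 -[v]compm1 -fg !compA e. Qed.

Lemma mono_comp x y z (g : hom y z) (f : hom x y) : mono g -> mono f -> mono (g \c f).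
Proof. by move=> mg mf t u v; rewrite -!compA => /mg /mf. Qed.

Lemma epi_comp x y z (g : hom y z) (f : hom x y) : epi g -> epi f -> epi (g \c f).
Proof. by move=> eg ef t u v; rewrite !compA => /ef /eg. Qed.

Lemma short_exact_iso x x' y z z' (f : hom x y) (g : hom y z) (u : hom x' x) (v : hom z z') :
  short_exact f g -> iso_arrow u -> iso_arrow v -> short_exact (f \c u) (v \c g).
Proof.
move=> [kf cg] iu iv; have mf := kernel_mono kf; have eg := cokernel_epi cg.
have [u' [u'u uu']] := iu; have [v' [v'v vv']] := iv.
split; split.
- by rewrite compA -(compA v) kf.1 comp0r comp0l.
- move=> t h vgh; have [|w [fw _]] := kf.2 t h.
    by apply: (iso_mono iv); rewrite compA vgh comp0r.
  exists (u' \c w); split; first by rewrite -compA (compA u) uu' comp1m.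
  move=> w' e; apply: (mono_comp mf (iso_mono iu)).
  by rewrite e -compA (compA u) uu' comp1m.
- by rewrite compA -(compA v) kf.1 comp0r comp0l.
- move=> t h hfu; have [|w [gw _]] := cg.2 t h.
    by apply: (iso_epi iu); rewrite -compA hfu comp0l.
  exists (w \c v'); split; first by rewrite compA -(compA w) v'v compm1.
  move=> w' e; apply: (epi_comp (iso_epi iv) eg).
  by rewrite e compA -(compA w) v'v compm1.
Qed.

Lemma iso_id x : iso_arrow (idm x).
Proof. by exists (idm x); rewrite comp1m. Qed.

(* The extension xi is the image of f : A -> Y under the connecting map of
   0 -> A -> B -> X -> 0. *)
Definition classified (A B X Y : C) (d : hom A B) (pi : hom B X) (f : hom A Y)
    (xi : extension X Y) :=
  exists s : hom B (ext_mid xi), s \c d = ext_in xi \c f /\ ext_out xi \c s = pi.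

(** The middle term is the pushout of [d] and [f], its universal property being split into existence
    and joint cancellation. *)
Definition pushout_ext (A B X Y : C) (d : hom A B) (pi : hom B X) (f : hom A Y)
    (xi : extension X Y) (s : hom B (ext_mid xi)) :=
  [/\ s \c d = ext_in xi \c f, ext_out xi \c s = pi,
      forall Z (u : hom B Z) (v : hom Y Z), u \c d = v \c f ->
        exists h, h \c s = u /\ h \c ext_in xi = v
    & forall Z (h h' : hom (ext_mid xi) Z), h \c s = h' \c s ->
        h \c ext_in xi = h' \c ext_in xi -> h = h'].

(** The rest of the section rests on three properties of abelian categories, established for [coh]
    further on. *)
Hypothesis balanced : forall x y (f : hom x y), mono f -> epi f -> iso_arrow f.
Hypothesis biproducts : forall x y, exists s (i1 : hom x s) (i2 : hom y s)
  (p1 : hom s x) (p2 : hom s y), is_biproduct i1 i2 p1 p2.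
Hypothesis pushouts : forall (A B X Y : C) (d : hom A B) (pi : hom B X) (f : hom A Y),
  short_exact d pi -> exists xi (s : hom B (ext_mid xi)), pushout_ext d pi f s.

Lemma extension_mono x y (xi : extension x y) : mono (ext_in xi).
Proof. exact: kernel_mono (ext_exact xi).1. Qed.

Lemma extension_epi x y (xi : extension x y) : epi (ext_out xi).
Proof. exact: cokernel_epi (ext_exact xi).2. Qed.

Lemma ext_out_in x y (xi : extension x y) : ext_out xi \c ext_in xi = 0.
Proof. by case: (ext_exact xi) => -[]. Qed.

(** The short five lemma: the arrow is mono and epi by diagram chasing, and [balanced] makes it
    invertible. *)
Lemma ext_equiv_iso x y (xi xi' : extension x y) (h : hom (ext_mid xi) (ext_mid xi')) :
  h \c ext_in xi = ext_in xi' -> ext_out xi' \c h = ext_out xi -> iso_arrow h.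
Proof.
move=> hin hout; apply: balanced.
  apply: mono0 => t u hu; have [|v [uE _]] := (ext_exact xi).1.2 t u.
    by rewrite -hout -compA hu comp0r.
  suff v0 : v = 0 by rewrite -uE v0 comp0r.
  by apply: (extension_mono (xi := xi')); rewrite comp0r -hin -compA uE.
apply: epi0 => t u uh; have [|v [uE _]] := (ext_exact xi').2.2 t u.
  by rewrite -hin compA uh comp0l.
suff v0 : v = 0 by rewrite -uE v0 comp0l.
by apply: (extension_epi (xi := xi)); rewrite comp0l -hout compA uE.
Qed.

Section Resolution.
Variables (A B X Y : C) (d : hom A B) (pi : hom B X).
Hypothesis dpi : short_exact d pi.

Lemma pushout_map (f : hom A Y) (xi : extension X Y) (s : hom B (ext_mid xi))
    x' y' (xi' : extension x' y') (a : hom Y y') (b : hom X x') (u : hom B (ext_mid xi')) :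
  pushout_ext d pi f s -> u \c d = ext_in xi' \c a \c f -> ext_out xi' \c u = b \c pi ->
  ext_map a b xi xi'.
Proof.
move=> [sd os ex uq] ud ou; have [h [hs hin]] := ex _ u (ext_in xi' \c a) ud.
exists h; split=> //; apply: uq; first by rewrite -!compA hs os ou.
by rewrite -!compA hin compA !ext_out_in comp0r comp0l.
Qed.

(** [h \c s] and [s'] both lift [pi], so their difference factors through [Y]; this factor bounds
    the difference of the cocycles. *)
Lemma classified_equiv (f f' : hom A Y) (xi xi' : extension X Y) :
  classified d pi f xi -> classified d pi f' xi' -> ext_equiv xi xi' ->
  exists t : hom B Y, f - f' = t \c d.
Proof.
move=> [s [sd os]] [s' [sd' os']] [h [hin hout]].
have [|t [tE _]] := (ext_exact xi').1.2 B (h \c s - s').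
  by rewrite compBr compA hout -compA os os' comp1m subrr.
exists t; apply: (extension_mono (xi := xi')).
by rewrite compA tE compBr compBl -compA sd compA hin compm1 sd'.
Qed.

End Resolution.

(** The pushout of [f \c u] along [d'] maps to the pushout of [f] along [d], and by the five lemma
    this is an equivalence of extensions. An extension classified on a deeper resolution is thus
    classified on the shallower one as soon as its cocycle is a restriction from there. *)
Lemma classified_descend (A B A' B' X Y : C) (d : hom A B) (pi : hom B X)
    (d' : hom A' B') (pi' : hom B' X) (u : hom A' A) (v : hom B' B)
    (f : hom A Y) (xi : extension X Y) :
  short_exact d pi -> short_exact d' pi' -> v \c d' = d \c u -> pi \c v = pi' ->
  classified d' pi' (f \c u) xi -> classified d pi f xi.
Proof.
move=> dpi dpi' vd piv [s [sd os]].
have [eta [r re]] := pushouts f dpi; have [eta' [r' re']] := pushouts (f \c u) dpi'.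
have [h [hin hout]] : ext_map (idm Y) (idm X) eta' xi.
  by apply: (pushout_map (u := s) re'); [rewrite compm1 sd|rewrite comp1m os].
have [g [gin gout]] : ext_map (idm Y) (idm X) eta' eta.
  case: re => rd outr _ _; apply: pushout_map re' (_ : (r \c v) \c d' = _) _.
    by rewrite compm1 -compA vd compA rd compA.
  by rewrite compA outr comp1m piv.
rewrite compm1 comp1m in gin gout; rewrite compm1 comp1m in hin hout.
have [g' [g'g gg']] := ext_equiv_iso gin gout.
case: re => rd outr _ _; exists (h \c g' \c r); split.
  by rewrite -compA rd -!compA (compA g') -gin (compA g' g) g'g comp1m compA hin.
rewrite !compA hout -gout -(compA _ g) gg' compm1; exact: outr.
Qed.

(** The cocycles [f i] form a basis modulo those that factor through [d], and [Phi v] is a pushout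
    along the corresponding combination. [X0] and [Y0] are the models of [X] and [Y] on which
    computations are made. *)
Lemma ext1_dimP (A B X Y X0 Y0 : C) (d : hom A B) (pi : hom B X0) (n : nat)
    (f : 'I_n -> hom A Y0) :
  isomorphic X0 X -> isomorphic Y0 Y -> short_exact d pi ->
  (forall v : 'rV[k]_n, (exists t : hom B Y0, \sum_i v 0 i *: f i = t \c d) -> v = 0) ->
  (forall xi : extension X0 Y0, exists v : 'rV[k]_n,
     classified d pi (\sum_i v 0 i *: f i) xi) ->
  ext1_dim X Y n.
Proof.
move=> [phi iphi] [psi ipsi] dpi0 indep span.
have dpi : short_exact d (phi \c pi).
  by rewrite -[d]compm1; apply: short_exact_iso => //; apply: iso_id.
pose F (v : 'rV[k]_n) := psi \c (\sum_i v 0 i *: f i).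
have FD v w : F (v + w) = F v + F w.
  rewrite /F -compDr1 -big_split; congr (_ \c _); apply: eq_bigr => i _.
  by rewrite mxE scalerDl.
have FZ a v : F (a *: v) = a *: F v.
  rewrite /F -compZr scaler_sumr; congr (_ \c _); apply: eq_bigr => i _.
  by rewrite mxE scalerA.
have FB v w : F (v - w) = F v - F w by rewrite FD -[- w]scaleN1r FZ scaleN1r.
pose Phi v := projT1 (cid (pushouts (F v) dpi)).
have hPhi v : exists s : hom B (ext_mid (Phi v)), pushout_ext d (phi \c pi) (F v) s.
  exact: projT2 (cid (pushouts (F v) dpi)).
pose s v := projT1 (cid (hPhi v)).
have Phis v : pushout_ext d (phi \c pi) (F v) (s v) := projT2 (cid (hPhi v)).
exists Phi; split.
- move=> v w; have [yy [j1 [j2 [q1 [q2 bpy]]]]] := biproducts Y Y.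
  have [xx [l1 [l2 [r1 [r2 bpx]]]]] := biproducts X X.
  have [e [i1 [i2 [p1 [p2 bpe]]]]] := biproducts (ext_mid (Phi v)) (ext_mid (Phi w)).
  (* The direct sum of the two extensions, pulled back along the diagonal, is the pushout along the
     cocycle with components [F v] and [F w]. *)
  have [eta [r hr]] := pushouts (j1 \c F v + j2 \c F w) dpi.
  exists yy, j1, j2, q1, q2, xx, l1, l2, r1, r2, e, i1, i2, p1, p2, eta.
  have [q1j1 q2j2 q1j2 q2j1 _] := bpy; have [p1i1 p2i2 p1i2 p2i1 _] := bpe.
  have [svd ovs _ _] := Phis v; have [swd ows _ _] := Phis w.
  have [rd outr ex uq] := hr.
  split=> //.
    have [sd outs _ _] := Phis (v + w); apply: pushout_map hr (_ : s (v + w) \c d = _) _.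
      rewrite sd FD -compA; congr (_ \c _).
      rewrite compDl1 !compDr1 !compA q1j1 q1j2 q2j1 q2j2.
      by rewrite !comp1m !comp0l addr0 add0r.
    by rewrite comp1m.
  have [|h [hr' hin]] := ex e (i1 \c s v + i2 \c s w) (i1 \c ext_in (Phi v)
    \c q1 + i2 \c ext_in (Phi w) \c q2).
    rewrite !compDl1 !compDr1 -!compA svd swd (compA q1 j1) (compA q1 j2) (compA q2 j1)
      (compA q2 j2).
    by rewrite q1j1 q1j2 q2j1 q2j2 !comp1m !comp0l !comp0r addr0 add0r.
  exists h; split=> //; apply: uq; rewrite -!compA ?hr' ?hin ?outr ?ext_out_in ?comp0r.
    rewrite !compDl1 !compDr1 -!compA (compA p1 i1) (compA p1 i2) (compA p2 i1) (compA p2 i2).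
    by rewrite p1i1 p1i2 p2i1 p2i2 !comp1m !comp0l !comp0r addr0 add0r ovs ows.
  rewrite !compDl1 !compDr1 -!compA (compA p1 i1) (compA p1 i2) (compA p2 i1) (compA p2 i2).
  rewrite p1i1 p1i2 p2i1 p2i2 !comp1m !comp0l !comp0r addr0 add0r.
  by rewrite (compA (ext_out _) (ext_in _)) (compA (ext_out (Phi w)) (ext_in _))
    !ext_out_in !comp0l !comp0r addr0.
- move=> a v; have [sd outs _ _] := Phis (a *: v).
  apply: pushout_map (Phis v) (_ : s (a *: v) \c d = _) _; last by rewrite comp1m.
  by rewrite sd FZ !compZr compZl compm1.
- move=> v w e; have [||t tE] := classified_equiv (f := F v) (f' := F w) (d := d) (pi :=
    phi \c pi) _ _ e.
  + by exists (s v); case: (Phis v).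
  + by exists (s w); case: (Phis w).
  apply/eqP; rewrite -subr_eq0; apply/eqP/indep.
  have [psi' [psi'psi _]] := ipsi; exists (psi' \c t).
  by rewrite -compA -tE -FB compA psi'psi comp1m.
- move=> xi; have [phi' [phi'phi phiphi']] := iphi.
  (* The ends of [xi] are moved back to [X0] and [Y0], where [span] applies. *)
  have xe : short_exact (ext_in xi \c psi) (phi' \c ext_out xi).
    by apply: short_exact_iso => //; [exact: ext_exact|exists phi].
  have [v [u [ud ou]]] := span (Extension xe); exists v.
  move: u ud ou => /= u ud ou.
  apply: (pushout_map (u := u) (Phis v)); first by rewrite ud compm1 /F compA.
  by rewrite comp1m -ou !compA phiphi' comp1m.
Qed.

End Lincat.

(** * Morphisms of the quotient category *)

Section Coh.
Variables (k : closedFieldType) (p q : nat).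
Hypotheses (hp : (0 < p)%N) (hq : (0 < q)%N).
Local Notation S := {poly {poly k}}.
Local Notation L := (weight p q).
Local Notation grmod := (grmod k p q).
Local Notation coh := (coh k p q).
Local Notation ev := (@ev k _).
Local Notation tors := (@tors k _).

(** A [qgraph] without its two finiteness conditions, which [mkq] takes in the form of [ev] and
    [tors]. *)
Definition grel (M N : grmod) (R : M -> N -> Prop) :=
  [/\ R 0 0, forall (a : S) m m' n n', R m n -> R m' n' -> R (a *: m + m') (a *: n + n')
    & forall l m n, R m n -> R (hpart l m) (hpart l n)].

Lemma grel_q (M N : grmod) (R : qgraph M N) : grel R.
Proof. by split; [exact: qrel0|exact: qrelP|exact: qrel_gr]. Qed.

Section Relations.
Variables M N : grmod.

Lemma grelZ (R : M -> N -> Prop) (a : S) m n : grel R -> R m n -> R (a *: m) (a *: n).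
Proof. by move=> [h0 h _] Rmn; rewrite -[a *: m]addr0 -[a *: n]addr0; apply: h. Qed.

Lemma grelD (R : M -> N -> Prop) m n m' n' : grel R -> R m n -> R m' n' ->
  R (m + m') (n + n').
Proof. by move=> [h0 h _] *; rewrite -[m]scale1r -[n]scale1r; apply: h. Qed.

Lemma grelB (R : M -> N -> Prop) m n m' n' : grel R -> R m n -> R m' n' ->
  R (m - m') (n - n').
Proof.
by move=> [h0 h _] *; rewrite addrC [n - _]addrC -scaleN1r -[- n']scaleN1r; apply: h.
Qed.

Lemma grel_range (R : M -> N -> Prop) : grel R -> graded_submod [set n | exists m, R m n].
Proof.
move=> [h0 h hl]; split; first by exists 0.
  by move=> a n n' [m Rm] [m' Rm']; exists (a *: m + m'); apply: h.
by move=> l n [m Rm]; exists (hpart l m); apply: hl.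
Qed.

Lemma grel_inv (R : M -> N -> Prop) : grel R -> grel (fun n m => R m n).
Proof. by move=> [h0 h hl]; split=> // [a m m' n n'|l m n]; [exact: h|exact: hl]. Qed.

Lemma grel_dom (R : M -> N -> Prop) : grel R -> graded_submod [set m | exists n, R m n].
Proof.
move=> [h0 h hl]; split; first by exists 0.
  by move=> a m m' [n Rn] [n' Rn']; exists (a *: n + n'); apply: h.
by move=> l m [n Rn]; exists (hpart l n); apply: hl.
Qed.

Lemma grel_ind (R : M -> N -> Prop) : grel R -> graded_submod [set n | R 0 n].
Proof.
move=> [h0 h hl]; split=> //=.
  by move=> a m m' Rm Rm'; have := h a _ _ _ _ Rm Rm'; rewrite scaler0 addr0.
by move=> l m Rm; rewrite -(hpart0 M l); apply: hl.
Qed.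

Definition mkq (R : M -> N -> Prop) (gR : grel R)
    (dR : forall m, ev (fun m => exists n, R m n) m) (iR : forall n, R 0 n -> tors n) :
  qgraph M N.
Proof.
refine (@QGraph _ _ _ M N R _ _ _ _ _); try by case: gR.
  by apply/(finite_codimP hp hq _).2 => //; apply: grel_dom.
by apply/(finite_dimP hp hq _).2 => //; apply: grel_ind.
Defined.

Lemma qrel_ev (R : qgraph M N) m : ev (qdom R) m.
Proof. by apply: (finite_codimP hp hq _).1 (qrel_dom R) m; exact: graded_qdom. Qed.

Lemma qrel_tors (R : qgraph M N) n : R 0 n -> tors n.
Proof. by apply: (finite_dimP hp hq _).1 (qrel_ind R) n; exact/grel_ind/grel_q. Qed.

Lemma qrelZ (R : qgraph M N) (a : S) m n : R m n -> R (a *: m) (a *: n).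
Proof. by apply: grelZ; apply: grel_q. Qed.

Lemma qrel_torsW (R : qgraph M N) m n : R m n -> tors m -> tors n.
Proof.
move=> Rmn [K hK]; apply: (ev_sx (N := K)) => [|b]; first exact: submodule0.
by apply: (@qrel_tors R); rewrite -(hK b); apply: qrelZ.
Qed.

Lemma qclass_eq (R R' : qgraph M N) : qclass R = qclass R' <->
  forall m n n', R m n -> R' m n' -> tors (n - n').
Proof.
rewrite qclassP qequivP finite_dimP //; last exact: graded_qdiff.
split=> [h m n n' Rn Rn'|h _ [m [n [n' [Rn Rn' ->]]]]]; last exact: h Rn Rn'.
by apply: h; exists m, n, n'.
Qed.

Lemma qclass_eq0 (R : qgraph M N) : qclass R = 0 <-> forall m n, R m n -> tors n.
Proof.
rewrite [0](_ : _ = qclass (qzero M N)) // qclass_eq.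
by split=> h m n; [move=> Rn; rewrite -[n]subr0; apply: h Rn _|move=> n' Rn ->; rewrite subr0;
  apply: h Rn].
Qed.

Lemma qclass_surj (f : qhom M N) : exists R, f = qclass R.
Proof. by exists (repr f); rewrite qclass_repr. Qed.

End Relations.

Lemma compE (M N P : coh) (T : qgraph N P) (R : qgraph M N) :
  (qclass T : hom N P) \c (qclass R : hom M N) = qclass (qcomp T R).
Proof. exact: qhcompE. Qed.

Lemma zero_obP (M : coh) : zero_ob M <-> forall m : M, tors m.
Proof.
apply: (iff_trans (qclass_eq0 (qid M))).
by split=> h m; [apply: (h m)|move=> n ->].
Qed.

Lemma homogeneous_spart d (f : S) : homogeneous (d : L) (spart d f).
Proof. by move=> i j; rewrite coef_spart; case: ifP => [/eqP //|_]; rewrite eqxx. Qed.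

Lemma hpart_elt (M : grmod) (w l : L) (m : M) (f : S) : hpart (- w) m = m ->
  hpart l (f *: m) = spart (w + l) f *: m.
Proof.
move=> hm; have [s _ fE] := spart_sum p q f.
rewrite [in LHS]fE [in RHS]fE scaler_suml !(big_morph _ (hpartD _) (hpart0 M _)).
rewrite (big_morph (spart (w + l)) (spartD _) (id1 := 0)) ?scaler_suml; last first.
  by apply: spart_eqP => i j; rewrite coef_spart !coef0 if_same.
apply: eq_bigr => d _; have hd := @homogeneous_spart d f.
have E : hpart (d - w) (spart d f *: m) = spart d f *: m by rewrite hpart_homog // hm.
rewrite -{1}E hpartK spartK -(inj_eq (addrI w)) [w + (d - w)]addrC subrK.
case: eqP => [e|_]; last by rewrite scale0r.
by rewrite e -[RHS]E; congr (hpart _ _); rewrite -e [w + l]addrC addrK.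
Qed.

Section Element.
Variables (M : coh) (w : L) (m : M).
(** As [S(w)_l = S_(w + l)], the generator [1] of [line_bundle k w] has weight [- w], and an element
    of that weight defines a morphism. *)
Hypothesis hm : hpart (- w) (m : M) = m.

Lemma elt_grel : @grel (line_bundle k w) M (fun (f : S) n => n = f *: m).
Proof.
split; first by rewrite scale0r.
  by move=> a f f' _ _ -> ->; rewrite scalerDl scalerA.
by move=> l f _ ->; rewrite (hpart_elt _ _ hm).
Qed.

Definition eltq : qgraph (line_bundle k w) M.
Proof.
apply: (mkq elt_grel) => [f|n ->]; first by apply: ev_in; exists ((f : S) *: m).
by rewrite scale0r; apply: tors0.
Defined.

Definition elt : hom (line_bundle k w) M := qclass eltq.

End Element.

Lemma elt_eq0 (M : coh) w (m : M) (hm : hpart (- w) (m : M) = m) :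
  elt hm = 0 <-> tors m.
Proof.
rewrite /elt; have := @qclass_eq0 (line_bundle k w) M (eltq hm).
move=> ->; split=> [h|h f n ->]; last by apply: submoduleZ h; exact: tors_submodule.
by apply: (h (1 : S) m); rewrite /= scale1r.
Qed.

(** Line bundles detect monomorphisms: each homogeneous component of an element related to [0]
    defines a morphism from a line bundle whose composite with the given one vanishes. *)
Lemma monoP (M N : coh) (R : qgraph M N) :
  mono (qclass R : hom M N) <-> forall m, R m 0 -> tors m.
Proof.
split=> [mR m Rm|h].
  have gK : graded_submod (fun x : M => tors x) by apply: ev_graded; exact: graded0.
  apply: graded_sum => // l.
  have Rl : R (hpart l m) 0 by rewrite -(hpart0 N l); apply: qrel_gr.
  have hm : hpart (- - l) (hpart l m) = hpart l m by rewrite opprK hpart_idem.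
  apply/(elt_eq0 hm); apply: mR; rewrite comp0r /elt compE.
  apply/qclass_eq0 => f n [_ -> Rf]; apply: (@qrel_tors _ _ R).
  rewrite -(subrr ((f : S) *: hpart l m)) -[n]subr0.
  apply: (grelB (grel_q R)) => //; rewrite -(scaler0 _ (f : S)).
  exact: qrelZ.
apply: mono0 => t f; have [T ->] := qclass_surj f.
rewrite compE => /qclass_eq0 RT; apply/qclass_eq0 => x m Txm.
have [K hK] := qrel_ev R m.
apply: (ev_sx (N := K)) => [|b]; first exact: submodule0.
have [n Rn] := hK b.
have [|J hJ] := RT (sx k b ^+ K *: x) n; first by exists (sx k b ^+ K *: m) => //; apply: qrelZ.
apply: (ev_sx (N := J)) => [|c]; first exact: submodule0.
by apply: h; rewrite -(hJ c); apply: qrelZ.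
Qed.

(** * Graded quotient modules *)

Section QuotientModule.
Variables (M : grmod) (P : set M) (gP : graded_submod P).

Definition qpred of graded_submod P : {pred M} := fun m => `[< P m >].

Lemma qpred_closed : zmod_closed (qpred gP).
Proof.
have sP := graded_submodule gP.
split; first by apply/asboolP; case: sP.
by move=> m n /asboolP Pm /asboolP Pn; apply/asboolP; apply: submoduleB.
Qed.

HB.instance Definition _ := GRing.isZmodClosed.Build M (qpred gP) qpred_closed.

Definition qmod : Type := {quot (qpred gP)}.
HB.instance Definition _ := GRing.Zmodule.on qmod.

Definition qpi (m : M) : qmod := \pi_({quot (qpred gP)})%qT m.
Definition qrepr (x : qmod) : M := repr (x : {quot (qpred gP)}).

Lemma qpi_eq m n : qpi m = qpi n <-> P (m - n).
Proof.
split=> [/eqP|Pmn]; last apply/eqP; rewrite /qpi.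
  by rewrite -(idealrBE (qpred gP)) => /asboolP.
by rewrite -(idealrBE (qpred gP)); apply/asboolP.
Qed.

Lemma qreprK x : qpi (qrepr x) = x.
Proof. exact: reprK. Qed.

Lemma qpiD m n : qpi (m + n) = qpi m + qpi n.
Proof. exact: raddfD. Qed.

Lemma qpi0 : qpi 0 = 0.
Proof. exact: raddf0. Qed.

Lemma qpi_eq0 m : qpi m = 0 <-> P m.
Proof. by rewrite -qpi0 qpi_eq subr0. Qed.

Definition qmod_scale (a : S) (x : qmod) : qmod := qpi (a *: qrepr x).

Lemma qmod_scaleE a m : qmod_scale a (qpi m) = qpi (a *: m).
Proof.
apply/qpi_eq; rewrite -scalerBr; apply: submoduleZ; first exact: graded_submodule.
by apply/qpi_eq; rewrite qreprK.
Qed.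

Lemma qmodW (Q : qmod -> Prop) : (forall m, Q (qpi m)) -> forall x, Q x.
Proof. by move=> h x; rewrite -[x]qreprK. Qed.

Lemma qmod_scaleA a b x : qmod_scale a (qmod_scale b x) = qmod_scale (a * b) x.
Proof. by elim/qmodW: x => m; rewrite !qmod_scaleE scalerA. Qed.

Lemma qmod_scale1 : left_id 1 qmod_scale.
Proof. by elim/qmodW=> m; rewrite qmod_scaleE scale1r. Qed.

Lemma qmod_scaleDr : right_distributive qmod_scale +%R.
Proof.
move=> a; elim/qmodW=> m; elim/qmodW=> n.
by rewrite -qpiD !qmod_scaleE -qpiD scalerDr.
Qed.

Lemma qmod_scaleDl x : {morph qmod_scale^~ x : a b / a + b}.
Proof. by move=> a b; elim/qmodW: x => m; rewrite !qmod_scaleE -qpiD scalerDl. Qed.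

HB.instance Definition _ := GRing.Zmodule_isLmodule.Build S qmod
  qmod_scaleA qmod_scale1 qmod_scaleDr qmod_scaleDl.

Lemma qpiZ (a : S) m : qpi (a *: m) = a *: qpi m.
Proof. by rewrite -qmod_scaleE. Qed.

Definition qmod_hpart l (x : qmod) : qmod := qpi (hpart l (qrepr x)).

Lemma qmod_hpartE l m : qmod_hpart l (qpi m) = qpi (hpart l m).
Proof.
by apply/qpi_eq; rewrite -hpartB; case: gP => _ _; apply; apply/qpi_eq; rewrite qreprK.
Qed.

Lemma qmod_hpartD l : {morph qmod_hpart l : x y / x + y}.
Proof.
by elim/qmodW=> m; elim/qmodW=> n; rewrite -qpiD !qmod_hpartE hpartD qpiD.
Qed.

Lemma qmod_hpartK l l' x :
  qmod_hpart l (qmod_hpart l' x) = if l == l' then qmod_hpart l x else 0.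
Proof.
by elim/qmodW: x => m; rewrite !qmod_hpartE hpartK; case: eqP => // _; rewrite qpi0.
Qed.

Lemma qmod_sum x : exists2 s : seq L, uniq s & x = \sum_(l <- s) qmod_hpart l x.
Proof.
elim/qmodW: x => m; have [s us mE] := hpart_sum m; exists s => //.
rewrite [in LHS]mE (big_morph qpi qpiD qpi0).
by apply: eq_bigr => l _; rewrite qmod_hpartE.
Qed.

Lemma qmod_act d l (f : S) x : homogeneous d f ->
  qmod_hpart (d + l) (f *: qmod_hpart l x) = f *: qmod_hpart l x.
Proof.
by move=> hf; elim/qmodW: x => m; rewrite [qmod_hpart l _]qmod_hpartE -qpiZ qmod_hpartE
  hpart_act.
Qed.

Lemma qmod_fin_gen : exists s : seq qmod, forall m, exists c : nat -> S,
  m = \sum_(i < size s) c i *: s`_i.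
Proof.
have [s hs] := fin_gen M; exists (map qpi s); elim/qmodW=> m.
have [c ->] := hs m; exists c; rewrite size_map (big_morph qpi qpiD qpi0).
by apply: eq_bigr => i _; rewrite qpiZ (nth_map 0).
Qed.

Definition quot_grmod : grmod :=
  GrMod qmod_hpartD qmod_hpartK qmod_sum qmod_act qmod_fin_gen.

Lemma tors_qpi m : tors (qpi m) <-> ev P m.
Proof.
by split=> -[N h]; exists N => b; have := h b; rewrite -qpiZ => /qpi_eq0.
Qed.

End QuotientModule.

Section DirectSum.
Variables M N : grmod.

Definition dsum_hpart l (x : M * N) : M * N := (hpart l x.1, hpart l x.2).

Lemma dsum_hpartD l : {morph dsum_hpart l : x y / x + y}.
Proof. by move=> x y; rewrite /dsum_hpart !hpartD. Qed.

Lemma dsum_hpartK l l' x :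
  dsum_hpart l (dsum_hpart l' x) = if l == l' then dsum_hpart l x else 0.
Proof. by rewrite /dsum_hpart !hpartK; case: eqP. Qed.

(** The two components of a pair have different supports, so each decomposition must hold over
    larger sets of weights. *)
Lemma hpart_sum_sup (M' : grmod) (m : M') : exists2 s : seq L, uniq s &
  forall t, uniq t -> {subset s <= t} -> m = \sum_(l <- t) hpart l m.
Proof.
have [s us mE] := hpart_sum m; exists s => // t ut st.
rewrite (bigID (mem s)) /= [X in _ + X]big1 ?addr0 => [|l ls].
  rewrite -big_filter [LHS]mE; apply: perm_big; apply: uniq_perm => //.
    exact: filter_uniq.
  by move=> l; rewrite mem_filter; case: (boolP (l \in s)) => // /st ->.
rewrite mE (big_morph _ (hpartD l) (hpart0 M' l)) big1_seq // => l' /andP[_ l's].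
by rewrite hpartK; case: eqP => // e; rewrite e l's in ls.
Qed.

Lemma dsum_sum x : exists2 s : seq L, uniq s & x = \sum_(l <- s) dsum_hpart l x.
Proof.
have [s us hs] := hpart_sum_sup x.1; have [t ut ht] := hpart_sum_sup x.2.
exists (undup (s ++ t)); first exact: undup_uniq.
have -> : forall r, \sum_(l <- r) dsum_hpart l x =
    (\sum_(l <- r) hpart l x.1, \sum_(l <- r) hpart l x.2).
  by elim=> [|l r IH]; rewrite ?big_nil // !big_cons IH.
rewrite -hs -?ht ?undup_uniq //; first by case: (x).
  by move=> l lt; rewrite mem_undup mem_cat lt orbT.
by move=> l ls; rewrite mem_undup mem_cat ls.
Qed.

Lemma dsum_act d l (f : S) x : homogeneous d f ->
  dsum_hpart (d + l) (f *: dsum_hpart l x) = f *: dsum_hpart l x.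
Proof. by move=> hf; rewrite /dsum_hpart /= !hpart_act. Qed.

Lemma dsum_fin_gen : exists s : seq (M * N)%type, forall m, exists c : nat -> S,
  m = \sum_(i < size s) c i *: s`_i.
Proof.
have [s hs] := fin_gen M; have [t ht] := fin_gen N.
exists ([seq (m, 0) | m <- s] ++ [seq (0, n) | n <- t]) => -[m n].
have -> : (m, n) = (m, 0) + (0, n) :> M * N by rewrite /GRing.add /= /add_pair /= addr0 add0r.
apply: gen_cat.
  have [c ->] := hs m; exists c; rewrite size_map.
  rewrite (big_morph (fun m => (m, 0) : M * N) (id1 := 0) (op1 := +%R)) //; last first.
    by move=> u v; congr (_, _); rewrite /= addr0.
  by apply: eq_bigr => i _; rewrite (nth_map 0) //; congr (_, _); rewrite /= scaler0.
have [c ->] := ht n; exists c; rewrite size_map.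
rewrite (big_morph (fun n => (0, n) : M * N) (id1 := 0) (op1 := +%R)) //; last first.
  by move=> u v; congr (_, _); rewrite /= addr0.
by apply: eq_bigr => i _; rewrite (nth_map 0) //; congr (_, _); rewrite /= scaler0.
Qed.

Definition dsum : grmod := GrMod dsum_hpartD dsum_hpartK dsum_sum dsum_act dsum_fin_gen.

End DirectSum.

End Coh.

(** * The abelian structure of the quotient category *)

Section CohAbelian.
Variables (k : closedFieldType) (p q : nat).
Hypotheses (hp : (0 < p)%N) (hq : (0 < q)%N).
Local Notation S := {poly {poly k}}.
Local Notation L := (weight p q).
Local Notation grmod := (grmod k p q).
Local Notation coh := (coh k p q).
Local Notation ev := (@ev k _).
Local Notation tors := (@tors k _).
Local Notation mkq := (mkq hp hq).

Definition gmap (M N : grmod) (f : M -> N) :=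
  (forall (a : S) m m', f (a *: m + m') = a *: f m + f m') /\
  (forall l m, f (hpart l m) = hpart l (f m)).

Section GradedMap.
Variables (M N : grmod) (f : M -> N) (hf : gmap f).

Lemma gmap0 : f 0 = 0.
Proof.
have := hf.1 1 0 0; rewrite !scale1r addr0 => e.
by apply: (addrI (f 0)); rewrite -e addr0.
Qed.

Lemma gmap_grel : grel (fun m n => n = f m).
Proof.
split; first by rewrite gmap0.
  by move=> a m m' _ _ -> ->; rewrite hf.1.
by move=> l m _ ->; rewrite hf.2.
Qed.

Definition mapq : qgraph M N.
Proof.
apply: (mkq gmap_grel) => [m|n ->]; first by apply: ev_in; exists (f m).
by rewrite gmap0; apply: tors0.
Defined.

End GradedMap.

(** The test object is the quotient of [N] by the range of [R]. *)
Lemma epiP (M N : coh) (R : qgraph M N) :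
  epi (qclass R : hom M N) <-> forall n, ev (fun n => exists m, R m n) n.
Proof.
split=> [eR n|h].
  pose Q : coh := quot_grmod (grel_range (grel_q R)).
  have hpi : @gmap N Q (qpi (grel_range (grel_q R))).
    split; first by move=> a m m'; rewrite qpiD qpiZ.
    by move=> l m; rewrite /= -qmod_hpartE.
  have pi0 : (qclass (mapq hpi) : hom N Q) = 0.
    apply: eR; rewrite comp0l compE; apply/qclass_eq0 => // m _ [n' Rn ->].
    suff -> : qpi (grel_range (grel_q R)) n' = 0 by apply: tors0.
    by apply/qpi_eq0; exists m.
  by apply/(tors_qpi (grel_range (grel_q R))); apply: ((qclass_eq0 hp hq (mapq hpi)).1 pi0 n).
apply: epi0 => t f; have [T ->] := qclass_surj f.
rewrite compE => /(qclass_eq0 hp hq) RT; apply/(qclass_eq0 hp hq) => n x Tnx.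
have [K hK] := h n.
apply: (ev_sx (N := K)) => [|b]; first exact: submodule0.
by have [m Rm] := hK b; apply: (RT m); exists (sx k b ^+ K *: n) => //; apply: qrelZ.
Qed.

(** The inverse is the converse relation: [epiP] controls its domain and [monoP] its
    indeterminacy. *)
Lemma coh_balanced (M N : coh) (f : hom M N) : mono f -> epi f -> iso_arrow f.
Proof.
have [R ->] := qclass_surj f => /(monoP hp hq) mR /epiP eR.
exists (qclass (mkq (grel_inv (grel_q R)) eR mR)); split.
  rewrite compE; apply/(qclass_eq hp hq) => m n n' [x Rm Rn] ->.
  by apply: (mR); rewrite -(subrr x); apply: grelB Rn Rm; apply: grel_q.
rewrite compE; apply/(qclass_eq hp hq) => m n n' [x Rm Rn] ->.
apply: (@qrel_tors _ _ _ hp hq _ _ R); rewrite -(subrr x).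
by apply: grelB Rn Rm; apply: grel_q.
Qed.

(** Exactness read on elements, up to [ev] and [tors]. The factorization through the kernel or the
    cokernel is the relational composite with the converse of [F] or of [G]. *)
Lemma short_exactP (A B C : coh) (F : qgraph A B) (G : qgraph B C) :
  short_exact (qclass F : hom A B) (qclass G : hom B C) <->
  [/\ forall a, F a 0 -> tors a, forall c, ev (fun c => exists b, G b c) c,
      forall a b c, F a b -> G b c -> tors c
    & forall b, G b 0 -> ev (fun b => exists a, F a b) b].
Proof.
have ck0 : (qclass G : hom B C) \c (qclass F : hom A B) = 0 <->
    forall a b c, F a b -> G b c -> tors c.
  rewrite compE; apply: (iff_trans (qclass_eq0 hp hq _)).
  by split=> [h a b c Fab Gbc|h a c [b Fab Gbc]]; [apply: (h a); exists b|apply: h Fab Gbc].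
split=> [[kF cG]|[mF eG FG exact_]].
  have /(monoP hp hq) mF := kernel_mono kF; have /epiP eG := cokernel_epi cG.
  have FG := ck0.1 kF.1; split=> // b Gb.
  have gR := grel_range (grel_q F); pose Q : coh := quot_grmod gR.
  have hpi : @gmap B Q (qpi gR).
    split; first by move=> a m m'; rewrite qpiD qpiZ.
    by move=> l m; rewrite /= -qmod_hpartE.
  have [|u [uG _]] := cG.2 Q (qclass (mapq hpi)).
    rewrite compE; apply/(qclass_eq0 hp hq) => a _ [b' Fb ->].
    suff -> : qpi gR b' = 0 by apply: tors0.
    by apply/qpi_eq0; exists a.
  have [U uE] := qclass_surj u; move: uG; rewrite uE compE => /(qclass_eq hp hq) UG.
  have := UG b 0 (qpi gR b); rewrite sub0r => h.
  apply/(tors_qpi gR)/torsN; apply: h => //.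
  by exists 0 => //; apply: qrel0.
have mono_F : mono (qclass F : hom A B) by apply/(monoP hp hq).
have epi_G : epi (qclass G : hom B C) by apply/epiP.
split; split; [exact/ck0| |exact/ck0|].
  move=> t h; have [H ->] := qclass_surj h.
  rewrite compE => /(qclass_eq0 hp hq) GH.
  have gU : grel (fun x a => exists2 b, H x b & F a b).
    split; first by exists 0; apply: qrel0.
      by move=> a x x' y y' [b h1 h2] [b' h3 h4]; exists (a *: b + b'); apply: qrelP.
    by move=> l x y [b h1 h2]; exists (hpart l b); apply: qrel_gr.
  have dU x : ev (fun x => exists a, exists2 b, H x b & F a b) x.
    have sU : submodule (fun x => exists a, exists2 b, H x b & F a b).
      exact: (graded_submodule (grel_dom gU)).
    apply: ev_trans (qrel_ev hp hq H x) _ => // {}x [b Hb].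
    have [K hK] := qrel_ev hp hq G b.
    apply: (ev_sx (N := K)) => // c; have [z Gz] := hK c.
    have [|J hJ] := GH (sx k c ^+ K *: x) z.
      by exists (sx k c ^+ K *: b) => //; apply: qrelZ.
    apply: (ev_sx (N := J)) => // d.
    have [|I hI] := exact_ (sx k d ^+ J *: (sx k c ^+ K *: b)).
      by rewrite -(hJ d); apply: qrelZ.
    exists I => e; have [a Fa] := hI e; exists a.
    by exists (sx k e ^+ I *: (sx k d ^+ J *: (sx k c ^+ K *: b))) => //; do 3!apply: qrelZ.
  have iU a : (exists2 b, H 0 b & F a b) -> tors a.
    move=> [b Hb Fab]; have [K hK] := qrel_tors hp hq Hb.
    apply: (ev_sx (N := K)) => [|c]; first exact: submodule0.
    by apply: mF; rewrite -(hK c); apply: qrelZ.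
  have E : (qclass F : hom A B) \c (qclass (mkq gU dU iU) : hom t A) = qclass H.
    rewrite compE; apply/(qclass_eq hp hq) => x b b' [a [b1 Hb1 Fab1] Fab] Hb'.
    have F0 : F 0 (b - b1) by rewrite -(subrr a); apply: grelB (grel_q F) Fab Fab1.
    have H0 : H 0 (b1 - b') by rewrite -(subrr x); apply: grelB (grel_q H) Hb1 Hb'.
    have -> : b - b' = (b - b1) + (b1 - b') by rewrite addrA subrK.
    exact: torsD (qrel_tors hp hq F0) (qrel_tors hp hq H0).
  by exists (qclass (mkq gU dU iU)); split=> // u' e; apply: mono_F; rewrite E e.
move=> t h; have [H ->] := qclass_surj h.
rewrite compE => /(qclass_eq0 hp hq) HF.
have gU : grel (fun c x => exists2 b, G b c & H b x).
  split; first by exists 0; apply: qrel0.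
    by move=> a x x' y y' [b h1 h2] [b' h3 h4]; exists (a *: b + b'); apply: qrelP.
  by move=> l x y [b h1 h2]; exists (hpart l b); apply: qrel_gr.
have dU c : ev (fun c => exists x, exists2 b, G b c & H b x) c.
  apply: ev_trans (eG c) _ => [|{}c [b Gb]].
    exact: (graded_submodule (grel_dom gU)).
  have [K hK] := qrel_ev hp hq H b; exists K => e; have [x Hx] := hK e.
  by exists x, (sx k e ^+ K *: b) => //; apply: qrelZ.
have iU x : (exists2 b, G b 0 & H b x) -> tors x.
  move=> [b /exact_[K hK] Hb].
  apply: (ev_sx (N := K)) => [|c]; first exact: submodule0.
  have [a Fa] := hK c; apply: (HF a).
  by exists (sx k c ^+ K *: b) => //; apply: qrelZ.
have E : (qclass (mkq gU dU iU) : hom C t) \c (qclass G : hom B C) = qclass H.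
  rewrite compE; apply/(qclass_eq hp hq) => b x x' [c Gb [b' Gb' Hb']] Hb.
  apply: iU; exists (b' - b); last by apply: grelB (grel_q H) Hb' Hb.
  by rewrite -(subrr c); apply: grelB (grel_q G) Gb' Gb.
by exists (qclass (mkq gU dU iU)); split=> // u' e; apply: epi_G; rewrite E e.
Qed.

Lemma coh_biproducts (M N : coh) : exists (s : coh) (i1 : hom M s) (i2 : hom N s)
  (p1 : hom s M) (p2 : hom s N), is_biproduct i1 i2 p1 p2.
Proof.
pose s : coh := dsum M N; exists s.
have h1 : @gmap M s (fun m => (m, 0)).
  by split=> [a m m'|l m]; congr (_, _); rewrite /= ?scaler0 ?addr0 // hpart0.
have h2 : @gmap N s (fun n => (0, n)).
  by split=> [a m m'|l m]; congr (_, _); rewrite /= ?scaler0 ?addr0 // hpart0.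
have h3 : @gmap s M (fun x => x.1) by [].
have h4 : @gmap s N (fun x => x.2) by [].
exists (qclass (mapq h1)), (qclass (mapq h2)), (qclass (mapq h3)), (qclass (mapq h4)).
split; rewrite ?compE.
- by apply/(qclass_eq hp hq) => m n n' [x -> ->] -> /=; rewrite subrr; apply: tors0.
- by apply/(qclass_eq hp hq) => m n n' [x -> ->] -> /=; rewrite subrr; apply: tors0.
- by apply/(qclass_eq0 hp hq) => m n [x -> ->]; apply: tors0.
- by apply/(qclass_eq0 hp hq) => m n [x -> ->]; apply: tors0.
- rewrite [_ + _]qclassD; apply/(qclass_eq hp hq) => x y z.
  move=> [y1 [y2 [[m -> ->] [n -> ->] ->]]] ->.
  suff -> : (x.1, 0) + (0, x.2) - x = 0 :> s by apply: tors0.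
  by case: x => m' n'; congr (_, _); rewrite /= ?addr0 ?add0r subrr.
Qed.

Section Pushout.
Variables (A B X Y : coh) (D : qgraph A B) (Pi : qgraph B X) (F : qgraph A Y).
Hypothesis dpi : short_exact (qclass D : hom A B) (qclass Pi : hom B X).

(** The pushout is the quotient of the direct sum by the pairs [(d a, - f a)]; the existential
    replaces [d] and [f], which are relations here. *)
Definition push_rel : set (dsum B Y) := fun u => exists a, D a u.1 /\ F a (- u.2).

Lemma push_graded : graded_submod push_rel.
Proof.
split; first by exists 0; rewrite /= oppr0; split; apply: qrel0.
  move=> a u v [x [Dx Fx]] [y [Dy Fy]]; exists (a *: x + y); split; first exact: qrelP.
  by rewrite /= opprD -scalerN; apply: qrelP.
move=> l u [x [Dx Fx]]; exists (hpart l x); split; first exact: qrel_gr.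
by rewrite /= -[- hpart l _]add0r -(hpart0 Y l) -hpartB sub0r; apply: qrel_gr.
Qed.

Definition push_ob : coh := quot_grmod push_graded.
Local Notation cl b y := (qpi push_graded (b, y) : push_ob).

Lemma push_eq b y b' y' : cl b y = cl b' y' <-> exists a, D a (b - b') /\ F a (y' - y).
Proof.
apply: (iff_trans (qpi_eq _ _ _)).
by rewrite /push_rel /= opprB.
Qed.

Lemma push_lin (a : S) b y b' y' : cl (a *: b + b') (a *: y + y') = a *: cl b y + cl b' y'.
Proof. by rewrite -qpiZ -qpiD. Qed.

Lemma push_hpart l b y : hpart l (cl b y) = cl (hpart l b) (hpart l y).
Proof. exact: qmod_hpartE. Qed.

Lemma push_Z (a : S) b y : a *: cl b y = cl (a *: b) (a *: y).
Proof. exact: (esym (qpiZ push_graded a (b, y))). Qed.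

Lemma push_Z1 (a : S) b : a *: cl b 0 = cl (a *: b) 0.
Proof. by rewrite push_Z; congr (qpi _ _); congr (_, _); rewrite /= scaler0. Qed.

Lemma push_Z2 (a : S) y : a *: cl 0 y = cl 0 (a *: y).
Proof. by rewrite push_Z; congr (qpi _ _); congr (_, _); rewrite /= scaler0. Qed.

Lemma pushW (e : push_ob) : exists b y, e = cl b y.
Proof. by elim/qmodW: e => -[b y]; exists b, y. Qed.

Lemma push_gmap1 : @gmap B push_ob (fun b => cl b 0).
Proof.
split=> [a b b'|l b]; last by rewrite push_hpart hpart0.
by rewrite -push_lin scaler0 addr0.
Qed.

Lemma push_gmap2 : @gmap Y push_ob (fun y => cl 0 y).
Proof.
split=> [a b b'|l b]; last by rewrite push_hpart hpart0.
by rewrite -push_lin scaler0 addr0.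
Qed.

Let PiD a b x : D a b -> Pi b x -> tors x.
Proof. by case/short_exactP: dpi => _ _ h _; apply: h. Qed.

Section Universal.
Variables (Z : coh) (U : qgraph B Z) (V : qgraph Y Z).
Hypothesis UV : (qclass U : hom B Z) \c qclass D = (qclass V : hom Y Z) \c qclass F.

Let UVtors a b y z1 z2 : D a b -> F a y -> U b z1 -> V y z2 -> tors (z1 - z2).
Proof.
move: UV; rewrite !compE => /(qclass_eq hp hq) h Da Fa Ub Vy.
by apply: (h a); [exists b|exists y].
Qed.

Definition push_urel (e : push_ob) (z : Z) := exists b y z1 z2,
  [/\ e = cl b y, U b z1, V y z2 & z = z1 + z2].

Lemma push_urel_grel : grel push_urel.
Proof.
split.
- by exists 0, 0, 0, 0; split; [rewrite [cl _ _]qpi0|apply: qrel0|apply: qrel0|rewrite addr0].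
- move=> a _ _ _ _ [b [y [z1 [z2 [-> Ub Vy ->]]]]] [b' [y' [z1' [z2' [-> Ub' Vy' ->]]]]].
  exists (a *: b + b'), (a *: y + y'), (a *: z1 + z1'), (a *: z2 + z2').
  by split; [rewrite push_lin|apply: qrelP|apply: qrelP|rewrite scalerDr addrACA].
- move=> l _ _ [b [y [z1 [z2 [-> Ub Vy ->]]]]].
  exists (hpart l b), (hpart l y), (hpart l z1), (hpart l z2).
  by split; [rewrite push_hpart|apply: qrel_gr|apply: qrel_gr|rewrite hpartD].
Qed.

Lemma push_urel_tors b y b' y' z1 z2 z3 z4 : cl b y = cl b' y' ->
  U b z1 -> V y z2 -> U b' z3 -> V y' z4 -> tors ((z1 + z2) - (z3 + z4)).
Proof.
move=> /push_eq[a [Da Fa]] U1 V1 U2 V2.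
rewrite opprD addrACA -[z2 - z4]opprB; apply: UVtors Da Fa _ _.
  exact: grelB (grel_q U) U1 U2.
exact: grelB (grel_q V) V2 V1.
Qed.

Lemma push_univ : exists h : hom push_ob Z,
  h \c (qclass (mapq push_gmap1) : hom B push_ob) = qclass U /\
  h \c (qclass (mapq push_gmap2) : hom Y push_ob) = qclass V.
Proof.
have d e : ev (fun e => exists z, push_urel e z) e.
  have [b [y ->]] := pushW e.
  have [K hK] := qrel_ev hp hq U b; have [J hJ] := qrel_ev hp hq V y.
  exists (maxn K J) => c.
  have [z1 U1] := ev_pow (graded_submodule (graded_qdom U)) (leq_maxl K J) (hK c).
  have [z2 V2] := ev_pow (graded_submodule (graded_qdom V)) (leq_maxr K J) (hJ c).
  exists (z1 + z2), (sx k c ^+ maxn K J *: b), (sx k c ^+ maxn K J *: y), z1, z2.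
  by split=> //; rewrite push_Z.
have i z : push_urel 0 z -> tors z.
  move=> [b [y [z1 [z2 [e Ub Vy ->]]]]]; rewrite -[_ + _]subr0 -(addr0 0).
  apply: push_urel_tors Ub Vy (qrel0 U) (qrel0 V).
  by rewrite -e; apply/esym/qpi0.
exists (qclass (mkq push_urel_grel d i)); rewrite !compE; split.
  apply/(qclass_eq hp hq) => b z z' [e -> [b' [y' [z1 [z2 [e' U1 V1 ->]]]]]] U2.
  by rewrite -[z']addr0; apply: push_urel_tors U1 V1 U2 (qrel0 V).
apply/(qclass_eq hp hq) => y z z' [e -> [b' [y' [z1 [z2 [e' U1 V1 ->]]]]]] V2.
by rewrite -[z']add0r; apply: push_urel_tors U1 V1 (qrel0 U) V2.
Qed.

End Universal.

Lemma push_joint (Z : coh) (h h' : hom push_ob Z) :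
  h \c (qclass (mapq push_gmap1) : hom B push_ob) = h' \c qclass (mapq push_gmap1) ->
  h \c (qclass (mapq push_gmap2) : hom Y push_ob) = h' \c qclass (mapq push_gmap2) ->
  h = h'.
Proof.
move=> e1 e2; apply/subr0_eq; move: e1 e2 => /eqP; rewrite -subr_eq0 -compBl => /eqP + /eqP.
rewrite -subr_eq0 -compBl => + /eqP; move: (h - h') => {h h'} g.
have [G ->] := qclass_surj g; rewrite !compE.
move=> /(qclass_eq0 hp hq) g1 /(qclass_eq0 hp hq) g2; apply/(qclass_eq0 hp hq) => e z Gez.
have [b [y eE]] := pushW e.
have [K hK] := qrel_ev hp hq G (cl b 0); have [J hJ] := qrel_ev hp hq G (cl 0 y).
apply: (ev_sx (N := maxn K J)) => [|c]; first exact: submodule0.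
have [z1 G1] := ev_pow (graded_submodule (graded_qdom G)) (leq_maxl K J) (hK c).
have [z2 G2] := ev_pow (graded_submodule (graded_qdom G)) (leq_maxr K J) (hJ c).
set N := maxn K J in G1 G2 *.
have t1 : tors z1.
  apply: (g1 (sx k c ^+ N *: b)); exists (cl (sx k c ^+ N *: b) 0) => //.
  by rewrite -push_Z1.
have t2 : tors z2.
  apply: (g2 (sx k c ^+ N *: y)); exists (cl 0 (sx k c ^+ N *: y)) => //.
  by rewrite -push_Z2.
have t3 : tors (sx k c ^+ N *: z - (z1 + z2)).
  apply: (@qrel_tors _ _ _ hp hq _ _ G).
  rewrite [X in G X](_ : 0 = sx k c ^+ N *: e - (sx k c ^+ N *: cl b 0 + sx k c ^+ N *:
    cl 0 y)).
    by apply: grelB (grel_q G) (qrelZ _ Gez) (grelD (grel_q G) G1 G2).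
  by rewrite -scalerDr -qpiD [(b, 0) + _](_ : _ = (b, y)) ?eE ?subrr //; congr (_, _);
    rewrite /= ?addr0 ?add0r.
rewrite -[_ *: z](subrK (z1 + z2)); exact: torsD t3 (torsD t1 t2).
Qed.

Definition push_orel (e : push_ob) (x : X) := exists b y, e = cl b y /\ Pi b x.

Lemma push_orel_grel : grel push_orel.
Proof.
split.
- by exists 0, 0; split; [rewrite [cl _ _]qpi0|apply: qrel0].
- move=> a _ _ x x' [b [y [-> Px]]] [b' [y' [-> Px']]].
  by exists (a *: b + b'), (a *: y + y'); split; [rewrite push_lin|apply: qrelP].
- move=> l _ x [b [y [-> Px]]].
  by exists (hpart l b), (hpart l y); split; [rewrite push_hpart|apply: qrel_gr].
Qed.

Lemma push_orel_tors b y b' y' x x' : cl b y = cl b' y' -> Pi b x -> Pi b' x' -> tors (x - x').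
Proof.
by move=> /push_eq[a [Da _]] P1 P2; apply: PiD Da _; apply: grelB (grel_q Pi) P1 P2.
Qed.

Lemma push_extension : exists (xi : extension X Y) (s : hom B (ext_mid xi)),
  pushout_ext (qclass D : hom A B) (qclass Pi : hom B X) (qclass F : hom A Y) s.
Proof.
have [mD ePi _ exPi] := (short_exactP D Pi).1 dpi.
have d e : ev (fun e => exists x, push_orel e x) e.
  have [b [y ->]] := pushW e; have [K hK] := qrel_ev hp hq Pi b.
  exists K => c; have [x Px] := hK c; exists x, (sx k c ^+ K *: b), (sx k c ^+ K *: y).
  by rewrite push_Z.
have i x : push_orel 0 x -> tors x.
  move=> [b [y [e Pb]]]; rewrite -[x]subr0.
  by apply: (@push_orel_tors b y 0 0) Pb (qrel0 Pi); rewrite -e; apply/esym/qpi0.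
have xe : short_exact (qclass (mapq push_gmap2) : hom Y push_ob)
    (qclass (mkq push_orel_grel d i) : hom push_ob X).
  apply/short_exactP; split.
  - move=> y e; have /push_eq[a [Da Fa]] : cl 0 y = cl 0 0 by rewrite [cl 0 0]qpi0 e.
    rewrite subr0 in Da; rewrite sub0r in Fa; apply: torsN.
    by apply: (qrel_torsW hp hq Fa); apply: mD.
  - move=> x; apply: ev_sub (ePi x) => {}x [b Pb]; exists (cl b 0); by exists b, 0.
  - move=> y _ x -> [b [y' [e Pb]]]; apply: torsN; rewrite -sub0r.
    exact: push_orel_tors e (qrel0 Pi) Pb.
  - move=> e [b [y [-> /exPi[K hK]]]].
    apply: (ev_sx (N := K)) => [|c].
      exact: (graded_submodule (grel_range (gmap_grel push_gmap2))).
    have [a Da] := hK c; have [J hJ] := qrel_ev hp hq F a.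
    exists J => c'; have [y' Fy'] := hJ c'.
    exists (sx k c' ^+ J *: (sx k c ^+ K *: y) + y').
    rewrite !push_Z; apply/push_eq; exists (sx k c' ^+ J *: a); split.
      by rewrite subr0; apply: qrelZ.
    by rewrite addrC addKr.
exists (Extension xe), (qclass (mapq push_gmap1)); split.
- rewrite !compE; apply/(qclass_eq hp hq) => a _ _ [b Db ->] [y Fy ->].
  suff -> : cl b 0 = cl 0 y by rewrite subrr; apply: tors0.
  by apply/push_eq; exists a; rewrite !subr0.
- rewrite compE; apply/(qclass_eq hp hq) => b x x' [_ -> [b' [y' [e Pb']]]] Pb.
  exact: push_orel_tors (esym e) Pb' Pb.
- move=> Z u v; have [U ->] := qclass_surj u; have [V ->] := qclass_surj v.
  exact: push_univ.
- exact: push_joint.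
Qed.

End Pushout.

Lemma coh_pushouts (A B X Y : coh) (d : hom A B) (pi : hom B X) (f : hom A Y) :
  short_exact d pi -> exists (xi : extension X Y) (s : hom B (ext_mid xi)),
  pushout_ext d pi f s.
Proof.
have [D ->] := qclass_surj d; have [P ->] := qclass_surj pi.
by have [F ->] := qclass_surj f; apply: push_extension.
Qed.

End CohAbelian.

(** * Coefficients and monomial ideals *)

Section Coefficients.
Variables (k : closedFieldType) (p q : nat).
Local Notation S := {poly {poly k}}.
Local Notation L := (weight p q).
Local Notation wx := (wx p q).
Local Notation sx := (sx k).

(* The coefficient of (sx b)^i (sx (~~ b))^j in f. *)
Definition cf (b : bool) (f : S) (i j : nat) : k := if b then f`_i`_j else f`_j`_i.

Lemma cf_negb b f i j : cf (~~ b) f j i = cf b f i j.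
Proof. by case: b. Qed.

Lemma cf_inj b f g : (forall i j, cf b f i j = cf b g i j) -> f = g.
Proof. by case: b => h; apply: spart_eqP => i j; [apply: (h j i)|apply: (h i j)]. Qed.

Lemma cfD b f g i j : cf b (f + g) i j = cf b f i j + cf b g i j.
Proof. by case: b; rewrite /cf !coefD. Qed.

Lemma cfN b f i j : cf b (- f) i j = - cf b f i j.
Proof. by case: b; rewrite /cf !coefN. Qed.

Lemma cf0 b i j : cf b 0 i j = 0.
Proof. by case: b; rewrite /cf !coef0. Qed.

Lemma cfZ b a f i j : cf b (sC a * f) i j = a * cf b f i j.
Proof. by case: b; rewrite /cf /sC !coefCM. Qed.

Lemma cf_sum b (I : Type) (r : seq I) (P : pred I) (F : I -> S) i j :
  cf b (\sum_(l <- r | P l) F l) i j = \sum_(l <- r | P l) cf b (F l) i j.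
Proof. by apply: (big_morph (fun f => cf b f i j)) => [f g|]; [exact: cfD|exact: cf0]. Qed.

Lemma cf_sM b n f i j : cf b (sx b ^+ n * f) i j = if (i < n)%N then 0 else cf b f (i - n) j.
Proof.
case: b; rewrite /cf /= /sx2 /sx1; first by rewrite coefXnM; case: ifP; rewrite ?coef0.
by rewrite -polyC_exp coefCM coefXnM.
Qed.

Lemma cf_tM b n f i j :
  cf b (sx (~~ b) ^+ n * f) i j = if (j < n)%N then 0 else cf b f i (j - n).
Proof. by rewrite -cf_negb cf_sM cf_negb. Qed.

Lemma cf1 b i j : cf b 1 i j = ((i == 0%N) && (j == 0%N))%:R.
Proof.
case: b; rewrite /cf coef1; first by case: (i == 0%N); rewrite ?coef0 ?coef1.
by case: (j == 0%N); rewrite ?coef0 ?coef1 ?andbF ?andbT.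
Qed.

Lemma cf_mon b n m i j :
  cf b (sx b ^+ n * sx (~~ b) ^+ m) i j = ((i == n) && (j == m))%:R.
Proof.
rewrite cf_sM -[_ ^+ m]mulr1 cf_tM cf1.
case: ltnP => ni; first by rewrite (ltn_eqF ni).
case: ltnP => mj; first by rewrite (ltn_eqF mj) andbF.
by rewrite !subn_eq0 [i == n]eqn_leq [j == m]eqn_leq ni mj !andbT.
Qed.

Lemma homogeneousE b (d : L) f :
  homogeneous d f <-> forall i j, cf b f i j != 0 -> wx b *+ i + wx (~~ b) *+ j = d.
Proof.
by case: b; split=> h i j /h; rewrite /cf /mon_weight //= addrC.
Qed.

Lemma homogeneousD (d : L) (f g : S) : homogeneous d f -> homogeneous d g ->
  homogeneous d (f + g).
Proof.
move=> hf hg i j; rewrite !coefD.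
have [->|/hf //] := eqVneq (f`_j`_i) 0; rewrite add0r; exact: hg.
Qed.

Lemma homogeneousN (d : L) (f : S) : homogeneous d f -> homogeneous d (- f).
Proof. by move=> hf i j; rewrite !coefN oppr_eq0; apply: hf. Qed.

Lemma homogeneousZ (d : L) a (f : S) : homogeneous d f -> homogeneous d (sC a * f).
Proof.
move=> /(homogeneousE false) h; apply/(homogeneousE false) => i j.
by rewrite cfZ mulf_eq0 negb_or => /andP[_ /h].
Qed.

Lemma homogeneous0 (d : L) : homogeneous d (0 : S).
Proof. by apply/(homogeneousE false) => i j; rewrite cf0 eqxx. Qed.

Lemma homogeneous_bigsum (d : L) (I : Type) (r : seq I) (P : pred I) (F : I -> S) :
  (forall i, P i -> homogeneous d (F i)) -> homogeneous d (\sum_(i <- r | P i) F i).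
Proof. by move=> h; elim/big_ind: _ => //; [exact: homogeneous0|exact: homogeneousD]. Qed.

Definition fsel (Q : nat -> nat -> bool) (f : S) : S :=
  \poly_(j < size f) \poly_(i < size f`_j) (if Q i j then f`_j`_i else 0).

Lemma cf_fsel b Q f i j :
  cf b (fsel (fun i j => if b then Q j i else Q i j) f) i j = if Q i j then cf b f i j else 0.
Proof.
have E (Q' : nat -> nat -> bool) i' j' : (fsel Q' f)`_j'`_i' =
  if Q' i' j' then f`_j'`_i' else 0.
  rewrite /fsel coef_poly; case: ltnP => [_|hj]; last first.
    by rewrite (nth_default 0 hj) !coef0 if_same.
  rewrite coef_poly; case: ltnP => // hi.
  by rewrite (nth_default 0 hi) if_same.
by case: b; rewrite /cf E.
Qed.

Definition csel b (Q : nat -> nat -> bool) f :=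
  fsel (fun i j => if b then Q j i else Q i j) f.

Lemma cf_csel b Q f i j : cf b (csel b Q f) i j = if Q i j then cf b f i j else 0.
Proof. exact: cf_fsel. Qed.

Lemma homogeneous_csel b Q (d : L) f : homogeneous d f -> homogeneous d (csel b Q f).
Proof.
move=> /(homogeneousE b) h; apply/(homogeneousE b) => i j; rewrite cf_csel.
by case: ifP => [_ /h //|]; rewrite eqxx.
Qed.

Lemma cf_div b n f : (forall i j, (i < n)%N -> cf b f i j = 0) -> exists g, f = sx b ^+ n * g.
Proof.
move=> h; exists (if b then drop_poly n f else \poly_(j < size f) drop_poly n f`_j).
apply: (@cf_inj b) => i j; rewrite cf_sM; case: ltnP => [/h //|ni].
case: b h => h; rewrite /cf; first by rewrite coef_drop_poly subnK.
rewrite coef_poly; case: ltnP => [_|hj]; first by rewrite coef_drop_poly subnK.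
by rewrite (nth_default 0 hj) !coef0.
Qed.

Lemma homogeneous_div b n (d : L) g :
  homogeneous d (sx b ^+ n * g) -> homogeneous (d - wx b *+ n) g.
Proof.
move=> /(homogeneousE b) h; apply/(homogeneousE b) => i j cg.
rewrite -(h (i + n)%N j) ?cf_sM; last by rewrite ltnNge leq_addl /= addnK.
by rewrite mulrnDr addrAC addrK.
Qed.

Lemma homogeneous_mon b n m :
  homogeneous (wx b *+ n + wx (~~ b) *+ m) (sx b ^+ n * sx (~~ b) ^+ m).
Proof.
apply/(homogeneousE b) => i j; rewrite cf_mon.
by case: (i =P n) => [->|_]; case: (j =P m) => [->|_]; rewrite /= ?eqxx.
Qed.

Lemma spart_homogeneous (d : L) (f : S) : homogeneous d f -> spart d f = f.
Proof.
move=> hh; apply: spart_eqP => i j; rewrite coef_spart.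
by case: eqP => // ne; have [-> //|/hh /ne] := eqVneq (f`_j`_i) 0.
Qed.

Lemma sx_neq0 b n : sx b ^+ n != 0.
Proof.
rewrite expf_neq0 //; case: b; rewrite /= /sx1 /sx2 ?polyC_eq0 polyX_eq0 //.
Qed.

(* [None] stands for the zero ideal and [Some (b, n)] for the ideal of
   [sx b ^+ n]. *)
Definition up_set (o : option (bool * nat)) (i j : nat) : bool :=
  if o is Some (b, n) then (n <= if b then j else i)%N else false.

Definition mideal o : set S := fun f => forall i j, ~~ up_set o i j -> f`_j`_i = 0.

Lemma up_setW o i j i' j' : (i' <= i)%N -> (j' <= j)%N -> up_set o i' j' -> up_set o i j.
Proof. by case: o => [[[] n]|] //= hi hj h; apply: leq_trans h _. Qed.

Lemma midealN f : mideal None f <-> f = 0.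
Proof.
split=> [h|->]; last by move=> i j _; rewrite !coef0.
by apply: spart_eqP => i j; rewrite h // !coef0.
Qed.

Lemma midealS b n f : mideal (Some (b, n)) f <-> exists g, f = sx b ^+ n * g.
Proof.
split=> [h|[g ->] i j].
  apply: cf_div => i j ni; case: b h => h; rewrite /cf; apply: h => /=; rewrite -ltnNge //.
rewrite /= -ltnNge => hn; have := cf_sM b n g (if b then j else i) (if b then i else j).
by rewrite hn; case: (b).
Qed.

Lemma mideal_submodule o : submodule (mideal o : S^o -> Prop).
Proof.
split=> [i j _|a f g hf hg i j nU]; first by rewrite !coef0.
rewrite !coefD hg // addr0 [(a *: f)](_ : _ = a * f) // coefM2 big1 // => c _.
rewrite big1 // => c' _; rewrite hf ?mulr0 //; apply: contra nU.
by apply: up_setW; apply: leq_subr.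
Qed.

Lemma mideal_spart o (d : L) f : mideal o f -> mideal o (spart d f).
Proof. by move=> h i j nU; rewrite coef_spart h // if_same. Qed.

(** [sx (~~ b)] is not a zero divisor modulo [sx b ^+ n], and the zero ideal is prime. So the
    quotient of [S] by such an ideal has no torsion elements, and vanishing in the quotient category
    is membership in the ideal. *)
Lemma mideal_reg o N f : (forall b, mideal o (sx b ^+ N * f)) -> mideal o f.
Proof.
case: o => [[b n]|] h; last first.
  apply/midealN; have /midealN/eqP := h true; rewrite mulf_eq0 (negbTE (sx_neq0 _ _)) /=.
  by move/eqP.
have /midealS[g gE] := h (~~ b); apply/midealS/cf_div => i j ni.
have := congr1 (fun f => cf b f i (j + N)) gE.
by rewrite cf_tM cf_sM ni ltnNge leq_addl /= addnK.
Qed.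

End Coefficients.

(** * Cyclic modules *)

Section Cyclic.
Variables (k : closedFieldType) (p q : nat).
Hypotheses (hp : (0 < p)%N) (hq : (0 < q)%N).
Local Notation S := {poly {poly k}}.
Local Notation L := (weight p q).
Local Notation wx := (wx p q).
Local Notation sx := (sx k).
Local Notation grmod := (grmod k p q).
Local Notation coh := (coh k p q).
Local Notation ev := (@ev k _).
Local Notation tors := (@tors k _).
Local Notation mkq := (mkq hp hq).
Local Notation O := (@line_bundle k p q).

Lemma mideal_graded o (w : L) : @graded_submod _ _ _ (O w : grmod) (mideal o).
Proof.
have [h0 h] := mideal_submodule k o; split=> // l m; exact: mideal_spart.
Qed.

Section IdealQuotient.
Variables (w : L) (I : set S) (gI : @graded_submod _ _ _ (O w : grmod) I).

Definition cyclic : coh := quot_grmod gI.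
Definition ccl (f : S) : cyclic := qpi gI f.

Lemma ccl_eq f g : ccl f = ccl g <-> I (f - g).
Proof. exact: qpi_eq. Qed.

Lemma ccl_eq0 f : ccl f = 0 <-> I f.
Proof. exact: qpi_eq0. Qed.

Lemma cclD f g : ccl (f + g) = ccl f + ccl g.
Proof. exact: qpiD. Qed.

Lemma cclZ (a f : S) : ccl (a * f) = a *: ccl f.
Proof. exact: (qpiZ gI a f). Qed.

Lemma ccl1 (f : S) : ccl f = f *: ccl 1.
Proof. by rewrite -cclZ mulr1. Qed.

Lemma ccl_hpart l f : hpart l (ccl f) = ccl (spart (w + l) f).
Proof. exact: (qmod_hpartE gI l f). Qed.

Lemma ccl_surj (x : cyclic) : exists f, x = ccl f.
Proof. by elim/qmodW: x => f; exists f. Qed.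

Lemma ccl_homogeneous (a : L) f : homogeneous (w - a) f -> hpart (- a) (ccl f) = ccl f.
Proof. by move=> hf; rewrite ccl_hpart spart_homogeneous. Qed.

Lemma ccl_hlift (a : L) (x : cyclic) : hpart (- a) x = x ->
  exists f, homogeneous (w - a) f /\ x = ccl f.
Proof.
have [f ->] := ccl_surj x => hx; exists (spart (w - a) f); split; last by rewrite -ccl_hpart.
exact: homogeneous_spart.
Qed.

Lemma tors_ccl f : tors (ccl f) <-> ev (I : O w -> Prop) f.
Proof. exact: tors_qpi. Qed.

Lemma ccl_gmap : @gmap _ _ _ (O w) cyclic ccl.
Proof.
split; first by move=> a f g; rewrite cclD; congr (_ + _); apply: cclZ.
by move=> l f; rewrite ccl_hpart.
Qed.

End IdealQuotient.

Definition cyc o (w : L) : coh := cyclic (mideal_graded o w).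

Lemma tors_cyc o w (f : S) : tors (ccl (mideal_graded o w) f) <-> mideal o f.
Proof.
split=> [/tors_ccl[N h]|h]; last by rewrite (ccl_eq0 _ _).2 //; apply: tors0.
exact: (@mideal_reg _ _ N).
Qed.

Lemma line_bundle_hpart (w a : L) (f : S) : homogeneous (w - a) f ->
  hpart (- a) (f : (O w : grmod)) = f.
Proof. exact: spart_homogeneous. Qed.

Lemma cyc_line_bundle w : isomorphic (cyc None w) (O w).
Proof.
apply: isomorphic_sym; exists (qclass (mapq hp hq (ccl_gmap (mideal_graded None w)))).
apply: coh_balanced => //.
  apply/(monoP hp hq) => f /esym /ccl_eq0 /midealN ->; exact: tors0.
apply/(epiP hp hq) => x; apply: ev_in.
by have [f ->] := ccl_surj x; exists f.
Qed.

(* The morphism O a -> M sending 1 to m; it is only meaningful when m is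
   homogeneous of weight - a. *)
Definition el (M : coh) (a : L) (m : M) : hom (O a) M :=
  if pselect (hpart (- a) (m : M) = m) is left h then elt hp hq h else 0.

Lemma elE (M : coh) a (m : M) (h : hpart (- a) (m : M) = m) : el a m = elt hp hq h.
Proof.
rewrite /el; case: pselect => // h'; congr (elt hp hq _); exact: Prop_irrelevance.
Qed.

Lemma el_eq (M : coh) a (m m' : M) : hpart (- a) m = m -> hpart (- a) m' = m' ->
  el a m = el a m' <-> tors (m - m').
Proof.
move=> h h'; rewrite !elE; apply: (iff_trans (qclass_eq hp hq _ _)).
split=> [e|t f _ _ -> ->]; last by rewrite -scalerBr; apply: torsZ.
by apply: (e (1 : S)); rewrite /= scale1r.
Qed.

Lemma el_eq0 (M : coh) a (m : M) : hpart (- a) m = m -> el a m = 0 <-> tors m.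
Proof. by move=> h; rewrite elE; apply: elt_eq0. Qed.

Lemma elD (M : coh) a (m m' : M) : hpart (- a) m = m -> hpart (- a) m' = m' ->
  el a (m + m') = el a m + el a m'.
Proof.
move=> h h'; have h2 : hpart (- a) (m + m') = m + m' by rewrite hpartD h h'.
rewrite !elE [RHS]qclassD; apply/(qclass_eq hp hq) => f _ _ -> [_ [_ [-> -> ->]]].
by rewrite scalerDr subrr; apply: tors0.
Qed.

Lemma elZ (M : coh) a c (m : M) : hpart (- a) m = m -> el a (sC c *: m) = c *: el a m.
Proof.
move=> h; have h2 : hpart (- a) (sC c *: m) = sC c *: m by rewrite hpartZ h.
rewrite !elE [RHS](qhscaleE c (eltq hp hq h)); apply/(qclass_eq hp hq) => f _ _ -> [_ -> ->].
by rewrite !scalerA mulrC subrr; apply: tors0.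
Qed.

Lemma el0 (M : coh) a : el a (0 : M) = 0.
Proof. by apply/el_eq0; [apply: hpart0|apply: tors0]. Qed.

Lemma el_sum (M : coh) a (I : finType) (c : I -> k) (F : I -> M) :
  (forall i, hpart (- a) (F i) = F i) ->
  el a (\sum_i sC (c i) *: F i) = \sum_i c i *: el a (F i).
Proof.
move=> h; suff [] : hpart (- a) (\sum_i sC (c i) *: F i) = \sum_i sC (c i) *: F i /\
  el a (\sum_i sC (c i) *: F i) = \sum_i c i *: el a (F i) by [].
elim/big_rec2: _ => [|i y1 y2 _ [h1 IH]]; first by rewrite hpart0 el0.
by rewrite hpartD hpartZ h h1 elD ?IH ?elZ ?hpartZ ?h.
Qed.

Lemma el_rel (M N : coh) a (R : qgraph M N) m n : R m n -> hpart (- a) m = m ->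
  hpart (- a) n = n -> (qclass R : hom M N) \c el a m = el a n.
Proof.
move=> Rmn h h'; rewrite !elE compE; apply/(qclass_eq hp hq) => f x y [_ -> Rx] ->.
apply: (@qrel_tors _ _ _ hp hq _ _ R); rewrite -(subrr ((f : S) *: m)).
by apply: grelB (grel_q R) Rx _; apply: qrelZ.
Qed.

Lemma el_gmap (M N : coh) a (f : M -> N) (hf : gmap f) m : hpart (- a) m = m ->
  (qclass (mapq hp hq hf) : hom M N) \c el a m = el a (f m).
Proof. by move=> h; apply: el_rel => //; rewrite -hf.2 h. Qed.

Lemma el_comp (M : coh) a a' (m : M) (f : S) : hpart (- a) m = m ->
  homogeneous (a - a') f -> el a m \c el (M := O a) a' f = el a' ((f : S) *: m).
Proof.
move=> h hf; rewrite [el a m]elE /elt (@el_rel _ _ _ _ _ (f *: m)) //.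
  exact: line_bundle_hpart.
by rewrite (hpart_elt _ _ h) spart_homogeneous.
Qed.

Lemma el_homogeneous (M : coh) a a' (m : M) (f : S) : hpart (- a) m = m ->
  homogeneous (a - a') f -> hpart (- a') (f *: m) = f *: m.
Proof. by move=> h hf; rewrite (hpart_elt _ _ h) spart_homogeneous. Qed.

(** The domain of the relation has finite codimension, so it contains some [sx b ^+ K]; a
    homogeneous component of a related element has the right weight. *)
Lemma honest (M : coh) a (f : hom (O a) M) b :
  exists K, forall a', a' = a - wx b *+ K -> exists m, hpart (- a') m = m /\
    f \c el (M := O a) a' (sx b ^+ K : S) = el a' m.
Proof.
have [R ->] := qclass_surj f.
have [K hK] := qrel_ev hp hq R (1 : S); exists K => a' ->.
have [n Rn] := hK b; exists (hpart (- (a - wx b *+ K)) n); split; first exact: hpart_idem.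
have hs : hpart (- (a - wx b *+ K)) (sx b ^+ K : (O a : grmod)) = sx b ^+ K.
  by apply: line_bundle_hpart; rewrite subKr; apply: homogeneous_sx.
apply: el_rel => //; last exact: hpart_idem.
rewrite -hs; apply: qrel_gr; rewrite -[X in R X](mulr1); exact: Rn.
Qed.

(** All larger exponents are allowed, so that two morphisms can be represented by polynomials at a
    common exponent. *)
Lemma honest_cyc o w a (f : hom (O a) (cyc o w)) b :
  exists K, forall K' a', (K <= K')%N -> a' = a - wx b *+ K' -> exists g,
    homogeneous (w - a') g /\
    f \c el (M := O a) a' (sx b ^+ K' : S) = el a' (ccl (mideal_graded o w) g).
Proof.
have [K hK] := honest f b; exists K => K' a' KK' a'E.
have [m [hm e]] := hK _ erefl; have [g [hg mE]] := ccl_hlift hm.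
have h1 : homogeneous ((a - wx b *+ K) - a') (sx b ^+ (K' - K)).
  rewrite a'E opprB addrC addrA subrK -mulrnBr //; exact: homogeneous_sx.
exists (sx b ^+ (K' - K) * g); split.
  by have := homogeneousM h1 hg; rewrite addrC addrA subrK.
rewrite cclZ -mE -(el_comp hm h1) -e -compA el_comp //; last first.
  by apply: line_bundle_hpart; rewrite subKr; apply: homogeneous_sx.
by congr (_ \c el _ _); rewrite [_ *: _](_ : _ = sx b ^+ (K' - K) * sx b ^+ K) // -exprD subnK.
Qed.

Section Monomial.
(* Computation of Ext^1(X, S/I(y)) from a tower of resolutions
   0 -> O(al N) -> B N -> X -> 0, related by multiplication with powers of mu. *)
Variables (X : coh) (o : option (bool * nat)) (y : L).
Variables (al : nat -> L) (B : nat -> coh) (d : forall N, hom (O (al N)) (B N))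
  (pi : forall N, hom (B N) X) (mu : S) (vB : forall N K, hom (B (N + K)) (B N))
  (J : nat -> S -> Prop).
Local Notation Y := (cyc o y).
Local Notation cl f := (ccl (mideal_graded o y) f).
Hypothesis mu_homogeneous : forall N K, homogeneous (al N - al (N + K)%N) (mu ^+ K).
Hypothesis se : forall N, short_exact (d N) (pi N).
Hypothesis vBd : forall N K, vB N K \c d (N + K) = d N \c el (M := O (al N)) _ (mu ^+ K : S).
Hypothesis piv : forall N K, pi N \c vB N K = pi (N + K).
(** A substitute for projectivity of [B N]: an epimorphism onto [X] lifts at some level of the
    tower. *)
Hypothesis lift : forall (E : coh) (f : hom E X), epi f -> exists N s, f \c s = pi N.
(** [J N] describes the coboundaries: its elements factor through [d N], and a map that factors
    through [d N] is represented in [J] at a deeper level. *)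
Hypothesis Jd : forall N f, J N f -> homogeneous (y - al N) f ->
  exists t, el (al N) (cl f) = t \c d N.
Hypothesis dJ : forall N (t : hom (B N) Y), exists K f,
  [/\ J (N + K) f, homogeneous (y - al (N + K)%N) f &
   t \c d N \c el (M := O (al N)) _ (mu ^+ K : S) = el (al (N + K)%N) (cl f)].
Hypothesis honest_mu : forall N (f : hom (O (al N)) Y), exists K g,
  homogeneous (y - al (N + K)%N) g /\
  f \c el (M := O (al N)) _ (mu ^+ K : S) = el (al (N + K)%N) (cl g).
Variables (n : nat) (mon : 'I_n -> nat -> S) (N0 : nat).
Hypothesis mon_homogeneous : forall i N, (N0 <= N)%N -> homogeneous (y - al N) (mon i N).
Hypothesis monD : forall i N K, (N0 <= N)%N -> mon i (N + K) = mu ^+ K * mon i N.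
Hypothesis mon_free : forall N c f, (N0 <= N)%N -> J N f ->
  mideal o (\sum_i sC (c i) * mon i N - f) -> forall i, c i = 0.
Hypothesis mon_span : forall N g, (N0 <= N)%N -> homogeneous (y - al N) g ->
  exists c f, [/\ J N f, homogeneous (y - al N) f & mideal o (g - \sum_i sC (c i)
    * mon i N - f)].

Let monE N i : (N0 <= N)%N -> hpart (- al N) (cl (mon i N)) = cl (mon i N).
Proof. by move=> hN; apply/ccl_homogeneous/mon_homogeneous. Qed.

Let cl_sum N (c : 'I_n -> k) :
  cl (\sum_i sC (c i) * mon i N) = \sum_i sC (c i) *: cl (mon i N).
Proof.
elim/big_rec2: _ => [|i x z _ <-]; first by apply/ccl_eq0; case: (mideal_submodule k o).
by rewrite cclD cclZ.
Qed.

Let sum_homogeneous N (c : 'I_n -> k) : (N0 <= N)%N ->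
  homogeneous (y - al N) (\sum_i sC (c i) * mon i N).
Proof.
by move=> hN; apply: homogeneous_bigsum => i _; apply/homogeneousZ/mon_homogeneous.
Qed.

Let elmon N (c : 'I_n -> k) : (N0 <= N)%N ->
  \sum_i c i *: el (al N) (cl (mon i N)) = el (al N) (cl (\sum_i sC (c i) * mon i N)).
Proof. by move=> hN; rewrite cl_sum el_sum // => i; apply: monE. Qed.

Let elmonD N K (c : 'I_n -> k) : (N0 <= N)%N ->
  (\sum_i c i *: el (al N) (cl (mon i N))) \c el (M := O (al N)) _ (mu ^+ K : S)
  = \sum_i c i *: el (al (N + K)%N) (cl (mon i (N + K)%N)).
Proof.
move=> hN; rewrite comp_suml; apply: eq_bigr => i _; rewrite compZl el_comp //;
  last exact: monE.
by rewrite -cclZ monD.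
Qed.

(** Cocycles of level [N0] are compared at deeper levels, where coboundaries and arbitrary cocycles
    are given by polynomials. A relation among the monomials is restricted to such a level;
    conversely a cocycle found there is reduced to monomials, and these extend back to level
    [N0]. *)
Lemma ext1_monomial (X' Y' : coh) : isomorphic X X' -> isomorphic Y Y' -> ext1_dim X' Y' n.
Proof.
move=> iX iY.
apply: (ext1_dimP (@coh_biproducts _ _ _ hp hq) (@coh_pushouts _ _ _ hp hq) (f := fun i =>
  el (al N0) (cl (mon i N0))) iX iY (se N0)).
  move=> v [t tE]; have [K [f [Jf hf e]]] := dJ t.
  have := congr1 (fun u => u \c el (M := O (al N0)) (al (N0 + K)%N) (mu ^+ K : S)) tE.
  rewrite elmonD // e elmon ?leq_addr // => /el_eq h.
  apply/rowP => i; rewrite mxE; apply: (@mon_free (N0 + K)%N (fun i => v 0 i) f) => //.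
    exact: leq_addr.
  apply/(tors_cyc o y); rewrite cclD -[cl (- f)](_ : - cl f = _); last first.
    by rewrite -mulN1r cclZ scaleN1r.
  by apply: h; apply: ccl_homogeneous => //; apply: sum_homogeneous; apply: leq_addr.
move=> xi; have [N1 [s0 os0]] := lift (@extension_epi _ _ _ _ xi).
(* The projection lifts to the extension at level [N1]; adding [N0] reaches the range where the
   monomials are available. *)
pose N := (N1 + N0)%N; pose s1 := s0 \c vB N1 N0.
have os1 : ext_out xi \c s1 = pi N by rewrite /s1 compA os0 piv.
have [f [fE _]] : exists! f, ext_in xi \c f = s1 \c d N.
  by apply: (ext_exact xi).1.2; rewrite compA os1 (se N).1.1.
have [K [g [hg ge]]] := honest_mu f.
pose N' := (N + K)%N; pose s2 := s1 \c vB N K.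
have os2 : ext_out xi \c s2 = pi N' by rewrite /s2 compA os1 piv.
have s2d : s2 \c d N' = ext_in xi \c el (al N') (cl g).
  by rewrite /s2 -compA vBd compA -fE -compA ge.
have N0N' : (N0 <= N')%N by rewrite /N' /N -addnA addnCA leq_addr.
have [c [f' [Jf' hf' Mg]]] := mon_span N0N' hg.
have [t tE] := Jd Jf' hf'.
exists (\row_i c i); pose K' := (N' - N0)%N; have EN : (N0 + K')%N = N' by rewrite subnKC.
have gE : cl g = cl (\sum_i sC (c i) * mon i N') + cl f'.
  by rewrite -cclD; apply/ccl_eq; rewrite opprD addrA.
apply: (classified_descend (@coh_balanced _ _ _ hp hq) (@coh_pushouts _ _ _ hp hq)
  (se N0) (se (N0 + K')%N) (vBd N0 K') (piv N0 K')).
rewrite elmonD //; move: (K') EN => K2 EN; rewrite EN.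
(* Changing the lift by [t] removes the coboundary [f'] from the cocycle. *)
exists (s2 - ext_in xi \c t); split.
  rewrite compBl s2d gE elD; [|exact/ccl_homogeneous/sum_homogeneous|exact: ccl_homogeneous].
  rewrite -compA -tE compDr1 addrK -elmon //; congr (_ \c _).
  by apply: eq_bigr => i _; rewrite mxE.
by rewrite compBr os2 compA ext_out_in comp0l subr0.
Qed.

End Monomial.
End Cyclic.

(** * Extension spaces of cyclic modules *)

Section Towers.
Variables (k : closedFieldType) (p q : nat).
Hypotheses (hp : (0 < p)%N) (hq : (0 < q)%N).
Local Notation S := {poly {poly k}}.
Local Notation L := (weight p q).
Local Notation wx := (wx p q).
Local Notation pw := (pw p q).
Local Notation sx := (sx k).
Local Notation grmod := (grmod k p q).
Local Notation coh := (coh k p q).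
Local Notation ev := (@ev k _).
Local Notation tors := (@tors k _).
Local Notation O := (@line_bundle k p q).
Local Notation el := (el hp hq).
Local Notation cyc := (@cyc k p q).

Lemma tors_subr (M : lmodType S) (m m' : M) : m = m' -> tors (m - m').
Proof. by move=> <-; rewrite subrr; apply: tors0. Qed.

Lemma elN (M : coh) a (m : M) : hpart (- a) m = m -> el a (- m) = - el a m.
Proof.
move=> h; have hN : hpart (- a) (- m) = - m by rewrite -[- m]sub0r hpartB hpart0 h.
by apply/eqP; rewrite -addr_eq0 -elD // addNr el0.
Qed.

Definition upb (b : bool) o (i l : nat) := up_set o (if b then l else i) (if b then i else l).

Lemma mideal_cf b o (f : S) : mideal o f <-> forall i l, ~~ upb b o i l -> cf b f i l = 0.
Proof. by case: b; split=> h i l nU; apply: h. Qed.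

Lemma pw_gt0 b : (0 < pw b)%N.
Proof. by case: b. Qed.

(** Monomials of one weight differ by multiples of the relation between the two generators, so an
    integer [n] indexes them; up to sign it becomes the translation [m] of [pos_shift]. *)
Lemma wx_index b (i l : nat) (A B : int) :
  wx b *+ i + wx (~~ b) *+ l = wx b *~ A + wx (~~ b) *~ B <->
  exists n : int, i%:Z = A + n * (pw b)%:Z /\ l%:Z = B - n * (pw (~~ b))%:Z.
Proof.
have E : wx b *+ i + wx (~~ b) *+ l = wx b *~ A + wx (~~ b) *~ B <->
    wx b *~ (i%:Z - A) + wx (~~ b) *~ (l%:Z - B) = 0.
  rewrite !mulrzBr -!pmulrn addrACA -opprD; split=> [->|/eqP]; first by rewrite subrr.
  by rewrite subr_eq0 => /eqP.
apply: (iff_trans E); apply: (iff_trans (wx_eq0 _ _ _ _ _)).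
by split=> -[n [h1 h2]]; exists n; split; lia.
Qed.

Lemma inl_gmap (M N : grmod) : @gmap _ _ _ M (dsum M N) (fun m => (m, 0)).
Proof. by split=> [a m m'|l m]; congr (_, _); rewrite /= ?scaler0 ?addr0 // hpart0. Qed.

Lemma inr_gmap (M N : grmod) : @gmap _ _ _ N (dsum M N) (fun n => (0, n)).
Proof. by split=> [a m m'|l m]; congr (_, _); rewrite /= ?scaler0 ?addr0 // hpart0. Qed.

(** * Towers whose coboundaries are spanned by monomials *)

Section Tower.
Variables (X : coh) (o : option (bool * nat)) (y : L) (b : bool) (e : nat).
Variables (al : nat -> L) (B : nat -> coh) (d : forall N, hom (O (al N)) (B N))
  (pi : forall N, hom (B N) X) (vB : forall N K, hom (B (N + K)) (B N))
  (reg : nat -> nat -> nat -> bool).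
Local Notation Y := (cyc o y).
Local Notation cl f := (ccl (mideal_graded k o y) f).
(** One step down the tower: [e = 0] multiplies by one variable, for torsion sheaves, and [e = 1] by
    both, for the Koszul complexes. *)
Local Notation mu := (sx b ^+ e * sx (~~ b) : S).
Local Notation J := (fun N f => forall i l, ~~ reg N i l -> cf b f i l = 0).
Hypothesis mu_homogeneous : forall N K, homogeneous (al N - al (N + K)%N) (mu ^+ K).
Hypothesis se : forall N, short_exact (d N) (pi N).
Hypothesis vBd : forall N K, vB N K \c d (N + K) = d N \c el (M := O (al N)) _ (mu ^+ K : S).
Hypothesis piv : forall N K, pi N \c vB N K = pi (N + K).
Hypothesis lift : forall (E : coh) (f : hom E X), epi f -> exists N s, f \c s = pi N.
Hypothesis Jd : forall N f, J N f -> homogeneous (y - al N) f ->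
  exists t, el (al N) (cl f) = t \c d N.
Hypothesis dJ : forall N (t : hom (B N) Y), exists K f,
  [/\ J (N + K)%N f, homogeneous (y - al (N + K)%N) f &
   t \c d N \c el (M := O (al N)) _ (mu ^+ K : S) = el (al (N + K)%N) (cl f)].
Hypothesis honest_mu : forall N (f : hom (O (al N)) Y), exists K g,
  homogeneous (y - al (N + K)%N) g /\
  f \c el (M := O (al N)) _ (mu ^+ K : S) = el (al (N + K)%N) (cl g).
Variables (A C : int) (ns : seq int) (N0 : nat).
Hypothesis yE : forall N, y - al N = wx b *~ (A + (e * N)%N%:Z) + wx (~~ b) *~ (C + N%:Z).
Hypothesis ns_uniq : uniq ns.
Let ex N (n : int) := A + (e * N)%N%:Z + n * (pw b)%:Z.
Let ey N (n : int) := C + N%:Z - n * (pw (~~ b))%:Z.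
(** The surviving monomials have nonnegative exponents and lie outside both the coboundary region
    and the ideal of [Y]. Their exponents move with [N], but from [N0] on their indices are
    constant. *)
Hypothesis nsP : forall N n, (N0 <= N)%N -> (n \in ns) =
  [&& 0 <= ex N n, 0 <= ey N n, ~~ reg N `|ex N n|%N `|ey N n|%N
    & ~~ upb b o `|ex N n|%N `|ey N n|%N].

Let mon (i : 'I_(size ns)) (N : nat) : S :=
  sx b ^+ `|ex N ns`_i|%N * sx (~~ b) ^+ `|ey N ns`_i|%N.

Let nsi N (i : 'I_(size ns)) : (N0 <= N)%N ->
  [&& 0 <= ex N ns`_i, 0 <= ey N ns`_i, ~~ reg N `|ex N ns`_i|%N `|ey N ns`_i|%N
    & ~~ upb b o `|ex N ns`_i|%N `|ey N ns`_i|%N].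
Proof. by move=> hN; rewrite -nsP // mem_nth. Qed.

Lemma ext1_tower (X' Y' : coh) : isomorphic X X' -> isomorphic Y Y' ->
  ext1_dim X' Y' (size ns).
Proof.
apply: (ext1_monomial mu_homogeneous se vBd piv lift Jd dJ honest_mu (mon := mon) (N0 := N0)).
- move=> i N hN; have /and4P[h1 h2 _ _] := nsi i hN.
  rewrite yE; suff <- : wx b *+ `|ex N ns`_i|%N + wx (~~ b) *+ `|ey N ns`_i|%N =
    wx b *~ (A + (e * N)%N%:Z) + wx (~~ b) *~ (C + N%:Z) by apply: homogeneous_mon.
  by apply/wx_index; exists ns`_i; rewrite !gez0_abs.
- move=> i N K hN; have /and4P[h1 h2 _ _] := nsi i hN.
  have hNK : (N0 <= N + K)%N by rewrite (leq_trans hN) // leq_addr.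
  rewrite /mon exprMn mulrACA -exprM -!exprD; congr (_ ^+ _ * _ ^+ _).
    by rewrite /ex in h1 *; nia.
  by rewrite /ey in h2 *; lia.
- move=> N c f hN Jf /(mideal_cf b) h i; have /and4P[h1 h2 h3 h4] := nsi i hN.
  have := h _ _ h4; rewrite cfD cfN Jf // subr0 cf_sum (bigD1 i) //= cfZ cf_mon !eqxx mulr1.
  rewrite big1 ?addr0 // => i' ne; rewrite cfZ cf_mon.
  case: eqP => [e1|_]; last by rewrite mulr0.
  have /and4P[h1' _ _ _] := nsi i' hN.
  case/eqP: ne; apply/val_inj/eqP; rewrite -(nth_uniq 0 (ltn_ord i') (ltn_ord i) ns_uniq).
  apply/eqP; have e2 : ex N ns`_i = ex N ns`_i' by rewrite -(gez0_abs h1) e1 gez0_abs.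
  by move: e2 => /addrI /mulIf -> //; rewrite eqz_nat -lt0n pw_gt0.
- move=> N g hN hg.
  (* [g] is the sum of its surviving monomials, of terms in the coboundary region and of terms in
     the ideal of [Y]. *)
  pose c (i : 'I_(size ns)) := cf b g `|ex N ns`_i|%N `|ey N ns`_i|%N.
  pose r := g - \sum_i sC (c i) * mon i N.
  have hmon i : homogeneous (y - al N) (mon i N).
    have /and4P[h1 h2 _ _] := nsi i hN; rewrite yE.
    suff <- : wx b *+ `|ex N ns`_i|%N + wx (~~ b) *+ `|ey N ns`_i|%N =
      wx b *~ (A + (e * N)%N%:Z) + wx (~~ b) *~ (C + N%:Z) by apply: homogeneous_mon.
    by apply/wx_index; exists ns`_i; rewrite !gez0_abs.
  have hr : homogeneous (y - al N) r.
    by apply: homogeneousB => //; apply: homogeneous_bigsum => i _; apply: homogeneousZ.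
  exists c, (csel b (reg N) r); split.
  + by move=> i l /negbTE nr; rewrite cf_csel nr.
  + exact: homogeneous_csel.
  + apply/(mideal_cf b) => i l nU; rewrite cfD cfN cf_csel.
    case: ifPn => [_|nreg]; first by rewrite subrr.
    rewrite subr0; apply/eqP/negPn/negP => cr.
    (* Any other term would have an index in [ns], but the coefficients at these indices have been
       subtracted. *)
    have := (homogeneousE b _ _).1 hr _ _ cr; rewrite yE => /wx_index[n [iE lE]].
    have nns : n \in ns.
      by rewrite (nsP n hN) /ex /ey -iE -lE !absz_nat nreg nU.
    pose i0 := Ordinal (etrans (index_mem n ns) nns).
    have ni0 : ns`_i0 = n by rewrite nth_index.
    have ci0 : ex N ns`_i0 = i%:Z /\ ey N ns`_i0 = l%:Z by rewrite ni0 iE lE.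
    move: cr; rewrite cfD cfN cf_sum (bigD1 i0) //= cfZ cf_mon.
    rewrite /c ci0.1 ci0.2 !absz_nat !eqxx mulr1 big1 ?addr0 ?subrr ?eqxx // => i' ne.
    rewrite cfZ cf_mon; case: eqP => [e1|_]; last by rewrite mulr0.
    have /and4P[h1' _ _ _] := nsi i' hN.
    case/eqP: ne; apply/val_inj/eqP; rewrite -(nth_uniq 0 (ltn_ord i') (ltn_ord i0) ns_uniq).
    have : ex N ns`_i' = ex N n by rewrite -(gez0_abs h1') -e1 iE.
    by move=> /addrI /mulIf -> //; rewrite ?ni0 // eqz_nat -lt0n pw_gt0.
Qed.

End Tower.

(** * Extensions of a torsion sheaf *)

Section TorsionTower.
Variables (b : bool) (j : nat) (v : L).
Local Notation X := (cyc (Some (b, j)) v).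
Local Notation t := (~~ b).
(** A power of [sx b] is zero on [X], so the tower is built from powers of the other variable. *)
Let bt N := v - wx t *+ N.
Let al N := v - wx t *+ N - wx b *+ j.
Let X1 : X := ccl (mideal_graded k (Some (b, j)) v) 1.

Let al_bt N : bt N - al N = wx b *+ j. Proof. by rewrite /al subKr. Qed.
Let btD N K : bt (N + K) = bt N - wx t *+ K. Proof. by rewrite /bt mulrnDr opprD addrA. Qed.
Let alD N K : al (N + K) = al N - wx t *+ K. Proof. by rewrite /al -/(bt _) btD addrAC. Qed.

Let dT N : hom (O (al N)) (O (bt N)) := el (M := O (bt N)) (al N) (sx b ^+ j : S).
Let piT N : hom (O (bt N)) X := el (bt N) ((sx t ^+ N : S) *: X1).

Let h1 : hpart (- v) X1 = X1.
Proof.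
apply: ccl_homogeneous; rewrite subrr; apply/(homogeneousE b) => i l.
by rewrite cf1; case: i => [|i]; case: l => [|l]; rewrite ?eqxx // !mulr0n addr0.
Qed.

Let hsx (c : bool) w N : hpart (- (w - wx c *+ N)) (sx c ^+ N : (O w : grmod)) = sx c ^+ N.
Proof. by apply: line_bundle_hpart; rewrite subKr; apply: homogeneous_sx. Qed.

Let hpi N : hpart (- bt N) ((sx t ^+ N : S) *: X1) = (sx t ^+ N : S) *: X1.
Proof. by apply: (el_homogeneous h1); rewrite /bt subKr; apply: homogeneous_sx. Qed.

Let X1E (a f : S) : a *: (f *: X1) = ccl (mideal_graded k (Some (b, j)) v) (a * f).
Proof. by rewrite cclZ [ccl _ f]ccl1. Qed.

Lemma torsion_resolution N : short_exact (dT N) (piT N).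
Proof.
rewrite /dT /piT (elE hp hq (hsx b (bt N) j)) (elE hp hq (hpi N)).
apply/(short_exactP hp hq); split.
- move=> f /esym e; suff -> : f = 0 :> S by apply: tors0.
  have /eqP : (f : S) * sx b ^+ j = 0 by exact: e.
  by rewrite mulf_eq0 (negbTE (sx_neq0 _ _ _)) orbF => /eqP.
(* [sx b ^+ j] kills [x] and [sx t ^+ N] brings it into the image; one exponent serves for both. *)
- move=> x; have [g ->] := ccl_surj x; exists (maxn j N) => c.
  have [->|cb] := eqVneq c b.
    exists 0; rewrite /= scale0r -cclZ; apply/ccl_eq0/midealS.
    exists (sx b ^+ (maxn j N - j) * g).
    by rewrite mulrA -exprD subnKC // leq_maxl.
  have -> : c = t by case: (c) (b) cb => -[].
  exists (sx t ^+ (maxn j N - N) * g : S); apply: (etrans _ (esym (X1E _ _))).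
  rewrite -cclZ; congr (ccl _ _).
  by rewrite mulrAC -exprD subnK // leq_maxr.
- move=> f g x -> ->; rewrite [X in tors X]X1E; apply/tors_cyc/midealS.
  exists ((f : S) * sx t ^+ N); rewrite [_ *: _](_ : _ = (f : S) * sx b ^+ j) //.
  by rewrite mulrAC mulrC.
- move=> g /esym /(etrans (esym (X1E _ _))) /ccl_eq0 /midealS[h e].
  have [f fE] : exists f, (g : S) = sx b ^+ j * f.
    apply: cf_div => i l ij; have := congr1 (fun f => cf b f i (l + N)) e.
    by rewrite mulrC cf_tM cf_sM ij ltnNge leq_addl addnK.
  by apply: ev_in; exists f; rewrite fE mulrC.
Qed.

Variables (o : option (bool * nat)) (y : L) (A C : int) (ns : seq int).
Local Notation Y := (cyc o y).
Hypothesis yE : y - v + wx b *+ j = wx b *~ A + wx t *~ C.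
Hypothesis ns_uniq : uniq ns.
(** For large [N] the exponent of [sx t] is large: it is nonnegative, and if [Y] is supported at the
    other exceptional point the monomial lies in the ideal of [Y]. Only the exponent of [sx b] is
    left to constrain. *)
Hypothesis nsP : forall n, (n \in ns) =
  [&& 0 <= A + n * (pw b)%:Z, A + n * (pw b)%:Z < j%:Z &
   if o is Some (c, j') then (c == b) && (A + n * (pw b)%:Z < j'%:Z) else true].

Lemma ext1_torsion (X' Y' : coh) : isomorphic X X' -> isomorphic Y Y' ->
  ext1_dim X' Y' (size ns).
Proof.
pose vB N K : hom (O (bt (N + K))) (O (bt N)) := el (M := O (bt N)) (bt (N + K)) (sx t ^+ K :
  S).
(* The bounds on the exponent of [sx b] give [|n| <= |A| + j]; this [N0] then makes the exponent of
   [sx t] at least [j'], or nonnegative if [Y] is a line bundle. *)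
pose N0 := (`|C| + (`|A| + j) * pw t + if o is Some (_, j') then j' else 0)%N.
have hal N : hpart (- al N) (sx b ^+ j : (O (bt N) : grmod)) = sx b ^+ j by apply: hsx.
have hbt N K : hpart (- bt (N + K)) (sx t ^+ K : (O (bt N) : grmod)) = sx t ^+ K.
  by rewrite btD; apply: hsx.
have muE K : (sx b ^+ 0 * sx t) ^+ K = sx t ^+ K by rewrite expr0 mul1r.
apply: (@ext1_tower X o y b 0 al (fun N => O (bt N)) dT piT vB (fun _ i _ => (j <= i)%N)
  _ _ _ _ _ _ _ _ A C ns N0).
- by move=> N K; rewrite muE alD subKr; apply: homogeneous_sx.
- exact: torsion_resolution.
- move=> N K; rewrite /vB /dT muE !el_comp //.
  + by congr (el _ _); rewrite [LHS]mulrC.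
  + by rewrite alD subKr; apply: homogeneous_sx.
  + by rewrite al_bt; apply: homogeneous_sx.
- move=> N K; rewrite /piT /vB el_comp //; last by rewrite btD subKr; apply: homogeneous_sx.
  by rewrite scalerA -exprD addnC.
- move=> E f; have [R ->] := qclass_surj f => /(epiP hp hq) eR.
  have [N hN] := eR X1; have [e Re] := hN t; exists N.
  have R' : R (hpart (- bt N) e) ((sx t ^+ N : S) *: X1) by rewrite -hpi; apply: qrel_gr.
  exists (el (bt N) (hpart (- bt N) e)).
  by rewrite (el_rel hp hq R') //; apply: hpart_idem.
- move=> N f Jf hf; have [g gE] : exists g, f = sx b ^+ j * g.
    by apply: cf_div => i l ij; apply: Jf; rewrite -ltnNge.
  have hg : homogeneous (y - bt N) g.
    have := homogeneous_div (b := b) (n := j) (d := y - al N) (g := g).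
    by rewrite -gE -(al_bt N) opprB addrA subrK; apply.
  exists (el (bt N) (ccl (mideal_graded k o y) g)); rewrite /dT el_comp.
  + by rewrite -cclZ -gE.
  + exact: ccl_homogeneous.
  + by rewrite al_bt; apply: homogeneous_sx.
- move=> N u; have [K hK] := honest_cyc hp hq u t.
  have [g [hg ge]] := hK K (bt (N + K)) (leqnn K) (btD N K).
  exists K, (sx b ^+ j * g); split.
  + by move=> i l; rewrite cf_sM -ltnNge => ->.
  + have hj : homogeneous (wx b *+ j) (sx b ^+ j) by apply: homogeneous_sx.
    by have := homogeneousM hj hg; rewrite -(al_bt (N + K)) addrC addrA subrK.
  + have E : dT N \c el (M := O (al N)) (al (N + K)) ((sx b ^+ 0 * sx t) ^+ K : S) =
        vB N K \c dT (N + K).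
      rewrite /vB /dT muE !el_comp //.
      * by congr (el _ _); rewrite [LHS]mulrC.
      * by rewrite al_bt; apply: homogeneous_sx.
      * by rewrite alD subKr; apply: homogeneous_sx.
    rewrite -compA E compA ge /dT el_comp; first by rewrite -cclZ.
      exact: ccl_homogeneous.
    by rewrite al_bt; apply: homogeneous_sx.
- move=> N u; have [K hK] := honest_cyc hp hq u t.
  have [g [hg ge]] := hK K (al (N + K)%N) (leqnn K) (alD N K).
  by exists K, g; rewrite muE.
- move=> N; rewrite mul0n addr0 mulrzDr -pmulrn addrA -yE /al !opprD !opprK.
  by rewrite !addrA (ACl (1*2*4*3)).
- exact: ns_uniq.
- move=> N n hN; rewrite nsP mul0n addr0.
  have key : 0 <= A + n * (pw b)%:Z -> A + n * (pw b)%:Z < j%:Z ->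
      ((if o is Some (_, j') then j' else 0)%:Z <= C + N%:Z - n * (pw t)%:Z)%R.
    move=> a0 aj; have nb : (`|n| <= `|A| + j)%N.
      apply: (@leq_trans (`|n| * pw b)); first by rewrite leq_pmulr // pw_gt0.
      have -> : (`|n| * pw b = `|(n * (pw b)%:Z)%R|)%N by rewrite abszM absz_nat.
      by lia.
    have := leq_mul nb (leqnn (pw t)); move: hN; rewrite /N0.
    have : n * (pw t)%:Z <= (`|n| * pw t)%N%:Z.
      by rewrite PoszM ler_wpM2r // lez_abs.
    by lia.
  apply/idP/idP => [/and3P[a0 aj ho]|/and4P[a0 _ aj ho]].
    have := key a0 aj; have aj' : ~~ (j <= `|(A + n * (pw b)%:Z)%R|)%N by lia.
    rewrite a0 aj' /=; case: (o) ho => [[c j']|] /=; last by move=> _ ->.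
    move=> /andP[/eqP -> h] h'; apply/andP; split; first by lia.
    by rewrite /upb /=; case: (b) a0 h => /=; lia.
  have {}aj : A + n * (pw b)%:Z < j%:Z by lia.
  rewrite a0 aj /=; have := key a0 aj; case: (o) ho => [[c j']|] //=.
  rewrite /upb /=; case: (c) => /=; case: (b) a0 => /=; lia.
Qed.
End TorsionTower.

(* The Koszul complexes 0 -> O(x - N x1 - N x2) -> O(x - N x1) + O(x - N x2) -> O(x) -> 0. *)
Section KoszulTower.
Variable x : L.
Let b0 N := x - wx false *+ N.
Let b1 N := x - wx true *+ N.
Let al N := x - wx false *+ N - wx true *+ N.
Let B N : coh := dsum (O (b0 N)) (O (b1 N)).

Let b0D N K : b0 (N + K) = b0 N - wx false *+ K. Proof. by rewrite /b0 mulrnDr opprD addrA. Qed.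
Let b1D N K : b1 (N + K) = b1 N - wx true *+ K. Proof. by rewrite /b1 mulrnDr opprD addrA. Qed.
Let b0_al N : b0 N - al N = wx true *+ N. Proof. by rewrite /al subKr. Qed.
Let b1_al N : b1 N - al N = wx false *+ N. Proof. by rewrite /al [x - _ - _]addrAC subKr. Qed.
Let alD N K : al (N + K) = al N - wx false *+ K - wx true *+ K.
Proof. by rewrite /al !mulrnDr !opprD !addrA (ACl (1*2*4*3*5)). Qed.

Let hsx (c : bool) w N : hpart (- (w - wx c *+ N)) (sx c ^+ N : (O w : grmod)) = sx c ^+ N.
Proof. by apply: line_bundle_hpart; rewrite subKr; apply: homogeneous_sx. Qed.

Let h0 N : hpart (- al N) (sx true ^+ N : (O (b0 N) : grmod)) = sx true ^+ N.
Proof. by apply: line_bundle_hpart; rewrite b0_al; apply: homogeneous_sx. Qed.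

Let h1 N : hpart (- al N) (sx false ^+ N : (O (b1 N) : grmod)) = sx false ^+ N.
Proof. by apply: line_bundle_hpart; rewrite b1_al; apply: homogeneous_sx. Qed.

Let hN (a : L) (M : grmod) (m : M) : hpart a m = m -> hpart a (- m) = - m.
Proof. by move=> h; rewrite -[- m]sub0r hpartB hpart0 h. Qed.

Let dv N : B N := (sx true ^+ N : S, - sx false ^+ N : S).

Let dvE N : hpart (- al N) (dv N) = dv N.
Proof. by congr (_, _); [exact: h0|apply: hN; apply: h1]. Qed.

Let dK N : hom (O (al N)) (B N) := el (al N) (dv N).

Let mul_gmap c w w' N (f : (O w : grmod) -> (O w' : grmod)) :
  (forall g, f g = sx c ^+ N * g) -> w' = w + wx c *+ N -> gmap f.
Proof.
move=> fE ->; split; first by move=> a m m'; rewrite !fE mulrDr mulrCA.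
move=> l m; rewrite !fE /= addrAC addrC.
by rewrite spartM //; apply: homogeneous_sx.
Qed.

Let pi_gmap N : @gmap _ _ _ (B N) (O x) (fun u => sx false ^+ N * (u.1 : S)
  + sx true ^+ N * (u.2 : S)).
Proof.
have g0 : @gmap _ _ _ (O (b0 N)) (O x) (fun f => sx false ^+ N * f).
  by apply: (@mul_gmap false _ _ N) => //; rewrite /b0 subrK.
have g1 : @gmap _ _ _ (O (b1 N)) (O x) (fun f => sx true ^+ N * f).
  by apply: (@mul_gmap true _ _ N) => //; rewrite /b1 subrK.
split=> [a u u'|l u]; last by rewrite hpartD -g0.2 -g1.2.
by rewrite (g0.1 a u.1 u'.1) (g1.1 a u.2 u'.2) scalerDr addrACA.
Qed.

Let piK N : hom (B N) (O x) := qclass (mapq hp hq (pi_gmap N)).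

Let v_gmap N K : @gmap _ _ _ (B (N + K)) (B N)
  (fun u => (sx false ^+ K * (u.1 : S), sx true ^+ K * (u.2 : S))).
Proof.
have g0 : @gmap _ _ _ (O (b0 (N + K))) (O (b0 N)) (fun f => sx false ^+ K * f).
  by apply: (@mul_gmap false _ _ K) => //; rewrite b0D subrK.
have g1 : @gmap _ _ _ (O (b1 (N + K))) (O (b1 N)) (fun f => sx true ^+ K * f).
  by apply: (@mul_gmap true _ _ K) => //; rewrite b1D subrK.
split=> [a u u'|l u]; last by congr (_, _); [exact: g0.2|exact: g1.2].
by congr (_, _); [exact: g0.1|exact: g1.1].
Qed.

Let vK N K : hom (B (N + K)) (B N) := qclass (mapq hp hq (v_gmap N K)).

Let i0_gmap N : @gmap _ _ _ (O (b0 N)) (B N) (fun m => (m, 0)). Proof. exact: inl_gmap. Qed.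
Let i1_gmap N : @gmap _ _ _ (O (b1 N)) (B N) (fun m => (0, m)). Proof. exact: inr_gmap. Qed.
Let p0_gmap N : @gmap _ _ _ (B N) (O (b0 N)) (fun u => u.1). Proof. by []. Qed.
Let p1_gmap N : @gmap _ _ _ (B N) (O (b1 N)) (fun u => u.2). Proof. by []. Qed.
Let i0 N : hom (O (b0 N)) (B N) := qclass (mapq hp hq (i0_gmap N)).
Let i1 N : hom (O (b1 N)) (B N) := qclass (mapq hp hq (i1_gmap N)).
Let p0 N : hom (B N) (O (b0 N)) := qclass (mapq hp hq (p0_gmap N)).
Let p1 N : hom (B N) (O (b1 N)) := qclass (mapq hp hq (p1_gmap N)).

(** The two powers form a regular sequence. Surjectivity holds only after multiplication by
    [sx c ^+ N], which suffices in the quotient category. *)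
Lemma koszul_resolution N : short_exact (dK N) (piK N).
Proof.
rewrite /dK /piK (elE hp hq (dvE N)); apply/(short_exactP hp hq); split.
- move=> f /esym e; suff -> : f = 0 :> S by apply: tors0.
  have /eqP : (f : S) * sx true ^+ N = 0 by exact: (congr1 (fun u : B N => u.1) e).
  by rewrite mulf_eq0 (negbTE (sx_neq0 _ _ _)) orbF => /eqP.
- move=> g; exists N => -[].
    by exists (0, g); rewrite /= mulr0 add0r.
  by exists (g, 0); rewrite /= mulr0 addr0.
- move=> f u g -> ->; suff -> : sx false ^+ N * ((f : S) * sx true ^+ N) +
      sx true ^+ N * ((f : S) * - sx false ^+ N) = 0 :> S by apply: tors0.
  by rewrite !mulrN mulrCA [sx true ^+ N * _]mulrCA [sx true ^+ N * _]mulrC subrr.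
- move=> [f g] /esym /= e; apply: ev_in.
  have {}e : sx false ^+ N * (f : S) = - (sx true ^+ N * (g : S)).
    by apply/eqP; rewrite -addr_eq0; apply/eqP.
  have [h fE] : exists h, (f : S) = sx true ^+ N * h.
    apply: cf_div => i l iN; have := congr1 (fun f => cf true f i (l + N)) e.
    by rewrite cfN (cf_tM true) cf_sM iN oppr0 ltnNge leq_addl addnK.
  exists h; congr (_, _); first by rewrite [RHS]mulrC.
  rewrite [_ *: _](_ : _ = h * - sx false ^+ N) //.
  apply: (mulfI (sx_neq0 k true N)); rewrite !mulrN.
  have -> : sx true ^+ N * (h * sx false ^+ N) = sx false ^+ N * (f : S) by rewrite fE; ring.
  by rewrite e opprK.
Qed.

Let dKE N : dK N = i0 N \c el (M := O (b0 N)) (al N) (sx true ^+ N : S) +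
  i1 N \c el (M := O (b1 N)) (al N) (- sx false ^+ N : S).
Proof.
rewrite /i0 /i1 !el_gmap //; last exact: hN.
rewrite -elD; [|by rewrite -(i0_gmap N).2 h0|by rewrite -(i1_gmap N).2 hN].
by congr (el _ _); congr (_, _); rewrite /= ?addr0 ?add0r.
Qed.

Let hmu N K : homogeneous (al N - al (N + K)%N) (sx false ^+ K * sx true ^+ K).
Proof.
have -> : al N - al (N + K) = wx false *+ K + wx true *+ K.
  by rewrite alD -[al N - _ - _]addrA -opprD subKr.
by apply: homogeneousM; apply: homogeneous_sx.
Qed.

Let vdK N K : vK N K \c dK (N + K) =
  dK N \c el (M := O (al N)) (al (N + K)) (sx false ^+ K * sx true ^+ K : S).
Proof.
rewrite /vK /dK el_gmap // el_comp //.
congr (el _ _); congr (_, _) => /=.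
  by rewrite exprD [RHS](_ : _ = sx false ^+ K * sx true ^+ K * sx true ^+ N) //; ring.
by rewrite exprD [RHS](_ : _ = sx false ^+ K * sx true ^+ K * - sx false ^+ N) //; ring.
Qed.

Let vi0 N K : vK N K \c i0 (N + K) = i0 N \c el (M := O (b0 N)) (b0 (N + K)) (sx false ^+ K :
  S).
Proof.
have hb : hpart (- b0 (N + K)) (sx false ^+ K : (O (b0 N) : grmod)) = sx false ^+ K.
  by rewrite b0D; apply: hsx.
rewrite (elE hp hq hb) /elt /vK /i0 !compE.
apply/(qclass_eq hp hq) => f _ _ [_ -> ->] [_ -> ->]; apply: tors_subr.
by congr (_, _); rewrite /= ?mulr0 // mulrC.
Qed.

Let vi1 N K : vK N K \c i1 (N + K) = i1 N \c el (M := O (b1 N)) (b1 (N + K)) (sx true ^+ K : S).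
Proof.
have hb : hpart (- b1 (N + K)) (sx true ^+ K : (O (b1 N) : grmod)) = sx true ^+ K.
  by rewrite b1D; apply: hsx.
rewrite (elE hp hq hb) /elt /vK /i1 !compE.
apply/(qclass_eq hp hq) => f _ _ [_ -> ->] [_ -> ->]; apply: tors_subr.
by congr (_, _); rewrite /= ?mulr0 // mulrC.
Qed.

Variables (o : option (bool * nat)) (y : L) (A C : int) (ns : seq int).
Local Notation Y := (cyc o y).
Hypothesis yE : y - x = wx false *~ A + wx true *~ C.
Hypothesis ns_uniq : uniq ns.
(** Both exponents contain the summand [N], so they become nonnegative, and avoiding the
    coboundaries means staying below [N]. For a torsion sheaf [Y] they also exceed its length
    eventually, so that nothing survives. *)
Hypothesis nsP : forall n, (n \in ns) =
  [&& A + n * p%:Z < 0, C - n * q%:Z < 0 & if o is Some _ then false else true].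

Lemma ext1_line_bundle (X' Y' : coh) : isomorphic (O x) X' -> isomorphic Y Y' ->
  ext1_dim X' Y' (size ns).
Proof.
have muE K : (sx false ^+ 1 * sx true) ^+ K = sx false ^+ K * sx true ^+ K.
  by rewrite expr1 exprMn.
(* The two strict inequalities bound [|n|] by [|A| + |C|]; this [N0] then makes both exponents
   nonnegative, and at least [j'] when [Y] is torsion. *)
pose N0 := (`|A| + `|C| + (`|A| + `|C|) * (p + q) + if o is Some (_, j') then j' else 0)%N.
apply: (@ext1_tower (O x) o y false 1 al B dK piK vK (fun N i l => (N <= i) || (N <= l))%N
  _ _ _ _ _ _ _ _ A C ns N0).
- by move=> N K; rewrite muE.
- exact: koszul_resolution.
- by move=> N K; rewrite muE vdK.
- move=> N K; rewrite /piK /vK compE; apply/(qclass_eq hp hq) => u _ _ [_ -> ->] ->.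
  by apply: (@tors_subr (O x : grmod)); rewrite /= !exprD !mulrA.
- move=> E f; have [R ->] := qclass_surj f => /(epiP hp hq) eR.
  have [N hN'] := eR (1 : S).
  have [e0 Re0] := hN' false; have [e1 Re1] := hN' true; exists N.
  have R0 : R (hpart (- b0 N) e0) (sx false ^+ N : S).
    by rewrite -(hsx false x N); apply: qrel_gr; rewrite -[X in R _ X](mulr1).
  have R1 : R (hpart (- b1 N) e1) (sx true ^+ N : S).
    by rewrite -(hsx true x N); apply: qrel_gr; rewrite -[X in R _ X](mulr1).
  exists (el (b0 N) (hpart (- b0 N) e0) \c p0 N + el (b1 N) (hpart (- b1 N) e1) \c p1 N).
  rewrite compDr1 !compA (el_rel hp hq R0) ?hpart_idem //; last exact: hsx.
  rewrite (el_rel hp hq R1) ?hpart_idem //; last exact: hsx.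
  rewrite (elE hp hq (hsx false x N)) (elE hp hq (hsx true x N)) /p0 /p1 !compE [LHS]qclassD.
  apply/(qclass_eq hp hq) => u _ _ [_ [_ [[_ -> ->] [_ -> ->] ->]]] ->.
  by apply: (@tors_subr (O x : grmod)); congr (_ + _); apply: mulrC.
- move=> N f Jf hf.
  (* [f] is split into its terms divisible by [sx true ^+ N] and the others, which are divisible by
     [sx false ^+ N]. *)
  have [g0 g0E] : exists g, csel false (fun i l => (N <= l)%N) f = sx true ^+ N * g.
    by apply: cf_div => i l iN; rewrite (cf_negb false) cf_csel leqNgt iN.
  have [g1 g1E] : exists g, csel false (fun i l => ~~ (N <= l)%N) f = sx false ^+ N * g.
    apply: cf_div => i l iN; rewrite cf_csel; case: ifP => // nl.
    by rewrite Jf // negb_or nl -ltnNge iN.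
  have hg0 : homogeneous (y - b0 N) g0.
    have := homogeneous_csel (b := false) (Q := fun i l => (N <= l)%N) hf.
    by rewrite g0E => /homogeneous_div; rewrite -b0_al opprB addrA subrK.
  have hg1 : homogeneous (y - b1 N) g1.
    have := homogeneous_csel (b := false) (Q := fun i l => ~~ (N <= l)%N) hf.
    by rewrite g1E => /homogeneous_div; rewrite -b1_al opprB addrA subrK.
  have fE : f = sx true ^+ N * g0 + sx false ^+ N * g1.
    rewrite -g0E -g1E; apply: (@cf_inj _ false) => i l; rewrite cfD !cf_csel.
    by case: leqP => _; rewrite ?addr0 ?add0r.
  have hc0 := ccl_homogeneous (mideal_graded k o y) hg0.
  have hc1 := ccl_homogeneous (mideal_graded k o y) hg1.
  have hw0 : homogeneous (b0 N - al N) (sx true ^+ N).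
    by rewrite b0_al; apply: homogeneous_sx.
  have hw1 : homogeneous (b1 N - al N) (sx false ^+ N).
    by rewrite b1_al; apply: homogeneous_sx.
  have hw1N : homogeneous (b1 N - al N) (- sx false ^+ N) by apply: homogeneousN.
  exists (el (b0 N) (ccl (mideal_graded k o y) g0) \c p0 N -
          el (b1 N) (ccl (mideal_graded k o y) g1) \c p1 N).
  rewrite compBl -!compA /dK /p0 /p1 !el_gmap // !el_comp //= scaleNr elN; last first.
    exact: (el_homogeneous hc1).
  rewrite opprK -!cclZ -elD -?cclD -?fE //; rewrite cclZ.
    exact: (el_homogeneous hc0).
  exact: (el_homogeneous hc1).
(* A map from [B N] is a pair of morphisms from line bundles; both are brought to the exponent
   [K]. *)
- move=> N t; have [K0 hK0] := honest_cyc hp hq (t \c i0 N) false.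
  have [K1 hK1] := honest_cyc hp hq (t \c i1 N) true; pose K := maxn K0 K1.
  have [g0 [hg0 e0]] := hK0 K (b0 (N + K)) (leq_maxl _ _) (b0D N K).
  have [g1 [hg1 e1]] := hK1 K (b1 (N + K)) (leq_maxr _ _) (b1D N K).
  have hc0 := ccl_homogeneous (mideal_graded k o y) hg0.
  have hc1 := ccl_homogeneous (mideal_graded k o y) hg1.
  have hw0 : homogeneous (b0 (N + K) - al (N + K)) (sx true ^+ (N + K)).
    by rewrite b0_al; apply: homogeneous_sx.
  have hw1 : homogeneous (b1 (N + K) - al (N + K)) (- sx false ^+ (N + K)).
    by rewrite b1_al; apply/homogeneousN/homogeneous_sx.
  exists K, (sx true ^+ (N + K) * g0 + - sx false ^+ (N + K) * g1); split.
  + move=> i l; rewrite negb_or -!ltnNge => /andP[iN lN].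
    by rewrite cfD mulNr cfN (cf_tM false) cf_sM iN lN oppr0 addr0.
  + apply: homogeneousD.
      by rewrite -[y - al _](subrKA (b0 (N + K))) addrC; apply: homogeneousM.
    by rewrite -[y - al _](subrKA (b1 (N + K))) addrC; apply: homogeneousM.
  + rewrite muE -compA -vdK dKE !compDr1 (compA (vK N K)) vi0 (compA (vK N K)) vi1.
    rewrite !compA e0 e1 !el_comp // -elD; last 2 first.
    * exact: (el_homogeneous hc0).
    * exact: (el_homogeneous hc1).
    by rewrite cclD !cclZ.
- move=> N f; have [K hK] := honest_cyc hp hq f false.
  have [g [hg ge]] := hK K (al N - wx false *+ K) (leqnn K) erefl.
  have hg' : homogeneous ((al N - wx false *+ K) - al (N + K)) (sx true ^+ K).
    by rewrite alD subKr; apply: homogeneous_sx.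
  have hc := ccl_homogeneous (mideal_graded k o y) hg.
  exists K, (sx true ^+ K * g); split.
    rewrite -[y - al _](subrKA (al N - wx false *+ K)) addrC; exact: homogeneousM.
  rewrite cclZ -(el_comp hp hq hc hg') -ge -compA el_comp ?hsx //.
  by rewrite muE; congr (_ \c el _ _); rewrite [RHS]mulrC.
- by move=> N; rewrite mul1n !mulrzDr -!pmulrn addrACA -yE /al !opprD !opprK !addrA.
- exact: ns_uniq.
- move=> N n N0N; rewrite nsP mul1n /=.
  have key : A + n * p%:Z < 0 -> C - n * q%:Z < 0 ->
      ((if o is Some (_, j') then j' else 0)%:Z <= A + N%:Z + n * p%:Z)%R /\
      ((if o is Some (_, j') then j' else 0)%:Z <= C + N%:Z - n * q%:Z)%R.
    move=> a0 c0; have nb : (`|n| <= `|A| + `|C|)%N.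
      have [n0|n0] := lerP 0 n.
        have : n <= n * p%:Z by rewrite ler_peMr // lez_nat.
        by lia.
      have : n * q%:Z <= n by rewrite ger_nMr // lez_nat.
      by lia.
    have := leq_mul nb (leqnn (p + q)); move: N0N; rewrite /N0 mulnDr.
    have : - (`|n| * p)%N%:Z <= n * p%:Z.
      by rewrite PoszM -mulNr ler_wpM2r //; lia.
    have : n * q%:Z <= (`|n| * q)%N%:Z.
      by rewrite PoszM ler_wpM2r // lez_abs.
    by case: (o) => [[_ j']|]; lia.
  apply/idP/idP => [/and3P[a0 c0 ho]|/and4P[a0 c0 nr nu]].
    have [k1 k2] := key a0 c0; case: (o) ho k1 k2 => // _ k1 k2.
    by rewrite k1 k2 /= andbT; lia.
  have ha : A + n * p%:Z < 0 by move: nr; lia.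
  have hc : C - n * q%:Z < 0 by move: nr; lia.
  have [k1 k2] := key ha hc; rewrite ha hc /=.
  by case: (o) nu k1 k2 => // -[c j']; rewrite /upb /=; case: (c); lia.
Qed.
End KoszulTower.
End Towers.

(** * Uniserial sheaves *)

Section Uniserial.
Variables (k : closedFieldType) (p q : nat).
Hypotheses (hp : (0 < p)%N) (hq : (0 < q)%N).
Local Notation S := {poly {poly k}}.
Local Notation L := (weight p q).
Local Notation wx := (wx p q).
Local Notation pw := (pw p q).
Local Notation sx := (sx k).
Local Notation grmod := (grmod k p q).
Local Notation coh := (coh k p q).
Local Notation ev := (@ev k _).
Local Notation tors := (@tors k _).
Local Notation O := (@line_bundle k p q).
Local Notation el := (el hp hq).
Local Notation cyc := (@cyc k p q).
Local Notation mkq := (mkq hp hq).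

(** [c] is the least exponent such that [K] contains [sx b ^+ c] times a power of the other
    variable. The part of lowest degree in [sx b] of a homogeneous element of [K] is a single term,
    and nilpotency of [sx b] modulo [K] isolates it, so its exponent is at least [c]. *)
Lemma graded_ideal_power b (a : L) (K : set S) (n : nat) :
  @graded_submod _ _ _ (O a : grmod) K -> K (sx b ^+ n) ->
  exists c m, [/\ (c <= n)%N, K (sx b ^+ c * sx (~~ b) ^+ m)
    & forall h, K h -> mideal (Some (b, c)) h].
Proof.
move=> gK Kn; have sK := graded_submodule gK.
have KM f g : K g -> K (f * g) by exact: (@submoduleZ _ (O a : grmod) K f g sK).
have exP : exists c, `[< exists m, K (sx b ^+ c * sx (~~ b) ^+ m) >].
  by exists n; apply/asboolP; exists 0%N; rewrite mulr1.
case: (ex_minnP exP) => c /asboolP[m Kc] cmin; exists c, m; split=> //.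
  by apply: cmin; apply/asboolP; exists 0%N; rewrite mulr1.
have key d h : homogeneous (d : L) h -> K h -> mideal (Some (b, c)) h.
  move=> hh Kh; apply/(mideal_cf b) => i l.
  have -> : upb b (Some (b, c)) i l = (c <= i)%N by rewrite /upb /=; case: (b).
  rewrite -ltnNge => ic; apply/eqP/negPn/negP => hil.
  have exQ : exists i, `[< exists l, cf b h i l != 0 >] by exists i; apply/asboolP; exists l.
  case: (ex_minnP exQ) => i0 /asboolP[l0 h0] i0min.
  have i0c : (i0 < c)%N.
    by apply: leq_ltn_trans ic; apply: i0min; apply/asboolP; exists l.
  have [h' hE] : exists h', h = sx b ^+ i0 * h'.
    apply: cf_div => i1 l1 i10; apply/eqP/negPn/negP => h1.
    have : (i0 <= i1)%N by apply: i0min; apply/asboolP; exists l1.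
    by rewrite leqNgt i10.
  have h'0 : cf b h' 0 l0 != 0 by move: h0; rewrite hE cf_sM ltnn subnn.
  pose u := sC (cf b h' 0 l0) * sx (~~ b) ^+ l0.
  (* Monomials of one weight that do not contain [sx b] coincide, so [h'] is the single term [u]
     modulo [sx b]. *)
  have [r rE] : exists r, h' - u = sx b ^+ 1 * r.
    apply: cf_div => i1 l1; rewrite ltnS leqn0 => /eqP ->.
    rewrite cfD cfN /u cfZ -[sx _ ^+ l0]mul1r -(expr0 (sx b)) cf_mon eqxx /=.
    case: (l1 =P l0) => [->|ne]; first by rewrite mulr1 subrr.
    rewrite mulr0 subr0; apply/eqP/negPn/negP => h1; apply: ne.
    have hh' : homogeneous (d - wx b *+ i0) h' by apply: homogeneous_div; rewrite -hE.
    have E1 := (homogeneousE b _ _).1 hh' _ _ h1.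
    have E0 := (homogeneousE b _ _).1 hh' _ _ h'0.
    by apply: (@wx_inj p q (~~ b)) => //; apply: (addrI (wx b *+ 0)); rewrite E1 E0.
  suff : (c <= i0)%N by rewrite leqNgt i0c.
  apply: cmin; apply/asboolP; exists (l0 * n)%N.
  (* [u ^+ n - (- (sx b * r)) ^+ n] is a multiple of [u + sx b * r = h'], and [(sx b * r) ^+ n] is a
     multiple of [sx b ^+ n]; together they put [sx b ^+ i0 * u ^+ n] in [K]. *)
  have K1 : K (sx b ^+ i0 * (u ^+ n - (- (sx b * r)) ^+ n)).
    rewrite subrXX opprK; have -> : u + sx b * r = h'.
      by rewrite -[sx b](expr1 (sx b)) -rE addrC subrK.
    by rewrite mulrA -hE mulrC; apply: KM.
  have K2 : K (sx b ^+ i0 * (- (sx b * r)) ^+ n).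
    by rewrite exprNn exprMn [sx b ^+ n * _]mulrC !mulrA; exact: KM.
  have := @submoduleD _ (O a : grmod) K _ _ sK K1 K2.
  rewrite [_ + _](_ : _ = sx b ^+ i0 * u ^+ n); last by rewrite -mulrDr subrK.
  have -> : sx b ^+ i0 * u ^+ n = sC (cf b h' 0 l0 ^+ n) * (sx b ^+ i0 * sx (~~ b) ^+ (l0 * n)).
    have sCX x e : sC x ^+ e = sC (x ^+ e) :> S.
      by elim: e => [|e IH]; rewrite ?expr0 ?sC1 // !exprS sCM IH.
    by rewrite /u exprMn sCX exprM mulrCA.
  move/(KM (sC (cf b h' 0 l0 ^- n))); rewrite mulrA -sCM mulVf ?sC1 ?mul1r //.
  by rewrite expf_neq0.
move=> h Kh; have [s _ ->] := spart_sum p q h.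
have sM := mideal_submodule k (Some (b, c)).
apply: (submodule_sum (M := S^o)) => // d _; apply: (key d); first exact: homogeneous_spart.
have := (let: And3 _ _ H := gK in H) (d - a) h Kh.
by rewrite /= addrC subrK.
Qed.

Section Image.
Variables (M : coh) (a : L) (g : M).
Hypothesis hg : hpart (- a) (g : M) = g.

Definition ann : set (O a : grmod) := fun f => (f : S) *: g = 0.

Lemma ann_graded : graded_submod ann.
Proof.
split; first exact: scale0r.
  by move=> c f f'; rewrite /ann scalerDl -scalerA => -> ->; rewrite scaler0 addr0.
by move=> l f; rewrite /ann /= -(hpart_elt _ _ hg) => ->; apply: hpart0.
Qed.

(** The subobject generated by [g], presented by the annihilator so that ideals can be used on
    it. *)
Definition img : coh := cyclic ann_graded.

Definition img_rel (e : img) (x : M) := exists f : S, e = ccl ann_graded f /\ x = f *: g.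

Lemma img_grel : grel img_rel.
Proof.
split; first by exists 0; rewrite scale0r; split=> //; apply/esym/ccl_eq0; apply: scale0r.
  move=> c _ _ _ _ [f [-> ->]] [f' [-> ->]]; exists (c * f + f').
  by rewrite cclD cclZ scalerDl scalerA.
move=> l _ _ [f [-> ->]]; exists (spart (a + l) f).
by rewrite ccl_hpart (hpart_elt _ _ hg).
Qed.

Definition imgq : qgraph img M.
Proof.
apply: (mkq img_grel) => [e|x [f [/esym /ccl_eq0 fg ->]]].
  by have [f ->] := ccl_surj e; apply: ev_in; exists (f *: g), f.
by rewrite [f *: g]fg; apply: tors0.
Defined.

Lemma img_mono : mono (qclass imgq : hom img M).
Proof.
apply/(monoP hp hq) => e [f [-> /esym fg]].
by rewrite (ccl_eq0 _ _).2 //; apply: tors0.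
Qed.

End Image.

Arguments img_mono {M a g} hg t g0 h _ : rename.

Lemma subob_ev (U V X : coh) (F : qgraph U X) (G : qgraph V X) :
  subob_le (qclass F : hom U X) (qclass G : hom V X) ->
  forall u x, F u x -> ev (fun x => exists v, G v x) x.
Proof.
move=> [h]; have [H ->] := qclass_surj h; rewrite compE => /(qclass_eq hp hq) e u x Fx.
have sG := graded_submodule (grel_range (grel_q G)).
have [N hN] := qrel_ev hp hq (qcomp G H) u.
apply: (ev_sx (N := N)) => // c; have [y [v Hv Gv]] := hN c.
have t : tors (sx c ^+ N *: x - y) by apply: (e (sx c ^+ N *: u)); [apply: qrelZ|exists v].
have [N' hN'] := t; exists N' => c'; exists (sx c' ^+ N' *: v).
have /eqP := hN' c'; rewrite scalerBr subr_eq0 => /eqP ->; exact: qrelZ.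
Qed.

(** The isomorphism relates elements of [U] and [V] with a common image in [X]. *)
Lemma mono_range_iso (U V X : coh) (F : qgraph U X) (G : qgraph V X) :
  mono (qclass F : hom U X) -> mono (qclass G : hom V X) ->
  (forall u x, F u x -> ev (fun x => exists v, G v x) x) ->
  (forall v x, G v x -> ev (fun x => exists u, F u x) x) ->
  isomorphic U V.
Proof.
move=> /(monoP hp hq) mF /(monoP hp hq) mG FG GF.
have gR : grel (fun u v => exists2 x, F u x & G v x).
  split; first by exists 0; apply: qrel0.
    by move=> c u u' v v' [x h1 h2] [x' h3 h4]; exists (c *: x + x'); apply: qrelP.
  by move=> l u v [x h1 h2]; exists (hpart l x); apply: qrel_gr.
have inv (A B : coh) (F' : qgraph A X) (G' : qgraph B X) :
    (forall b, G' b 0 -> tors b) -> forall b, (exists2 x, F' 0 x & G' b x) -> tors b.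
  move=> m b [x F0 Gb]; have [N hN] := qrel_tors hp hq F0.
  apply: (ev_sx (N := N)) => [|c]; first exact: submodule0.
  by apply: m; rewrite -(hN c); apply: qrelZ.
have dom (A B : coh) (F' : qgraph A X) (G' : qgraph B X) :
    (forall a x, F' a x -> ev (fun x => exists b, G' b x) x) ->
    forall a, ev (fun a => exists b, exists2 x, F' a x & G' b x) a.
  move=> h a; have [N hN] := qrel_ev hp hq F' a.
  have gR' : grel (fun a b => exists2 x, F' a x & G' b x).
    split; first by exists 0; apply: qrel0.
      by move=> c u u' v v' [x h1 h2] [x' h3 h4]; exists (c *: x + x'); apply: qrelP.
    by move=> l u v [x h1 h2]; exists (hpart l x); apply: qrel_gr.
  apply: (ev_sx (N := N)) => [|c]; first exact: (graded_submodule (grel_dom gR')).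
  have [x Fx] := hN c; have [N' hN'] := h _ _ Fx.
  by exists N' => c'; have [b Gb] := hN' c'; exists b, (sx c' ^+ N' *: x) => //; apply: qrelZ.
exists (qclass (mkq gR (dom _ _ F G FG) (inv _ _ F G mG))); apply: coh_balanced => //.
  by apply/(monoP hp hq) => u [x Fu G0]; apply: (inv _ _ G F mF); exists x.
apply/(epiP hp hq) => v; apply: ev_sub (dom _ _ G F GF v) => {}v [u [x G0 F0]].
by exists u, x.
Qed.

Lemma isomorphic_zero (X Y : coh) : isomorphic X Y -> zero_ob Y -> zero_ob X.
Proof.
rewrite /zero_ob => -[f [g [gf fg]]] Y0.
by rewrite -gf -[f]comp1m Y0 comp0l comp0r.
Qed.

Lemma cyc_zero b n w : zero_ob (cyc (Some (b, n)) w) -> n = 0%N.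
Proof.
move/(zero_obP hp hq) => /(_ (ccl (mideal_graded k (Some (b,
  n)) w) 1)) /tors_cyc /(mideal_cf b).
move=> /(_ 0%N 0%N); rewrite cf1 /upb /=; case: n => // n.
have -> : (if b then if b then 0%N else 0%N else if b then 0%N else 0%N) = 0%N by case: b.
by move=> /(_ isT) /eqP; rewrite oner_eq0.
Qed.

(** Multiplication by [sx (~~ b) ^+ m] is injective modulo [sx b ^+ n], and its cokernel is killed
    by a power of each variable. *)
Lemma cyc_shift b n w m : isomorphic (cyc (Some (b, n)) (w - wx (~~ b) *+ m)) (cyc (Some (b,
  n)) w).
Proof.
set w' := w - _; pose gm := @mideal_graded k p q (Some (b, n)).
have gR : grel (fun (e : cyc (Some (b, n)) w') (e' : cyc (Some (b, n)) w) =>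
    exists f : S, e = ccl (gm w') f /\ e' = ccl (gm w) (sx (~~ b) ^+ m * f)).
  split.
  - by exists 0; rewrite mulr0; split; apply/esym/ccl_eq0; case: (mideal_submodule k (Some (b,
      n))).
  - move=> c _ _ _ _ [f [-> ->]] [f' [-> ->]]; exists (c * f + f').
    split; first by rewrite cclD cclZ.
    by rewrite mulrDr cclD [sx _ ^+ m * (c * _)]mulrCA [ccl _ (c * _)]cclZ.
  - move=> l _ _ [f [-> ->]]; exists (spart (w' + l) f); rewrite !ccl_hpart; split=> //.
    have ht : homogeneous (wx (~~ b) *+ m) (sx (~~ b) ^+ m) by apply: homogeneous_sx.
    by rewrite -(spartM _ _ ht) /w' addrA [_ *+ m + _]addrC subrK.
have dR (e : cyc (Some (b, n)) w') : ev (fun e => exists e' : cyc (Some (b, n)) w,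
    exists f : S, e = ccl (gm w') f /\ e' = ccl (gm w) (sx (~~ b) ^+ m * f)) e.
  by have [f ->] := ccl_surj e; apply: ev_in; exists (ccl (gm w) (sx (~~ b) ^+ m * f)), f.
have iR (e' : cyc (Some (b, n)) w) : (exists f : S, (0 : cyc (Some (b,
  n)) w') = ccl (gm w') f /\
    e' = ccl (gm w) (sx (~~ b) ^+ m * f)) -> tors e'.
  move=> [f [/esym /ccl_eq0 hf ->]]; rewrite cclZ (ccl_eq0 _ _).2 // scaler0; exact: tors0.
exists (qclass (mkq gR dR iR)); apply: coh_balanced => //.
  apply/(monoP hp hq) => _ [f [-> /esym /ccl_eq0 hf]]; apply/tors_cyc.
  apply/(mideal_cf b) => i l; have := (mideal_cf b _ _).1 hf i (l + m)%N.
  rewrite cf_tM ltnNge leq_addl addnK /= /upb /=; by case: (b).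
apply/(epiP hp hq) => e; have [f ->] := ccl_surj e; exists (maxn n m) => c.
have [->|cb] := eqVneq c b.
  exists 0, 0; split; first by apply/esym/ccl_eq0; case: (mideal_submodule k (Some (b, n))).
  rewrite mulr0 -cclZ; apply/ccl_eq; rewrite subr0; apply/midealS.
  by exists (sx b ^+ (maxn n m - n) * f); rewrite mulrA -exprD subnKC // leq_maxl.
have -> : c = ~~ b by case: (c) (b) cb => -[].
exists (ccl (gm w') (sx (~~ b) ^+ (maxn n m - m) * f)), (sx (~~ b) ^+ (maxn n m - m) * f).
by rewrite -cclZ mulrA -exprD subnKC // leq_maxr.
Qed.

(** Induction on the composition series. The subobject [X'] with simple quotient [t] corresponds to
    an ideal [K] containing [sx b ^+ n]. Simplicity forces the exponent [c] of [graded_ideal_power]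
    to be [1], so [X'] is the submodule generated by [sx b], again cyclic, with [n - 1] in place of
    [n]. *)
Lemma cyc_length b j (X : coh) : has_length X j ->
  forall n w, isomorphic (cyc (Some (b, n)) w) X -> n = j.
Proof.
elim=> {j X} [X X0 n w iX|X' X t f g j fg st _ IH n w [phi iphi]].
  exact: cyc_zero (isomorphic_zero iX X0).
have [phi' [phi'phi phiphi']] := iphi.
have iphi' : iso_arrow phi' by exists phi.
have fg' : short_exact (phi' \c f) (g \c phi).
  have -> : phi' \c f = phi' \c f \c idm X' by rewrite compm1.
  split; split.
  - by rewrite compm1 !compA -(compA g) phiphi' compm1 fg.1.1.
  - move=> z h; rewrite -compA => /fg.1.2[u [uE uU]]; exists u; split.
      by rewrite compm1 -compA uE compA phi'phi comp1m.
    move=> u' e; apply: uU; rewrite -e compm1 compA compA phiphi' comp1m //.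
  - by rewrite compm1 !compA -(compA g) phiphi' compm1 fg.1.1.
  - move=> z h; rewrite compm1 compA => /fg.2.2[u [uE uU]]; exists u; split.
      by rewrite compA uE -compA phi'phi compm1.
    by move=> u' e; apply: uU; rewrite -e -!compA phiphi' compm1.
have [F FE] := qclass_surj (phi' \c f : qhom X' (cyc (Some (b, n)) w)).
have [G GE] := qclass_surj (g \c phi : qhom (cyc (Some (b, n)) w) t).
move: fg'; rewrite FE GE => fg'; have [mF eG FG exFG] := (short_exactP hp hq F G).1 fg'.
pose cl h := ccl (mideal_graded k (Some (b, n)) w) h.
pose K : set S := fun h => ev (fun x => exists u, F u x) (cl h).
have sF := graded_submodule (grel_range (grel_q F)).
have gK : @graded_submod _ _ _ (O w : grmod) K.
  split.
  - by apply: ev_in; exists 0; rewrite /cl (ccl_eq0 _ _).2;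
      [apply: qrel0|case: (mideal_submodule k (Some (b, n)))].
  - move=> c h h' Kh Kh'; rewrite /K /cl cclD [ccl _ (c *: h)]cclZ.
    by case: (ev_submodule sF) => _; apply.
  - move=> l h Kh; rewrite /K /cl -[ccl _ _](ccl_hpart (mideal_graded k (Some (b, n)) w)).
    have gE := ev_graded (grel_range (grel_q F)).
    by case: gE => _ _; apply.
have KG h x : K h -> G (cl h) x -> tors x.
  move=> [N hN] Gx; apply: (ev_sx (N := N)) => [|c]; first exact: submodule0.
  by have [u Fu] := hN c; apply: (FG u); [exact: Fu|apply: qrelZ].
have GK h x : G (cl h) x -> tors x -> K h.
  move=> Gx [N hN]; apply: (ev_sx (N := N)) => // c; apply: exFG.
  by rewrite -(hN c); apply: qrelZ.
have Kn : K (sx b ^+ n).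
  rewrite /K /cl (ccl_eq0 _ _).2; first by apply: ev_in; exists 0; apply: qrel0.
  by apply/midealS; exists 1; rewrite mulr1.
have [c [m [cn Kc Kmid]]] := graded_ideal_power gK Kn.
have sK := graded_submodule gK.
have KM (a h : S) : K h -> K (a * h) by exact: (@submoduleZ _ (O w : grmod) K a h sK).
have KM' (h a : S) : K h -> K (h * a) by rewrite mulrC; apply: KM.
(* [c = 0] would make [t] zero. If [c >= 2], the image in [t] of [sx b * sx (~~ b) ^+ N] generates a
   subobject that is neither zero nor all of [t]. *)
have c1 : c = 1%N.
  have [c0|c0] := posnP c.
    case: st => + _; case; apply/(zero_obP hp hq) => x.
    have [N hN] := eG x; apply: (ev_sx (N := N)) => [|e]; first exact: submodule0.
    have [y Gy] := hN e; have [h hE] := ccl_surj y; apply: (KG h); last by rewrite /cl -hE.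
    have Kt : K (sx (~~ b) ^+ m) by move: Kc; rewrite c0 mul1r.
    rewrite /K; apply: (ev_sx (N := maxn n m)) => // e'.
    rewrite /cl -cclZ mulrC; apply: (KM); have [->|eb] := eqVneq e' b.
      by rewrite -(subnK (leq_maxl n m)) exprD; apply: (KM).
    have -> : e' = ~~ b by case: (e') (b) eb => -[].
    by rewrite -(subnK (leq_maxr n m)) exprD; apply: (KM).
  apply/eqP; rewrite eqn_leq c0 andbT leqNgt; apply/negP => c2.
  have [N hN] := qrel_ev hp hq G (cl 1); have [y Gy] := hN (~~ b).
  have Gs : G (cl (sx b * sx (~~ b) ^+ N)) (sx b *: y).
    rewrite /cl cclZ -[sx (~~ b) ^+ N]mulr1 cclZ; exact: qrelZ.
  pose a := w - (wx b *+ 1 + wx (~~ b) *+ N).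
  have hs : homogeneous (w - a) (sx b * sx (~~ b) ^+ N).
    by rewrite /a subKr -{1}(expr1 (sx b)); apply: homogeneous_mon.
  have Gs' : G (cl (sx b * sx (~~ b) ^+ N)) (hpart (- a) (sx b *: y)).
    rewrite /cl -(ccl_homogeneous (mideal_graded k (Some (b, n)) w) hs); exact: qrel_gr.
  set y' := hpart _ _ in Gs'.
  have hy' : hpart (- a) y' = y' by apply: hpart_idem.
  case: st => _ /(_ _ _ (img_mono hy'))[z0|[v iv]].
    have t0 : tors y'.
      have [N' hN'] := (zero_obP hp hq _).1 z0 (ccl (ann_graded hy') 1).
      exists N' => e; have := hN' e; rewrite -cclZ mulr1 => /ccl_eq0; exact.
    have := (mideal_cf b _ _).1 (Kmid _ (GK _ _ Gs' t0)) 1%N N.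
    rewrite -{1}(expr1 (sx b)) cf_mon !eqxx /upb /=.
    have -> : (if b then if b then 1 else N else if b then N else 1)%N = 1%N by case: (b).
    by rewrite -ltnNge => /(_ c2) /eqP; rewrite oner_eq0.
  have /(epiP hp hq)/(_ y)[N' hN'] : epi (qclass (imgq hy') : hom (img hy') t).
    by apply: iso_epi; exists v.
  have [_ [h [_ hE]]] := hN' (~~ b).
  have G1 : G (cl (sx (~~ b) ^+ N' * sx (~~ b) ^+ N - h * (sx b * sx (~~ b) ^+ N))) 0.
    have e1 : G (sx (~~ b) ^+ N' *: cl (sx (~~ b) ^+ N)) (sx (~~ b) ^+ N' *: y).
      by apply: qrelZ; rewrite /cl ccl1.
    have := grelB (grel_q G) e1 (qrelZ h Gs'); rewrite hE subrr /cl.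
    by rewrite cclD -mulNr [ccl _ (sx _ ^+ N' * _)]cclZ [ccl _ (- h * _)]cclZ scaleNr.
  have := (mideal_cf b _ _).1 (Kmid _ (GK _ _ G1 (tors0 _))) 0%N (N' + N)%N.
  rewrite cfD cfN mulrCA -(expr1 (sx b)) cf_sM subr0 -exprD -[sx (~~ b) ^+ _]mul1r.
  rewrite -(expr0 (sx b)) cf_mon !eqxx /upb /=.
  have -> : (if b then if b then 0 else (N' + N) else if b then (N' + N) else 0)%N =
    0%N by case: (b).
  by rewrite -ltnNge => /(_ c0) /eqP; rewrite oner_eq0.
have n0 : (0 < n)%N by rewrite -c1.
pose w' := w - wx b *+ 1.
pose cl' h := ccl (mideal_graded k (Some (b, n.-1)) w') h.
have mm (h : S) : mideal (Some (b, n)) (sx b * h) <-> mideal (Some (b, n.-1)) h.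
  split=> /midealS[h' hE]; apply/midealS; exists h'; last by rewrite hE mulrA -exprS prednK.
  apply: (mulfI (sx_neq0 k b 1)); rewrite expr1 hE mulrA -exprS prednK //.
have gR : grel (fun (e : cyc (Some (b, n.-1)) w') (e' : cyc (Some (b, n)) w) =>
    exists h : S, e = cl' h /\ e' = cl (sx b * h)).
  split.
  - by exists 0; rewrite mulr0; split; apply/esym/ccl_eq0; [case: (mideal_submodule k (Some (b,
      n.-1)))|case: (mideal_submodule k (Some (b, n)))].
  - move=> a _ _ _ _ [h [-> ->]] [h' [-> ->]]; exists (a * h + h'); split.
      by rewrite /cl' cclD cclZ.
    by rewrite /cl mulrDr cclD [sx b * (a * _)]mulrCA [ccl _ (a * _)]cclZ.
  - move=> l _ _ [h [-> ->]]; exists (spart (w' + l) h); rewrite /cl /cl' !ccl_hpart;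
      split=> //.
    have hs : homogeneous (wx b *+ 1) (sx b) by rewrite -[sx b]expr1; apply: homogeneous_sx.
    by rewrite -(spartM _ _ hs) /w' addrA [wx b *+ 1 + (w - _)]addrC subrK.
have dR (e : cyc (Some (b, n.-1)) w') : ev (fun e => exists e' : cyc (Some (b, n)) w,
    exists h : S, e = cl' h /\ e' = cl (sx b * h)) e.
  by have [h ->] := ccl_surj e; apply: ev_in; exists (cl (sx b * h)), h.
have iR (e' : cyc (Some (b, n)) w) : (exists h : S, (0 : cyc (Some (b, n.-1)) w') = cl' h /\
    e' = cl (sx b * h)) -> tors e'.
  by move=> [h [/esym /ccl_eq0 /mm hh ->]]; rewrite /cl (ccl_eq0 _ _).2 //; apply: tors0.
(* Multiplication by [sx b] embeds the cyclic module with exponent [n - 1], with the same range as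
   [X']. *)
have iX' : isomorphic (cyc (Some (b, n.-1)) w') X'.
  apply: (@mono_range_iso _ _ _ (mkq gR dR iR) F).
  - apply/(monoP hp hq) => _ [h [-> /esym /ccl_eq0 /mm hh]].
    by rewrite /cl' (ccl_eq0 _ _).2 //; apply: tors0.
  - exact/(monoP hp hq).
  - move=> u x [h [_ ->]]; apply: (ev_sx (N := maxn n m)) => // e.
    rewrite /cl -cclZ; change (K (sx e ^+ maxn n m * (sx b * h))).
    rewrite mulrCA mulrC; have [->|eb] := eqVneq e b.
      by rewrite -(subnK (leq_maxl n m)) exprD; do 2!apply: (KM'); apply: (KM).
    have -> : e = ~~ b by case: (e) (b) eb => -[].
    rewrite -(subnK (leq_maxr n m)) exprD mulrAC; apply: (KM'); rewrite -mulrA; apply: (KM).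
    by rewrite mulrC; move: Kc; rewrite c1 expr1.
  - move=> u x Fu; have [h hE] := ccl_surj x.
    have /midealS[h' h'E] : mideal (Some (b, 1%N)) h.
      by rewrite -c1; apply: Kmid; apply: ev_in; exists u; rewrite /cl -hE.
    by apply: ev_in; exists (cl' h'), h'; rewrite hE h'E expr1.
by rewrite -(IH _ _ iX') prednK.
Qed.

Lemma cyc_simple_cokernel b (w w' : L) (G : qgraph (O w') (O w)) :
  (forall m n, G m n <-> (n : S) = sx b * (m : S)) ->
  is_cokernel (qclass G : hom (O w') (O w))
    (qclass (mapq hp hq (ccl_gmap (mideal_graded k (Some (b, 1%N)) w)))
      : hom (O w) (cyc (Some (b, 1%N)) w)).
Proof.
move=> GE; suff [] : short_exact (qclass G : hom (O w') (O w))
  (qclass (mapq hp hq (ccl_gmap (mideal_graded k (Some (b, 1%N)) w)))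
      : hom (O w) (cyc (Some (b, 1%N)) w)) by [].
apply/(short_exactP hp hq); split.
- move=> m /GE/esym/eqP; rewrite mulf_eq0 -(expr1 (sx b)) (negbTE (sx_neq0 _ _ _)) /=.
  by move=> /eqP ->; apply: tors0.
- by move=> x; have [f ->] := ccl_surj x; apply: ev_in; exists f.
- by move=> m n _ /GE -> ->; apply/tors_cyc/midealS; exists m; rewrite expr1.
- move=> n /esym/ccl_eq0/midealS[g gE]; apply: ev_in; exists g; apply/GE.
  by rewrite gE expr1.
Qed.

(** A homogeneous lift [g] of a generator of the top generates [X]: the subobject it generates is
    comparable with the radical and not contained in it. It remains to show that the annihilator of
    [g] is the ideal of a power of [sx b] up to torsion; [cyc_length] identifies the exponent. *)
Lemma uniserial_cyc b j (w w' : L) (X T : coh) (G : qgraph (O w') (O w)) :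
  (forall m n, G m n <-> (n : S) = sx b * (m : S)) ->
  coker_object (qclass G : hom (O w') (O w)) T -> uniserial_of T j X ->
  isomorphic (cyc (Some (b, j)) w) X.
Proof.
move=> GE [cT cokT] [uX lX [r [i [c [_ ic]]]]].
have [u [iu _]] := cokernel_unique cokT (cyc_simple_cokernel GE).
set T0 := cyc (Some (b, 1%N)) w in u iu.
pose cl f : T0 := ccl (mideal_graded k (Some (b, 1%N)) w) f.
have [C CE] := qclass_surj (u \c c : qhom X T0).
have epiC : epi (qclass C : hom X T0).
  by rewrite -CE; apply: epi_comp (cokernel_epi ic.2); apply: iso_epi.
have t0 f : tors (cl f) -> forall l, cf b f 0 l = 0.
  by move=> /tors_cyc /(mideal_cf b) h l; apply: h; rewrite /upb /=; case: (b).
pose t := ~~ b.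
(* The generator of the top lifts to an element of [X] only after multiplication by a power of
   [sx t]. *)
have [M [x0 Cx0]] : exists M x0, C x0 (sx t ^+ M *: cl 1).
  by have [M hM] := (epiP hp hq C).1 epiC (cl 1); have [x0 h] := hM t; exists M, x0.
pose a := w - wx t *+ M; pose g := hpart (- a) x0.
have hg : hpart (- a) g = g by apply: hpart_idem.
have Cg : C g (cl (sx t ^+ M)).
  have hs : homogeneous (w - a) (sx t ^+ M) by rewrite /a subKr; apply: homogeneous_sx.
  rewrite /cl -(ccl_homogeneous (mideal_graded k (Some (b, 1%N)) w) hs).
  by apply: qrel_gr; rewrite ccl1.
have Cfg f : C (f *: g) (cl (f * sx t ^+ M)) by rewrite /cl cclZ; apply: qrelZ.
(* An annihilator of [g] also kills its image in the top, so all its terms contain [sx b]. *)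
have Kann f : f *: g = 0 -> forall l, cf b f 0 l = 0.
  move=> fg l; have := Cfg f; rewrite fg => /(qrel_tors hp hq) /t0 /(_ (l + M)%N).
  by rewrite mulrC cf_tM ltnNge leq_addl addnK.
have mU := img_mono hg; set U := (qclass (imgq hg) : hom (img hg) X) in mU.
have cuE : epi ((u \c c) \c U).
  rewrite CE compE; apply/(epiP hp hq) => x; have [f ->] := ccl_surj x.
  exists (maxn 1 M) => e; have [->|eb] := eqVneq e b.
    exists 0, 0; first by exists 0; rewrite scale0r; split=> //; apply/esym/ccl_eq0;
      apply: scale0r.
    rewrite -cclZ (ccl_eq0 _ _).2; first exact: qrel0.
    apply/midealS; exists (sx b ^+ (maxn 1 M - 1) * f).
    by rewrite mulrA -exprD subnKC // leq_maxl.
  have -> : e = t by rewrite /t; case: (e) (b) eb => -[].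
  exists (ccl (ann_graded hg) (sx t ^+ (maxn 1 M - M) * f)),
    ((sx t ^+ (maxn 1 M - M) * f) *: g).
    by exists (sx t ^+ (maxn 1 M - M) * f).
  rewrite -cclZ; have -> : sx t ^+ maxn 1 M * f = sx t ^+ (maxn 1 M - M) * f * sx t ^+ M.
    by rewrite mulrAC -exprD subnK // leq_maxr.
  exact: Cfg.
have T0n0 : ~ zero_ob T0 by move/cyc_zero.
have iU : iso_arrow U.
  apply: coh_balanced => //.
  case: (uX _ _ _ _ mU (kernel_mono ic.1)) => [[h hE]|[h hE]].
    case: T0n0; rewrite /zero_ob; apply: cuE.
    by rewrite hE comp0l comp1m -compA (compA c) ic.1.1 comp0l comp0r.
  apply: epi0 => z v vU; have [|v' [vE _]] := ic.2.2 _ v.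
    by rewrite hE compA vU comp0l.
  have [u' [u'u _]] := iu.
  suff v'0 : v' \c u' = 0 by rewrite -vE -[v']compm1 -u'u compA v'0 !comp0l.
  apply: cuE; rewrite comp0l -!compA (compA u') u'u comp1m compA vE; exact: vU.
pose K : set S := fun f => f *: g = 0.
have gK : @graded_submod _ _ _ (O a : grmod) K := ann_graded hg.
have KM (f h : S) : K h -> K (f * h) by move=> hK; rewrite /K -scalerA hK scaler0.
have hgf (f : S) d : homogeneous d f -> hpart (- (a - d)) (f *: g) = f *: g.
  by move=> hf; apply: (el_homogeneous hg); rewrite subKr.
have hsx e : hpart (- (a - wx e *+ 1)) (sx e *: g) = sx e *: g.
  have h : homogeneous (wx e *+ 1) (sx e ^+ 1) by apply: homogeneous_sx.
  by apply: hgf; rewrite expr1 in h.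
(* If [g] had zero annihilator, the subobjects generated by its multiples by the two variables would
   not be comparable. *)
have Kn0 : exists F d, [/\ F != 0, homogeneous (d : L) F & K F].
  apply: contrapT => nK.
  have K0 f : K f -> f = 0.
    move=> Kf; have [s _ ->] := spart_sum p q f.
    apply: big1 => d _; apply/eqP/negPn/negP => fd; apply: nK; exists (spart d f), d.
    split=> //; first exact: homogeneous_spart.
    have := (let: And3 _ _ H := gK in H) (d - a) f Kf.
    by rewrite /= addrC subrK.
  have bad e : ~ subob_le (qclass (imgq (hsx e)) : hom _ X) (qclass (imgq (hsx (~~ e))) :
    hom _ X).
    move=> /subob_ev /(_ (ccl (ann_graded (hsx e)) 1) (sx e *: g)) []; first by exists 1;
      rewrite scale1r.
    move=> N /(_ e)[_ [f [_ fE]]].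
    have /K0/(congr1 (fun h => cf e h (N + 1)%N 0%N)) : K (sx e ^+ N * sx e - f * sx (~~ e)).
      by rewrite /K scalerBl -!scalerA fE subrr.
    rewrite cf0 cfD cfN [f * _]mulrC -[sx (~~ e)]expr1 cf_tM /= subr0 -exprSr addn1.
    by rewrite -[sx e ^+ _]mulr1 -(expr0 (sx (~~ e))) cf_mon !eqxx => /eqP; rewrite oner_eq0.
  case: (uX _ _ _ _ (img_mono (hsx false)) (img_mono (hsx true))) => [|h].
    exact: (bad false).
  exact: (bad true).
have [F [d [F0 hF KF]]] := Kn0.
(* Write [F = sx b ^+ e * f'] with [f'] not divisible by [sx b], and compare the subobjects
   generated by [sx b ^+ e *: g] and [f' *: g]. If the first lies in the second, a further factor
   [sx b ^+ e] produces a power of [sx b] in [K]; the other inclusion contradicts [Kann]. *)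
have [n Kn] : exists n, K (sx b ^+ n).
  have exQ : exists i, `[< exists l, cf b F i l != 0 >].
    apply: contrapT => nQ; move/eqP: F0; apply; apply: (@cf_inj _ b) => i0 l0; rewrite cf0.
    by apply/eqP/negPn/negP => h; apply: nQ; exists i0; apply/asboolP; exists l0.
  case: (ex_minnP exQ) => e /asboolP[l0 h0] emin.
  have [f' FE] : exists f', F = sx b ^+ e * f'.
    apply: cf_div => i1 l1 i10; apply/eqP/negPn/negP => h1.
    have : (e <= i1)%N by apply: emin; apply/asboolP; exists l1.
    by rewrite leqNgt i10.
  have f'0 : cf b f' 0 l0 != 0 by move: h0; rewrite FE cf_sM ltnn subnn.
  have e0 : (0 < e)%N.
    rewrite lt0n; apply: contraNneq f'0 => e0.
    by have := Kann F KF l0; rewrite FE e0 mul1r => ->.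
  have hf' : homogeneous (d - wx b *+ e) f' by apply: homogeneous_div; rewrite -FE.
  have hs' : homogeneous (wx b *+ e) (sx b ^+ e) by apply: homogeneous_sx.
  have hs := hgf _ _ hs'; have hf := hgf _ _ hf'.
  case: (uX _ _ _ _ (img_mono (hs)) (img_mono (hf))).
    move=> /subob_ev /(_ (ccl (ann_graded hs) 1) (sx b ^+ e *: g)) []; first by exists 1;
      rewrite scale1r.
    move=> N /(_ b)[_ [h [_ hE]]]; exists (e + (N + e))%N.
    rewrite /K exprD -scalerA [sx b ^+ (N + e)]exprD -[(_ * _) *: g]scalerA hE !scalerA.
    by rewrite mulrAC -FE mulrC; exact: (KM h F KF).
  move=> /subob_ev /(_ (ccl (ann_graded hf) 1) (f' *: g)) []; first by exists 1;
    rewrite scale1r.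
  move=> N /(_ t)[_ [h [_ hE]]].
  have /Kann/(_ (l0 + N)%N) : K (sx t ^+ N * f' - sx b ^+ e * h).
    by rewrite /K scalerBl -scalerA hE scalerA mulrC subrr.
  rewrite cfD cfN cf_sM e0 subr0 cf_tM ltnNge leq_addl addnK => h1.
  by rewrite /= in h1; rewrite h1 eqxx in f'0.
have [e [m [en Ke Kmid]]] := graded_ideal_power gK Kn.
have gR : grel (fun (x : img hg) (y : cyc (Some (b, e)) a) =>
    exists f : S, x = ccl (ann_graded hg) f /\ y = ccl (mideal_graded k (Some (b, e)) a) f).
  split.
  - by exists 0; split; apply/esym/ccl_eq0; [apply: scale0r|case: (mideal_submodule k (Some (b,
      e)))].
  - by move=> h _ _ _ _ [f [-> ->]] [f' [-> ->]]; exists (h * f + f'); rewrite !cclD !cclZ.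
  - by move=> l _ _ [f [-> ->]]; exists (spart (a + l) f); rewrite !ccl_hpart.
have dR (x : img hg) : ev (fun x => exists y : cyc (Some (b, e)) a, exists f : S,
    x = ccl (ann_graded hg) f /\ y = ccl (mideal_graded k (Some (b, e)) a) f) x.
  have [f ->] := ccl_surj x; apply: ev_in.
  by exists (ccl (mideal_graded k (Some (b, e)) a) f), f.
have iR (y : cyc (Some (b, e)) a) : (exists f : S,
    (0 : img hg) = ccl (ann_graded hg) f /\ y = ccl (mideal_graded k (Some (b,
      e)) a) f) -> tors y.
  by move=> [f [/esym/ccl_eq0/Kmid hf ->]]; rewrite (ccl_eq0 _ _).2 //; apply: tors0.
have iso1 : isomorphic (img hg) (cyc (Some (b, e)) a).
  exists (qclass (mkq gR dR iR)); apply: coh_balanced => //.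
    apply/(monoP hp hq) => _ [f [-> /esym/ccl_eq0/midealS[h hE]]].
    exists (maxn n m) => e'; rewrite -cclZ; apply/ccl_eq0.
    have KM' (x y : S) : K x -> K (x * y) by rewrite mulrC; apply: KM.
    change (K (sx e' ^+ maxn n m * f)); have [->|eb] := eqVneq e' b.
      by rewrite -(subnK (leq_maxl n m)) exprD; apply: (KM'); apply: (KM).
    have -> : e' = ~~ b by case: (e') (b) eb => -[].
    rewrite -(subnK (leq_maxr n m)) exprD hE mulrA; apply: (KM'); rewrite -mulrA; apply: (KM).
    by rewrite mulrC.
  apply/(epiP hp hq) => y; have [f ->] := ccl_surj y.
  by apply: ev_in; exists (ccl (ann_graded hg) f), f.
have iso2 : isomorphic (cyc (Some (b, e)) w) X.
  apply: isomorphic_trans (isomorphic_sym (cyc_shift b e w M)) _.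
  by apply: isomorphic_trans (isomorphic_sym iso1) _; exists U.
by rewrite -(cyc_length lX iso2).
Qed.

End Uniserial.

(** * Dimensions of extension spaces *)

(* [Chord i j] stands for the curve from the outer point [j] to the inner point
   [i], and [Loop b a c] for the curve from the point [a] to the point [c] of
   the inner ([b = false]) or outer ([b = true]) boundary. *)
Inductive curve_type := Chord of int & int | Loop of bool & int & int.

(* The integers [m] such that the lift of the second curve translated by [m]
   has to cross a fixed lift of the first one positively. *)
Definition pos_shift (p q : nat) (d d' : curve_type) (m : int) : bool :=
  match d, d' with
  | Chord i j, Chord i' j' => (j < j' + m * q%:Z) && (i' + m * p%:Z < i)
  | Loop b a c, Chord i j =>
    let e := (if b then j else i) + m * (pw p q b)%:Z in (a < e) && (e < c)
  | Loop false a c, Loop false a' c' =>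
    [&& a' + m * p%:Z < a, a < c' + m * p%:Z & c' + m * p%:Z < c]
  | Loop true a c, Loop true a' c' =>
    [&& a < a' + m * q%:Z, a' + m * q%:Z < c & c < c' + m * q%:Z]
  | _, _ => false
  end.

Lemma pos_shift_finite (p q : nat) d d' : (0 < p)%N -> (0 < q)%N ->
  exists ns : seq int, uniq ns /\ forall m, (m \in ns) = pos_shift p q d d' m.
Proof.
move=> hp hq.
suff [B hB] : exists B : nat, forall m, pos_shift p q d d' m -> (`|m| <= B)%N.
  pose r := [seq n%:Z - B%:Z | n <- iota 0 (B + B).+1].
  exists [seq m <- r | pos_shift p q d d' m]; split.
    by rewrite filter_uniq // map_inj_uniq ?iota_uniq // => x y /addIr[].
  move=> m; rewrite mem_filter; case h: pos_shift => //=.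
  have := hB m h; set rhs := true => mB.
  by apply/mapP; exists (absz (m + B%:Z)); rewrite ?mem_iota; lia.
case: d => [i j|b a c]; case: d' => [i' j'|b' a' c'] /=; last first.
- exists (`|a| + `|a'| + `|c| + `|c'|)%N => m.
  by case: b; case: b' => // /and3P[]; nia.
- exists (`|a| + `|i'| + `|c| + `|j'|)%N => m.
  by case: b => /= /andP[]; nia.
- by exists 0%N.
- by exists (`|i| + `|i'| + `|j| + `|j'|)%N => m /andP[]; nia.
Qed.

Section Sheaves.
Variables (k : closedFieldType) (p q : nat).
Hypotheses (hp : (0 < p)%N) (hq : (0 < q)%N).
Local Notation wx := (wx p q).
Local Notation O := (@line_bundle k p q).
Local Notation cyc := (@cyc k p q).

Definition sheaf_of (d : curve_type) (X : coh k p q) : Prop :=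
  match d with
  | Chord i j => isomorphic X (O (wx1 p q *~ i - wx2 p q *~ j))
  | Loop false a c => exists (i : int) (j : nat),
      [/\ a = i - j%:Z - 1, c = i & is_torsion_infty i j X]
  | Loop true a c => exists (i : int) (j : nat),
      [/\ a = - i, c = j%:Z - i + 1 & is_torsion_zero i j X]
  end.

Lemma torsion_infty_cyc i j (X : coh k p q) : is_torsion_infty i j X ->
  isomorphic (cyc (Some (false, j)) (wx false *~ i)) X.
Proof.
by move=> [T [cT uX]]; apply: (uniserial_cyc hp hq (b := false) _ cT uX) => m n.
Qed.

Lemma torsion_zero_cyc i j (X : coh k p q) : is_torsion_zero i j X ->
  isomorphic (cyc (Some (true, j)) (wx true *~ i)) X.
Proof.
by move=> [T [cT uX]]; apply: (uniserial_cyc hp hq (b := true) _ cT uX) => m n.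
Qed.

Lemma wx_comboB (a c a' c' : int) :
  wx false *~ a + wx true *~ c - (wx false *~ a' + wx true *~ c') =
  wx false *~ (a - a') + wx true *~ (c - c').
Proof. by rewrite !mulrzBr opprD addrACA. Qed.

(** Both sheaves are replaced by cyclic modules; the inequalities between exponents then become
    those of [pos_shift]. *)
Lemma ext1_dim_sheaf d d' (X Y : coh k p q) (ns : seq int) :
  sheaf_of d X -> sheaf_of d' Y ->
  uniq ns -> (forall m, (m \in ns) = pos_shift p q d d' m) ->
  ext1_dim X Y (size ns).
Proof.
have chord i j : wx1 p q *~ i - wx2 p q *~ j = wx false *~ i + wx true *~ (- j).
  by rewrite mulrNz.
have tube b i : wx b *~ i =
    wx false *~ (if b then 0 else i) + wx true *~ (if b then i else 0).
  by case: b; rewrite mulr0z ?add0r ?addr0.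
move=> dX dY uns nsP.
have [t [y [iY yE]]] : exists t y, isomorphic (cyc t y) Y /\
    match d' with
    | Chord i j => t = None /\ y = wx false *~ i + wx true *~ (- j)
    | Loop b a c => exists (i : int) (j : nat),
      [/\ t = Some (b, j), y = wx b *~ i, c - a = j%:Z + 1 & if b then a = - i else c = i]
    end.
  case: d' dY {nsP} => [i j /= iY|b a c].
    exists None, (wx1 p q *~ i - wx2 p q *~ j); split; last by rewrite -chord.
    exact: isomorphic_trans (cyc_line_bundle k hp hq _) (isomorphic_sym iY).
  case: b => -[i [j [-> ->]]].
    move=> /torsion_zero_cyc iY; exists (Some (true, j)), (wx true *~ i).
    by split=> //; exists i, j; split=> //; lia.
  move=> /torsion_infty_cyc iY; exists (Some (false, j)), (wx false *~ i).
  by split=> //; exists i, j; split=> //; lia.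
case: d dX nsP => [i j /= iX|b a c /= dX] nsP.
  have ext A C yA nA := ext1_line_bundle hp hq (A := A) (C := C) yA uns nA (isomorphic_sym iX)
    iY.
  case: d' dY yE nsP => [i' j' _ [tE yE]|b' a' c' _ [i' [j' [tE yE _ _]]]] nsP.
    apply: (ext (i' - i) (j - j')); first by rewrite yE chord wx_comboB opprK [- j' + j]addrC.
    by move=> n; rewrite nsP tE /=; lia.
  apply: (ext ((if b' then 0 else i') - i) ((if b' then i' else 0) + j)).
    by rewrite yE chord tube wx_comboB opprK.
  by move=> n; rewrite nsP tE /=; lia.
have [i [j [iX caE abE]]] : exists (i : int) (j : nat),
    [/\ isomorphic (cyc (Some (b, j)) (wx b *~ i)) X, c - a = j%:Z + 1
      & if b then a = - i else c = i].
  case: b dX {nsP} => -[i [j [-> -> hX]]]; exists i, j; split=> //; try lia.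
    exact: torsion_zero_cyc.
  exact: torsion_infty_cyc.
(* The outer point [j] corresponds to the weight [- j] times [wx2], so at the outer boundary the
   index of a monomial and the translation have opposite signs. *)
pose sg (m : int) := if b then - m else m.
have sgK : involutive sg by rewrite /sg; case: (b) => m; rewrite ?opprK.
rewrite -(size_map sg).
have uns' : uniq (map sg ns) by rewrite map_inj_uniq //; apply: inv_inj.
have mns n : (n \in map sg ns) = pos_shift p q (Loop b a c) d' (sg n).
  by rewrite -[n in LHS]sgK (mem_map (inv_inj sgK)) nsP.
have ext A C yA nA := ext1_torsion hp hq (A := A) (C := C) yA uns' nA iX iY.
have wj : wx b *+ j = wx b *~ j by [].
case: d' dY yE {nsP} mns => [i' j' _ [tE yE]|b' a' c' _ [i' [j' [tE yE caE' abE']]]] mns.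
  apply: (ext ((if b then - j' else i') - i + j%:Z) (if b then i' else - j')).
    rewrite yE wj (tube b i) wx_comboB (tube b j) -[X in _ + X]opprK opprD -!mulrNz wx_comboB.
    by case: (b); rewrite /= ?oppr0 ?opprK ?subr0 ?addr0 ?add0r //; rewrite addrC.
  move=> n; rewrite mns tE /sg /=; case: (b) caE abE => caE abE /=; lia.
apply: (ext ((if b == b' then i' else 0) - i + j%:Z) (if b == b' then 0 else i')).
  rewrite yE wj (tube b' i') (tube b i) wx_comboB (tube b j)
    -[X in _ + X]opprK opprD -!mulrNz wx_comboB.
  by case: (b); case: (b'); rewrite /= ?oppr0 ?opprK ?subr0 ?addr0 ?add0r //;
    rewrite addrC ?mulr0z ?add0r.
move=> n; rewrite mns tE /sg /=.
by case: (b) caE abE; case: (b') caE' abE' => /= *; lia.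
Qed.

End Sheaves.

Import numFieldNormedType.Exports.
Local Open Scope classical_set_scope.

(** * Angles in the plane *)

Section Angle.
Variable R : realType.
Implicit Types (P Q : R * R) (s t : R).

Definition dot2 P Q := P.1 * Q.1 + P.2 * Q.2.
Definition nrm2 P := Num.sqrt (dot2 P P).

Lemma dot2_ge0 P : 0 <= dot2 P P.
Proof. by rewrite addr_ge0 // -expr2 sqr_ge0. Qed.

Lemma nrm2_sqr P : nrm2 P ^+ 2 = dot2 P P.
Proof. by rewrite sqr_sqrtr // dot2_ge0. Qed.

Lemma nrm2_ge0 P : 0 <= nrm2 P.
Proof. exact: sqrtr_ge0. Qed.

Lemma nrm2_gt0 P : P <> (0, 0) -> 0 < nrm2 P.
Proof.
case: P => x y h; rewrite sqrtr_gt0 lt_neqAle dot2_ge0 andbT eq_sym /dot2 /=.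
apply/eqP => e; apply: h; have := sqr_ge0 x; have := sqr_ge0 y; rewrite !expr2.
move=> hy hx; have /eqP : x * x = 0 by lra.
have /eqP : y * y = 0 by lra.
by rewrite !mulf_eq0 !orbb => /eqP -> /eqP ->.
Qed.

Lemma lagrange2 P Q : (nrm2 P * nrm2 Q) ^+ 2 = dot2 P Q ^+ 2 + det2 P Q ^+ 2.
Proof. by rewrite exprMn !nrm2_sqr /dot2 /det2; ring. Qed.

(** Both vectors are nonzero and the angle between them is less than pi. *)
Definition not_opposite P Q := 0 < nrm2 P * nrm2 Q + dot2 P Q.

(** The half angle formula [tan (th / 2) = sin th / (1 + cos th)]. It gives the oriented angle
    between -pi and pi, continuous in both vectors as long as they are not opposite. *)
Definition angle P Q := atan (det2 P Q / (nrm2 P * nrm2 Q + dot2 P Q)) *+ 2.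

Lemma not_opposite_neq0 P Q : not_opposite P Q -> P <> (0, 0) /\ Q <> (0, 0).
Proof.
by rewrite /not_opposite /nrm2 /dot2 => h; split=> e; move: h;
  rewrite e /= !(mul0r, mulr0) addr0 sqrtr0 ?(mul0r, mulr0) addr0 ltxx.
Qed.

Lemma not_opposite_dot P Q : 0 < dot2 P Q -> not_opposite P Q.
Proof. by move=> h; apply: ltr_wpDl => //; rewrite mulr_ge0 ?nrm2_ge0. Qed.

Lemma not_opposite_det P Q : det2 P Q != 0 -> not_opposite P Q.
Proof.
move=> h; have : 0 < det2 P Q ^+ 2 by rewrite lt_neqAle sqr_ge0 eq_sym sqrf_eq0 h.
have n0 : 0 <= nrm2 P * nrm2 Q by rewrite mulr_ge0 ?nrm2_ge0.
have := lagrange2 P Q; rewrite /not_opposite; move: n0.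
move: (nrm2 P * nrm2 Q) (dot2 P Q) (det2 P Q) => r d e; nra.
Qed.

Lemma angleN P Q : angle Q P = - angle P Q.
Proof.
rewrite /angle -mulNrn -atanN -mulNr; congr (atan (_ / _) *+ 2).
  by rewrite /det2; ring.
by rewrite /dot2; ring.
Qed.

Lemma angle_ge0 P Q : not_opposite P Q -> 0 <= det2 P Q -> 0 <= angle P Q.
Proof.
move=> h d; rewrite mulrn_wge0 // -atan0; apply: le_atan.
by rewrite divr_ge0 // ltW.
Qed.

Definition is_arg (th : R) P := P.1 = nrm2 P * cos th /\ P.2 = nrm2 P * sin th.

Lemma cos_angle P Q : not_opposite P Q -> nrm2 P * nrm2 Q * cos (angle P Q) = dot2 P Q.
Proof.
move=> h; have [P0 Q0] := not_opposite_neq0 h; have L := lagrange2 P Q.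
have r0 : 0 < nrm2 P * nrm2 Q by rewrite mulr_gt0 ?nrm2_gt0.
rewrite cos_mulr2n cos_atan exprVn sqr_sqrtr; last by rewrite addr_ge0 // sqr_ge0.
move: h L r0; rewrite /not_opposite; move: (_ * nrm2 Q) (dot2 P Q) (det2 P Q) => r d e h L r0.
have h0 : r + d != 0 by rewrite gt_eqF.
have E : 1 + (e / (r + d)) ^+ 2 = 2 * r / (r + d).
  by rewrite expr_div_n; apply: (mulIf (expf_neq0 2 h0));
    rewrite mulrDl divfK ?expf_neq0 // expr2; move: L; rewrite !expr2 => L; field : L.
by rewrite E; field; rewrite h0 gt_eqF.
Qed.

Lemma sin_angle P Q : not_opposite P Q -> nrm2 P * nrm2 Q * sin (angle P Q) = det2 P Q.
Proof.
move=> h; have h0 : nrm2 P * nrm2 Q + dot2 P Q != 0 by rewrite gt_eqF.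
have C := cos_angle h; rewrite cos_mulr2n in C; rewrite sin_mulr2n.
set a := atan _ in C *; have c0 : cos a != 0.
  by rewrite cos_atan invr_eq0 gt_eqF // sqrtr_gt0 ltr_pwDl // sqr_ge0.
have T : sin a = det2 P Q / (nrm2 P * nrm2 Q + dot2 P Q) * cos a.
  by rewrite -[X in X * _](atanK) -/a /tan divfK.
rewrite T; move: C h0; move: (_ * nrm2 Q) (dot2 P Q) (det2 P Q) => r d e.
rewrite !mulr2n !expr2 => C h0; have C' : r * (cos a * cos a) *+ 2 = r + d by rewrite -C; ring.
have -> : r * (cos a * (e / (r + d) * cos a) + cos a * (e / (r + d) * cos a)) =
   r * (cos a * cos a) *+ 2 * (e / (r + d)) by ring.
by rewrite C' mulrC divfK.
Qed.

Lemma is_arg_angle th P Q : is_arg th P -> not_opposite P Q -> is_arg (th + angle P Q) Q.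
Proof.
move=> [p1 p2] h; have [P0 Q0] := not_opposite_neq0 h.
have C := cos_angle h; have S := sin_angle h; have n0 := nrm2_gt0 P0.
have := nrm2_sqr P; move: C S; rewrite /dot2 /det2.
rewrite /is_arg cosD sinD; set r := nrm2 P in p1 p2 n0 *; set c := cos (angle _ _);
  set s := sin (angle _ _).
set m := nrm2 Q => C S n2; have r2 : r ^+ 2 != 0 by rewrite expf_neq0 ?gt_eqF.
split; apply: (mulfI r2).
  rewrite {1}n2 /dot2; transitivity (P.1 * (P.1 * Q.1 + P.2 * Q.2)
    - P.2 * (P.1 * Q.2 - P.2 * Q.1)).
    by ring.
  by rewrite -C -S {1}p1 {1}p2; ring.
rewrite {1}n2 /dot2; transitivity (P.2 * (P.1 * Q.1 + P.2 * Q.2)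
  + P.1 * (P.1 * Q.2 - P.2 * Q.1)).
  by ring.
by rewrite -C -S {1}p1 {1}p2; ring.
Qed.

Lemma periodic_int (f : R -> R) (c x : R) (n : int) : periodic f c -> f (x + c *~ n) = f x.
Proof.
move=> pf; have perN (y : R) (m : nat) : f (y + c *~ m%:Z) = f y.
  by rewrite -pmulrn; apply: periodicn.
by case: n => n; rewrite ?perN // NegzE mulrNz -[LHS](perN _ n.+1) subrK.
Qed.

Lemma cos_int (x : R) (n : int) : cos (x + pi *+ 2 *~ n) = cos x.
Proof. exact: periodic_int (@cosD2pi R). Qed.

Lemma sin_int (x : R) (n : int) : sin (x + pi *+ 2 *~ n) = sin x.
Proof. exact: periodic_int (@sinD2pi R). Qed.

Lemma cos_eq1 (x : R) : cos x = 1 -> exists n : int, x = pi *+ 2 *~ n.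
Proof.
move=> cx; have pi2 : 0 < pi *+ 2 :> R by rewrite mulrn_wgt0 ?pi_gt0.
exists (Num.floor (x / (pi *+ 2))); set n := Num.floor _.
have := cos_int x (- n); rewrite mulrNz cx; set y := x - _ => cy.
suff : y = 0 by move/eqP; rewrite subr_eq0 => /eqP.
have y0 : 0 <= y.
  by rewrite subr_ge0 -mulrzr mulrC -ler_pdivlMr // floor_le.
have y1 : y < pi *+ 2.
  have := floorD1_gt (x / (pi *+ 2)); rewrite -/n ltr_pdivrMr // intrD mulrDl mul1r.
  by rewrite mulrC mulrzr ltrBlDl.
have : sin (y / 2) = 0.
  have : cos ((y / 2) *+ 2) = 1 by rewrite -[_ *+ 2]mulr_natr divfK.
  rewrite cos_mulr2n => h; have := sin2cos2 (y / 2); move: h; rewrite mulr2n => h.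
  have -> : cos (y / 2) ^+ 2 = 1 by lra.
  by rewrite subrr => /eqP; rewrite sqrf_eq0 => /eqP.
have := @sin_gt0_pi R (y / 2); move=> H E; apply: contrapT => yN.
suff : 0 < sin (y / 2) by rewrite E ltxx.
apply: H; apply/andP; split; first by rewrite divr_gt0 // lt_neqAle y0 andbT eq_sym; apply/eqP.
by rewrite ltr_pdivrMr // mulr_natr.
Qed.

Lemma is_arg_eq s t P : is_arg s P -> is_arg t P -> P <> (0, 0) ->
  exists n : int, t - s = pi *+ 2 *~ n.
Proof.
move=> [a b] [c d] /nrm2_gt0 P0; apply: cos_eq1; rewrite cosB.
have r0 : nrm2 P != 0 by rewrite gt_eqF.
move: c d; rewrite {1}a {1}b => /(mulfI r0) <- /(mulfI r0) <-.
by rewrite -!expr2 cos2Dsin2.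
Qed.

Lemma arg_exists P : P <> (0, 0) -> exists t, is_arg t P.
Proof.
case: P => x y P0; have n1 (e : R) : e ^+ 2 = 1 -> nrm2 (e, 0) = 1.
  by move=> h; rewrite /nrm2 /dot2 /= mul0r addr0 -expr2 h sqrtr1.
have a0 : is_arg 0 (1, 0) by rewrite /is_arg n1 ?expr1n // cos0 sin0 mulr1 mulr0.
have a1 : is_arg pi (-1, 0) by rewrite /is_arg n1 ?sqrrN ?expr1n // cospi sinpi mulr0 mul1r.
have [y0|y0] := eqVneq y 0; last first.
  eexists; apply: is_arg_angle a0 _; apply: not_opposite_det.
  by rewrite /det2 /= mul1r mul0r subr0.
have [x0|x0|x0] := ltgtP x 0; last by case: P0; rewrite x0 y0.
  by eexists; apply: is_arg_angle a1 _; apply: not_opposite_dot;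
    rewrite /dot2 /= mul0r addr0 mulN1r oppr_gt0.
by eexists; apply: is_arg_angle a0 _; apply: not_opposite_dot;
  rewrite /dot2 /= mul0r addr0 mul1r.
Qed.

Section Continuity.
Variables (T : topologicalType) (x : T) (f g : T -> R * R).
Hypotheses (cf : {for x, continuous f}) (cg : {for x, continuous g}).

Let c1 (h : T -> R * R) : {for x, continuous h} -> {for x, continuous (fun z => (h z).1)}.
Proof. by move=> ch; apply: cvg_comp ch _; apply: cvg_fst. Qed.
Let c2 (h : T -> R * R) : {for x, continuous h} -> {for x, continuous (fun z => (h z).2)}.
Proof. by move=> ch; apply: cvg_comp ch _; apply: cvg_snd. Qed.

Lemma continuous_dot2 : {for x, continuous (fun z => dot2 (f z) (g z))}.
Proof. by apply: cvgD; apply: cvgM; [exact: c1|exact: c1|exact: c2|exact: c2]. Qed.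

Lemma continuous_det2 : {for x, continuous (fun z => det2 (f z) (g z))}.
Proof. by apply: cvgB; apply: cvgM; [exact: c1|exact: c2|exact: c2|exact: c1]. Qed.
End Continuity.

Section Continuity2.
Variables (T : topologicalType) (x : T) (f g : T -> R * R).
Hypotheses (cf : {for x, continuous f}) (cg : {for x, continuous g}).

Lemma continuous_nrm2 (h : T -> R * R) : {for x, continuous h} -> {for x,
  continuous (fun z => nrm2 (h z))}.
Proof. by move=> ch; apply: (@continuous_comp _ _ _ (fun z => dot2 (h z) (h z)) Num.sqrt);
  [exact: continuous_dot2|exact: sqrt_continuous]. Qed.

Lemma continuous_not_opposite : {for x, continuous (fun z => nrm2 (f z) * nrm2 (g z)
  + dot2 (f z) (g z))}.
Proof. by apply: cvgD; [apply: cvgM; exact: continuous_nrm2|exact: continuous_dot2]. Qed.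

Lemma continuous_angle : not_opposite (f x) (g x) -> {for x,
  continuous (fun z => angle (f z) (g z))}.
Proof.
move=> h; apply: cvgMn.
apply: (@continuous_comp _ _ _ (fun z => det2 (f z) (g z) / _) atan);
  last exact: continuous_atan.
apply: cvgM; first exact: continuous_det2.
by apply: cvgV; [rewrite gt_eqF|exact: continuous_not_opposite].
Qed.
End Continuity2.

End Angle.

(** * Lifting of angles over the square *)

Section Lifting.
Variable R : realType.
Implicit Types (s t u : R) (z : R * R).

(** A retraction of the line onto [[0, 1]], which turns continuity within the square into continuity
    everywhere. *)
Definition clamp (t : R) := Num.max 0 (Num.min t 1).
Definition clamp2 z := (clamp z.1, clamp z.2).
Definition unit_square z := 0 <= z.1 <= 1 /\ 0 <= z.2 <= 1.

Lemma clamp_itv t : 0 <= clamp t <= 1.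
Proof. by rewrite /clamp le_max lexx ge_max ler01 ge_min lexx orbT. Qed.

Lemma clampE t : 0 <= t <= 1 -> clamp t = t.
Proof. by move=> /andP[t0 t1]; rewrite /clamp min_l // max_r. Qed.

Lemma clamp2_square z : unit_square (clamp2 z).
Proof. by split; apply: clamp_itv. Qed.

Lemma clamp2E z : unit_square z -> clamp2 z = z.
Proof. by case: z => t u [] ht hu; rewrite /clamp2 !clampE. Qed.

Lemma continuous_clamp : continuous clamp.
Proof.
move=> t; apply: (@continuous_max R _ (fun=> 0) (fun t => Num.min t 1)); first exact: cvg_cst.
apply: (@continuous_min R _ id (fun=> 1)); [exact: cvg_id|exact: cvg_cst].
Qed.

Lemma continuous_pair (T : topologicalType) (x : T) (f g : T -> R) :
  {for x, continuous f} -> {for x, continuous g} ->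
  {for x, continuous (fun y => (f y, g y) : R * R)}.
Proof. exact: cvg_pair. Qed.

Lemma continuous_clamp2 : continuous clamp2.
Proof.
move=> z; apply: (@continuous_pair _ z (fun z => clamp z.1) (fun z => clamp z.2)).
  by apply: (@continuous_comp _ _ _ fst clamp); [exact: cvg_fst|exact: continuous_clamp].
by apply: (@continuous_comp _ _ _ snd clamp); [exact: cvg_snd|exact: continuous_clamp].
Qed.

Lemma continuous_sum (T : topologicalType) (x : T) (n : nat) (f : nat -> T -> R) :
  (forall k, (k < n)%N -> {for x, continuous (f k)}) ->
  {for x, continuous (fun y => \sum_(k < n) f k y)}.
Proof.
elim: n => [_|n IH h].
  have -> : (fun y => \sum_(k < 0) f k y) = fun=> 0 by apply/funext => y; rewrite big_ord0.
  exact: cvg_cst.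
have -> : (fun y => \sum_(k < n.+1) f k y) = fun y => \sum_(k < n) f k y + f n y.
  by apply/funext => y; rewrite big_ord_recr.
by apply: cvgD; [apply: IH => k kn; apply: h; apply: ltnW|apply: h].
Qed.

(** Compactness of the square, applied to the continuous function whose positivity is
    [not_opposite]. *)
Lemma not_opposite_uniform (f : R * R -> R * R) : continuous f ->
  (forall z, unit_square z -> f z <> (0, 0)) ->
  exists N : nat, forall z w, unit_square z ->
    `|z.1 - w.1| <= N.+1%:R^-1 -> `|z.2 - w.2| <= N.+1%:R^-1 -> not_opposite (f z) (f w).
Proof.
move=> cf f0.
have K : compact (`[0, 1] `*` `[0, 1] : set (R * R)).
  by apply: compact_setX; apply: segment_compact.
move/compact_near_coveringP: K => /(_ nat \oo (fun N z => forall w,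
  `|z.1 - w.1| <= N.+1%:R^-1 -> `|z.2 - w.2| <= N.+1%:R^-1 -> not_opposite (f z) (f w)))[].
  move=> z [/= z1 z2]; have fz0 : f z <> (0, 0).
    by apply: f0; split; move: z1 z2; rewrite /= !in_itv.
  have pos : 0 < nrm2 (f z) * nrm2 (f z) + dot2 (f z) (f z).
    have := nrm2_gt0 fz0; have := nrm2_sqr (f z); rewrite expr2 => <- h.
    by rewrite addr_gt0 // mulr_gt0.
  have ct : {for (z, z), continuous (fun y : (R * R) * (R * R) =>
      nrm2 (f y.1) * nrm2 (f y.2) + dot2 (f y.1) (f y.2))}.
    apply: continuous_not_opposite.
      by apply: continuous_comp; [apply: cvg_fst|apply: cf].
    by apply: continuous_comp; [apply: cvg_snd|apply: cf].
  have [[A B] /= [nA nB] AB] : nbhs (z, z) [set y : (R * R) * (R * R) | not_opposite (f y.1)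
    (f y.2)].
    have := ct [set r | 0 < r]; apply; apply: open_nbhs_nbhs; split=> //; exact: open_gt.
  have [eA /= eA0 hA] := (nbhs_ballP z A).1 nA; have [eB /= eB0 hB] := (nbhs_ballP z B).1 nB.
  exists (ball z (Num.min eA (eB / 2)), [set N : nat | N.+1%:R^-1 < eB / 2]).
    split; first by apply: nbhsx_ballx; rewrite lt_min eA0 divr_gt0.
    exact: (near_infty_natSinv_lt (PosNum (divr_gt0 eB0 (ltr0Sn _ 1)))).
  move=> [y N] /= [[y1 y2] hN] w w1 w2; apply: (AB (y, w)); split=> /=.
    by apply: hA; split; [move: y1|move: y2]; apply: le_ball; rewrite ge_min lexx.
  have tri (a b c : R) : `|a - b| < Num.min eA (eB / 2) -> `|b - c| <= N.+1%:R^-1 -> `|a - c|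
    < eB.
    move=> ab bc; rewrite -(subrK b a) -addrA (le_lt_trans (ler_normD _ _))
      // [eB]splitr ltrD //.
      by apply: lt_le_trans ab _; rewrite ge_min lexx orbT.
    exact: le_lt_trans bc hN.
  by apply: hB; split; [exact: tri y1 w1|exact: tri y2 w2].
move=> N _ /(_ N (leqnn N)) hN; exists N => z w [z1 z2]; apply: hN.
by split; rewrite /= in_itv.
Qed.

(** The square is star-shaped about the origin. The segment to [z] is cut into [N.+1] pieces, short
    enough that consecutive values of [f] are not opposite, and the small angles are added up; the
    sum is continuous in [z]. *)
Lemma angle_lift (f : R * R -> R * R) : continuous f ->
  (forall z, unit_square z -> f z <> (0, 0)) ->
  exists2 th : R * R -> R, continuous th &
    forall z, unit_square z -> is_arg (th z) (f z).
Proof.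
move=> cf f0; have [N hN] := not_opposite_uniform cf f0.
have [t0 ht0] : exists t, is_arg t (f (0, 0)).
  by apply: arg_exists; apply: f0; split; rewrite /= lexx ler01.
pose sc (k : nat) z : R * R := (k%:R / N.+1%:R * clamp z.1, k%:R / N.+1%:R * clamp z.2).
have kN k : (k <= N.+1)%N -> 0 <= (k%:R / N.+1%:R : R) <= 1.
  by move=> h; rewrite divr_ge0 //= ler_pdivrMr // mul1r ler_nat.
have scS k z : (k <= N.+1)%N -> unit_square (sc k z).
  move=> /kN /andP[k0 k1]; split; rewrite /sc /=.
    by have /andP[c0 c1] := clamp_itv z.1; rewrite mulr_ge0 // mulr_ile1.
  by have /andP[c0 c1] := clamp_itv z.2; rewrite mulr_ge0 // mulr_ile1.
have dist k (c : R) : 0 <= c <= 1 -> `|k%:R / N.+1%:R * c - k.+1%:R / N.+1%:R * c| <=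
  N.+1%:R^-1.
  move=> /andP[c0 c1]; rewrite -mulrBl -mulrBl -[k.+1]addn1 natrD opprD addrA subrr add0r
    mulN1r mulNr normrN.
  by rewrite ger0_norm ?mulr_ge0 // ler_piMr.
have opp k z : (k < N.+1)%N -> not_opposite (f (sc k z)) (f (sc k.+1 z)).
  by move=> kn; apply: hN; [apply: scS; apply: ltnW|apply: dist; apply: clamp_itv..].
have csc k : continuous (sc k).
  move=> z; apply: (@continuous_pair _ z (fun z => _ * clamp z.1) (fun z => _ * clamp z.2));
    apply: cvgM; try exact: cvg_cst.
    by apply: (@continuous_comp _ _ _ fst clamp); [exact: cvg_fst|exact: continuous_clamp].
  by apply: (@continuous_comp _ _ _ snd clamp); [exact: cvg_snd|exact: continuous_clamp].
pose part n z := t0 + \sum_(k < n) angle (f (sc k z)) (f (sc k.+1 z)).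
exists (part N.+1).
  move=> z; apply: cvgD; first exact: cvg_cst.
  apply: (@continuous_sum _ z N.+1 (fun k z => angle (f (sc k z)) (f (sc k.+1 z)))) => k kn.
  by apply: continuous_angle; [apply: continuous_comp; [exact: csc|exact: cf]..|exact: opp].
move=> z hz; have {2}-> : z = sc N.+1 z.
  by rewrite /sc divff // !mul1r -/(clamp2 z) clamp2E.
suff H n : (n <= N.+1)%N -> is_arg (part n z) (f (sc n z)) by exact: H.
elim: n => [|n IH] hn.
  rewrite /part big_ord0 addr0; have -> // : sc 0 z = (0, 0).
  by rewrite /sc !mul0r.
rewrite /part big_ord_recr addrA; apply: is_arg_angle (opp _ _ hn).
by apply: IH; apply: ltnW.
Qed.

Lemma continuous_mod_const (phi : R -> R) (c a b : R) : 0 < c -> a <= b ->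
  (forall t, a <= t <= b -> {for t, continuous phi}) ->
  (forall t, a <= t <= b -> exists n : int, phi t - phi a = c *~ n) ->
  phi b = phi a.
Proof.
move=> c0 ab cphi modc; have [|n phin] := modc b; first by rewrite ab lexx.
have [n0|n0] := eqVneq n 0; first by move/eqP: phin; rewrite n0 mulr0z subr_eq0 => /eqP.
exfalso.
have W : {within `[a, b], continuous phi}.
  by apply: continuous_in_subspaceT => t; rewrite inE /= in_itv; exact: cphi.
(* A value half a period away from [phi a], which [phi] would have to take between [a] and [b]. *)
pose v := phi a + (if 0 < n then c / 2 else - (c / 2)).
have hv : Num.min (phi a) (phi b) <= v <= Num.max (phi a) (phi b).
  have -> : phi b = phi a + c * n%:~R by rewrite mulrzr -phin addrC subrK.
  rewrite /v; have [np|nn] := ltP 0 n.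
    have h : c <= c * n%:~R by rewrite ler_peMr ?ler1z ?gtz0_ge1 // ltW.
    by rewrite ge_min le_max lerDl divr_ge0 ?(ltW c0) //= lerD2l; apply/orP; right; lra.
  have h : c * n%:~R <= - c.
    have : n%:~R <= (-1)%:~R :> R by rewrite ler_int; lia.
    by rewrite -(ler_pM2l c0) mulrN1z mulrN1.
  rewrite ge_min le_max; apply/andP; split; apply/orP; [right|left]; rewrite ?lerD2l; lra.
have [t tab tv] := IVT ab W hv.
have [|k hk] := modc t; first by move: tab; rewrite in_itv.
move: hk; rewrite tv /v addrC addKr -mulrzr => hk.
have c2 : c != 0 by rewrite gt_eqF.
have : (2 * k)%:~R = (if 0 < n then 1 else -1)%:~R :> R.
  apply: (mulfI c2); rewrite intrM mulrCA -hk; case: ifP => _; rewrite ?mulrN1z.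
    by rewrite mulr1 mulrC divfK.
  by rewrite mulrN1 mulrN mulrC divfK.
by move/intr_inj; case: ifP => _; lia.
Qed.
End Lifting.

(** * Lifts of curves to the strip *)

Section Cylinder.
Variable R : realType.
Implicit Types (s t u : R) (z w P Q : R * R) (a b : R -> cylinder R).

Lemma cpiP z w : cpi z = cpi w <-> exists n : int, z = w + (n%:~R, 0).
Proof.
split=> [e|[n ->]].
  have : \pi_({quot (@deck R)})%qT z == \pi_({quot (@deck R)})%qT w by apply/eqP.
  rewrite -(idealrBE (@deck R)) => /asboolP[n e']; exists n.
  by rewrite -e' addrC subrK.
suff /eqP : \pi_({quot (@deck R)})%qT (w + (n%:~R, 0)) == \pi_({quot (@deck R)})%qT w by [].
by rewrite -(idealrBE (@deck R)); apply/asboolP; exists n; rewrite addrC addKr.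
Qed.

Lemma cpi_surj (x : cylinder R) : exists z, x = cpi z.
Proof. by exists (repr x); rewrite /cpi reprK. Qed.

(** Circle and height coordinates separate the points of the cylinder, which reduces lifting from
    the cylinder to lifting of angles. *)
Definition circle_pt z : R * R := (cos (pi *+ 2 * z.1), sin (pi *+ 2 * z.1)).
Definition cyl_circle (x : cylinder R) := circle_pt (repr x).
Definition cyl_height (x : cylinder R) := (repr x).2.

Lemma cpi_repr z : exists n : int, repr (cpi z) = z + (n%:~R, 0).
Proof. by apply/cpiP; rewrite /cpi reprK. Qed.

Lemma cyl_circleE z : cyl_circle (cpi z) = circle_pt z.
Proof.
have [n e] := cpi_repr z; rewrite /cyl_circle e /circle_pt /= mulrDr mulrzr.
by rewrite cos_int sin_int.
Qed.

Lemma cyl_heightE z : cyl_height (cpi z) = z.2.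
Proof. by have [n e] := cpi_repr z; rewrite /cyl_height e /= addr0. Qed.

Lemma continuous_cyl_circle : continuous cyl_circle.
Proof.
apply/quotient_continuous.
have -> : cyl_circle \o \pi_(cylinder R)%qT = circle_pt.
  by apply/funext => z; exact: cyl_circleE.
move=> z; apply: (@continuous_pair _ _ z (fun z => cos (pi *+ 2 * z.1)) (fun z =>
  sin (pi *+ 2 * z.1))).
  apply: (@continuous_comp _ _ _ (fun z => pi *+ 2 * z.1) cos); last exact: continuous_cos.
  by apply: cvgM; [exact: cvg_cst|exact: cvg_fst].
apply: (@continuous_comp _ _ _ (fun z => pi *+ 2 * z.1) sin); last exact: continuous_sin.
by apply: cvgM; [exact: cvg_cst|exact: cvg_fst].
Qed.

Lemma continuous_cyl_height : continuous cyl_height.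
Proof.
apply/quotient_continuous.
have -> : cyl_height \o \pi_(cylinder R)%qT = snd.
  by apply/funext => z; exact: cyl_heightE.
by move=> z; exact: cvg_snd.
Qed.

Lemma continuous_cpi : continuous (@cpi R).
Proof. exact: pi_continuous. Qed.

Lemma circle_pt_eq (x : cylinder R) z : cyl_circle x = circle_pt z ->
  cyl_height x = z.2 -> x = cpi z.
Proof.
have [w ->] := cpi_surj x; rewrite cyl_circleE cyl_heightE => -[c s] h.
have [n hn] : exists n : int, pi *+ 2 * w.1 - pi *+ 2 * z.1 = pi *+ 2 *~ n.
  by apply: cos_eq1; rewrite cosB c s -!expr2 cos2Dsin2.
have pi0 : pi *+ 2 != 0 :> R by rewrite gt_eqF // mulrn_wgt0 ?pi_gt0.
apply/cpiP; exists n; rewrite [w]surjective_pairing [z]surjective_pairing h.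
congr (_, _); rewrite /= ?addr0 //.
have E : w.1 - z.1 = n%:~R by apply: (mulfI pi0); rewrite mulrBr hn mulrzr.
by rewrite -E addrC subrK.
Qed.

Lemma within_comp_continuous (T U : topologicalType) (A : set T) (f : T -> U) (c : T -> T) :
  {within A, continuous f} -> continuous c -> (forall x, A (c x)) -> continuous (f \o c).
Proof.
move=> /subspace_continuousP cf cc cA z; apply: cvg_comp (cf _ (cA z)).
move=> B hB; have H : nbhs z (c @^-1` [set x | A x -> B x]) by exact: cc z _ hB.
by apply: (filterS _ H) => y hy; apply: hy; apply: cA.
Qed.

Lemma continuous_snd_comp (T : topologicalType) (x : T) (f : T -> R * R) :
  {for x, continuous f} -> {for x, continuous (fun y => (f y).2)}.
Proof. by move=> cf; apply: cvg_comp cf _; apply: cvg_snd. Qed.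

Lemma continuous_fst_comp (T : topologicalType) (x : T) (f : T -> R * R) :
  {for x, continuous f} -> {for x, continuous (fun y => (f y).1)}.
Proof. by move=> cf; apply: cvg_comp cf _; apply: cvg_fst. Qed.

Lemma cylinder_lift (f : R * R -> cylinder R) :
  {within `[0, 1] `*` `[0, 1], continuous f} ->
  exists2 F : R * R -> R * R, continuous F & forall z, unit_square z -> f z = cpi (F z).
Proof.
move=> cf; pose f' := f \o @clamp2 R.
have cf' : continuous f'.
  apply: (within_comp_continuous cf); first exact: continuous_clamp2.
  by move=> z; have [h1 h2] := clamp2_square z; split; rewrite /= in_itv.
pose g := cyl_circle \o f'.
have cg : continuous g by move=> z; apply: continuous_comp;
  [exact: cf'|exact: continuous_cyl_circle].
have nrm_circle z : nrm2 (circle_pt z) = 1.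
  by rewrite /nrm2 /dot2 /= -!expr2 cos2Dsin2 sqrtr1.
have gE z : exists w, f' z = cpi w /\ g z = circle_pt w.
  by have [w hw] := cpi_surj (f' z); exists w; split=> //; rewrite /g /= hw cyl_circleE.
have g0 z : g z <> (0, 0).
  have [w [_ ->]] := gE z; move=> e; have := nrm_circle w.
  by rewrite e /nrm2 /dot2 /= mulr0 addr0 sqrtr0 => /eqP; rewrite eq_sym oner_eq0.
have [th cth hth] := angle_lift cg (fun z _ => g0 z).
have pi0 : pi *+ 2 != 0 :> R by rewrite gt_eqF // mulrn_wgt0 ?pi_gt0.
exists (fun z => (th z / (pi *+ 2), cyl_height (f' z))).
  move=> z; apply: (@continuous_pair _ _ z (fun z => th z / (pi *+ 2)) (fun z =>
    cyl_height (f' z))).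
    by apply: cvgM; [exact: cth|exact: cvg_cst].
  by apply: (@continuous_comp _ _ _ f' cyl_height); [exact: cf'|exact: continuous_cyl_height].
move=> z hz; have -> : f z = f' z by rewrite /f' /= clamp2E.
apply: circle_pt_eq => //=; have [w [fw gw]] := gE z.
have := hth z hz; rewrite gw /is_arg nrm_circle !mul1r => -[c s].
by rewrite -[LHS]/(g z) gw [LHS]surjective_pairing c s /circle_pt /= mulrC divfK.
Qed.

Definition lift_of a P Q (g : R -> R * R) :=
  [/\ continuous g, g 0 = P, g 1 = Q & forall t, 0 <= t <= 1 -> a t = cpi (g t)].

Lemma lift_eq (F G : R -> R * R) s t : s <= t ->
  (forall u, s <= u <= t -> {for u, continuous F}) ->
  (forall u, s <= u <= t -> {for u, continuous G}) ->
  (forall u, s <= u <= t -> cpi (F u) = cpi (G u)) -> F s = G s -> F t = G t.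
Proof.
move=> st cF cG FG e.
have FGn u : s <= u <= t -> exists n : int, F u = G u + (n%:~R, 0).
  by move=> hu; apply/cpiP/FG.
have : (F t).1 - (G t).1 = (F s).1 - (G s).1.
  apply: (@continuous_mod_const R (fun u => (F u).1 - (G u).1) 1 s t ltr01 st).
    by move=> u hu; apply: cvgB; apply: continuous_fst_comp; [exact: cF|exact: cG].
  by move=> u /FGn[n ->]; exists n; rewrite e subrr subr0 /= addrC addKr.
have [|n E] := FGn t; first by rewrite st lexx.
rewrite e subrr => /eqP; rewrite subr_eq0 => /eqP e1.
by rewrite [LHS]surjective_pairing e1 E /= addr0 -surjective_pairing.
Qed.

(** The lifted homotopy is translated so that it starts at [g]. Its two sides cover constant curves,
    so the final curve keeps the end points of [g]. *)
Lemma homotopic_lift a b P Q g : lift_of a P Q g -> homotopic a b ->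
  exists g', lift_of b P Q g'.
Proof.
move=> [cg gP gQ ag] [H [cH _ Hab He]].
have [F cF HF] := cylinder_lift cH.
have i0 : 0 <= (0 : R) <= 1 by rewrite lexx ler01.
have i1 : 0 <= (1 : R) <= 1 by rewrite lexx ler01.
have [n hn] : exists n : int, g 0 = F (0, 0) + (n%:~R, 0).
  by apply/cpiP; rewrite -ag // -HF; [have [-> _] := Hab 0 i0|split].
pose G z := F z + (n%:~R, 0).
have cG : continuous G.
  move=> z; apply: (@continuous_pair _ _ z (fun z => (F z).1 + n%:~R) (fun z => (F z).2 + 0));
    apply: cvgD; try exact: cvg_cst.
    by apply: continuous_fst_comp; exact: cF.
  by apply: continuous_snd_comp; exact: cF.
have GE z : unit_square z -> cpi (G z) = H z by move=> /HF ->; apply/cpiP; exists n.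
have ct u : continuous (fun t => G (t, u)).
  by move=> t; apply: (@continuous_comp _ _ _ (fun t => (t, u)) G);
    [apply: (@continuous_pair _ _ t id (fun=> u)); [exact: cvg_id|exact: cvg_cst]|exact: cG].
have cu t : continuous (fun u => G (t, u)).
  by move=> u; apply: (@continuous_comp _ _ _ (fun u => (t, u)) G);
    [apply: (@continuous_pair _ _ u (fun=> t) id); [exact: cvg_cst|exact: cvg_id]|exact: cG].
have Gg1 : G (1, 0) = g 1.
  apply: (@lift_eq (fun t => G (t, 0)) g 0 1) => //; [by move=> u _; exact: ct|by move=> u _;
    exact: cg|].
  by move=> u hu; rewrite GE //; have [-> _] := Hab u hu; rewrite ag.
exists (fun t => G (t, 1)); split.
- exact: ct.
- rewrite -gP -[RHS]/((fun=> g 0) (1 : R)).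
  apply: (@lift_eq (fun u => G (0, u)) (fun=> g 0) 0 1) => //.
  + by move=> u _; exact: cu.
  + by move=> u _; exact: cvg_cst.
  + by move=> u hu; rewrite GE //; have [-> _] := He u hu; rewrite ag.
- rewrite -gQ -[RHS]/((fun=> g 1) (1 : R)).
  apply: (@lift_eq (fun u => G (1, u)) (fun=> g 1) 0 1) => //.
  + by move=> u _; exact: cu.
  + by move=> u _; exact: cvg_cst.
  + by move=> u hu; rewrite GE //; have [_ ->] := He u hu; rewrite ag.
- by move=> t ht; rewrite GE //; have [_ ->] := Hab t ht.
Qed.

Lemma lift_strip_curve P Q g : strip_curve P Q g -> lift_of (@cpi R \o g) P Q (g \o @clamp R).
Proof.
move=> [cg g0 g1 _]; split.
- apply: (within_comp_continuous cg); first exact: continuous_clamp.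
  by move=> t; rewrite /= in_itv; exact: clamp_itv.
- by rewrite /= clampE // lexx ler01.
- by rewrite /= clampE // lexx ler01.
- by move=> t ht; rewrite /= clampE.
Qed.

Lemma lift_interior a P Q g t : lift_of a P Q g -> 0 < t < 1 ->
  annulus_interior (a t) -> 0 < (g t).2 < 1.
Proof.
move=> [_ _ _ ag] /andP[t0 t1]; rewrite ag ?(ltW t0) ?(ltW t1) // => -[z hz /esym/cpiP[n ->]].
by rewrite /= addr0.
Qed.

(** Near [t] the lift and the local coordinates differ by an integer, which is constant by
    continuity. *)
Lemma velocity_lift a P Q g t v : lift_of a P Q g -> 0 < t < 1 -> velocity a t v ->
  is_derive t 1 (fun u => (g u).1) v.1 /\ is_derive t 1 (fun u => (g u).2) v.2.
Proof.
move=> [cg _ _ ag] /andP[t0 t1] [x [y [axy dx dy]]].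
have nE : \forall u \near t, exists n : int, g u = (x u, y u) + (n%:~R, 0).
  near=> u; apply/cpiP; rewrite -ag; first by near: u.
  by apply/andP; split; apply: ltW; near: u; [exact: lt_nbhsr|exact: lt_nbhsl].
have [n gt] := nbhs_singleton nE.
have cx : {for t, continuous x}.
  have [hx _] := dx.
  by apply: differentiable_continuous; apply/derivable1_diffP.
have cgx : {for t, continuous (fun u => (g u).1 - x u)}.
  by apply: cvgB => //; apply: continuous_fst_comp; exact: cg.
have n1 : \forall u \near t, `|(g t).1 - x t - ((g u).1 - x u)| < 1.
  by move/cvgrPdist_lt : cgx; apply.
have gE : \forall u \near t, g u = (x u + n%:~R, y u).
  near=> u; have [k gk] : exists n : int, g u = (x u, y u) + (n%:~R, 0) by near: u.
  have : `|(g t).1 - x t - ((g u).1 - x u)| < 1 by near: u.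
  rewrite gk gt /= ![_ + _ - x _]addrC !addKr -intrB -intr_norm -[1]/(1%:~R) ltr_int => h.
  have -> : n = k by lia.
  by rewrite [LHS]surjective_pairing /= addr0.
split.
  apply: (near_eq_is_derive (f := fun u => x u + n%:~R)); first by apply: filterS gE => u ->.
  by rewrite -[v.1]addr0; apply: is_deriveD.
by apply: (near_eq_is_derive (f := y)) => //; apply: filterS gE => u ->.
Unshelve. all: by end_near. Qed.

Lemma velocity_cpi (g : R -> R * R) t v :
  is_derive t 1 (fun u => (g u).1) v.1 -> is_derive t 1 (fun u => (g u).2) v.2 ->
  velocity (@cpi R \o g) t v.
Proof.
move=> d1 d2; exists (fun u => (g u).1), (fun u => (g u).2); split=> //.
by near=> u; rewrite /= -surjective_pairing.
Unshelve. all: by end_near. Qed.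

Lemma is_derive_unique (f : R -> R) t d e : is_derive t 1 f d -> is_derive t 1 f e -> d = e.
Proof. by move=> [_ <-] [_ <-]. Qed.

End Cylinder.

(** * Turning numbers *)

Section Winding.
Variable R : realType.
Implicit Types (s t u x y : R) (z w : R * R).

(** Subdivision by a supremum argument on the [s] for which [P 0 s] is known. End points of
    intervals are restricted to a dense set [V], so that a subdivision can avoid the zeros of a
    function. *)
Lemma interval_ind (V : R -> Prop) (P : R -> R -> Prop) : V 0 -> V 1 ->
  (forall a b : R, 0 <= a -> a < b -> b <= 1 -> exists2 c, V c & a < c < b) ->
  (forall a b c, V a -> V b -> V c -> a < b -> b < c -> P a b -> P b c -> P a c) ->
  (forall x, 0 <= x <= 1 -> exists2 d : R, 0 < d & forall a b, V a -> V b ->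
    0 <= a -> b <= 1 -> a <= x <= b -> a < b -> b - a < d -> P a b) ->
  P 0 1.
Proof.
move=> V0 V1 dV PD loc.
pose S := [set s | [/\ V s, 0 < s, s <= 1 & P 0 s]].
have [|d0 d00 h0] := loc 0; first by rewrite lexx ler01.
have [s1 [Vs1 s10 s11 Ps1]] : S !=set0.
  have [|||c Vc /andP[c0 c1]] := dV 0 (Num.min d0 1);
    rewrite ?lexx ?lt_min ?d00 ?ltr01 ?ge_min ?lexx ?orbT //.
  exists c; move: c1; rewrite lt_min => /andP[cd c1].
  by split=> //; [exact: ltW|apply: h0; rewrite ?subr0 ?lexx ?(ltW c0) ?(ltW c1)].
have hsup : has_sup S by split; [exists s1|exists 1 => s []].
have ubS s : S s -> s <= sup S by move=> Ss; apply: ub_le_sup => //; case: hsup.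
have x1 : sup S <= 1 by apply: ge_sup; [exists s1|move=> s []].
have x0 : 0 <= sup S by apply: le_trans (ltW s10) (ubS s1 _).
have [|d d00' hd] := loc (sup S); first by rewrite x0 x1.
have [s [Vs s0 sl1 Ps] sx] : exists2 s, S s & sup S - d / 2 < s.
  by apply: sup_adherent => //; rewrite divr_gt0.
have sS : s <= sup S by apply: ubS.
have [x1'|x1'] := ltP (sup S) 1.
  have [|||c Vc /andP[c0 c1]] := dV (sup S) (Num.min (sup S + d / 2) 1);
    rewrite ?lt_min ?x1' ?ltrDl ?divr_gt0 ?ge_min ?lexx ?orbT //.
  move: c1; rewrite lt_min => /andP[cd c1].
  have sc : s < c by apply: le_lt_trans c0.
  suff /ubS : S c by rewrite leNgt c0.
  split=> //; [exact: lt_trans sc|exact: ltW|].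
  apply: (PD 0 s c) => //; apply: hd => //; rewrite ?(ltW s0) ?(ltW c1) ?sS ?(ltW c0) //; lra.
have e1 : sup S = 1 by apply/eqP; rewrite eq_le x1 x1'.
have [s1'|s1'] := ltP s 1; last by have -> : 1 = s by apply/eqP; rewrite eq_le s1' sl1.
apply: (PD 0 s 1) => //; apply: hd => //; rewrite ?(ltW s0) ?sS ?x1' ?lexx //; lra.
Qed.

Lemma avoid_seq (r : seq R) a b : a < b -> exists2 c, c \notin r & a < c < b.
Proof.
suff H : forall a b, a < b -> exists a' b', [/\ a <= a', a' < b', b' <= b &
    forall c, a' < c < b' -> c \notin r].
  move=> /H[a' [b' [aa ab bb h]]]; exists ((a' + b') / 2); first by apply: h; lra.
  lra.
elim: r => [|x r IH] {}a {}b ab; first by exists a, b.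
have [a' [b' [aa ab' bb h]]] := IH a b ab.
have [xm|xm] := leP x ((a' + b') / 2).
  exists ((a' + b') / 2), b'; split=> //; try lra.
  move=> c /andP[c1 c2]; rewrite inE negb_or h ?andbT; last lra.
  by rewrite gt_eqF //; lra.
exists a', ((a' + b') / 2); split=> //; try lra.
move=> c /andP[c1 c2]; rewrite inE negb_or h ?andbT; last lra.
by rewrite lt_eqF //; lra.
Qed.

Definition arg_on (gam : R -> R * R) a b (th : R -> R) := forall s, a <= s <= b ->
  {for s, continuous th} /\ is_arg (th s) (gam s).

(** [lam] is a comparison curve: the argument of [gam s] is that of [lam a], plus the angle to
    [lam s], plus the angle from there to [gam s], up to a multiple of a full turn that is constant
    by continuity. *)
Lemma arg_on_diff gam lam a b th : a <= b -> arg_on gam a b th ->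
  (forall s, a <= s <= b -> {for s, continuous gam}) ->
  (forall s, a <= s <= b -> {for s, continuous lam}) ->
  (forall s, a <= s <= b -> not_opposite (lam s) (gam s)) ->
  (forall s, a <= s <= b -> not_opposite (lam a) (lam s)) ->
  th b - th a = angle (lam a) (lam b) + angle (lam b) (gam b) - angle (lam a) (gam a).
Proof.
move=> ab hth cg cl h1 h2.
have aa : a <= a <= b by rewrite lexx.
have [t0 ht0] : exists t, is_arg t (lam a).
  by apply: arg_exists; have [] := not_opposite_neq0 (h1 a aa).
pose phi s := th s - angle (lam s) (gam s) - angle (lam a) (lam s).
have phib : phi b = phi a.
  apply: (@continuous_mod_const R phi (pi *+ 2)) => //; first by rewrite mulrn_wgt0 ?pi_gt0.
    move=> s hs; have [cth _] := hth s hs.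
    apply: cvgB; last by apply: continuous_angle; [exact: cvg_cst|exact: cl|exact: h2].
    by apply: cvgB => //; apply: continuous_angle; [exact: cl|exact: cg|exact: h1].
  have key s : a <= s <= b -> exists n : int, phi s - t0 = pi *+ 2 *~ n.
    move=> hs; have [_ ag] := hth s hs.
    have := is_arg_angle (is_arg_angle ht0 (h2 s hs)) (h1 s hs).
    move=> /is_arg_eq/(_ ag)[]; first by have [] := not_opposite_neq0 (h1 s hs).
    by move=> n E; exists n; rewrite -E /phi; ring.
  move=> s /key[n hn]; have [m hm] := key a aa; exists (n - m).
  by rewrite mulrzBr -hn -hm; ring.
have a0 : angle (lam a) (lam a) = 0.
  by have := angleN (lam a) (lam a); lra.
by move: phib; rewrite /phi a0; lra.
Qed.

Lemma arg_on_const gam e a b th : a <= b -> arg_on gam a b th ->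
  (forall s, a <= s <= b -> {for s, continuous gam}) ->
  (forall s, a <= s <= b -> not_opposite e (gam s)) ->
  th b - th a = angle e (gam b) - angle e (gam a).
Proof.
move=> ab hth cg h; have e0 : e <> (0, 0).
  by have [] := not_opposite_neq0 (h a _); rewrite ?lexx.
have ee : not_opposite e e.
  by apply: not_opposite_dot; rewrite -nrm2_sqr exprn_gt0 // nrm2_gt0.
rewrite (arg_on_diff (lam := fun=> e) ab hth cg) //; last by move=> *; exact: cvg_cst.
have := angleN e e; lra.
Qed.

Lemma arg_on_exists (gam : R -> R * R) : continuous gam ->
  (forall s, 0 <= s <= 1 -> gam s <> (0, 0)) -> exists th, arg_on gam 0 1 th.
Proof.
move=> cg g0; have cf : continuous (fun z => gam z.1).
  by move=> z; apply: continuous_comp; [exact: cvg_fst|exact: cg].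
have [|th cth hth] := angle_lift cf; first by move=> z [/g0].
exists (fun s => th (s, 0)) => s hs; split; last by apply: (hth (s, 0)); split;
  rewrite //= lexx ler01.
apply: (@continuous_comp _ _ _ (fun s => (s, 0)) th); last exact: cth.
by apply: (@continuous_pair _ _ s id (fun=> 0)); [exact: cvg_id|exact: cvg_cst].
Qed.

(* [F] is locally orientation preserving at its zero [z]: it stays within a
   right angle of an invertible linear map. *)
Definition positive_zero (F : R * R -> R * R) z := exists v w d,
  [/\ 0 < d, 0 < det2 v w & forall t u, `|t - z.1| < d -> `|u - z.2| < d ->
    (t, u) <> z -> 0 < dot2 ((t - z.1) * v.1 + (u - z.2) * w.1,
                            (t - z.1) * v.2 + (u - z.2) * w.2) (F (t, u))].

Lemma not_opposite_near (F : R * R -> R * R) z : {for z, continuous F} -> F z <> (0, 0) ->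
  exists2 e : R, 0 < e & ball z e `<=` [set w | not_opposite (F z) (F w)].
Proof.
move=> cF Fz; apply/nbhs_ballP.
have ct : {for z, continuous (fun w => nrm2 (F z) * nrm2 (F w) + dot2 (F z) (F w))}.
  by apply: continuous_not_opposite; [exact: cvg_cst|exact: cF].
apply: (ct [set r | 0 < r]); apply: open_nbhs_nbhs; split; first exact: open_gt.
have := nrm2_gt0 Fz; have := nrm2_sqr (F z); rewrite expr2 => <- h.
by rewrite /= addr_gt0 // mulr_gt0.
Qed.

Section Square.
Variable F : R * R -> R * R.
Hypothesis cF : continuous F.
Hypothesis zero_pos : forall z, unit_square z -> F z = (0, 0) -> positive_zero F z.
Hypothesis boundary : forall t u, 0 <= t <= 1 -> 0 <= u <= 1 ->
  [\/ t = 0, t = 1, u = 0 | u = 1] -> F (t, u) <> (0, 0).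

Lemma isolated_zero z : unit_square z -> exists2 d, 0 < d & forall w, unit_square w ->
  `|w.1 - z.1| < d -> `|w.2 - z.2| < d -> F w = (0, 0) -> w = z.
Proof.
move=> hz; have [/(zero_pos hz)[v [w [d [d0 _ h]]]]|Fz] := pselect (F z = (0, 0)).
  exists d => // -[t u] _ /= ht hu Fw; apply: contrapT => /(h t u ht hu).
  by rewrite Fw /dot2 /= !mulr0 addr0 ltxx.
have [e e0 he] := not_opposite_near (@cF z) Fz.
exists e => // -[t u] _ /= ht hu Fw; exfalso.
have /he /= : ball z e (t, u) by split; rewrite /ball /= distrC.
by move=> /not_opposite_neq0[_]; rewrite Fw.
Qed.

(** The zeros are isolated and the square is compact; compactness enters through [interval_ind],
    once for each coordinate. *)
Lemma finite_zeros : exists r : seq (R * R), forall z, unit_square z -> F z = (0, 0) -> z \in r.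
Proof.
have dT (a b : R) : 0 <= a -> a < b -> b <= 1 -> exists2 c, True & a < c < b.
  by move=> _ ab _; exists ((a + b) / 2) => //; lra.
pose P a b := exists r : seq (R * R), forall z, unit_square z -> a <= z.1 <= b -> F z = (0,
  0) -> z \in r.
suff [r hr] : P 0 1 by exists r => z [h1 h2]; apply: hr.
apply: (@interval_ind (fun=> True)) => //.
  move=> a b c _ _ _ ab bc [r hr] [r' hr']; exists (r ++ r') => z hz /andP[z1 z2] Fz;
    rewrite mem_cat.
  have [zb|zb] := leP z.1 b; first by rewrite hr // z1 zb.
  by rewrite (hr' z) ?orbT // z2 (ltW zb).
move=> x hx.
pose Q c d := exists2 e, 0 < e & exists r : seq (R * R), forall z,
  unit_square z -> `|z.1 - x| < e ->
  c <= z.2 <= d -> F z = (0, 0) -> z \in r.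
have [e e0 [r hr]] : Q 0 1.
  apply: (@interval_ind (fun=> True)) => //.
    move=> a b c _ _ _ ab bc [e e0 [r hr]] [e' e0' [r' hr']]; exists (Num.min e e');
      first by rewrite lt_min e0.
    exists (r ++ r') => z hz; rewrite lt_min => /andP[xe xe'] /andP[z1 z2] Fz; rewrite mem_cat.
    have [zb|zb] := leP z.2 b; first by rewrite hr // z1 zb.
    by rewrite (hr' z) ?orbT // z2 (ltW zb).
  move=> y hy; have [|d d0 hd] := @isolated_zero (x, y); first by [].
  exists d => // a b _ _ a0 b1 /andP[ay yb] ab abd; exists d => //; exists [:: (x,
    y)] => z hz zx /andP[z1 z2] Fz.
  rewrite inE; apply/eqP; apply: hd => //=.
  rewrite ltr_norml; lra.
exists e => // a b _ _ a0 b1 /andP[ax xb] ab abe; exists r => z hz /andP[z1 z2] Fz;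
  apply: hr => //.
  by rewrite ltr_norml; lra.
by have [_] := hz.
Qed.

Let hline u := fun t => F (t, u).
Let vline t := fun u => F (t, u).

Let chline u : continuous (hline u).
Proof.
move=> t; apply: (@continuous_comp _ _ _ (fun t => (t, u)) F); last exact: cF.
by apply: (@continuous_pair _ _ t id (fun=> u)); [exact: cvg_id|exact: cvg_cst].
Qed.

Let cvline t : continuous (vline t).
Proof.
move=> u; apply: (@continuous_comp _ _ _ (fun u => (t, u)) F); last exact: cF.
by apply: (@continuous_pair _ _ u (fun=> t) id); [exact: cvg_cst|exact: cvg_id].
Qed.

(** The change of argument around the rectangle, counterclockwise from [(a, c)]. Only increments
    along one line occur, so the branches on different lines are independent and the sum is additive
    under subdivision. *)
Definition turning (H V : R -> R -> R) a b c d :=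
  (H c b - H c a) + (V b d - V b c) - (H d b - H d a) - (V a d - V a c).

(** The lines free of zeros of [F], along which rectangles may be cut. *)
Let Vt t := 0 <= t <= 1 /\ forall u, 0 <= u <= 1 -> F (t, u) <> (0, 0).
Let Vu u := 0 <= u <= 1 /\ forall t, 0 <= t <= 1 -> F (t, u) <> (0, 0).

Section Local.
Variables H V : R -> R -> R.
Hypothesis argH : forall u, Vu u -> arg_on (hline u) 0 1 (H u).
Hypothesis argV : forall t, Vt t -> arg_on (vline t) 0 1 (V t).

Let sub (a b s : R) : 0 <= a -> b <= 1 -> a <= s <= b -> 0 <= s <= 1.
Proof. by move=> a0 b1 /andP[h1 h2]; rewrite (le_trans a0 h1) (le_trans h2 b1). Qed.

(** Away from zeros, [F] is nowhere opposite to [F z] and the turning vanishes. At a zero, [F] is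
    compared on each side with the linear map [lam]; the corner terms cancel and four nonnegative
    angles of [lam] remain. *)
Lemma turning_local z : unit_square z -> exists2 e, 0 < e & forall a b c d,
  Vt a -> Vt b -> Vu c -> Vu d -> a <= z.1 <= b -> c <= z.2 <= d ->
  a < b -> c < d -> b - a < e -> d - c < e -> 0 <= turning H V a b c d.
Proof.
move=> hz; have [Fz|Fz] := pselect (F z = (0, 0)); last first.
  have [e e0 he] := not_opposite_near (@cF z) Fz.
  exists e => // a b c d Va Vb Vc Vd /andP[az zb] /andP[cz zd] ab cd abe cde.
  have near_z t u : a <= t <= b -> c <= u <= d -> not_opposite (F z) (F (t, u)).
    move=> /andP[t1 t2] /andP[u1 u2]; apply: he; split; rewrite /ball /= ltr_norml; lra.
  have [[/andP[a0 _] _] [/andP[_ b1] _] [/andP[c0 _] _] [/andP[_ d1] _]] := And4 Va Vb Vc Vd.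
  have h u : Vu u -> c <= u <= d -> H u b - H u a = angle (F z) (F (b, u)) - angle (F z) (F (a,
    u)).
    move=> Vu_ hu; apply: (arg_on_const (gam := hline u) (ltW ab)).
    - by move=> s hs; apply: argH => //; apply: sub hs.
    - by move=> s _; exact: chline.
    - by move=> s hs; apply: near_z.
  have v t : Vt t -> a <= t <= b -> V t d - V t c = angle (F z) (F (t, d)) - angle (F z) (F (t,
    c)).
    move=> Vt_ ht; apply: (arg_on_const (gam := vline t) (ltW cd)).
    - by move=> s hs; apply: argV => //; apply: sub hs.
    - by move=> s _; exact: cvline.
    - by move=> s hs; apply: near_z.
  by rewrite /turning !h ?v ?lexx ?(ltW ab) ?(ltW cd) //; lra.
have [v [w [e [e0 D h]]]] := zero_pos hz Fz.
pose lam t u : R * R := ((t - z.1) * v.1 + (u - z.2) * w.1, (t - z.1) * v.2 + (u - z.2) * w.2).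
have detlam t u t' u' : det2 (lam t u) (lam t' u') =
    ((t - z.1) * (u' - z.2) - (u - z.2) * (t' - z.1)) * det2 v w by rewrite /det2 /=; ring.
exists e => // a b c d Va Vb Vc Vd /andP[az zb] /andP[cz zd] ab cd abe cde.
have [[/andP[a0 a1] na] [/andP[b0 b1] nb] [/andP[c0 c1] nc] [/andP[d0 d1] nd]] :=
  And4 Va Vb Vc Vd.
have [hz1 hz2] := hz.
have zE : F (z.1, z.2) = (0, 0) by rewrite -surjective_pairing.
have {az} az : a < z.1 by rewrite lt_neqAle az andbT; apply/eqP => E; apply: (na z.2) => //;
  rewrite E.
have {zb} zb : z.1 < b by rewrite lt_neqAle zb andbT; apply/eqP => E; apply: (nb z.2) => //;
  rewrite -E.
have {cz} cz : c < z.2 by rewrite lt_neqAle cz andbT; apply/eqP => E; apply: (nc z.1) => //;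
  rewrite E.
have {zd} zd : z.2 < d by rewrite lt_neqAle zd andbT; apply/eqP => E; apply: (nd z.1) => //;
  rewrite -E.
have opF t u : a <= t <= b -> c <= u <= d -> (t, u) <> z -> not_opposite (lam t u) (F (t, u)).
  move=> /andP[t1 t2] /andP[u1 u2] ne; apply: not_opposite_dot; apply: h => //.
    by rewrite ltr_norml; lra.
  by rewrite ltr_norml; lra.
have clam t u : {for t, continuous (lam^~ u)}.
  apply: (@continuous_pair _ _ t (fun t => (t - z.1) * v.1 + (u - z.2) * w.1) (fun t =>
    (t - z.1) * v.2 + (u - z.2) * w.2));
   (apply: cvgD; last exact: cvg_cst); (apply: cvgM; last exact: cvg_cst);
   by apply: cvgB; [exact: cvg_id|exact: cvg_cst].
have clam' t u : {for u, continuous (lam t)}.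
  apply: (@continuous_pair _ _ u (fun u => (t - z.1) * v.1 + (u - z.2) * w.1) (fun u =>
    (t - z.1) * v.2 + (u - z.2) * w.2));
   (apply: cvgD; first exact: cvg_cst); (apply: cvgM; last exact: cvg_cst);
   by apply: cvgB; [exact: cvg_id|exact: cvg_cst].
have hE u : Vu u -> c <= u <= d -> u != z.2 -> H u b - H u a =
    angle (lam a u) (lam b u) + angle (lam b u) (F (b, u)) - angle (lam a u) (F (a, u)).
  move=> Vu_ hu uz; have ne t : (t, u) <> z by move=> E; move: uz; rewrite -E eqxx.
  apply: (arg_on_diff (gam := hline u) (lam := lam^~ u) (ltW ab)).
  - by move=> s hs; apply: argH => //; apply: sub hs.
  - by move=> s _; exact: chline.
  - by move=> s _.
  - by move=> s hs; apply: opF.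
  move=> s /andP[s1 s2]; have [->|sa] := eqVneq s a.
    have ha : a <= a <= b by rewrite lexx ltW.
    have [L0 _] := not_opposite_neq0 (opF a u ha hu (ne a)).
    by apply: not_opposite_dot; rewrite -nrm2_sqr exprn_gt0 // nrm2_gt0.
  apply: not_opposite_det; rewrite detlam mulf_neq0 //; last by rewrite gt_eqF.
  have -> : (a - z.1) * (u - z.2) - (u - z.2) * (s - z.1) = (u - z.2) * (a - s) by ring.
  by rewrite mulf_neq0 ?subr_eq0 // eq_sym.
have vE t : Vt t -> a <= t <= b -> t != z.1 -> V t d - V t c =
    angle (lam t c) (lam t d) + angle (lam t d) (F (t, d)) - angle (lam t c) (F (t, c)).
  move=> Vt_ ht tz; have ne u : (t, u) <> z by move=> E; move: tz; rewrite -E eqxx.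
  apply: (arg_on_diff (gam := vline t) (lam := lam t) (ltW cd)).
  - by move=> s hs; apply: argV => //; apply: sub hs.
  - by move=> s _; exact: cvline.
  - by move=> s _.
  - by move=> s hs; apply: opF.
  move=> s /andP[s1 s2]; have [->|sa] := eqVneq s c.
    have hc : c <= c <= d by rewrite lexx ltW.
    have [L0 _] := not_opposite_neq0 (opF t c ht hc (ne c)).
    by apply: not_opposite_dot; rewrite -nrm2_sqr exprn_gt0 // nrm2_gt0.
  apply: not_opposite_det; rewrite detlam mulf_neq0 //; last by rewrite gt_eqF.
  have -> : (t - z.1) * (s - z.2) - (c - z.2) * (t - z.1) = (t - z.1) * (s - c) by ring.
  by rewrite mulf_neq0 ?subr_eq0.
have np P Q : det2 P Q != 0 -> 0 <= det2 P Q -> 0 <= angle P Q.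
  by move=> n0; apply: angle_ge0; apply: not_opposite_det.
have pos P Q : 0 < det2 P Q -> 0 <= angle P Q by move=> p0; apply: np; rewrite ?gt_eqF // ltW.
have A1 : 0 <= angle (lam a c) (lam b c) by apply: pos; rewrite detlam; apply: mulr_gt0 => //;
  nra.
have A2 : 0 <= angle (lam b c) (lam b d) by apply: pos; rewrite detlam; apply: mulr_gt0 => //;
  nra.
have A3 : 0 <= angle (lam b d) (lam a d) by apply: pos; rewrite detlam; apply: mulr_gt0 => //;
  nra.
have A4 : 0 <= angle (lam a d) (lam a c) by apply: pos; rewrite detlam; apply: mulr_gt0 => //;
  nra.
rewrite (angleN (lam a d)) in A3; rewrite (angleN (lam a c)) in A4.
rewrite /turning hE ?vE ?hE ?vE ?lexx ?(ltW ab) ?(ltW cd) ?(lt_eqF az) ?(gt_eqF zb)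
  ?(lt_eqF cz) ?(gt_eqF zd) //.
lra.
Qed.
End Local.

(** One coordinate is subdivided inside the subdivision of the other, along lines that avoid the
    finitely many zeros. *)
Theorem turning_ge0 : exists H V : R -> R -> R, 
  [/\ forall u, u = 0 \/ u = 1 -> arg_on (hline u) 0 1 (H u),
      forall t, t = 0 \/ t = 1 -> arg_on (vline t) 0 1 (V t)
    & 0 <= turning H V 0 1 0 1].
Proof.
have [H argH] : exists H : R -> R -> R, forall u, Vu u -> arg_on (hline u) 0 1 (H u).
  suff /choice [H hH] : forall u, exists th, Vu u -> arg_on (hline u) 0 1 th by exists H.
  move=> u.
  have [Vu_|nV] := pselect (Vu u); last by exists (fun=> 0).
  by have [th hth] := arg_on_exists (@chline u) Vu_.2; exists th.
have [V argV] : exists V : R -> R -> R, forall t, Vt t -> arg_on (vline t) 0 1 (V t).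
  suff /choice [V hV] : forall t, exists th, Vt t -> arg_on (vline t) 0 1 th by exists V.
  move=> t.
  have [Vt_|nV] := pselect (Vt t); last by exists (fun=> 0).
  by have [th hth] := arg_on_exists (@cvline t) Vt_.2; exists th.
have [r hr] := finite_zeros.
have i0 : 0 <= (0 : R) <= 1 by rewrite lexx ler01.
have i1 : 0 <= (1 : R) <= 1 by rewrite lexx ler01.
have Vt0 : Vt 0 by split=> // u hu; apply: boundary => //; apply: Or41.
have Vt1 : Vt 1 by split=> // u hu; apply: boundary => //; apply: Or42.
have Vu0 : Vu 0 by split=> // u hu; apply: boundary => //; apply: Or43.
have Vu1 : Vu 1 by split=> // u hu; apply: boundary => //; apply: Or44.
exists H, V; split; try by move=> s [->|->]; auto.
have dVt a b : 0 <= a -> a < b -> b <= 1 -> exists2 c, Vt c & a < c < b.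
  move=> a0 ab b1; have [c cr /andP[ac cb]] := avoid_seq (map fst r) ab.
  exists c; rewrite ?ac //; have hc : 0 <= c <= 1 by lra.
  split=> // u hu Fc; move/negP: cr; apply; apply/mapP; exists (c, u) => //.
  by apply: hr.
have dVu a b : 0 <= a -> a < b -> b <= 1 -> exists2 c, Vu c & a < c < b.
  move=> a0 ab b1; have [c cr /andP[ac cb]] := avoid_seq (map snd r) ab.
  exists c; rewrite ?ac //; have hc : 0 <= c <= 1 by lra.
  split=> // t ht Fc; move/negP: cr; apply; apply/mapP; exists (t, c) => //.
  by apply: hr.
apply: (interval_ind (P := fun a b => 0 <= turning H V a b 0 1) Vt0 Vt1 dVt).
  by move=> a b c _ _ _ _ _; rewrite /turning; lra.
move=> x hx.
apply: (interval_ind (P := fun c d => exists2 e, 0 < e & forall a b,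
  Vt a -> Vt b -> 0 <= a -> b <= 1 ->
  a <= x <= b -> a < b -> b - a < e -> 0 <= turning H V a b c d) Vu0 Vu1 dVu).
  move=> c d e _ _ _ _ _ [s s0 hs] [s' s0' hs']; exists (Num.min s s');
    first by rewrite lt_min s0.
  move=> a b Va Vb a0 b1 hx' ab; rewrite lt_min => /andP[abs abs'].
  by have := hs a b Va Vb a0 b1 hx' ab abs; have := hs' a b Va Vb a0 b1 hx' ab abs';
    rewrite /turning; lra.
move=> y hy; have [|e e0 he] := @turning_local H V argH argV (x, y); first by [].
exists e => // c d Vc Vd c0 d1 hcd cd cde; exists e => // a b Va Vb a0 b1 hab ab abe.
exact: (he a b c d).
Qed.
End Square.
End Winding.

(** * Existence of crossings that are not positive zeros *)

Section Crossing.
Variable R : realType.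
Implicit Types (s t u : R) (z v w P Q : R * R).

Lemma is_derive_approx (f : R -> R) t d e : is_derive t 1 f d -> 0 < e ->
  exists2 r, 0 < r & forall s, `|s - t| < r -> `|f s - f t - (s - t) * d| <= e * `|s - t|.
Proof.
move=> [df <-] e0; have := df; rewrite /derivable => /cvgrPdist_le/(_ e e0).
rewrite -/('D_1 f t) => /nbhs_ballP[r /= r0 hr]; exists r => // s hs.
have [->|st] := eqVneq s t; first by rewrite !subrr mul0r subrr normr0 mulr0.
have st0 : s - t != 0 by rewrite subr_eq0.
have := hr (s - t); rewrite /ball /= sub0r normrN => /(_ hs st0).
rewrite [(s - t) *: 1]mulr1 /= subrK => H.
have -> : f s - f t - (s - t) * 'D_1 f t = - (('D_1 f t - (s - t)^-1 * (f s - f t)) * (s - t)).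
  by field.
by rewrite normrN normrM ler_pM2r ?normr_gt0.
Qed.

(** For [N = |X| + |Y|], Cramer's rule gives [|det2 v w| * s <= 2 * K * N]. The factor [8 * K] thus
    makes the errors at most [N / 4], against [X ^ 2 + Y ^ 2 >= N ^ 2 / 2]. *)
Lemma perturbed_linear_dot v w (x y e1 e2 K : R) : det2 v w != 0 ->
  0 < `|x| + `|y| -> `|v.1| <= K -> `|v.2| <= K -> `|w.1| <= K -> `|w.2| <= K -> 0 < K ->
  `|e1| <= `|det2 v w| / (8 * K) * (`|x| + `|y|) -> `|e2| <= `|det2 v w| / (8 * K) * (`|x|
    + `|y|) ->
  0 < dot2 (x * v.1 + y * w.1, x * v.2 + y * w.2) (x * v.1 + y * w.1 + e1,
    x * v.2 + y * w.2 + e2).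
Proof.
move=> D0 s0 v1 v2 w1 w2 K0.
set X := x * v.1 + y * w.1; set Y := x * v.2 + y * w.2; set D := det2 v w; set s := `|x| + `|y|.
move=> h1 h2; pose N := `|X| + `|Y|.
have N0 : 0 <= N by rewrite addr_ge0.
have le2 (a b c d : R) : `|b| <= K -> `|d| <= K -> `|a * b - c * d| <= K * (`|a| + `|c|).
  move=> hb hd; apply: le_trans (ler_normB _ _) _; rewrite !normrM mulrDr ![K * _]mulrC.
  by apply: lerD; apply: ler_wpM2l.
have Dx : `|D| * `|x| <= K * N.
  have -> : `|D| * `|x| = `|X * w.2 - Y * w.1|.
    by rewrite -normrM; congr (`|_|); rewrite /D /X /Y /det2; ring.
  exact: le2.
have Dy : `|D| * `|y| <= K * N.
  have -> : `|D| * `|y| = `|Y * v.1 - X * v.2|.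
    by rewrite -normrM; congr (`|_|); rewrite /D /X /Y /det2; ring.
  by rewrite (_ : N = `|Y| + `|X|); [apply: le2|rewrite /N addrC].
have Ds : `|D| * s <= 2 * K * N by rewrite /s mulrDr; lra.
have E : `|D| / (8 * K) * s * (4 * K) <= K * N.
  have -> : `|D| / (8 * K) * s * (4 * K) = `|D| * s / 2 by field; rewrite gt_eqF.
  lra.
set e := `|D| / (8 * K) * s in h1 h2 E.
have e0 : 0 < e by rewrite mulr_gt0 // divr_gt0 ?normr_gt0 // mulr_gt0.
have eN : 4 * e <= N by rewrite -(ler_pM2l K0); apply: le_trans E;
  rewrite mulrCA mulrA [e * _]mulrC mulrCA; lra.
have N2 : N ^+ 2 <= 2 * (X ^+ 2 + Y ^+ 2).
  rewrite -[X ^+ 2](real_normK (num_real X)) -[Y ^+ 2](real_normK (num_real Y)) /N;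
    have := sqr_ge0 (`|X| - `|Y|); rewrite !expr2; lra.
have F : - (e * N) <= X * e1 + Y * e2.
  have : `|X * e1 + Y * e2| <= e * N.
    apply: le_trans (ler_normD _ _) _; rewrite !normrM /N mulrDr ![e * _]mulrC.
    by apply: lerD; apply: ler_wpM2l.
  by rewrite ler_norml => /andP[].
rewrite /dot2 /=; have -> : X * (X + e1) + Y * (Y + e2) = (X ^+ 2 + Y ^+ 2) + (X * e1 + Y * e2)
  by ring.
have : e * N <= N ^+ 2 / 4.
  by rewrite (_ : N ^+ 2 / 4 = N / 4 * N); [rewrite ler_wpM2r //; lra|rewrite expr2 mulrAC].
have : 0 < N ^+ 2 by rewrite exprn_gt0 //; lra.
lra.
Qed.

(** The derivative of [h u - g t] has columns [- v] and [w], hence determinant [- det2 v w]: a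
    crossing from left to right is a positive zero. *)
Lemma positive_zero_derive (g h : R -> R * R) z v w :
  is_derive z.1 1 (fun t => (g t).1) v.1 -> is_derive z.1 1 (fun t => (g t).2) v.2 ->
  is_derive z.2 1 (fun t => (h t).1) w.1 -> is_derive z.2 1 (fun t => (h t).2) w.2 ->
  g z.1 = h z.2 -> det2 v w < 0 -> positive_zero (fun z => h z.2 - g z.1) z.
Proof.
move=> g1 g2 h1 h2 gh D.
have D' : 0 < det2 (- v.1, - v.2) w by move: D; rewrite /det2 /=; lra.
pose K := `|v.1| + `|v.2| + `|w.1| + `|w.2| + 1.
have [a1 a2 a3 a4] := And4 (normr_ge0 v.1) (normr_ge0 v.2) (normr_ge0 w.1) (normr_ge0 w.2).
have K0 : 0 < K by rewrite /K; lra.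
set e := `|det2 (- v.1, - v.2) w| / (8 * K).
have e0 : 0 < e by rewrite divr_gt0 ?mulr_gt0 // normr_gt0 gt_eqF.
have [r1 r10 b1] := is_derive_approx g1 e0; have [r2 r20 b2] := is_derive_approx g2 e0.
have [r3 r30 b3] := is_derive_approx h1 e0; have [r4 r40 b4] := is_derive_approx h2 e0.
exists (- v.1, - v.2), w, (Num.min (Num.min r1 r2) (Num.min r3 r4)); split=> //.
  by rewrite !lt_min r10 r20 r30 r40.
move=> t u; rewrite !lt_min => /andP[/andP[t1 t2] _] /andP[_ /andP[u3 u4]] ne.
have bnd (a b c d : R) : `|a - c| <= e * `|u - z.2| -> `|b - d| <= e * `|t - z.1| ->
    `|(a - b) - (c - d)| <= e * (`|t - z.1| + `|u - z.2|).
  move=> k1 k2; have -> : a - b - (c - d) = (a - c) - (b - d) by ring.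
  by apply: le_trans (ler_normB _ _) _; rewrite mulrDr addrC; apply: lerD.
have s0 : 0 < `|t - z.1| + `|u - z.2|.
  rewrite lt_neqAle addr_ge0 // andbT eq_sym paddr_eq0 // !normr_eq0 !subr_eq0.
  by apply/negP => /andP[/eqP tz /eqP uz]; apply: ne; rewrite tz uz -surjective_pairing.
have Hd : h u - g t = ((t - z.1) * (- v.1) + (u - z.2) * w.1 + (((h u).1 - (h z.2).1)
  - ((g t).1 - (g z.1).1) - ((u - z.2) * w.1 - (t - z.1) * v.1)),
   (t - z.1) * (- v.2) + (u - z.2) * w.2 + (((h u).2 - (h z.2).2) - ((g t).2 - (g z.1).2)
     - ((u - z.2) * w.2 - (t - z.1) * v.2))).
  by rewrite gh [LHS]surjective_pairing; congr (_, _); rewrite /=; ring.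
rewrite /= Hd; apply: (perturbed_linear_dot (v := (- v.1, - v.2)) (K := K)) => //=;
  rewrite ?normrN.
- by rewrite gt_eqF.
- by rewrite /K; lra.
- by rewrite /K; lra.
- by rewrite /K; lra.
- by rewrite /K; lra.
- by apply: bnd; [exact: b3|exact: b1].
- by apply: bnd; [exact: b4|exact: b2].
Qed.

Lemma not_opposite_side (y x : R) (s : R) : s != 0 -> 0 <= s * y -> (x, y) <> (0,
  0) -> not_opposite (0, s) (x, y).
Proof.
move=> s0 sy xy; have [x0|x0] := eqVneq x 0; last first.
  by apply: not_opposite_det; rewrite /det2 /= mul0r sub0r oppr_eq0 mulf_neq0.
apply: not_opposite_dot; rewrite /dot2 /= mul0r add0r lt_neqAle sy andbT eq_sym mulf_neq0 //.
by apply/eqP => y0; apply: xy; rewrite x0 y0.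
Qed.

(** [atan 1 *+ 2] is a right angle. *)
Lemma angle_vertical (x s : R) : x != 0 -> s != 0 ->
  angle (0, s) (x, 0) = - (Num.sg s * Num.sg x * (atan 1 *+ 2)).
Proof.
move=> x0 s0; rewrite /angle.
have -> : det2 (0, s) (x, 0) / (nrm2 (0, s) * nrm2 (x, 0) + dot2 (0, s) (x,
  0)) = - (Num.sg s * Num.sg x).
  rewrite /det2 /dot2 /nrm2 /dot2 /= !(mul0r, mulr0, add0r, addr0, sub0r) -!expr2 !sqrtr_sqr.
  rewrite {1}[s]numEsg {1}[x]numEsg mulNr; congr (- _).
  by field; rewrite !normr_eq0 x0 s0.
rewrite atanN; have [sx|sx] : Num.sg s * Num.sg x = 1 \/ Num.sg s * Num.sg x = -1.
  by rewrite -sgrM; case: sgrP => h; [move/eqP: h;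
    rewrite mulf_eq0 (negPf s0) (negPf x0)|left|right].
  by rewrite sx mul1r mulNrn.
by rewrite sx atanN mulN1r !opprK.
Qed.

(* The side of the boundary line of height [y] in which the strip lies. *)
Definition inward (y : R) : R := 1 - 2 * y.

(** If every zero were positive, [turning_ge0] would contradict the last inequality. On each side of
    the square one curve rests at an end point on a boundary line, so the difference stays in a
    closed half plane and its change of argument is read off at the corners. *)
Lemma crossing_exists (g h : R -> R * R) P Q P' Q' :
  continuous g -> continuous h -> g 0 = P -> g 1 = Q -> h 0 = P' -> h 1 = Q' ->
  (forall t, 0 < t < 1 -> 0 < (g t).2 < 1) -> (forall t, 0 < t < 1 -> 0 < (h t).2 < 1) ->
  (forall z, z \in [:: P; Q; P'; Q'] -> z.2 = 0 \/ z.2 = 1) ->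
  [/\ P' != P, P' != Q, Q' != P & Q' != Q] ->
  let F z w := (z.1 - w.1, z.2 - w.2) in
  angle (0, - inward P'.2) (F P' Q) - angle (0, - inward P'.2) (F P' P)
  + (angle (0, inward Q.2) (F Q' Q) - angle (0, inward Q.2) (F P' Q))
  - (angle (0, - inward Q'.2) (F Q' Q) - angle (0, - inward Q'.2) (F Q' P))
  - (angle (0, inward P.2) (F Q' P) - angle (0, inward P.2) (F P' P)) < 0 ->
  exists t u, [/\ 0 < t < 1, 0 < u < 1, g t = h u & ~ positive_zero (fun z => h z.2 - g z.1)
    (t, u)].
Proof.
move=> cg ch g0 g1 h0 h1 ig ih ends [n00 n10 n01 n11] D turn.
apply: contrapT => nC; pose F z := h z.2 - g z.1.
have DE (z w : R * R) : z - w = D z w by [].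
have D0 z w : z != w -> D z w <> (0, 0) by rewrite -DE => + /eqP; rewrite subr_eq0 => /negPf ->.
have [eP eQ eP' eQ'] : [/\ P.2 = 0 \/ P.2 = 1, Q.2 = 0 \/ Q.2 = 1,
  P'.2 = 0 \/ P'.2 = 1 & Q'.2 = 0 \/ Q'.2 = 1].
  by split; apply: ends; rewrite !inE eqxx ?orbT.
have hR u : 0 <= u <= 1 -> 0 <= (h u).2 <= 1 /\ ((h u).2 = 0 \/ (h u).2 = 1 -> u = 0 \/ u = 1).
  move=> /andP[]; rewrite le_eqVlt => /predU1P[<- _|u0].
    by split; [rewrite h0; case: eP' => ->; rewrite lexx ler01|left].
  rewrite le_eqVlt => /predU1P[->|u1].
    by split; [rewrite h1; case: eQ' => ->; rewrite lexx ler01|right].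
  have /ih /andP[i0 i1] : 0 < u < 1 by rewrite u0.
  by split; [rewrite !ltW|move=> [E|E]; move: i0 i1; rewrite E ltxx].
have gR u : 0 <= u <= 1 -> 0 <= (g u).2 <= 1 /\ ((g u).2 = 0 \/ (g u).2 = 1 -> u = 0 \/ u = 1).
  move=> /andP[]; rewrite le_eqVlt => /predU1P[<- _|u0].
    by split; [rewrite g0; case: eP => ->; rewrite lexx ler01|left].
  rewrite le_eqVlt => /predU1P[->|u1].
    by split; [rewrite g1; case: eQ => ->; rewrite lexx ler01|right].
  have /ig /andP[i0 i1] : 0 < u < 1 by rewrite u0.
  by split; [rewrite !ltW|move=> [E|E]; move: i0 i1; rewrite E ltxx].
(* On the boundary of the square one curve has height [0] or [1]. At a common point the other has it
   too and is therefore at one of its ends, but the end points are distinct. *)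
have bd t u : 0 <= t <= 1 -> 0 <= u <= 1 -> [\/ t = 0, t = 1, u = 0 | u = 1] -> g t <> h u.
  move=> ht hu; have [_ Hu] := hR u hu; have [_ Ht] := gR t ht; case=> e; rewrite e => E.
  - have [] := Hu; first by rewrite -E g0.
      by move=> e'; move: E n00; rewrite e' g0 h0 => ->; rewrite eqxx.
    by move=> e'; move: E n01; rewrite e' g0 h1 => ->; rewrite eqxx.
  - have [] := Hu; first by rewrite -E g1.
      by move=> e'; move: E n10; rewrite e' g1 h0 => ->; rewrite eqxx.
    by move=> e'; move: E n11; rewrite e' g1 h1 => ->; rewrite eqxx.
  - have [] := Ht; first by rewrite E h0.
      by move=> e'; move: E n00; rewrite e' g0 h0 => ->; rewrite eqxx.
    by move=> e'; move: E n10; rewrite e' g1 h0 => ->; rewrite eqxx.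
  - have [] := Ht; first by rewrite E h1.
      by move=> e'; move: E n01; rewrite e' g0 h1 => ->; rewrite eqxx.
    by move=> e'; move: E n11; rewrite e' g1 h1 => ->; rewrite eqxx.
have cF : continuous F.
  move=> z; apply: cvgB.
    by apply: (@continuous_comp _ _ _ snd h); [exact: cvg_snd|exact: ch].
  by apply: (@continuous_comp _ _ _ fst g); [exact: cvg_fst|exact: cg].
have F0 z : F z = (0, 0) -> g z.1 = h z.2 by move=> /eqP; rewrite subr_eq0 => /eqP.
have bF t u : 0 <= t <= 1 -> 0 <= u <= 1 -> [\/ t = 0, t = 1, u = 0 | u = 1] -> F (t, u) <> (0,
  0).
  by move=> ht hu b /F0; apply: bd.
have zp z : unit_square z -> F z = (0, 0) -> positive_zero F z.
  move=> [z1 z2] Fz; apply: contrapT => np; apply: nC; exists z.1, z.2;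
    rewrite -surjective_pairing.
  have lt01 (x : R) : 0 <= x <= 1 -> x != 0 -> x != 1 -> 0 < x < 1.
    by move=> /andP[x0 x1] e0 e1; rewrite !lt_neqAle x0 x1 eq_sym e0 e1.
  split=> //; last exact: F0.
    by apply: lt01 => //; apply/eqP => e; [apply: (bF z.1 z.2 z1 z2 (Or41 _ _ _ e))|apply:
      (bF z.1 z.2 z1 z2 (Or42 _ _ _ e))]; rewrite -surjective_pairing.
  by apply: lt01 => //; apply/eqP => e; [apply: (bF z.1 z.2 z1 z2 (Or43 _ _ _ e))|apply:
    (bF z.1 z.2 z1 z2 (Or44 _ _ _ e))]; rewrite -surjective_pairing.
have [H [V [argH argV]]] := turning_ge0 cF zp bF.
have inw y : y = 0 \/ y = 1 -> inward y != 0.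
  by rewrite /inward => -[->|->]; apply/eqP; lra.
have inw' y x : y = 0 \/ y = 1 -> 0 <= x <= 1 -> 0 <= inward y * (x - y).
  by rewrite /inward => -[->|->] /andP[x0 x1]; nra.
have i0 : 0 <= (0 : R) <= 1 by rewrite lexx ler01.
have i1 : 0 <= (1 : R) <= 1 by rewrite lexx ler01.
have hline u : continuous (fun t => F (t, u)).
  move=> t; apply: (@continuous_comp _ _ _ (fun t => (t, u)) F); last exact: cF.
  by apply: (@continuous_pair _ _ t id (fun=> u)); [exact: cvg_id|exact: cvg_cst].
have vline t : continuous (fun u => F (t, u)).
  move=> u; apply: (@continuous_comp _ _ _ (fun u => (t, u)) F); last exact: cF.
  by apply: (@continuous_pair _ _ u (fun=> t) id); [exact: cvg_cst|exact: cvg_id].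
have Hd u : u = 0 \/ u = 1 -> H u 1 - H u 0 =
    angle (0, - inward (h u).2) (F (1, u)) - angle (0, - inward (h u).2) (F (0, u)).
  move=> hu; have u01 : 0 <= u <= 1 by case: hu => ->.
  have hu2 : (h u).2 = 0 \/ (h u).2 = 1 by case: hu => ->; rewrite ?h0 ?h1.
  apply: (arg_on_const ler01 (argH u hu)) => s hs; first exact: hline.
  rewrite [F _]surjective_pairing; apply: not_opposite_side.
  - by rewrite oppr_eq0 inw.
  - by rewrite mulNr -mulrN opprB; apply: inw' => //; have [] := gR s hs.
  - by rewrite -surjective_pairing; apply: bF => //; case: hu => ->; [apply: Or43|apply: Or44].
have Vd t : t = 0 \/ t = 1 -> V t 1 - V t 0 =
    angle (0, inward (g t).2) (F (t, 1)) - angle (0, inward (g t).2) (F (t, 0)).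
  move=> ht; have t01 : 0 <= t <= 1 by case: ht => ->.
  have ht2 : (g t).2 = 0 \/ (g t).2 = 1 by case: ht => ->; rewrite ?g0 ?g1.
  apply: (arg_on_const ler01 (argV t ht)) => s hs; first exact: vline.
  rewrite [F _]surjective_pairing; apply: not_opposite_side.
  - by rewrite inw.
  - by apply: inw' => //; have [] := hR s hs.
  - by rewrite -surjective_pairing; apply: bF => //; case: ht => ->; [apply: Or41|apply: Or42].
rewrite /turning !Hd ?Vd; auto.
rewrite /F /= g0 g1 h0 h1 !DE => /le_lt_trans /(_ turn); by rewrite ltxx.
Qed.
End Crossing.

(** * Lower bound for the number of positive crossings *)

Section LowerBound.
Variable R : realType.
Implicit Types (s t u : R) (z w v P Q : R * R).

(* The contribution of a corner of the square to the turning number, in units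
   of [pi]. *)
Definition corner z w : R :=
  if z.2 == w.2 then Num.sg (inward z.2) * Num.sg (z.1 - w.1) else 0.

(** [atan 1 *+ 4] is pi. At different heights the two reference directions coincide and the angles
    cancel; at equal heights they are opposite and two right angles add up. *)
Lemma corner_angle z w : z.2 = 0 \/ z.2 = 1 -> w.2 = 0 \/ w.2 = 1 -> z != w ->
  angle (0, - inward z.2) (z.1 - w.1, z.2 - w.2) - angle (0, inward w.2) (z.1 - w.1,
    z.2 - w.2) =
  corner z w * (atan 1 *+ 4).
Proof.
move=> z2 w2 zw; rewrite /corner; case: eqP => [e|ne]; last first.
  rewrite (_ : - inward z.2 = inward w.2) ?subrr ?mul0r // /inward.
  by case: z2 ne => ->; case: w2 => -> // _; lra.
have s0 : inward z.2 != 0 by rewrite /inward; case: z2 => ->; apply/eqP; lra.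
have x0 : z.1 - w.1 != 0.
  rewrite subr_eq0; apply: contra zw => /eqP e1.
  by rewrite [z]surjective_pairing [w]surjective_pairing e e1.
rewrite -e subrr !angle_vertical ?oppr_eq0 // sgrN -[4%N]/(2 * 2)%N mulrnA.
by rewrite !mulNr opprK mulr2n; ring.
Qed.

Lemma crossing_exists_corner (g h : R -> R * R) P Q P' Q' :
  continuous g -> continuous h -> g 0 = P -> g 1 = Q -> h 0 = P' -> h 1 = Q' ->
  (forall t, 0 < t < 1 -> 0 < (g t).2 < 1) -> (forall t, 0 < t < 1 -> 0 < (h t).2 < 1) ->
  (forall z, z \in [:: P; Q; P'; Q'] -> z.2 = 0 \/ z.2 = 1) ->
  [/\ P' != P, P' != Q, Q' != P & Q' != Q] ->
  corner P' Q + corner Q' P < corner P' P + corner Q' Q ->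
  exists t u, [/\ 0 < t < 1, 0 < u < 1, g t = h u & ~ positive_zero (fun z => h z.2 - g z.1)
    (t, u)].
Proof.
move=> cg ch g0 g1 h0 h1 ig ih ends ne C.
apply: (crossing_exists cg ch g0 g1 h0 h1 ig ih ends ne).
have [eP eQ eP' eQ'] : [/\ P.2 = 0 \/ P.2 = 1, Q.2 = 0 \/ Q.2 = 1,
  P'.2 = 0 \/ P'.2 = 1 & Q'.2 = 0 \/ Q'.2 = 1].
  by split; apply: ends; rewrite !inE eqxx ?orbT.
have [n00 n10 n01 n11] := ne.
have k0 : 0 < atan 1 *+ 4 :> R by rewrite mulrn_wgt0 // -[X in X < _](@atan0 R) lt_atan.
have := corner_angle eP' eP n00; have := corner_angle eP' eQ n10.
have := corner_angle eQ' eP n01; have := corner_angle eQ' eQ n11.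
move=> c11 c01 c10 c00.
have : (corner P' Q + corner Q' P - corner P' P - corner Q' Q) * (atan 1 *+ 4) < 0.
  by rewrite pmulr_llt0 //; lra.
rewrite !mulrDl !mulNr -c11 -c01 -c10 -c00; lra.
Qed.

Variables p q : nat.
Hypotheses (hp : (0 < p)%N) (hq : (0 < q)%N).

Definition source (d : curve_type) : R * R :=
  match d with
  | Chord i j => outer_pt R q j
  | Loop b a c => if b then outer_pt R q a else inner_pt R p a
  end.

Definition target (d : curve_type) : R * R :=
  match d with
  | Chord i j => inner_pt R p i
  | Loop b a c => if b then outer_pt R q c else inner_pt R p c
  end.

Lemma ltr_div_int (r : nat) (a b m : int) : (0 < r)%N ->
  (a%:~R / r%:R + m%:~R < b%:~R / r%:R :> R) = (a + m * r%:Z < b).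
Proof.
move=> r0; have rR : 0 < r%:R :> R by rewrite ltr0n.
rewrite ltr_pdivlMr // mulrDl divfK ?gt_eqF // -(ltr_int R) intrD intrM.
by rewrite -pmulrn.
Qed.

Lemma gtr_div_int (r : nat) (a b m : int) : (0 < r)%N ->
  (b%:~R / r%:R < a%:~R / r%:R + m%:~R :> R) = (b < a + m * r%:Z).
Proof.
move=> r0; have rR : 0 < r%:R :> R by rewrite ltr0n.
rewrite ltr_pdivrMr // mulrDl divfK ?gt_eqF // -(ltr_int R) intrD intrM.
by rewrite -pmulrn.
Qed.

Lemma source_height d : (source d).2 = 0 \/ (source d).2 = 1.
Proof. by case: d => [i j|[] a c]; [left|left|right]. Qed.

Lemma target_height d : (target d).2 = 0 \/ (target d).2 = 1.
Proof. by case: d => [i j|[] a c]; [right|left|right]. Qed.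

Lemma neq_fst z w : z.1 < w.1 \/ w.1 < z.1 -> z != w.
Proof. by move=> h; apply/eqP => e; move: h; rewrite e ltxx => -[]. Qed.

Lemma neq_snd z w : z.2 != w.2 -> z != w.
Proof. by move=> h; apply: contra h => /eqP ->. Qed.

(** In every case the two sides of the inequality differ by [2]: the boundary makes one full turn in
    the negative direction. *)
Lemma corner_pos_shift d d' (m : int) (sh := fun z : R * R => (z.1 + m%:~R, z.2 + 0)) :
  pos_shift p q d d' m ->
  [/\ sh (source d') != source d, sh (source d') != target d,
      sh (target d') != source d & sh (target d') != target d] /\
  corner (sh (source d')) (target d) + corner (sh (target d')) (source d) <
  corner (sh (source d')) (source d) + corner (sh (target d')) (target d).
Proof.
have c0 (x y : R) : x < y -> corner (x, 0 + 0) (y, 0) = -1.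
  by move=> h; rewrite /corner addr0 eqxx /inward /= mulr0 subr0 sgr1 mul1r ltr0_sg // subr_lt0.
have c0' (x y : R) : y < x -> corner (x, 0 + 0) (y, 0) = 1.
  by move=> h; rewrite /corner addr0 eqxx /inward /= mulr0 subr0 sgr1 mul1r gtr0_sg // subr_gt0.
have i1 : inward (1 : R) = -1 by rewrite /inward; lra.
have c1 (x y : R) : x < y -> corner (x, 1 + 0) (y, 1) = 1.
  by move=> h; rewrite /corner addr0 eqxx /= i1 sgrN sgr1 mulN1r ltr0_sg ?opprK // subr_lt0.
have c1' (x y : R) : y < x -> corner (x, 1 + 0) (y, 1) = -1.
  by move=> h; rewrite /corner addr0 eqxx /= i1 sgrN sgr1 mulN1r gtr0_sg // subr_gt0.
have c01 (x y : R) : corner (x, 0 + 0) (y, 1) = 0.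
  by rewrite /corner addr0 /= eq_sym oner_eq0.
have c10 (x y : R) : corner (x, 1 + 0) (y, 0) = 0.
  by rewrite /corner addr0 /= oner_eq0.
have cE := (c01, c10); have n01 : 0 + 0 != 1 :> R by rewrite addr0 eq_sym oner_eq0.
have n10 : 1 + 0 != 0 :> R by rewrite addr0 oner_eq0.
case: d => [i j|b a c]; case: d' => [i' j'|b' a' c'] //=; rewrite /sh /=.
- move=> /andP[h1 h2].
  have x0 : j%:~R / q%:R < j'%:~R / q%:R + m%:~R :> R by rewrite gtr_div_int.
  have x1 : i'%:~R / p%:R + m%:~R < i%:~R / p%:R :> R by rewrite ltr_div_int.
  split; first by split; try (by apply: neq_snd); apply: neq_fst; rewrite /= ?x0 ?x1; auto.
  by rewrite !cE (c0' _ _ x0) (c1 _ _ x1); lra.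
- case: b => /= /andP[h1 h2].
    have x0 : a%:~R / q%:R < j'%:~R / q%:R + m%:~R :> R by rewrite gtr_div_int.
    have x1 : j'%:~R / q%:R + m%:~R < c%:~R / q%:R :> R by rewrite ltr_div_int.
    split; first by split; try (by apply: neq_snd); apply: neq_fst; rewrite /= ?x0 ?x1; auto.
    by rewrite !cE (c0' _ _ x0) (c0 _ _ x1); lra.
  have x0 : a%:~R / p%:R < i'%:~R / p%:R + m%:~R :> R by rewrite gtr_div_int.
  have x1 : i'%:~R / p%:R + m%:~R < c%:~R / p%:R :> R by rewrite ltr_div_int.
  split; first by split; try (by apply: neq_snd); apply: neq_fst; rewrite /= ?x0 ?x1; auto.
  by rewrite !cE (c1' _ _ x0) (c1 _ _ x1); lra.
- case: b => //; case: b' => // /and3P[h1 h2 h3].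
    have x0 : a%:~R / q%:R < a'%:~R / q%:R + m%:~R :> R by rewrite gtr_div_int.
    have x1 : a'%:~R / q%:R + m%:~R < c%:~R / q%:R :> R by rewrite ltr_div_int.
    have x2 : c%:~R / q%:R < c'%:~R / q%:R + m%:~R :> R by rewrite gtr_div_int.
    have x3 : a%:~R / q%:R < c'%:~R / q%:R + m%:~R :> R by rewrite (lt_trans (lt_trans x0 x1)).
    split; first by split; apply: neq_fst; auto.
    by rewrite (c0' _ _ x0) (c0 _ _ x1) (c0' _ _ x2) (c0' _ _ x3); lra.
  have x0 : a'%:~R / p%:R + m%:~R < a%:~R / p%:R :> R by rewrite ltr_div_int.
  have x1 : a%:~R / p%:R < c'%:~R / p%:R + m%:~R :> R by rewrite gtr_div_int.
  have x2 : c'%:~R / p%:R + m%:~R < c%:~R / p%:R :> R by rewrite ltr_div_int.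
  have x3 : a'%:~R / p%:R + m%:~R < c%:~R / p%:R :> R by rewrite (lt_trans x0 (lt_trans x1 x2)).
  split; first by split; apply: neq_fst; auto.
  by rewrite (c1 _ _ x0) (c1' _ _ x1) (c1 _ _ x2) (c1 _ _ x3); lra.
Qed.

(** The second lift is translated by [m]. At a zero that is not positive [det2 v w < 0] is
    impossible, and transversality excludes the value [0]. *)
Lemma positive_crossing_exists d d' (m : int) (a b : R -> cylinder R) g h :
  pos_shift p q d d' m -> lift_of a (source d) (target d) g ->
  lift_of b (source d') (target d') h ->
  (forall t, 0 < t < 1 -> annulus_interior (a t)) ->
  (forall t, 0 < t < 1 -> annulus_interior (b t)) -> transversal a b ->
  exists t u, positive_crossing a b (t, u) /\ g t = h u + (m%:~R, 0).
Proof.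
move=> /corner_pos_shift[ne C] lg lh ia ib tr.
have [cg g0 g1 ag] := lg; have [ch h0 h1 bh] := lh.
pose h' u : R * R := ((h u).1 + m%:~R, (h u).2 + 0).
have ch' : continuous h'.
  move=> u; apply: (@continuous_pair _ _ u (fun u => (h u).1 + m%:~R) (fun u => (h u).2 + 0));
    apply: cvgD; try exact: cvg_cst.
    by apply: continuous_fst_comp; exact: ch.
  by apply: continuous_snd_comp; exact: ch.
have [|||||t [u [t01 u01 ghtu np]]] := crossing_exists_corner cg ch' g0 g1 (erefl _) (erefl _)
  _ _ _ _ _.
- by move=> t ht; apply: (lift_interior lg ht); apply: ia.
- by move=> t ht; rewrite /= addr0; apply: (lift_interior lh ht); apply: ib.
- move=> z; rewrite !inE /h' h0 h1 => /or4P[] /eqP -> /=; rewrite ?addr0;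
    try exact: source_height; exact: target_height.
- by rewrite /h' h0 h1.
- by rewrite /h' h0 h1.
have tu01 := And4 t01 u01 ag bh.
have hE : h' u = h u + (m%:~R, 0) by [].
exists t, u; split; last by rewrite ghtu.
have ct : crossing a b (t, u).
  split=> //=; have /andP[t0 t1] := t01; have /andP[u0 u1] := u01.
  by rewrite ag ?bh ?ltW //; apply/cpiP; exists m.
split=> //; have [v [w [va wb D]]] := tr _ ct; exists v, w; split=> //.
rewrite ltNge; apply/negP => D'; apply: np.
have [dv1 dv2] := velocity_lift lg t01 va; have [dw1 dw2] := velocity_lift lh u01 wb.
apply: (positive_zero_derive (v := v) (w := w)) => //=.
- by rewrite -[w.1]addr0; apply: is_deriveD.
- by rewrite -[w.2]addr0; apply: is_deriveD.
- by rewrite lt_neqAle D.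
Qed.

End LowerBound.

(** * Quadratic curves *)

Section UpperBound.
Variable R : realType.
Implicit Types (s t u : R) (z w v P Q A B C : R * R).

(** Affine interpolation from [a] to [b], bent by [e]. The same family gives the coordinates of the
    curves and, after elimination, the equations for their crossings. *)
Definition quad (a b e t : R) := a * (1 - t) + b * t - e * (t * (1 - t)).
Definition dquad (a b e t : R) := b - a - e * (1 - 2 * t).

Lemma is_derive_quad a b e t : is_derive t 1 (quad a b e) (dquad a b e t).
Proof.
have H1 : is_derive t 1 (fun t : R => 1 - t) (-1).
  by rewrite -[-1]add0r; apply: is_deriveB.
have H2 : is_derive t 1 (quad a b e) (a *: (-1) + b *: 1 - e *: (t *: (-1) + (1 - t) *: 1)).
  have Ia := is_deriveZ a H1; have Ib := is_deriveZ b (is_derive_id t (1 : R)).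
  have Ie := is_deriveZ e (is_deriveM (is_derive_id t (1 : R)) H1).
  exact: is_deriveB (is_deriveD Ia Ib) Ie.
have -> : dquad a b e t = a *: (-1) + b *: 1 - e *: (t *: (-1) + (1 - t) *: 1).
  by rewrite /dquad /GRing.scale /=; ring.
exact: H2.
Qed.

Lemma continuous_quad a b e : continuous (quad a b e).
Proof.
move=> t; have [h _] := is_derive_quad a b e t.
by apply: differentiable_continuous; apply/derivable1_diffP.
Qed.

Section Roots.
Variables a b e : R.
(** A bending smaller than the nonzero end values creates no additional roots. End values may vanish
    because the curves may share end points. *)
Hypotheses (ha : a = 0 \/ `|e| < `|a|) (hb : b = 0 \/ `|e| < `|b|)
  (ne0 : ~ [/\ a = 0, b = 0 & e = 0]).

(* At a root, [t (1 - t) dquad t = b t^2 - a (1 - t)^2]. *)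
Lemma quad_root t : 0 < t < 1 -> quad a b e t = 0 -> a * b < 0 /\ 0 < b * dquad a b e t.
Proof.
move=> /andP[t0 t1] r; have t1' : 0 < 1 - t by rewrite subr_gt0.
have E : t * (1 - t) * dquad a b e t = b * t ^+ 2 - a * (1 - t) ^+ 2.
  rewrite -[RHS]addr0 -(mulr0 (1 - 2 * t)) -{}r /quad /dquad; ring.
have tt : 0 < t * (1 - t) < 1 by apply/andP; split; nra.
have et (x : R) : x = 0 \/ `|e| < `|x| -> x != 0 -> `|e| < `|x| by move=> [->|//]; rewrite eqxx.
have small : `|e * (t * (1 - t))| <= `|e|.
  by have /andP[h0 h1] := tt; rewrite normrM ler_piMr // ger0_norm ltW.
have ab : a * b < 0.
  rewrite ltNge; apply/negP => ab; move: r; rewrite /quad.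
  have [a0|a0] := eqVneq a 0.
    have [b0|b0] := eqVneq b 0.
      rewrite a0 b0 !mul0r add0r sub0r => /eqP; rewrite oppr_eq0 mulf_eq0 =>
        /orP[/eqP e0|/eqP te].
        by apply: ne0.
      by move: tt; rewrite te ltxx.
    rewrite a0 mul0r add0r => r; have : t * (b - e * (1 - t)) = 0 by rewrite -r; ring.
    move=> /eqP; rewrite mulf_eq0 (gt_eqF t0) /= subr_eq0 => /eqP be.
    have := et b hb b0; rewrite be normrM (ger0_norm (ltW t1')) => h.
    have : `|e| * (1 - t) <= `|e| by rewrite ler_piMr //; lra.
    lra.
  have [b0|b0] := eqVneq b 0.
    rewrite b0 mul0r addr0 => r; have : (1 - t) * (a - e * t) = 0 by rewrite -r; ring.
    move=> /eqP; rewrite mulf_eq0 (gt_eqF t1') /= subr_eq0 => /eqP be.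
    have := et a ha a0; rewrite be normrM (ger0_norm (ltW t0)) => h.
    have : `|e| * t <= `|e| by rewrite ler_piMr //; lra.
    lra.
  move=> r; have ea := et a ha a0; have eb := et b hb b0.
  have h : a * (1 - t) + b * t = e * (t * (1 - t)) by lra.
  have : `|a * (1 - t) + b * t| <= `|e| by rewrite h.
  have [a1|a1] := ltP 0 a.
    have b1 : 0 < b by rewrite lt_neqAle eq_sym b0 /=; nra.
    rewrite (gtr0_norm a1) in ea; rewrite (gtr0_norm b1) in eb.
    rewrite gtr0_norm ?addr_gt0 ?mulr_gt0 //; nra.
  have a1' : a < 0 by rewrite lt_neqAle a0.
  have b1 : b < 0 by rewrite lt_neqAle b0 /=; nra.
  rewrite (ltr0_norm a1') in ea; rewrite (ltr0_norm b1) in eb.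
  rewrite -normrN gtr0_norm ?opprD ?addr_gt0 -?mulNr ?mulr_gt0 ?oppr_gt0 //; nra.
split=> //; have tp : 0 < t * (1 - t) by have /andP[] := tt.
rewrite -(pmulr_rgt0 _ tp) mulrCA E.
have : 0 < b ^+ 2 by rewrite exprn_even_gt0 //=; apply/eqP => b0; move: ab;
  rewrite b0 mulr0 ltxx.
rewrite mulrBr !mulrA -expr2 => b2; rewrite subr_gt0 (@lt_le_trans _ _ 0) //.
  by rewrite 2?pmulr_llt0 // mulrC.
exact: mulr_ge0 (mulr_ge0 (ltW b2) (ltW t0)) (ltW t0).
Qed.

Lemma quad_root_exists : a * b < 0 -> exists2 t, 0 < t < 1 & quad a b e t = 0.
Proof.
move=> ab; have q0 : quad a b e 0 = a by rewrite /quad; ring.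
have q1 : quad a b e 1 = b by rewrite /quad; ring.
have W : {within `[0, 1], continuous (quad a b e)}.
  by apply: continuous_subspaceT => t; apply: continuous_quad.
have [t] : exists2 c, c \in `[0, 1]%R & quad a b e c = 0.
  apply: IVT => //; rewrite q0 q1 ge_min le_max; have [a0|a0] := leP a 0; nra.
rewrite in_itv /= => /andP[t0 t1] qt; exists t => //.
rewrite !lt_neqAle t0 t1 !andbT eq_sym; apply/andP; split; apply/eqP => te; move: qt ab;
  rewrite te ?q0 ?q1 => ->;
  by rewrite ?mul0r ?mulr0 ltxx.
Qed.

(** Two distinct roots would satisfy [a = e * (s * t)], hence [|a| <= |e|]. *)
Lemma quad_root_unique s t : 0 < s < 1 -> 0 < t < 1 ->
  quad a b e s = 0 -> quad a b e t = 0 -> s = t.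
Proof.
move=> s01 t01 hs ht; have [ab _] := quad_root s01 hs.
apply: contrapT => /eqP st; have st0 : s - t != 0 by rewrite subr_eq0.
have /eqP : (s - t) * (b - a - e * (1 - (s + t))) = 0.
  by transitivity (quad a b e s - quad a b e t); [rewrite /quad; ring|rewrite hs ht subrr].
rewrite mulf_eq0 (negPf st0) /= => /eqP h.
have : a = e * (s * t).
  have : quad a b e s + (a - e * (s * t)) * (-1) = s * (b - a - e * (1 - (s + t)))
    by rewrite /quad; ring.
  by rewrite h hs; lra.
have a0 : a != 0 by apply/eqP => a0; move: ab; rewrite a0 mul0r ltxx.
move=> ae; case: ha => [a0'|ea]; first by rewrite a0' eqxx in a0.
have : `|a| <= `|e|.
  rewrite ae normrM ler_piMr // ger0_norm; nra.
by rewrite leNgt ea.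
Qed.
End Roots.

Lemma quad0 a b e : quad a b e 0 = a. Proof. by rewrite /quad; ring. Qed.
Lemma quad1 a b e : quad a b e 1 = b. Proof. by rewrite /quad; ring. Qed.

Definition qcurve A B C t : R * R := (quad A.1 B.1 C.1 t, quad A.2 B.2 C.2 t).
Definition dqcurve A B C t : R * R := (dquad A.1 B.1 C.1 t, dquad A.2 B.2 C.2 t).

Lemma continuous_qcurve A B C : continuous (qcurve A B C).
Proof.
by move=> t; apply: (@continuous_pair _ _ t (quad A.1 B.1 C.1) (quad A.2 B.2 C.2));
  exact: continuous_quad.
Qed.

Lemma qcurve0 A B C : qcurve A B C 0 = A.
Proof. by rewrite /qcurve !quad0 -surjective_pairing. Qed.

Lemma qcurve1 A B C : qcurve A B C 1 = B.
Proof. by rewrite /qcurve !quad1 -surjective_pairing. Qed.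

Lemma lift_qcurve A B C : lift_of (@cpi R \o qcurve A B C) A B (qcurve A B C).
Proof. by split; [exact: continuous_qcurve|exact: qcurve0|exact: qcurve1|]. Qed.

(** The strip is convex, so two lifts with the same ends are joined by segments. *)
Lemma straight_homotopic (a : R -> cylinder R) P Q g G :
  lift_of a P Q g -> lift_of (@cpi R \o G) P Q G ->
  (forall t, 0 <= t <= 1 -> 0 <= (g t).2 <= 1) -> (forall t,
    0 <= t <= 1 -> 0 <= (G t).2 <= 1) ->
  homotopic a (@cpi R \o G).
Proof.
move=> [cg g0 g1 ag] [cG G0 G1 _] hg hG.
pose K (z : R * R) : R * R := ((1 - z.2) * (g z.1).1 + z.2 * (G z.1).1,
  (1 - z.2) * (g z.1).2 + z.2 * (G z.1).2).
have cK : continuous K.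
  have c1 (f : R -> R * R) : continuous f -> continuous (fun z : R * R => f z.1).
    by move=> cf z; apply: (@continuous_comp _ _ _ fst f); [exact: cvg_fst|exact: cf].
  have c2 : continuous (fun z : R * R => z.2) by move=> z; exact: cvg_snd.
  have c3 : continuous (fun z : R * R => 1 - z.2) by move=> z; apply: cvgB;
    [exact: cvg_cst|exact: c2].
  have cc (x y : R * R -> R) : continuous x -> continuous y -> continuous (fun z => (1 - z.2)
    * x z + z.2 * y z).
    by move=> cx cy z; apply: cvgD; apply: cvgM; [exact: c3|exact: cx|exact: c2|exact: cy].
  move=> z; apply: (@continuous_pair _ _ z (fun z => (1 - z.2) * (g z.1).1 + z.2 * (G z.1).1)
    (fun z => (1 - z.2) * (g z.1).2 + z.2 * (G z.1).2)); apply: cc => y.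
  - by apply: continuous_fst_comp; apply: c1.
  - by apply: continuous_fst_comp; apply: c1.
  - by apply: continuous_snd_comp; apply: c1.
  - by apply: continuous_snd_comp; apply: c1.
have KE t u x : g t = x -> G t = x -> K (t, u) = x.
  by move=> gx Gx; rewrite /K /= gx Gx -!mulrDl subrK !mul1r -surjective_pairing.
exists (@cpi R \o K); split.
- by apply: continuous_subspaceT => z; apply: continuous_comp;
    [exact: cK|exact: continuous_cpi].
- move=> t u ht hu; exists (K (t, u)) => //=.
  have /andP[u0 u1] := hu; have /andP[h0 h1] := hg t ht; have /andP[h2 h3] := hG t ht;
    apply/andP; split; nra.
- move=> t ht; rewrite ag //= /K /= !subr0 subrr !mul1r !mul0r !addr0 !add0r.
  by rewrite -!surjective_pairing.
- have i0 : 0 <= (0 : R) <= 1 by rewrite lexx ler01.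
  have i1 : 0 <= (1 : R) <= 1 by rewrite lexx ler01.
  by move=> u hu; rewrite /= !ag // (KE _ _ P) // (KE _ _ Q) // g0 g1.
Qed.

(** Crossings of the projections are the solutions of [G t = H u + (m, 0)]; each [m] in [ns] has
    exactly one, which is positive, so [ns] enumerates the positive crossings. *)
Lemma crossing_count (G dG H dH : R -> R * R) (ns : seq int) :
  (forall t, is_derive t 1 (fun t => (G t).1) (dG t).1 /\ is_derive t 1 (fun t => (G t).2)
    (dG t).2) ->
  (forall t, is_derive t 1 (fun t => (H t).1) (dH t).1 /\ is_derive t 1 (fun t => (H t).2)
    (dH t).2) ->
  continuous G -> continuous H -> uniq ns ->
  (forall (m : int) t u, 0 < t < 1 -> 0 < u < 1 -> G t = H u + (m%:~R, 0) ->
     det2 (dG t) (dH u) != 0 /\ (0 < det2 (dG t) (dH u) -> m \in ns)) ->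
  (forall m, m \in ns -> exists t u, [/\ 0 < t < 1, 0 < u < 1, G t = H u + (m%:~R,
    0) & 0 < det2 (dG t) (dH u)]) ->
  (forall (m : int) t u t' u', 0 < t < 1 -> 0 < u < 1 -> 0 < t' < 1 -> 0 < u' < 1 ->
     G t = H u + (m%:~R, 0) -> G t' = H u' + (m%:~R, 0) -> t = t' /\ u = u') ->
  transversal (@cpi R \o G) (@cpi R \o H) /\
  (positive_crossing (@cpi R \o G) (@cpi R \o H) #= `I_(size ns))%card.
Proof.
move=> DG DH cG cH uns cross ex unq.
have vG t : velocity (@cpi R \o G) t (dG t) by have [d1 d2] := DG t; apply: velocity_cpi.
have vH t : velocity (@cpi R \o H) t (dH t) by have [d1 d2] := DH t; apply: velocity_cpi.
have lG : lift_of (@cpi R \o G) (G 0) (G 1) G by [].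
have lH : lift_of (@cpi R \o H) (H 0) (H 1) H by [].
split.
  move=> [t u] [/= ht hu /cpiP[m E]]; exists (dG t), (dH u); split=> //.
  by have [] := cross m t u ht hu E.
have PE t u : positive_crossing (@cpi R \o G) (@cpi R \o H) (t, u) <->
    exists m, [/\ m \in ns, 0 < t < 1, 0 < u < 1, G t = H u + (m%:~R,
      0) & 0 < det2 (dG t) (dH u)].
  split=> [[[/= ht hu /cpiP[m E]] [v [w [hv hw D]]]]|[m [mn ht hu E D]]]; last first.
    split; last by exists (dG t), (dH u).
    by split=> //=; apply/cpiP; exists m.
  have vE : v = dG t.
    have [d1 d2] := velocity_lift lG ht hv; have [e1 e2] := DG t.
    by rewrite [v]surjective_pairing (is_derive_unique d1 e1) (is_derive_unique d2 e2)
      -surjective_pairing.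
  have wE : w = dH u.
    have [d1 d2] := velocity_lift lH hu hw; have [e1 e2] := DH u.
    by rewrite [w]surjective_pairing (is_derive_unique d1 e1) (is_derive_unique d2 e2)
      -surjective_pairing.
  rewrite vE wE in D; exists m; split=> //.
  by have [_ /(_ D)] := cross m t u ht hu E.
pose pt (m : int) : R * R := xget (0, 0) [set z | [/\ 0 < z.1 < 1, 0 < z.2 < 1,
  G z.1 = H z.2 + (m%:~R, 0) & 0 < det2 (dG z.1) (dH z.2)]].
have ptP m : m \in ns -> [/\ 0 < (pt m).1 < 1, 0 < (pt m).2 < 1,
  G (pt m).1 = H (pt m).2 + (m%:~R, 0) & 0 < det2 (dG (pt m).1) (dH (pt m).2)].
  move=> /ex[t [u h]]; rewrite /pt; case: xgetP => [z _ //|/(_ (t, u))].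
  by move=> /(_ h).
have -> : positive_crossing (@cpi R \o G) (@cpi R \o H) = (fun i : nat => pt (nth 0 ns i))
  @` `I_(size ns).
  apply/seteqP; split=> [[t u] /PE[m [mn ht hu E D]]|_ [i /= hi <-]].
    exists (index m ns); first by rewrite /= index_mem.
    rewrite nth_index //; have [h1 h2 h3 _] := ptP m mn.
    have [e1 e2] := unq m _ _ _ _ ht hu h1 h2 E h3.
    by rewrite [RHS]surjective_pairing /= e1 e2 -surjective_pairing.
  have [h1 h2 h3 h4] := ptP _ (mem_nth 0 hi).
  rewrite [pt _]surjective_pairing; apply/PE; exists (nth 0 ns i); split=> //; exact: mem_nth.
apply: inj_card_eq => i j; rewrite !inE /= => hi hj e.
have [_ _ h3 _] := ptP _ (mem_nth 0 hi); have [_ _ h3' _] := ptP _ (mem_nth 0 hj).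
have : (nth 0 ns i)%:~R = (nth 0 ns j)%:~R :> R.
  by move: h3; rewrite e h3' => /addrI [].
by move=> /intr_inj /eqP; rewrite nth_uniq // => /eqP.
Qed.

End UpperBound.

(** * Representatives with the least number of positive crossings *)

Section StandardCurves.
Variables (R : realType) (p q : nat).
Hypotheses (hp : (0 < p)%N) (hq : (0 < q)%N).
Implicit Types (s t u e : R) (d : curve_type).
Local Notation source := (source R p q).
Local Notation target := (target R p q).

(** Loops are bent vertically into the strip, with opposite signs at the two boundaries; chords are
    bent horizontally. *)
Definition bend d e : R * R :=
  match d with Chord _ _ => (e, 0) | Loop b _ _ => (0, if b then - e else e) end.

Definition std d e := qcurve (source d) (target d) (bend d e).
Definition dstd d e := dqcurve (source d) (target d) (bend d e).

(** The height of a loop over its boundary line is at most [e / 4], so [e < 4] keeps it off the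
    opposite boundary. *)
Definition wf_bend d e := if d is Loop _ _ _ then 0 < e < 4 else true.
Definition wf_type d := if d is Loop _ a c then a < c else true.

Lemma std_height d e t : wf_bend d e -> 0 < t < 1 -> 0 < (std d e t).2 < 1.
Proof.
move=> he /andP[t0 t1]; have tt : 0 < t * (1 - t) by rewrite mulr_gt0 // subr_gt0.
have t4 : t * (1 - t) * 4 <= 1 by have := sqr_ge0 (2 * t - 1); rewrite expr2; lra.
by case: d he => [i j _|[] a c /andP[e0 e4]]; rewrite /= /quad; apply/andP; split; nra.
Qed.

Lemma std_height_closed d e t : wf_bend d e -> 0 <= t <= 1 -> 0 <= (std d e t).2 <= 1.
Proof.
move=> he /andP[]; rewrite le_eqVlt => /predU1P[<- _|t0].
  by rewrite /std qcurve0; case: (source_height R p q d) => ->; rewrite lexx ler01.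
rewrite le_eqVlt => /predU1P[->|t1].
  by rewrite /std qcurve1; case: (target_height R p q d) => ->; rewrite lexx ler01.
have t01 : 0 < t < 1 by rewrite t0.
by have /andP[h1 h2] := std_height he t01; rewrite !ltW.
Qed.

Definition counted d d' e e' :=
  [/\ forall (m : int) t u, 0 < t < 1 -> 0 < u < 1 -> std d e t = std d' e' u + (m%:~R, 0) ->
        det2 (dstd d e t) (dstd d' e' u) != 0 /\
        (0 < det2 (dstd d e t) (dstd d' e' u) -> pos_shift p q d d' m),
      forall m, pos_shift p q d d' m -> exists t u, [/\ 0 < t < 1, 0 < u < 1,
        std d e t = std d' e' u + (m%:~R, 0) & 0 < det2 (dstd d e t) (dstd d' e' u)]
    & forall (m : int) t u t' u', 0 < t < 1 -> 0 < u < 1 -> 0 < t' < 1 -> 0 < u' < 1 ->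
        std d e t = std d' e' u + (m%:~R, 0) -> std d e t' = std d' e' u' + (m%:~R, 0) ->
        t = t' /\ u = u'].

(* The crossings of the two curves are parametrized by the roots of a quadratic
   function of [S t u]. *)
Lemma counted_quad d d' e e' (a b c : int -> R) (K : R) (S : R -> R -> R) (T U : int -> R -> R)
  :
  (forall m, [/\ a m = 0 \/ `|c m| < `|a m|, b m = 0 \/ `|c m| < `|b m| & ~ [/\ a m = 0,
    b m = 0 & c m = 0]]) ->
  (forall (m : int) t u, 0 < t < 1 -> 0 < u < 1 -> std d e t = std d' e' u + (m%:~R, 0) ->
    [/\ 0 < S t u < 1, quad (a m) (b m) (c m) (S t u) = 0, t = T m (S t u), u = U m (S t u)
      & det2 (dstd d e t) (dstd d' e' u) = K * dquad (a m) (b m) (c m) (S t u)]) ->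
  (forall (m : int) s, 0 < s < 1 -> quad (a m) (b m) (c m) s = 0 ->
    [/\ 0 < T m s < 1, 0 < U m s < 1, std d e (T m s) = std d' e' (U m s) + (m%:~R, 0)
      & S (T m s) (U m s) = s]) ->
  K != 0 ->
  (forall m, pos_shift p q d d' m <-> a m * b m < 0 /\ 0 < K * b m) ->
  counted d d' e e'.
Proof.
move=> small cross root K0 pos; split.
- move=> m t u ht hu E; have [hs qs _ _ ->] := cross m t u ht hu E.
  have [sa sb sc] := small m; have [ab D] := quad_root sa sb sc hs qs.
  have D0 : dquad (a m) (b m) (c m) (S t u) != 0 by apply/eqP => D0; move: D;
    rewrite D0 mulr0 ltxx.
  split=> [|KD]; first by rewrite mulf_neq0.
  apply/pos; split=> //.
  have D2 : 0 < dquad (a m) (b m) (c m) (S t u) ^+ 2 by rewrite exprn_even_gt0.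
  rewrite -(pmulr_lgt0 _ D2) (_ : K * b m * _ = (K * dquad (a m) (b m) (c m) (S t u))
    * (b m * dquad (a m) (b m) (c m) (S t u))).
    exact: mulr_gt0.
  by ring.
- move=> m /pos[ab Kb]; have [sa sb sc] := small m.
  have [s hs qs] := quad_root_exists (c m) ab.
  have [hT hU E SE] := root m s hs qs; exists (T m s), (U m s); split=> //.
  have [_ _ _ _ ->] := cross m _ _ hT hU E; rewrite SE.
  have [_ D] := quad_root sa sb sc hs qs.
  have b0 : b m != 0 by apply/eqP => b0; move: ab; rewrite b0 mulr0 ltxx.
  have b2 : 0 < b m ^+ 2 by rewrite exprn_even_gt0.
  rewrite -(pmulr_lgt0 _ b2) (_ : K * dquad (a m) (b m) (c m) s * _ = (K * b m)
    * (b m * dquad (a m) (b m) (c m) s)).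
    exact: mulr_gt0.
  by ring.
move=> m t u t' u' ht hu ht' hu' E E'.
have [hs qs tE uE _] := cross m t u ht hu E; have [hs' qs' tE' uE' _] :=
  cross m t' u' ht' hu' E'.
have [sa sb sc] := small m.
have ss := quad_root_unique sa sb sc hs hs' qs qs'.
by split; [apply: etrans tE _; rewrite ss -tE'|apply: etrans uE _; rewrite ss -uE'].
Qed.

Lemma norm_int_ge1 (n : int) : n != 0 -> 1 <= (`|n|)%:~R :> R.
Proof. by rewrite ler1z; lia. Qed.

Lemma small_or_zero (r : nat) (n : int) (e : R) : (0 < r)%N -> e < r%:R^-1 ->
  n%:~R / r%:R = 0 :> R \/ e < `|n%:~R / r%:R|.
Proof.
move=> r0 er; have rR : 0 < r%:R^-1 :> R by rewrite invr_gt0 ltr0n.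
have [->|n0] := eqVneq n 0; first by left; rewrite mul0r.
right; apply: lt_le_trans er _; rewrite normrM (gtr0_norm rR) ler_peMl ?(ltW rR) //.
by rewrite -intr_norm norm_int_ge1.
Qed.

Lemma sign_split (a b : R) : a * b < 0 /\ 0 < b <-> a < 0 /\ 0 < b.
Proof. by split=> -[h b0]; move: h; rewrite pmulr_llt0. Qed.

(** The height of a chord is its parameter, so crossings happen at equal times and only the
    horizontal coordinates are compared. *)
Lemma counted_chord_chord i j i' j' : exists e e',
  wf_bend (Chord i j) e /\ wf_bend (Chord i' j') e' /\
  counted (Chord i j) (Chord i' j') e e'.
Proof.
have pR : 0 < p%:R :> R by rewrite ltr0n.
have qR : 0 < q%:R :> R by rewrite ltr0n.
(* Smaller than [1 / p] and [1 / q], the least nonzero distances between marked points on a boundary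
   line, and nonzero so that equal chords do not coincide. *)
pose e' : R := (2 * p%:R * q%:R)^-1; have e0 : 0 < e' by rewrite invr_gt0 !mulr_gt0.
have p1 : 1 <= p%:R :> R by rewrite ler1n.
have q1 : 1 <= q%:R :> R by rewrite ler1n.
have ep : e' < p%:R^-1.
  by rewrite ltf_pV2 ?posrE ?mulr_gt0 //; nra.
have eq : e' < q%:R^-1.
  by rewrite ltf_pV2 ?posrE ?mulr_gt0 //; nra.
exists 0, e'; split=> //; split=> //.
have aE (m : int) : j%:~R / q%:R - j'%:~R / q%:R - m%:~R = (j - j' - m * q%:Z)%:~R / q%:R :> R.
  by rewrite !intrD !intrN intrM -pmulrn; field; rewrite gt_eqF.
have bE (m : int) : i%:~R / p%:R - i'%:~R / p%:R - m%:~R = (i - i' - m * p%:Z)%:~R / p%:R :> R.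
  by rewrite !intrD !intrN intrM -pmulrn; field; rewrite gt_eqF.
apply: (@counted_quad _ _ _ _ (fun m => j%:~R / q%:R - j'%:~R / q%:R - m%:~R)
  (fun m => i%:~R / p%:R - i'%:~R / p%:R - m%:~R) (fun=> - e') 1 (fun t u => t) (fun m s => s)
    (fun m s => s)).
- move=> m; rewrite normrN (gtr0_norm e0) aE bE; split.
  + exact: small_or_zero.
  + exact: small_or_zero.
  + by case=> _ _ /eqP; rewrite oppr_eq0 gt_eqF.
- move=> m t u ht hu []; rewrite /quad /= => E1 E2.
  have tu : u = t by lra.
  split=> //; first by move: E1; rewrite /quad tu; lra.
  by rewrite tu /det2 /dstd /dqcurve /dquad /=; lra.
- move=> m s hs; rewrite /quad /= => E; split=> //; rewrite /std /qcurve /quad; congr (_, _);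
    rewrite /=; lra.
- exact: oner_neq0.
- move=> m; rewrite mul1r /= aE bE; have qi : 0 < q%:R^-1 :> R by rewrite invr_gt0.
  have pi : 0 < p%:R^-1 :> R by rewrite invr_gt0.
  rewrite sign_split !pmulr_llt0 // !pmulr_lgt0 // ltr0z ltrz0 subr_gt0 subr_lt0 ltrBlDr [m * _
    + j']addrC.
  by rewrite !ltrBrDr ?add0r [m * _ + i']addrC; split=> [/andP[-> ->]|[-> ->]].
Qed.

Lemma bend_bound (r : nat) (x : R) : (0 < r)%N ->
  let e := (r%:R * (`|x| + 1))^-1 in [/\ 0 < e, e < 4 & `|x| * e < r%:R^-1].
Proof.
move=> r0 e; have rR : 1 <= r%:R :> R by rewrite ler1n.
have x0 := normr_ge0 x.
have e0 : 0 < e by rewrite invr_gt0; nra.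
have E : e * (r%:R * (`|x| + 1)) = 1 by rewrite mulVf // gt_eqF //; nra.
have P : 1 <= r%:R * (`|x| + 1) by nra.
have e1 : e <= 1 by rewrite -E ler_peMr // ltW.
split=> //; first by lra.
rewrite -(ltr_pM2r (_ : 0 < r%:R)); last by lra.
by rewrite mulVf ?gt_eqF //; nra.
Qed.

(** The straight chord is the graph of an affine function of the height; inserting the height of the
    loop gives a quadratic equation in the parameter of the loop. *)
Lemma counted_loop_chord b a c i j : a < c -> exists e e',
  wf_bend (Loop b a c) e /\ wf_bend (Chord i j) e' /\
  counted (Loop b a c) (Chord i j) e e'.
Proof.
move=> ac; pose r := pw p q b; have r0 : (0 < r)%N by rewrite /r; case: (b).
have rR : 0 < r%:R :> R by rewrite ltr0n.
have ri : 0 < r%:R^-1 :> R by rewrite invr_gt0.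
pose x0 : R := j%:~R / q%:R; pose x1 : R := i%:~R / p%:R.
pose e := (r%:R * (`|x1 - x0| + 1))^-1.
have [e0 e4 er] := bend_bound (x1 - x0) r0; rewrite -/e in e0 e4 er.
pose C := if b then - e else e; pose z : R := if b then 0 else 1.
pose X : R := if b then x0 else x1.
have XE (n m : int) : n%:~R / r%:R - X - m%:~R = (n - (if b then j else i)
  - m * r%:Z)%:~R / r%:R.
  have -> : X = (if b then j else i)%:~R / r%:R by rewrite /X /x0 /x1 /r; case: (b).
  by rewrite !intrD !intrN intrM -pmulrn; field; rewrite gt_eqF.
have stdE t : std (Loop b a c) e t = (quad (a%:~R / r%:R) (c%:~R / r%:R) 0 t, quad z z C t).
  by rewrite /std /qcurve /z /C /r /=; case: (b).
have dstdE t : dstd (Loop b a c) e t = (dquad (a%:~R / r%:R) (c%:~R / r%:R) 0 t, dquad z z C t).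
  by rewrite /dstd /dqcurve /z /C /r /=; case: (b).
have XzE : X = x0 + (x1 - x0) * z by rewrite /X /z; case: (b); rewrite ?mulr0 ?mulr1; lra.
have wb : wf_bend (Loop b a c) e by rewrite /= e0 e4.
exists e, 0; split=> //; split=> //.
apply: (@counted_quad _ _ _ _ (fun m => a%:~R / r%:R - X - m%:~R) (fun m =>
  c%:~R / r%:R - X - m%:~R)
  (fun=> - (x1 - x0) * C) 1 (fun t u => t) (fun m s => s) (fun m s => quad z z C s)).
- move=> m; have -> : `|- (x1 - x0) * C| = `|x1 - x0| * e.
    rewrite normrM normrN; congr (_ * _); rewrite /C; case: (b); rewrite ?normrN gtr0_norm //.
  rewrite !XE; split; try exact: small_or_zero.
  case=> /eqP h1 /eqP h2 _; move: h1 h2; rewrite !mulf_eq0 !invr_eq0 !(gt_eqF rR)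
    !orbF !intr_eq0; lia.
- move=> m t u ht hu; rewrite dstdE stdE => -[E1 E2].
  have uE : u = quad z z C t by move: E2; rewrite /quad /=; lra.
  split=> //; first by move: E1; rewrite uE /quad /= -/x0 -/x1 XzE; lra.
  by rewrite /det2 /dstd /dqcurve /dquad /= -/x0 -/x1; lra.
- move=> m s hs qs; have := std_height wb hs; rewrite stdE /= => hu; split=> //.
  by rewrite /std /qcurve; congr (_, _); move: qs; rewrite /quad /= -/x0 -/x1 XzE; lra.
- exact: oner_neq0.
- move=> m; rewrite mul1r sign_split !XE !pmulr_llt0 // !pmulr_lgt0 // ltr0z ltrz0 /=.
  by rewrite -/r if_same; split=> [/andP[]|[]]; lia.
Qed.

(** The same equation with the curves exchanged. The factor [-1] together with [a < c] makes every
    crossing negative, in agreement with [pos_shift]. *)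
Lemma counted_chord_loop b a c i j : a < c -> exists e e',
  wf_bend (Chord i j) e /\ wf_bend (Loop b a c) e' /\
  counted (Chord i j) (Loop b a c) e e'.
Proof.
move=> ac; pose r := pw p q b; have r0 : (0 < r)%N by rewrite /r; case: (b).
have rR : 0 < r%:R :> R by rewrite ltr0n.
have ri : 0 < r%:R^-1 :> R by rewrite invr_gt0.
pose x0 : R := j%:~R / q%:R; pose x1 : R := i%:~R / p%:R.
pose e := (r%:R * (`|x1 - x0| + 1))^-1.
have [e0 e4 er] := bend_bound (x1 - x0) r0; rewrite -/e in e0 e4 er.
pose C := if b then - e else e; pose z : R := if b then 0 else 1.
pose X : R := if b then x0 else x1.
have XE (n m : int) : n%:~R / r%:R - X + m%:~R = (n - (if b then j else i)
  + m * r%:Z)%:~R / r%:R.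
  have -> : X = (if b then j else i)%:~R / r%:R by rewrite /X /x0 /x1 /r; case: (b).
  by rewrite !intrD !intrN intrM -pmulrn; field; rewrite gt_eqF.
have stdE t : std (Loop b a c) e t = (quad (a%:~R / r%:R) (c%:~R / r%:R) 0 t, quad z z C t).
  by rewrite /std /qcurve /z /C /r /=; case: (b).
have dstdE t : dstd (Loop b a c) e t = (dquad (a%:~R / r%:R) (c%:~R / r%:R) 0 t, dquad z z C t).
  by rewrite /dstd /dqcurve /z /C /r /=; case: (b).
have XzE : X = x0 + (x1 - x0) * z by rewrite /X /z; case: (b); rewrite ?mulr0 ?mulr1; lra.
have wb : wf_bend (Loop b a c) e by rewrite /= e0 e4.
exists 0, e; split=> //; split=> //.
apply: (@counted_quad _ _ _ _ (fun m => a%:~R / r%:R - X + m%:~R) (fun m =>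
  c%:~R / r%:R - X + m%:~R)
  (fun=> - (x1 - x0) * C) (-1) (fun t u => u) (fun m s => quad z z C s) (fun m s => s)).
- move=> m; have -> : `|- (x1 - x0) * C| = `|x1 - x0| * e.
    rewrite normrM normrN; congr (_ * _); rewrite /C; case: (b); rewrite ?normrN gtr0_norm //.
  rewrite !XE; split; try exact: small_or_zero.
  case=> /eqP h1 /eqP h2 _; move: h1 h2; rewrite !mulf_eq0 !invr_eq0 !(gt_eqF rR)
    !orbF !intr_eq0; lia.
- move=> m t u ht hu; rewrite dstdE stdE => -[E1 E2].
  have uE : t = quad z z C u by move: E2; rewrite /quad /=; lra.
  split=> //; first by move: E1; rewrite uE /quad /= -/x0 -/x1 XzE; lra.
  by rewrite /det2 /dstd /dqcurve /dquad /= -/x0 -/x1; lra.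
- move=> m s hs qs; have := std_height wb hs; rewrite stdE /= => hu; split=> //.
  by rewrite /std /qcurve; congr (_, _); move: qs; rewrite /quad /= -/x0 -/x1 XzE; lra.
- by rewrite oppr_eq0 oner_neq0.
- move=> m; split=> // -[]; rewrite !XE mulN1r oppr_gt0 => ab b0.
  have : a%:~R / r%:R < c%:~R / r%:R :> R by rewrite ltr_pM2r // ltr_int.
  rewrite nmulr_llt0 // in ab; rewrite -!XE in ab b0; lra.
Qed.

(** With bending [1] the two loops stay in the lowest and the highest quarter of the strip. *)
Lemma counted_loop_opposite b a c a' c' : exists e e',
  wf_bend (Loop b a c) e /\ wf_bend (Loop (~~ b) a' c') e' /\
  counted (Loop b a c) (Loop (~~ b) a' c') e e'.
Proof.
have w14 : 0 < (1 : R) < 4 by lra.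
exists 1, 1; split=> //; split=> //.
have q4 t : 0 < t < 1 -> 0 < t * (1 - t) <= 4^-1.
  by move=> /andP[t0 t1]; have := sqr_ge0 (2 * t - 1); rewrite expr2 => h; apply/andP; split;
    nra.
have no (m : int) t u : 0 < t < 1 -> 0 < u < 1 -> std (Loop b a c) 1 t <> std (Loop (~~ b)
  a' c') 1 u + (m%:~R, 0).
  move=> /q4 /andP[t0 t1] /q4 /andP[u0 u1] [_]; rewrite /quad.
  by case: b => /=; lra.
split=> [m t u ht hu /(no m t u ht hu)//|m|m t u t' u' ht hu _ _ /(no m t u ht hu)//].
by case: (b).
Qed.

Lemma sign_split_neg (a b : R) : a * b < 0 /\ b < 0 <-> 0 < a /\ b < 0.
Proof. by split=> -[h b0]; move: h; rewrite nmulr_llt0. Qed.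

Lemma between_pos (n x y : int) : x < y -> (0 < (n - x) * (y - n)) = (x < n) && (n < y).
Proof.
move=> xy; have [nx|xn|->] := ltgtP n x; last by rewrite subrr mul0r.
  by rewrite nmulr_rgt0 ?subr_lt0 //=; lia.
by rewrite pmulr_rgt0 ?subr_gt0.
Qed.

Lemma between_neg (n x y : int) : x < y -> ((n - x) * (y - n) < 0) = (n < x) || (y < n).
Proof.
move=> xy; have [nx|xn|->] := ltgtP n x; last by rewrite subrr mul0r ltxx; lia.
  by rewrite nmulr_rlt0 ?subr_lt0 //=; lia.
by rewrite pmulr_rlt0 ?subr_gt0 // subr_lt0.
Qed.

Lemma between_source (a c x y : int) : a < c -> x < y ->
  ((a - x) * (y - a) < 0 /\ 0 < (c - x) * (y - c) <-> [&& a < x, x < c & c < y]).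
Proof.
by move=> ac xy; rewrite between_neg // between_pos //; split=> [[]|/and3P[]]; lia.
Qed.

Lemma between_target (a c x y : int) : a < c -> x < y ->
  (0 < (a - x) * (y - a) /\ (c - x) * (y - c) < 0 <-> [&& x < a, a < y & y < c]).
Proof.
by move=> ac xy; rewrite between_neg // between_pos //; split=> [[]|/and3P[]]; lia.
Qed.

(** Over the horizontal coordinate the loops are parabolas with curvature given by [k] and [k'], and
    their difference is quadratic in the parameter of the first. The second is slightly more curved,
    by the factor [1 + eta], so that translates of equal loops do not coincide. *)
Lemma counted_loop_loop b a c a' c' : a < c -> a' < c' -> exists e e',
  wf_bend (Loop b a c) e /\ wf_bend (Loop b a' c') e' /\
  counted (Loop b a c) (Loop b a' c') e e'.
Proof.
move=> ac ac'; pose r := pw p q b; have r0 : (0 < r)%N by rewrite /r; case: (b).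
have rR : 1 <= r%:R :> R by rewrite ler1n.
have rn0 : r%:R != 0 :> R by rewrite pnatr_eq0 -lt0n.
have ri : 0 < r%:R^-1 :> R by rewrite invr_gt0 ltr0n.
pose x n : R := n%:~R / r%:R.
pose l := x c - x a; pose l' := x c' - x a'.
have l0 : 0 < l by rewrite subr_gt0 ltr_pM2r // ltr_int.
have l0' : 0 < l' by rewrite subr_gt0 ltr_pM2r // ltr_int.
(* This choice makes both bendings admissible: [k * l ^+ 2 < 1], and [k' * l' ^+ 2 < 2] as soon as
   [eta < 1]. *)
pose k := (l ^+ 2 + l' ^+ 2)^-1.
have ll : 0 < l ^+ 2 + l' ^+ 2 by rewrite addr_gt0 // exprn_gt0.
have k0 : 0 < k by rewrite invr_gt0.
have kE : k * (l ^+ 2 + l' ^+ 2) = 1 by rewrite mulVf // gt_eqF.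
(* Nonzero values of [P] at marked points are at least [1 / r ^ 2] in absolute value; this [eta]
   keeps the bending [k * eta * l ^+ 2] of the difference below [k' / r ^ 2]. *)
pose eta := (2 * (r%:R ^+ 2 * l ^+ 2 + 1))^-1.
have rl : 0 < r%:R ^+ 2 * l ^+ 2 by rewrite mulr_gt0 // exprn_gt0 // ltr0n.
have etaE : eta * (2 * (r%:R ^+ 2 * l ^+ 2 + 1)) = 1 by rewrite mulVf // gt_eqF //; lra.
have eta0 : 0 < eta by rewrite invr_gt0; lra.
have etaE' : 2 * (eta * (r%:R ^+ 2 * l ^+ 2)) + 2 * eta = 1 by rewrite -[RHS]etaE; ring.
have [eta1 eta2] : eta * (r%:R ^+ 2 * l ^+ 2) < 1 /\ eta < 1.
  by have := mulr_gt0 eta0 rl; split; lra.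
pose k' := k * (1 + eta); have k0' : 0 < k' by rewrite mulr_gt0 //; lra.
have kl : 0 < k * l ^+ 2 by rewrite mulr_gt0 // exprn_gt0.
have kl' : 0 < k * l' ^+ 2 by rewrite mulr_gt0 // exprn_gt0.
have w : 0 < k * l ^+ 2 < 4 by rewrite kl /=; lra.
have w' : 0 < k' * l' ^+ 2 < 4.
  rewrite /k' mulrAC; have : k * l' ^+ 2 * (1 + eta) < 1 * 2 by apply: ltr_pM; lra.
  by move=> h; rewrite mulr_gt0 //=; lra.
exists (k * l ^+ 2), (k' * l' ^+ 2); split=> //; split=> //.
pose sg : R := if b then -1 else 1; pose z : R := if b then 0 else 1.
have stdE t : std (Loop b a c) (k * l ^+ 2) t = (quad (x a) (x c) 0 t,
  quad z z (sg * (k * l ^+ 2)) t).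
  by rewrite /std /qcurve /z /sg /x /r /=; case: (b); rewrite ?mulN1r ?mul1r.
have stdE' t : std (Loop b a' c') (k' * l' ^+ 2) t = (quad (x a') (x c') 0 t,
  quad z z (sg * (k' * l' ^+ 2)) t).
  by rewrite /std /qcurve /z /sg /x /r /=; case: (b); rewrite ?mulN1r ?mul1r.
have dstdE t : dstd (Loop b a c) (k * l ^+ 2) t = (l - 0 * (1 - 2 * t),
  - (sg * (k * l ^+ 2)) * (1 - 2 * t)).
  by rewrite /dstd /dqcurve /z /sg /l /x /r /dquad /=; case: (b); congr (_, _); ring.
have dstdE' t : dstd (Loop b a' c') (k' * l' ^+ 2) t = (l' - 0 * (1 - 2 * t),
  - (sg * (k' * l' ^+ 2)) * (1 - 2 * t)).
  by rewrite /dstd /dqcurve /z /sg /l' /x /r /dquad /=; case: (b); congr (_, _); ring.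
have sg0 : sg != 0 by rewrite /sg; case: (b); rewrite ?oppr_eq0 oner_eq0.
pose P m n : R := (x n - (x a' + m%:~R)) * ((x c' + m%:~R) - x n).
have PE (m n : int) : P m n = ((n - (a' + m * r%:Z)) * ((c' + m * r%:Z) - n))%:~R / r%:R ^+ 2.
  by rewrite /P /x !(intrM, intrD, intrN) -pmulrn; field.
have r2 : 0 < (r%:R ^+ 2)^-1 :> R by rewrite invr_gt0 exprn_gt0 // ltr0n.
have QE (m : int) t : quad (- k' * P m a) (- k' * P m c) ((k' - k) * l ^+ 2) t =
    k * l ^+ 2 * (t * (1 - t)) - k' * ((quad (x a) (x c) 0 t - (x a' + m%:~R))
      * ((x c' + m%:~R) - quad (x a) (x c) 0 t)).
  by rewrite /quad /P /l; ring.
have ln0' : l' != 0 by rewrite gt_eqF.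
apply: (@counted_quad _ _ _ _ (fun m => - k' * P m a) (fun m => - k' * P m c) (fun=> (k' - k)
  * l ^+ 2)
  (sg * l') (fun t u => t) (fun m s => s) (fun m s => (quad (x a) (x c) 0 s - (x a' + m%:~R))
    / l')).
- have eE : (k' - k) * l ^+ 2 = k * eta * l ^+ 2 by rewrite /k'; ring.
  have e0 : 0 < (k' - k) * l ^+ 2 by rewrite eE !mulr_gt0 // exprn_gt0.
  have small m n : - k' * P m n = 0 \/ `|(k' - k) * l ^+ 2| < `|- k' * P m n|.
    rewrite PE; set N := (_ * _ : int); have [->|N0] := eqVneq N 0; first by left;
      rewrite mul0r mulr0.
    right; rewrite (gtr0_norm e0) normrM normrN (gtr0_norm k0') normrM (gtr0_norm r2)
      -intr_norm.
    have N1 : 1 <= (`|N|)%:~R :> R by apply: norm_int_ge1.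
    apply: (@lt_le_trans _ _ (k' * (r%:R ^+ 2)^-1)); last first.
      by rewrite ler_pM2l // ler_peMl // ltW.
    rewrite ltr_pdivlMr ?exprn_gt0 ?ltr0n // eE.
    have -> : k * eta * l ^+ 2 * r%:R ^+ 2 = k * (eta * (r%:R ^+ 2 * l ^+ 2)) by ring.
    by rewrite /k' ltr_pM2l //; lra.
  by move=> m; split=> // -[_ _ /eqP]; rewrite gt_eqF.
- move=> m t u ht hu; rewrite dstdE dstdE' stdE stdE' => -[E1 E2].
  have uE : u = (quad (x a) (x c) 0 t - (x a' + m%:~R)) / l'.
    by apply: (mulIf ln0'); rewrite divfK // E1 /quad /l'; ring.
  have E3 : k * l ^+ 2 * (t * (1 - t)) = k' * l' ^+ 2 * (u * (1 - u)).
    by apply: (mulfI sg0); move: E2; rewrite /quad; lra.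
  split=> //.
    rewrite QE E1 E3 /quad /l'; ring.
  have U2 : l' * (1 - 2 * u) = x a' + x c' + 2 * m%:~R - 2 * quad (x a) (x c) 0 t.
    by rewrite E1 /quad /l'; ring.
  rewrite /det2 /=; transitivity (- sg * k' * l' * l * (l' * (1 - 2 * u)) + sg * (k * l ^+ 2)
    * l' * (1 - 2 * t)).
    by ring.
  by rewrite U2 /dquad /P /quad /l; ring.
- move=> m s hs; rewrite QE => qs; have /andP[s0 s1] := hs.
  set X := quad (x a) (x c) 0 s in qs *.
  have ss : 0 < k * l ^+ 2 * (s * (1 - s)) by rewrite !mulr_gt0 // ?subr_gt0 // exprn_gt0.
  (* At a root both loops are equally far from their boundary line, at a positive distance, so [X]
     lies strictly between the ends of the second loop. *)
  have PP : 0 < (X - (x a' + m%:~R)) * ((x c' + m%:~R) - X) by rewrite -(pmulr_rgt0 _ k0'); lra.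
  have L : (X - (x a' + m%:~R)) + ((x c' + m%:~R) - X) = l' by rewrite /l'; ring.
  have X0 : 0 < X - (x a' + m%:~R).
    rewrite ltNge; apply/negP => h; move: PP; rewrite ltNge; case/negP.
    by rewrite mulr_le0_ge0 //; lra.
  have X1 : 0 < (x c' + m%:~R) - X by rewrite -(pmulr_rgt0 _ X0).
  split=> //; first by rewrite divr_gt0 //= ltr_pdivrMr //; lra.
  rewrite stdE stdE'; congr (_, _).
    by rewrite -/X /quad /= -/l'; rewrite /l'; field; exact: ln0'.
  have E3 : k' * l' ^+ 2 * ((X - (x a' + m%:~R)) / l' * (1 - (X - (x a' + m%:~R)) / l')) =
    k * l ^+ 2 * (s * (1 - s)).
    transitivity (k' * ((X - (x a' + m%:~R)) * (l' - (X - (x a' + m%:~R))))); first by field.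
    by rewrite -{1}L; lra.
  by rewrite /quad /= -[sg * _ * _ in RHS]mulrA E3; ring.
- by rewrite mulf_neq0.
- move=> m; have -> : (- k' * P m a * (- k' * P m c) < 0) = (P m a * P m c < 0).
    by rewrite mulrACA mulrNN pmulr_rlt0 // mulr_gt0.
  have -> : (0 < sg * l' * (- k' * P m c)) = (if b then 0 < P m c else P m c < 0).
    rewrite (_ : sg * l' * (- k' * P m c) = (l' * k') * (- sg * P m c)); last by ring.
    rewrite (pmulr_rgt0 _ (mulr_gt0 l0' k0')) /sg; case: (b); first by rewrite opprK mul1r.
    by rewrite mulN1r oppr_gt0.
  rewrite /=; have rz : r%:Z = (if b then q else p)%:Z by rewrite /r; case: (b).
  case: (b) rz => rz; [rewrite sign_split|rewrite sign_split_neg]; rewrite !PE.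
    by rewrite pmulr_llt0 // pmulr_lgt0 // ltr0z ltrz0 rz between_source ?ltrD2r.
  by rewrite pmulr_llt0 // pmulr_lgt0 // ltr0z ltrz0 rz between_target ?ltrD2r.
Qed.

End StandardCurves.

(** * Proof of the theorem *)

Section Curves.
Variables (R : realType) (p q : nat) (k : closedFieldType).
Implicit Types (t u : R) (d : curve_type) (a b : R -> cylinder R).
Local Notation source := (source R p q).
Local Notation target := (target R p q).

Lemma phi_curve_type a (X : coh k p q) : phi a X -> exists d,
  [/\ wf_type d, sheaf_of d X & exists2 g, strip_curve (source d) (target d) g &
    homotopic (@cpi R \o g) a].
Proof.
case=> [i j g sg ha iX|i j g j0 sg ha iX|i j g j0 sg ha iX].
- by exists (Chord i j); split=> //; exists g.
- exists (Loop false (i - j%:Z - 1) i); split; last by exists g.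
    by rewrite /=; lia.
  by exists i, j.
- exists (Loop true (- i) (j%:Z - i + 1)); split; last by exists g.
    by rewrite /=; lia.
  by exists i, j.
Qed.

Hypotheses (hp : (0 < p)%N) (hq : (0 < q)%N).

Lemma counted_exists d d' : wf_type d -> wf_type d' -> exists e e',
  [/\ wf_bend d e, wf_bend d' e' & @counted R p q d d' e e'].
Proof.
case: d => [i j|b a c] wd; case: d' => [i' j'|b' a' c'] wd'.
- by have [e [e' [we [we' ce]]]] := counted_chord_chord R hp hq i j i' j'; exists e, e'.
- by have [e [e' [we [we' ce]]]] := counted_chord_loop R hp hq b' i j wd'; exists e, e'.
- by have [e [e' [we [we' ce]]]] := counted_loop_chord R hp hq b i' j' wd; exists e, e'.
have [bb|bb] := eqVneq b' b.
  by rewrite bb; have [e [e' [we [we' ce]]]] := counted_loop_loop R hp hq b wd wd'; exists e,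
    e'.
have -> : b' = ~~ b by case: (b) bb; case: (b').
by have [e [e' [we [we' ce]]]] := counted_loop_opposite R p q b a c a' c'; exists e, e'.
Qed.

Lemma marked_ends d : marked p q (@cpi R (source d)) /\ marked p q (@cpi R (target d)).
Proof.
by case: d => [i j|[] a c]; split; eexists; try reflexivity; by [left; eexists|right; eexists].
Qed.

Lemma curve_std d e : wf_bend d e -> curve p q (@cpi R \o std p q d e).
Proof.
move=> we; have [ms mt] := marked_ends d; split.
- apply: continuous_subspaceT => t; apply: continuous_comp; first exact: continuous_qcurve.
  exact: continuous_cpi.
- by rewrite /= /std qcurve0.
- by rewrite /= /std qcurve1.
- by move=> t ht; exists (std p q d e t) => //; apply: std_height.
Qed.

Lemma lift_height a d g t : curve p q a -> lift_of a (source d) (target d) g ->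
  0 <= t <= 1 -> 0 <= (g t).2 <= 1.
Proof.
move=> [_ _ _ ia] lg; have [_ g0 g1 _] := lg => /andP[]; rewrite le_eqVlt => /predU1P[<- _|t0].
  by rewrite g0; case: (source_height R p q d) => ->; rewrite lexx ler01.
rewrite le_eqVlt => /predU1P[->|t1].
  by rewrite g1; case: (target_height R p q d) => ->; rewrite lexx ler01.
have t01 : 0 < t < 1 by rewrite t0.
by have /andP[h0 h1] := lift_interior lg t01 (ia t t01); rewrite !ltW.
Qed.

Lemma homotopic_std a d g e : curve p q a -> lift_of a (source d) (target d) g -> wf_bend d e ->
  homotopic a (@cpi R \o std p q d e).
Proof.
move=> ca lg we; apply: (straight_homotopic lg (lift_qcurve _ _ _)).
  by move=> t; apply: lift_height lg.
by move=> t; apply: std_height_closed.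
Qed.

(** The quadratic curves attain the count. For arbitrary representatives the positive crossings
    found for different [m] are different, because [m] is the difference of the lifts at the
    crossing. *)
Lemma Iplus_curve_type a b d d' g h (ns : seq int) :
  wf_type d -> wf_type d' -> curve p q a -> curve p q b ->
  lift_of a (source d) (target d) g -> lift_of b (source d') (target d') h ->
  uniq ns -> (forall m, (m \in ns) = pos_shift p q d d' m) -> Iplus p q a b (size ns).
Proof.
move=> wd wd' ca cb lg lh uns nsP; split.
  have [e [e' [we we' [c1 c2 c3]]]] := counted_exists wd wd'.
  exists (@cpi R \o std p q d e), (@cpi R \o std p q d' e').
  have [||||||||tr card] := @crossing_count R (std p q d e) (dstd p q d e) (std p q d' e')
    (dstd p q d' e') ns.
  - by move=> t; split; apply: is_derive_quad.
  - by move=> t; split; apply: is_derive_quad.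
  - exact: continuous_qcurve.
  - exact: continuous_qcurve.
  - exact: uns.
  - by move=> m t u ht hu E; rewrite nsP; apply: c1.
  - by move=> m; rewrite nsP; apply: c2.
  - exact: c3.
  split=> //; split=> //; split; try exact: curve_std.
    exact: homotopic_std lg _.
  exact: homotopic_std lh _.
move=> a' b' n [[[_ _ _ ia] ha] [[_ _ _ ib] hb] tr] card.
have [g' lg'] := homotopic_lift lg ha; have [h' lh'] := homotopic_lift lh hb.
have [z hz] : exists z : int -> R * R, forall m, m \in ns ->
    positive_crossing a' b' (z m) /\ g' (z m).1 = h' (z m).2 + (m%:~R, 0).
  suff /choice [z hz] : forall m, exists z : R * R, m \in ns ->
    positive_crossing a' b' z /\ g' z.1 = h' z.2 + (m%:~R, 0) by exists z.
  move=> m; have [mn|] := boolP (m \in ns); last by exists (0, 0).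
  rewrite nsP in mn; have [t [u [pc E]]] := positive_crossing_exists hp hq mn lg' lh' ia ib tr.
  by exists (t, u).
have zi : {in `I_(size ns) &, injective (fun i : nat => z (nth 0 ns i))}.
  move=> i j; rewrite !inE /= => hi hj e.
  have [_ E] := hz _ (mem_nth 0 hi); have [_ E'] := hz _ (mem_nth 0 hj).
  have : (nth 0 ns i)%:~R = (nth 0 ns j)%:~R :> R by move: E; rewrite e E' => /addrI [].
  by move=> /intr_inj /eqP; rewrite nth_uniq // => /eqP.
have sub : (fun i : nat => z (nth 0 ns i)) @` `I_(size ns) `<=` positive_crossing a' b'.
  by move=> _ [i /= hi <-]; have [] := hz _ (mem_nth 0 hi).
have := subset_card_le sub.
by rewrite (card_le_eql (inj_card_eq zi)) (card_le_eqr card) card_le_II.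
Qed.

End Curves.

Theorem theorem3p10 (k : closedFieldType) (R : realType) (p q : nat)
    (hp : (1 <= p)%N) (hpq : (p <= q)%N)
    (X Y : coh k p q)
    (indecX : indecomposable X) (indecY : indecomposable Y)
    (ordX : ~ ordinary_support X) (ordY : ~ ordinary_support Y)
    (alpha beta : R -> cylinder R)
    (curve_alpha : curve p q alpha) (curve_beta : curve p q beta)
    (phi_alpha : phi alpha X) (phi_beta : phi beta Y) :
  exists n : nat, ext1_dim X Y n /\ Iplus p q alpha beta n.
Proof.
have hq : (0 < q)%N by apply: leq_trans hpq.
have [d [wd dX [g sg hg]]] := phi_curve_type phi_alpha.
have [d' [wd' dY [h sh hh]]] := phi_curve_type phi_beta.
have [g' lg] := homotopic_lift (lift_strip_curve sg) hg.
have [h' lh] := homotopic_lift (lift_strip_curve sh) hh.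
(* One list counts the monomials on the algebraic side and the positive crossings on the geometric
   side. *)
have [ns [uns nsP]] := pos_shift_finite d d' hp hq.
exists (size ns); split; first exact: ext1_dim_sheaf hp hq _ _ _ _ _ dX dY uns nsP.
exact: Iplus_curve_type lg lh uns nsP.
Qed.
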